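(* Let $k,N$ be positive real numbers with $k+N>1$, and $x\in\mathbb{C}\setminus(-\infty,0]$. Then as $x\to\infty$, $$\mathscr{F}_{k,N}(x)\sim-\frac{1}{2x}\zeta(k+N)-\sum_{n=1}^\infty\frac{B_{2n}}{2n}\zeta(k+2nN)x^{-2n}.$$ Moreover, as $x\to0$: (i) if $k,N\in\mathbb{N}$ with $1<k\le N$, $$\mathscr{F}_{k,N}(x)\sim-\frac{\zeta(k+N)}{x}-(\gamma+\log x)\zeta(k)+N\zeta'(k)+\frac{\pi}{N}\frac{\zeta\left(1+\frac{k-1}{N}\right)}{\sin\left(\frac{\pi}{N}(k-1)\right)}x^{\frac{k-1}{N}}+x^{\frac{k-1}{N}}\mathscr{B}(k,N,x)+(-1)^k\sum_{m=1}^\infty(-1)^{m(N+1)}\zeta(k-mN)\zeta(1+m)x^m;$$ (ii) for $N\in\mathbb{N}$, $$\mathscr{F}_{1,N}(x)\sim-\frac{\zeta(N+1)}{x}+\frac1N\left\{\frac{\pi^2}{6}-(N-1)\gamma\log x+\frac12\log^2x-N\gamma^2-(N^2+1)\gamma_1\right\}+\mathscr{B}(1,N,x)-\sum_{m=1}^\infty(-1)^{m(N+1)}\zeta(1-mN)\zeta(1+m)x^m.$$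
   Context: For positive real $k,N$ with $k+N>1$ and $x\in\mathbb{C}\setminus(-\infty,0]$, $\mathscr{F}_{k,N}(x):=\sum_{n=1}^{\infty}\frac{\psi(n^Nx)-\log(n^Nx)}{n^k}$, with $\psi=\Gamma'/\Gamma$ and principal branches of $\log$ and powers. For $k,N\in\mathbb{N}$, $\mathscr{B}(k,N,x):=(-1)^{k+N+1}x^{1/N}\zeta(1+\frac kN)$ if $k=N$ and $\mathscr{B}(k,N,x):=0$ if $k\ne N$. $B_n$ are the Bernoulli numbers, $\zeta$ the Riemann zeta function, $\gamma$ Euler's constant, $\gamma_1$ the first Stieltjes constant. The symbol $\sim$ denotes an asymptotic expansion (in the Poincaré sense). *)

(* Defs.v *)
From Stdlib Require Import Reals Arith ClassicalEpsilon.
From Coquelicot Require Import Coquelicot.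

Open Scope R_scope.

(* Principal branches; the argument takes values in (-PI, PI]. *)
Definition Cexp (z : C) : C :=
  (exp (Re z) * cos (Im z), exp (Re z) * sin (Im z)).

Definition Carg (z : C) : R :=
  if Rle_dec 0 (Im z) then acos (Re z / Cmod z) else - acos (Re z / Cmod z).

Definition Clog (z : C) : C := (ln (Cmod z), Carg z).

Definition Cpower (z w : C) : C := Cexp (w * Clog z)%C.

(* Membership in C \ (-infinity, 0]. *)
Definition slit_plane (x : C) : Prop := ~ (Re x <= 0 /\ Im x = 0).

(* Componentwise limit and sum: total functions, giving the usual values for
   convergent sequences and series. *)
Definition CLim_seq (u : nat -> C) : C :=
  (real (Lim_seq (fun n => Re (u n))), real (Lim_seq (fun n => Im (u n)))).

Definition CSeries (u : nat -> C) : C :=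
  (Series (fun n => Re (u n)), Series (fun n => Im (u n))).

(* z (z + 1) ... (z + n) *)
Fixpoint rising (z : C) (n : nat) : C :=
  match n with
  | O => z
  | S p => (rising z p * (z + INR n))%C
  end.

(* Euler's limit n! n^z / (z (z + 1) ... (z + n)), valid for every z other
   than the poles 0, -1, -2, ... *)
Definition Cgamma (z : C) : C :=
  CLim_seq (fun n => (INR (fact n) * Cpower (INR n) z / rising z n)%C).

Definition digamma (z : C) : C := (C_derive Cgamma z / Cgamma z)%C.

(* Recurrence B_0 = 1, sum_(i <= n) binom(n + 1, i) B_i = 0 for n >= 1;
   [bernoulli_upto n] is correct on the indices 0, ..., n. *)
Fixpoint bernoulli_upto (n : nat) : nat -> R :=
  match n with
  | O => fun _ => 1
  | S p => fun j =>
      if (j <=? p)%nat then bernoulli_upto p j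
      else - / INR (S n)
           * sum_n (fun i => Binomial.C (S n) i * bernoulli_upto p i) p
  end.

Definition bernoulli (n : nat) : R := bernoulli_upto n n.

(* gamma_0 is Euler's constant. *)
Definition stieltjes (j : nat) : R :=
  real (Lim_seq (fun n =>
    sum_n_m (fun i => ln (INR i) ^ j / INR i) 1 n
    - ln (INR n) ^ S j / INR (S j))).

Definition analytic_at (f : C -> C) (z : C) : Prop :=
  exists (a : nat -> C) (r : R), 0 < r /\
    forall w : C, Cmod (w - z) < r ->
      @is_pseries C_AbsRing C_NormedModule a (w - z)%C (f w).

(* The analytic continuation to C \ {1} of the Dirichlet series; the value at
   1 is unspecified. *)
Definition is_riemann_zeta (f : C -> C) : Prop :=
  (forall s : C, s <> RtoC 1 -> analytic_at f s) /\
  (forall s : C, 1 < Re s ->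
     @is_series C_AbsRing C_NormedModule
       (fun n => Cpower (INR (S n)) (- s)%C) (f s)).

Definition zeta : C -> C :=
  epsilon (inhabits (fun _ : C => RtoC 0)) is_riemann_zeta.

(* The series starts at n = 1, hence the shifted index. *)
Definition scriptF (k N : R) (x : C) : C :=
  CSeries (fun n =>
    let y := (Rpower (INR (S n)) N * x)%C in
    ((digamma y - Clog y) / Rpower (INR (S n)) k)%C).

Definition scriptB (k N : nat) (x : C) : C :=
  if (k =? N)%nat
  then ((-1) ^ (k + N + 1) * Cpower x (1 / INR N) * zeta (1 + INR k / INR N))%C
  else RtoC 0.

(* Limits in the slit plane are taken, as is usual for asymptotic expansions,
   uniformly in each closed subsector |arg x| <= PI - delta.  No uniformity up
   to the cut is possible: x |-> digamma (n^N x) has poles on it. *)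
Definition sector (delta : R) (x : C) : Prop :=
  slit_plane x /\ Rabs (Carg x) <= PI - delta.

Definition C_infty (P : C -> Prop) : Prop :=
  exists r : R, forall x : C, r < Cmod x -> P x.

(* Poincare expansion f ~ g + sum_(m >= 1) a_m phi_m along the filter F:
   each remainder is of the order of the first omitted gauge function.  For
   M = 0 this says f - g = O(phi_1). *)
Definition expansion_along (F : (C -> Prop) -> Prop)
    (f g : C -> C) (a : nat -> C) (phi : nat -> C -> C) : Prop :=
  forall M : nat, exists K : R,
    F (fun x =>
      Cmod (f x - (g x + sum_n_m (fun m => a m * phi m x)%C 1 M))
        <= K * Cmod (phi (S M) x)).

Definition expansion_at_infty (f g : C -> C) (a : nat -> C)
    (phi : nat -> C -> C) : Prop :=
  forall delta : R, 0 < delta < PI ->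
    expansion_along (within (sector delta) C_infty) f g a phi.

Definition expansion_at_0 (f g : C -> C) (a : nat -> C)
    (phi : nat -> C -> C) : Prop :=
  forall delta : R, 0 < delta < PI ->
    expansion_along (within (sector delta) (locally' (RtoC 0))) f g a phi.

(* Main.v *)
(** As [x] tends to infinity, the asymptotic series of digamma is inserted at [y = n^N x] and summed over [n].

    Near [0], write [digamma y = - 1/y - sum_(1 <= m <= L) 1/(m + y) + digamma (y + L + 1)].  With [y = n^N x] and
    [w = m/x], the sums over [n] of [n^-k / (m + n^N x)] become [S(w) / m], where
    [S(w) = sum_n n^-k w / (w + n^N)].  Decomposing into partial fractions over the roots of [rho^N = - w] turns [S]
    into a finite sum of digamma values at [1 - rho], hence gives its expansion in powers of [1/w]; the powers not
    divisible by [N] cancel, and the coefficients are the values [zeta (k - m N)] because [zeta (1 - q)] equals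
    [- (-1)^q B_q / q].  Summing over [m] yields the power series part.

    The remaining sum [sum_n n^-k (digamma (n^N x + L + 1) - Clog (n^N x))] is, up to [o(1)],
    [zeta k (ln L - Clog x) + N zeta' k] if [k > 1].  If [k = 1] it is [sum_n Clog (1 + w / n^N) / n] with [w = L/x];
    comparing the term [n] with the block of integers between [(n - 1)^N] and [n^N] reduces it to the case [N = 1],
    where it is [Clog w ^ 2 / 2 + gamma Clog w + kappa + o(1)].  The case [N = 2], where the sum also splits as
    [sum_n Clog (1 + i r / n) / n + sum_n Clog (1 - i r / n) / n] with [w = r^2], then forces
    [kappa = PI^2 / 6 - gamma_1].

    The continuation of zeta comes from the recursion for [(s - 1) zeta s] given by the binomial expansion of
    [(n - 1/2)^(1 - s) - (n + 1/2)^(1 - s)]. *)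

Require Import Defs.
From Stdlib Require Import Reals Arith Lra Lia Psatz ClassicalEpsilon FunctionalExtensionality.
From Coquelicot Require Import Coquelicot.

Open Scope R_scope.

(** The parameter L tends to infinity with x fixed, where mere convergence suffices. Uniformity in
    the sector is needed only for S(w): at w = m/x its error O(|w|^(-M-1)) is O(|x|^(M+1) m^(-M-1)),
    still summable against 1/m. Each expansion at 0 is thus an exact identity for [scriptF] with a
    single error term, found by evaluating one limit in two ways. No contour integral occurs,
    because the roots of -w reduce the behaviour at 0 to the asymptotic expansion of digamma. [zeta]
    is chosen by [epsilon], so nothing is known about it before some continuation exists. The
    witness [zeta0] lives among power series of bounded weighted norm, where infinite sums are
    controlled by norms alone; its values at real points left of 1 pass to [zeta] along a segment
    that starts in Re s > 1 off the real axis and so avoids the pole. The sign pattern of the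
    coefficients is uniform except where zeta(0) occurs, since B_1 is the only nonzero Bernoulli
    number of odd index. This happens only for k = N and m = 1, and [scriptB] repairs it. *)

Fixpoint Csum (f : nat -> C) (n : nat) : C :=
  match n with O => RtoC 0 | S p => (Csum f p + f p)%C end.

Fixpoint Rsum (f : nat -> R) (n : nat) : R :=
  match n with O => 0 | S p => Rsum f p + f p end.

(** Stated with [Cmod] so that estimates apply directly; [Ccv_filterlim], [Ccv_CLim_seq] and
    [Ccv_CSeries] link it to the limits that occur in the definitions. *)
Definition Ccv (u : nat -> C) (l : C) : Prop :=
  forall eps : R, 0 < eps ->
    exists n0 : nat, forall n, (n0 <= n)%nat -> Cmod (u n - l)%C < eps.

(** * Moduli, finite sums and limits of complex sequences *)

Lemma Cmod_sym (a b : C) : Cmod (a - b)%C = Cmod (b - a)%C.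
Proof. rewrite <- (Cmod_opp (a - b)%C). f_equal. ring. Qed.

Lemma Cmod_tri_sub (a b c : C) : Cmod (a - c)%C <= Cmod (a - b)%C + Cmod (b - c)%C.
Proof.
  replace (a - c)%C with ((a - b) + (b - c))%C by ring. apply Cmod_triangle.
Qed.

Lemma Cmod_minus_le (a b : C) : Cmod (a - b)%C <= Cmod a + Cmod b.
Proof. unfold Cminus. rewrite <- (Cmod_opp b). apply Cmod_triangle. Qed.

Lemma Cmod_ge_sub (a b : C) : Cmod a - Cmod b <= Cmod (a + b)%C.
Proof.
  assert (H := Cmod_minus_le (a + b) b).
  replace (a + b - b)%C with a in H by ring. lra.
Qed.

Lemma im_le_Cmod (c : C) : Rabs (Im c) <= Cmod c.
Proof. eapply Rle_trans; [apply Rmax_r | apply (Rmax_Cmod c)]. Qed.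

Lemma Cmod_le_abs (c : C) : Cmod c <= Rabs (Re c) + Rabs (Im c).
Proof.
  replace c with ((Re c : C) + Im c * Ci)%C at 1.
  - eapply Rle_trans; [apply Cmod_triangle|].
    rewrite Cmod_mult, Cmod_Ci, !Cmod_R. lra.
  - destruct c as [a b]. unfold Ci, RtoC, Cplus, Cmult. simpl. f_equal; ring.
Qed.

Lemma C_eq (a b : C) : Re a = Re b -> Im a = Im b -> a = b.
Proof. destruct a, b; simpl; intros; subst; reflexivity. Qed.

Lemma Csum_ext f g n : (forall i, (i < n)%nat -> f i = g i) -> Csum f n = Csum g n.
Proof.
  induction n; intros H; simpl; [reflexivity|].
  rewrite IHn, (H n); auto.
Qed.

Lemma Rsum_ext f g n : (forall i, (i < n)%nat -> f i = g i) -> Rsum f n = Rsum g n.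
Proof.
  induction n; intros H; simpl; [reflexivity|].
  rewrite IHn, (H n); auto.
Qed.

Lemma Csum_S f n : Csum f (S n) = (Csum f n + f n)%C.
Proof. reflexivity. Qed.

Lemma Rsum_S f n : Rsum f (S n) = Rsum f n + f n.
Proof. reflexivity. Qed.

Lemma Csum_plus f g n : Csum (fun i => f i + g i)%C n = (Csum f n + Csum g n)%C.
Proof. induction n; simpl; [ring | rewrite IHn; ring]. Qed.

Lemma Csum_minus f g n : Csum (fun i => f i - g i)%C n = (Csum f n - Csum g n)%C.
Proof. induction n; simpl; [ring | rewrite IHn; ring]. Qed.

Lemma Csum_scal c f n : Csum (fun i => c * f i)%C n = (c * Csum f n)%C.
Proof. induction n; simpl; [ring | rewrite IHn; ring]. Qed.

Lemma Csum_const c n : Csum (fun _ => c) n = (INR n * c)%C.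
Proof.
  induction n; [simpl; ring|]. rewrite S_INR, RtoC_plus. simpl Csum. rewrite IHn. ring.
Qed.

Lemma Csum_0 n f : (forall i, (i < n)%nat -> f i = RtoC 0) -> Csum f n = RtoC 0.
Proof.
  induction n; intros H; simpl; [reflexivity|]. rewrite IHn, (H n); auto. ring.
Qed.

Lemma Csum_app f n m : Csum f (n + m) = (Csum f n + Csum (fun i => f (n + i)%nat) m)%C.
Proof.
  induction m; simpl; [rewrite Nat.add_0_r; ring|].
  rewrite Nat.add_succ_r. simpl. rewrite IHm. ring.
Qed.

Lemma Csum_S_l f n : Csum f (S n) = (f O + Csum (fun i => f (S i)) n)%C.
Proof.
  change (S n) with (1 + n)%nat. rewrite Csum_app. simpl. ring.
Qed.

Lemma Rsum_app f n m : Rsum f (n + m) = Rsum f n + Rsum (fun i => f (n + i)%nat) m.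
Proof.
  induction m; simpl; [rewrite Nat.add_0_r; ring|].
  rewrite Nat.add_succ_r. simpl. rewrite IHm. ring.
Qed.

Lemma Rsum_S_l f n : Rsum f (S n) = f O + Rsum (fun i => f (S i)) n.
Proof. change (S n) with (1 + n)%nat. rewrite Rsum_app. simpl. ring. Qed.

Lemma Csum_swap (f : nat -> nat -> C) n m :
  Csum (fun i => Csum (f i) m) n = Csum (fun j => Csum (fun i => f i j) n) m.
Proof.
  induction n; simpl.
  - symmetry. apply Csum_0. reflexivity.
  - rewrite IHn, <- Csum_plus. reflexivity.
Qed.

Lemma Rsum_plus f g n : Rsum (fun i => f i + g i) n = Rsum f n + Rsum g n.
Proof. induction n; simpl; [ring | rewrite IHn; ring]. Qed.

Lemma Rsum_scal c f n : Rsum (fun i => c * f i) n = c * Rsum f n.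
Proof. induction n; simpl; [ring | rewrite IHn; ring]. Qed.

Lemma Rsum_le f g n : (forall i, (i < n)%nat -> f i <= g i) -> Rsum f n <= Rsum g n.
Proof.
  induction n; intros H; simpl; [lra|].
  assert (H1 : f n <= g n) by auto. assert (Rsum f n <= Rsum g n) by auto. lra.
Qed.

Lemma Rsum_nonneg f n : (forall i, (i < n)%nat -> 0 <= f i) -> 0 <= Rsum f n.
Proof.
  induction n; intros H; simpl; [lra|].
  assert (H1 : 0 <= f n) by auto. assert (0 <= Rsum f n) by auto. lra.
Qed.

Lemma Rsum_mono f n m : (forall i, 0 <= f i) -> (n <= m)%nat -> Rsum f n <= Rsum f m.
Proof.
  intros H Hn. replace m with (n + (m - n))%nat by lia. rewrite Rsum_app.
  assert (0 <= Rsum (fun i => f (n + i)%nat) (m - n)) by (apply Rsum_nonneg; auto). lra.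
Qed.

Lemma Cmod_Csum f n : Cmod (Csum f n) <= Rsum (fun i => Cmod (f i)) n.
Proof.
  induction n; simpl; [rewrite Cmod_0; lra|].
  eapply Rle_trans; [apply Cmod_triangle|]. lra.
Qed.

Lemma Cmod_Csum_le f g n :
  (forall i, (i < n)%nat -> Cmod (f i) <= g i) -> Cmod (Csum f n) <= Rsum g n.
Proof.
  intros H. eapply Rle_trans; [apply Cmod_Csum|]. apply Rsum_le. exact H.
Qed.

Lemma RtoC_Rsum f n : RtoC (Rsum f n) = Csum (fun i => RtoC (f i)) n.
Proof. induction n; simpl; [reflexivity|]. rewrite RtoC_plus, IHn. reflexivity. Qed.

Lemma Re_Csum f n : Re (Csum f n) = Rsum (fun i => Re (f i)) n.
Proof. induction n; simpl; [reflexivity|]. rewrite <- IHn. reflexivity. Qed.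

Lemma Im_Csum f n : Im (Csum f n) = Rsum (fun i => Im (f i)) n.
Proof. induction n; simpl; [reflexivity|]. rewrite <- IHn. reflexivity. Qed.

Lemma Csum_sum_n f n : sum_n f n = Csum f (S n).
Proof.
  induction n.
  - rewrite sum_O. symmetry. apply Cplus_0_l.
  - rewrite sum_Sn, IHn. reflexivity.
Qed.

Lemma Csum_sum_n_m f n : sum_n_m f 1 n = Csum (fun i => f (S i)) n.
Proof.
  induction n.
  - rewrite sum_n_m_zero by lia. reflexivity.
  - rewrite sum_n_Sm by lia. rewrite IHn. reflexivity.
Qed.

Lemma Rsum_sum_n (f : nat -> R) n : sum_n f n = Rsum f (S n).
Proof.
  induction n.
  - rewrite sum_O. symmetry. apply Rplus_0_l.
  - rewrite sum_Sn, IHn. reflexivity.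
Qed.

Lemma Rsum_sum_n_m (f : nat -> R) n : sum_n_m f 1 n = Rsum (fun i => f (S i)) n.
Proof.
  induction n.
  - rewrite sum_n_m_zero by lia. reflexivity.
  - rewrite sum_n_Sm by lia. rewrite IHn. reflexivity.
Qed.

Lemma Ccv_ext u v l : (forall n, u n = v n) -> Ccv u l -> Ccv v l.
Proof. intros H Hu eps He. destruct (Hu eps He) as [n0 Hn]. exists n0. intros n Hle. rewrite <- H. auto. Qed.

Lemma Ccv_const c : Ccv (fun _ => c) c.
Proof.
  intros eps He. exists O. intros. replace (c - c)%C with (RtoC 0) by ring.
  rewrite Cmod_0. exact He.
Qed.

Lemma Ccv_plus u v a b : Ccv u a -> Ccv v b -> Ccv (fun n => u n + v n)%C (a + b)%C.
Proof.
  intros Hu Hv eps He. destruct (Hu (eps / 2)) as [n1 H1]; [lra|].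
  destruct (Hv (eps / 2)) as [n2 H2]; [lra|].
  exists (max n1 n2). intros n Hn.
  replace (u n + v n - (a + b))%C with ((u n - a) + (v n - b))%C by ring.
  eapply Rle_lt_trans; [apply Cmod_triangle|].
  assert (Cmod (u n - a)%C < eps / 2) by (apply H1; lia).
  assert (Cmod (v n - b)%C < eps / 2) by (apply H2; lia). lra.
Qed.

Lemma Ccv_scal c u a : Ccv u a -> Ccv (fun n => c * u n)%C (c * a)%C.
Proof.
  intros Hu eps He.
  assert (Hc := Cmod_ge_0 c).
  destruct (Hu (eps / (Cmod c + 1))) as [n1 H1]; [apply Rdiv_lt_0_compat; lra|].
  exists n1. intros n Hn.
  replace (c * u n - c * a)%C with (c * (u n - a))%C by ring.
  rewrite Cmod_mult. specialize (H1 n Hn).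
  assert (H2 := Cmod_ge_0 (u n - a)%C).
  apply Rle_lt_trans with ((Cmod c + 1) * Cmod (u n - a)%C); [nra|].
  apply Rlt_le_trans with ((Cmod c + 1) * (eps / (Cmod c + 1))).
  - apply Rmult_lt_compat_l; lra.
  - right. field. lra.
Qed.

Lemma Ccv_opp u a : Ccv u a -> Ccv (fun n => - u n)%C (- a)%C.
Proof.
  intros H. replace (- a)%C with (RtoC (-1) * a)%C by ring.
  apply Ccv_ext with (fun n => RtoC (-1) * u n)%C.
  - intros; ring.
  - apply Ccv_scal, H.
Qed.

Lemma Ccv_minus u v a b : Ccv u a -> Ccv v b -> Ccv (fun n => u n - v n)%C (a - b)%C.
Proof. intros Hu Hv. apply Ccv_plus; [exact Hu | apply Ccv_opp, Hv]. Qed.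

Lemma Ccv_bounded u a : Ccv u a -> exists B, 0 < B /\ forall n, Cmod (u n) <= B.
Proof.
  intros Hu. destruct (Hu 1) as [n0 H0]; [lra|].
  assert (forall m, exists B, 0 < B /\ forall n, (n < m)%nat -> Cmod (u n) <= B) as Hf.
  { induction m as [|m [B [HB IH]]].
    - exists 1. split; [lra|]. intros; lia.
    - exists (B + Cmod (u m)). assert (Hm := Cmod_ge_0 (u m)). split; [lra|].
      intros n Hn. destruct (Nat.eq_dec n m) as [->|]; [lra|].
      assert (Cmod (u n) <= B) by (apply IH; lia). lra. }
  destruct (Hf n0) as [B [HB IH]].
  exists (B + Cmod a + 1). assert (Ha := Cmod_ge_0 a). split; [lra|].
  intros n. destruct (Nat.lt_ge_cases n n0) as [Hl|Hl].
  - specialize (IH n Hl). lra.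
  - specialize (H0 n Hl). replace (u n) with ((u n - a) + a)%C by ring.
    eapply Rle_trans; [apply Cmod_triangle|]. lra.
Qed.

Lemma Ccv_mult u v a b : Ccv u a -> Ccv v b -> Ccv (fun n => u n * v n)%C (a * b)%C.
Proof.
  intros Hu Hv. destruct (Ccv_bounded v b Hv) as [B [HB Hb]].
  intros eps He.
  assert (Ha := Cmod_ge_0 a).
  destruct (Hu (eps / (2 * B))) as [n1 H1]; [apply Rdiv_lt_0_compat; lra|].
  destruct (Ccv_scal a v b Hv (eps / 2)) as [n2 H2]; [lra|].
  exists (max n1 n2). intros n Hn.
  replace (u n * v n - a * b)%C with ((u n - a) * v n + (a * v n - a * b))%C by ring.
  eapply Rle_lt_trans; [apply Cmod_triangle|]. rewrite Cmod_mult.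
  assert (H3 : Cmod (u n - a)%C < eps / (2 * B)) by (apply H1; lia).
  assert (H4 : Cmod (a * v n - a * b)%C < eps / 2) by (apply H2; lia).
  assert (H5 : Cmod (u n - a)%C * Cmod (v n) <= eps / (2 * B) * B).
  { apply Rmult_le_compat; try apply Cmod_ge_0; [lra | apply Hb]. }
  replace (eps / (2 * B) * B) with (eps / 2) in H5 by (field; lra). lra.
Qed.

Lemma Ccv_unique u a b : Ccv u a -> Ccv u b -> a = b.
Proof.
  intros Ha Hb.
  assert (H : Cmod (a - b)%C = 0).
  { apply Rle_antisym; [|apply Cmod_ge_0].
    apply Rle_plus_epsilon. intros eps He.
    destruct (Ha (eps / 2)) as [n1 H1]; [lra|]. destruct (Hb (eps / 2)) as [n2 H2]; [lra|].
    assert (H3 : Cmod (u (max n1 n2) - a)%C < eps / 2) by (apply H1; lia).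
    assert (H4 : Cmod (u (max n1 n2) - b)%C < eps / 2) by (apply H2; lia).
    assert (H5 := Cmod_tri_sub a (u (max n1 n2)) b).
    rewrite Cmod_sym in H3. lra. }
  apply Cmod_eq_0 in H. replace a with ((a - b) + b)%C by ring. rewrite H. ring.
Qed.

Lemma Ccv_le u a B : (exists n0, forall n, (n0 <= n)%nat -> Cmod (u n) <= B) -> Ccv u a -> Cmod a <= B.
Proof.
  intros [n0 Hn] Ha. apply Rle_plus_epsilon. intros eps He.
  destruct (Ha eps He) as [n1 H1].
  assert (H2 : Cmod (u (max n0 n1)) <= B) by (apply Hn; lia).
  assert (H3 : Cmod (u (max n0 n1) - a)%C < eps) by (apply H1; lia).
  rewrite Cmod_sym in H3.
  replace a with ((a - u (max n0 n1)) + u (max n0 n1))%C by ring.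
  eapply Rle_trans; [apply Cmod_triangle|]. lra.
Qed.

Lemma Ccv_squeeze u a (e : nat -> R) :
  (exists n0, forall n, (n0 <= n)%nat -> Cmod (u n - a)%C <= e n) -> Un_cv e 0 -> Ccv u a.
Proof.
  intros [n0 H0] He eps Heps. destruct (He eps Heps) as [n1 H1].
  exists (max n0 n1). intros n Hn.
  assert (H2 : Cmod (u n - a)%C <= e n) by (apply H0; lia).
  assert (H3 : R_dist (e n) 0 < eps) by (apply H1; lia).
  unfold R_dist in H3. rewrite Rminus_0_r in H3.
  assert (H4 := Rle_abs (e n)). lra.
Qed.

Lemma Ccv_shift u a p : Ccv u a -> Ccv (fun n => u (n + p)%nat) a.
Proof. intros H eps He. destruct (H eps He) as [n0 Hn]. exists n0. intros. apply Hn. lia. Qed.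

Lemma Ccv_unshift u a p : Ccv (fun n => u (n + p)%nat) a -> Ccv u a.
Proof.
  intros H eps He. destruct (H eps He) as [n0 Hn]. exists (n0 + p)%nat. intros n Hle.
  replace n with ((n - p) + p)%nat by lia. apply Hn. lia.
Qed.

Lemma Ccv_S u a : Ccv u a <-> Ccv (fun n => u (S n)) a.
Proof.
  split; intros H.
  - apply Ccv_ext with (fun n => u (n + 1)%nat); [intros; f_equal; lia | apply Ccv_shift, H].
  - apply Ccv_unshift with 1%nat. apply Ccv_ext with (fun n => u (S n)); [intros; f_equal; lia | exact H].
Qed.

Lemma Ccv_Re u a : Ccv u a -> Un_cv (fun n => Re (u n)) (Re a).
Proof.
  intros H eps He. destruct (H eps He) as [n0 Hn]. exists n0. intros n Hle.
  unfold R_dist. apply Rle_lt_trans with (2 := Hn n Hle).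
  replace (Re (u n) - Re a) with (Re (u n - a)%C) by (destruct (u n), a; reflexivity).
  apply re_le_Cmod.
Qed.

Lemma Ccv_Im u a : Ccv u a -> Un_cv (fun n => Im (u n)) (Im a).
Proof.
  intros H eps He. destruct (H eps He) as [n0 Hn]. exists n0. intros n Hle.
  unfold R_dist. apply Rle_lt_trans with (2 := Hn n Hle).
  replace (Im (u n) - Im a) with (Im (u n - a)%C) by (destruct (u n), a; reflexivity).
  apply im_le_Cmod.
Qed.

Lemma Ccv_of_parts u a : Un_cv (fun n => Re (u n)) (Re a) -> Un_cv (fun n => Im (u n)) (Im a) -> Ccv u a.
Proof.
  intros H1 H2 eps He. destruct (H1 (eps / 2)) as [n1 Hn1]; [lra|].
  destruct (H2 (eps / 2)) as [n2 Hn2]; [lra|]. exists (max n1 n2). intros n Hn.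
  eapply Rle_lt_trans; [apply Cmod_le_abs|].
  assert (A1 : R_dist (Re (u n)) (Re a) < eps / 2) by (apply Hn1; lia).
  assert (A2 : R_dist (Im (u n)) (Im a) < eps / 2) by (apply Hn2; lia).
  unfold R_dist in *. replace (Re (u n - a)%C) with (Re (u n) - Re a) by (destruct (u n), a; reflexivity).
  replace (Im (u n - a)%C) with (Im (u n) - Im a) by (destruct (u n), a; reflexivity). lra.
Qed.

Lemma Ccv_RtoC (u : nat -> R) a : Un_cv u a -> Ccv (fun n => RtoC (u n)) (RtoC a).
Proof.
  intros H. apply Ccv_of_parts; simpl; [exact H|].
  intros eps He. exists O. intros. unfold R_dist. rewrite Rminus_0_r, Rabs_R0. exact He.
Qed.

Lemma Ccv_CLim_seq u a : Ccv u a -> CLim_seq u = a.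
Proof.
  intros H. unfold CLim_seq. destruct a as [x y].
  rewrite (is_lim_seq_unique (fun n => Re (u n)) x), (is_lim_seq_unique (fun n => Im (u n)) y).
  - reflexivity.
  - apply is_lim_seq_Reals. apply (Ccv_Im u (x, y) H).
  - apply is_lim_seq_Reals. apply (Ccv_Re u (x, y) H).
Qed.

(** [CSeries] is total, so its value means something only after convergence has been proved
    independently. The shift by one appears because [sum_n] includes its last index and [Csum] does
    not. *)
Lemma Ccv_CSeries f a : Ccv (Csum f) a -> CSeries f = a.
Proof.
  intros H. unfold CSeries. apply Ccv_S in H. destruct a as [x y].
  rewrite (is_series_unique (fun n => Re (f n)) x), (is_series_unique (fun n => Im (f n)) y).
  - reflexivity.
  - apply is_lim_seq_Reals. intros eps He. destruct (Ccv_Im _ _ H eps He) as [n0 Hn].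
    exists n0. intros n Hle. rewrite Rsum_sum_n, <- Im_Csum. apply Hn, Hle.
  - apply is_lim_seq_Reals. intros eps He. destruct (Ccv_Re _ _ H eps He) as [n0 Hn].
    exists n0. intros n Hle. rewrite Rsum_sum_n, <- Re_Csum. apply Hn, Hle.
Qed.

Lemma Ccv_filterlim u a : Ccv u a <-> filterlim u eventually (@locally C_UniformSpace a).
Proof.
  split.
  - intros H. apply (filterlim_locally (U := C_UniformSpace) u a). intros eps.
    destruct (H eps (cond_pos eps)) as [n0 Hn]. exists n0. intros n Hle.
    apply (C_NormedModule_mixin_compat1 a (u n) eps). apply Hn, Hle.
  - intros H eps He.
    (* Balls of the uniform structure on C are squares, hence the factor sqrt 2 on the way back to
       the modulus. *)
    assert (Hs : 0 < sqrt 2) by (apply sqrt_lt_R0; lra).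
    assert (He' : 0 < eps / sqrt 2) by (apply Rdiv_lt_0_compat; lra).
    destruct (proj1 (filterlim_locally (U := C_UniformSpace) u a) H (mkposreal _ He')) as [n0 Hn].
    exists n0. intros n Hle. specialize (Hn n Hle).
    apply (C_NormedModule_mixin_compat2 a (u n) (mkposreal _ He')) in Hn. simpl in Hn.
    replace (sqrt 2 * (eps / sqrt 2)) with eps in Hn by (field; lra). exact Hn.
Qed.

Lemma Ccv_is_series f a : Ccv (Csum f) a <-> @is_series C_AbsRing C_NormedModule f a.
Proof.
  unfold is_series. rewrite Ccv_S.
  assert (E : sum_n (G := C_AbelianMonoid) f = (fun n => Csum f (S n)))
    by (apply functional_extensionality; intro; apply Csum_sum_n).
  change (Ccv (fun n => Csum f (S n)) a <->
     filterlim (sum_n (G := C_AbelianMonoid) f) eventually (@locally C_UniformSpace a)).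
  rewrite E. apply Ccv_filterlim.
Qed.

Lemma Ccv_is_pseries a x l :
  Ccv (Csum (fun k => a k * x ^ k)%C) l <-> @is_pseries C_AbsRing C_NormedModule a x l.
Proof.
  unfold is_pseries. rewrite Ccv_is_series.
  assert (E : (fun k => a k * x ^ k)%C =
    (fun k => @scal C_AbsRing C_NormedModule (@pow_n C_AbsRing x k) (a k))).
  { apply functional_extensionality. intros k.
    change (@scal C_AbsRing C_NormedModule (@pow_n C_AbsRing x k) (a k)) with (@pow_n C_Ring x k * a k)%C.
    apply eq_trans with (x ^ k * a k)%C; [ring|]. reflexivity. }
  rewrite E. apply iff_refl.
Qed.

(** * Summable majorants and interchange of limits *)

Definition Rbdd (g : nat -> R) : Prop := exists A, forall n, Rsum g n <= A.

Lemma Rsum_cv_bdd (g : nat -> R) : (forall i, 0 <= g i) -> Rbdd g -> exists l, Un_cv (Rsum g) l /\ forall n, Rsum g n <= l.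
Proof.
  intros Hp [A HA].
  destruct (growing_cv (Rsum g)) as [l Hl].
  - intros n. simpl. specialize (Hp n). lra.
  - exists A. intros x [n ->]. apply HA.
  - exists l. split; [exact Hl|]. apply growing_ineq; [|exact Hl].
    intros n. simpl. specialize (Hp n). lra.
Qed.

Lemma Rsum_diff_tail g n m : (n <= m)%nat -> Rsum (fun i => g (n + i)%nat) (m - n) = Rsum g m - Rsum g n.
Proof. intros H. replace m with (n + (m - n))%nat at 2 by lia. rewrite Rsum_app. ring. Qed.

Lemma Csum_diff_tail f n m : (n <= m)%nat -> Csum (fun i => f (n + i)%nat) (m - n) = (Csum f m - Csum f n)%C.
Proof. intros H. replace m with (n + (m - n))%nat at 2 by lia. rewrite Csum_app. ring. Qed.

(** The tail estimate holds against every bound B of the partial sums of g, not only against their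
    limit, so that an explicit constant can be inserted without knowing the sum of g. *)
Lemma Csum_abs_cv (f : nat -> C) (g : nat -> R) :
  (forall i, Cmod (f i) <= g i) -> Rbdd g ->
  exists l, Ccv (Csum f) l /\
    forall B, (forall n, Rsum g n <= B) -> forall n, Cmod (l - Csum f n)%C <= B - Rsum g n.
Proof.
  intros Hfg Hb.
  assert (Hp : forall i, 0 <= g i) by (intros i; eapply Rle_trans; [apply Cmod_ge_0 | apply Hfg]).
  destruct (Rsum_cv_bdd g Hp Hb) as [A [HA HA']].
  assert (Hd : forall n m, (n <= m)%nat -> Cmod (Csum f m - Csum f n)%C <= Rsum g m - Rsum g n).
  { intros n m H. rewrite <- Csum_diff_tail, <- Rsum_diff_tail by exact H. apply Cmod_Csum_le. auto. }
  assert (HC : forall eps, 0 < eps -> exists N, forall n m, (N <= n)%nat -> (N <= m)%nat -> Cmod (Csum f n - Csum f m)%C < eps).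
  { intros eps He. destruct (HA eps He) as [N HN]. exists N.
    assert (forall n m, (N <= n)%nat -> (n <= m)%nat -> Cmod (Csum f m - Csum f n)%C < eps).
    { intros n m H1 H2. eapply Rle_lt_trans; [apply Hd, H2|].
      specialize (HN n H1). unfold R_dist in HN. apply Rabs_def2 in HN. specialize (HA' m). lra. }
    intros n m H1 H2. destruct (Nat.le_ge_cases n m).
    - rewrite Cmod_sym. apply H; auto.
    - apply H; auto. }
  assert (C1 : Cauchy_crit (fun n => Re (Csum f n))).
  { intros eps He. destruct (HC eps He) as [N HN]. exists N. intros n m Hn Hm.
    unfold R_dist. eapply Rle_lt_trans; [|apply (HN n m Hn Hm)].
    replace (Re (Csum f n) - Re (Csum f m)) with (Re (Csum f n - Csum f m)%C) by reflexivity.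
    apply re_le_Cmod. }
  assert (C2 : Cauchy_crit (fun n => Im (Csum f n))).
  { intros eps He. destruct (HC eps He) as [N HN]. exists N. intros n m Hn Hm.
    unfold R_dist. eapply Rle_lt_trans; [|apply (HN n m Hn Hm)].
    replace (Im (Csum f n) - Im (Csum f m)) with (Im (Csum f n - Csum f m)%C) by reflexivity.
    apply im_le_Cmod. }
  destruct (Rcomplete.R_complete _ C1) as [x Hx]. destruct (Rcomplete.R_complete _ C2) as [y Hy].
  assert (Hl : Ccv (Csum f) (x, y)) by (apply Ccv_of_parts; assumption).
  exists (x, y). split; [exact Hl|].
  intros B HB n. apply Ccv_le with (fun m => Csum f m - Csum f n)%C.
  - exists n. intros m Hm. specialize (Hd n m Hm). specialize (HB m). lra.
  - apply Ccv_minus; [exact Hl | apply Ccv_const].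
Qed.

Lemma Csum_cv_le f g l B :
  (forall i, Cmod (f i) <= g i) -> (forall n, Rsum g n <= B) -> Ccv (Csum f) l -> Cmod l <= B.
Proof.
  intros H1 H2 H3. apply Ccv_le with (Csum f); [|exact H3].
  exists O. intros n _. eapply Rle_trans; [apply Cmod_Csum_le; intros; apply H1 | apply H2].
Qed.

Lemma CSeries_correct f g : (forall i, Cmod (f i) <= g i) -> Rbdd g -> Ccv (Csum f) (CSeries f).
Proof.
  intros H1 H2. destruct (Csum_abs_cv f g H1 H2) as [l [Hl _]].
  rewrite (Ccv_CSeries _ _ Hl). exact Hl.
Qed.

(* Tannery's theorem. *)
Lemma Ccv_dominated (f : nat -> nat -> C) (h : nat -> C) (g : nat -> R) (s : nat -> C) (t : C) :
  (forall i, Ccv (fun L => f L i) (h i)) ->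
  (exists L0, forall L i, (L0 <= L)%nat -> Cmod (f L i) <= g i) -> Rbdd g ->
  (forall L, Ccv (Csum (f L)) (s L)) -> Ccv (Csum h) t ->
  Ccv s t.
Proof.
  intros Hf [L0 Hfg] Hb Hs Ht.
  assert (Hp : forall i, 0 <= g i) by (intros i; eapply Rle_trans; [apply Cmod_ge_0 | apply (Hfg L0 i); lia]).
  assert (Hhg : forall i, Cmod (h i) <= g i).
  { intros i. apply Ccv_le with (fun L => f L i); [|apply Hf]. exists L0. intros; auto. }
  destruct (Rsum_cv_bdd g Hp Hb) as [A [HA HA']].
  intros eps He.
  destruct (HA (eps / 4)) as [n0 Hn0]; [lra|].
  assert (HT : A - Rsum g n0 < eps / 4).
  { specialize (Hn0 n0 (le_n _)). unfold R_dist in Hn0. apply Rabs_def2 in Hn0. lra. }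
  assert (Hfin : Ccv (fun L => Csum (f L) n0) (Csum h n0)).
  { clear - Hf. induction n0; simpl; [apply Ccv_const|]. apply Ccv_plus; auto. }
  destruct (Hfin (eps / 4)) as [L1 HL1]; [lra|].
  exists (max L0 L1). intros L HL.
  assert (K1 : Cmod (s L - Csum (f L) n0)%C <= A - Rsum g n0).
  { destruct (Csum_abs_cv (f L) g) as [l [Hl Hl']]; [intros; apply Hfg; lia | exact Hb|].
    rewrite (Ccv_unique _ _ _ (Hs L) Hl). apply Hl', HA'. }
  assert (K2 : Cmod (t - Csum h n0)%C <= A - Rsum g n0).
  { destruct (Csum_abs_cv h g Hhg Hb) as [l [Hl Hl']].
    rewrite (Ccv_unique _ _ _ Ht Hl). apply Hl', HA'. }
  assert (K3 : Cmod (Csum (f L) n0 - Csum h n0)%C < eps / 4) by (apply HL1; lia).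
  assert (T1 := Cmod_tri_sub (s L) (Csum (f L) n0) t).
  assert (T2 := Cmod_tri_sub (Csum (f L) n0) (Csum h n0) t).
  rewrite Cmod_sym in K2. lra.
Qed.

(** Tannery's theorem for the truncated rows: [Csum (u i) J] tends to [r i] as J grows and is
    dominated by [A i], while its sum over i is the J-th partial sum of the columns. *)
Lemma Csum_fubini (u : nat -> nat -> C) (g : nat -> nat -> R) (A : nat -> R) (r c : nat -> C) (s : C) :
  (forall i j, Cmod (u i j) <= g i j) ->
  (forall i n, Rsum (g i) n <= A i) -> Rbdd A ->
  (forall i, Ccv (Csum (u i)) (r i)) ->
  (forall j, Ccv (Csum (fun i => u i j)) (c j)) ->
  Ccv (Csum r) s -> Ccv (Csum c) s.
Proof.
  intros Hug HgA HA Hr Hc Hs.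
  apply Ccv_dominated with (f := fun J i => Csum (u i) J) (h := r) (g := A).
  - exact Hr.
  - exists O. intros J i _. eapply Rle_trans; [apply Cmod_Csum_le; intros; apply Hug | apply HgA].
  - exact HA.
  - intros J. induction J; simpl.
    + apply Ccv_ext with (fun _ => RtoC 0); [|apply Ccv_const].
      intros n. symmetry. apply Csum_0. reflexivity.
    + apply Ccv_ext with (fun n => Csum (fun i => Csum (u i) J) n + Csum (fun i => u i J) n)%C.
      * intros n. rewrite <- Csum_plus. reflexivity.
      * apply Ccv_plus; auto.
  - exact Hs.
Qed.

Lemma Rbdd_le f g : (forall i, f i <= g i) -> Rbdd g -> Rbdd f.
Proof.
  intros H [A HA]. exists A. intros n. eapply Rle_trans; [apply Rsum_le; intros; apply H | apply HA].
Qed.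

Lemma Rbdd_scal c f : 0 <= c -> Rbdd f -> Rbdd (fun i => c * f i).
Proof.
  intros Hc [A HA]. exists (c * A). intros n. rewrite Rsum_scal. apply Rmult_le_compat_l; auto.
Qed.

Lemma Rbdd_plus f g : Rbdd f -> Rbdd g -> Rbdd (fun i => f i + g i).
Proof.
  intros [A HA] [B HB]. exists (A + B). intros n. rewrite Rsum_plus. specialize (HA n); specialize (HB n); lra.
Qed.

Lemma Rbdd_shift f p : (forall i, 0 <= f i) -> Rbdd (fun i => f (p + i)%nat) -> Rbdd f.
Proof.
  intros Hp [A HA]. exists (Rsum f p + A). intros n.
  apply Rle_trans with (Rsum f (p + n)); [apply Rsum_mono; [auto|lia]|].
  rewrite Rsum_app. specialize (HA n). lra.
Qed.

Lemma Rbdd_ratio f J q : 0 <= q < 1 -> (forall i, 0 <= f i) ->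
  (forall i, (J <= i)%nat -> f (S i) <= q * f i) -> Rbdd f.
Proof.
  intros Hq Hp Hr. apply (Rbdd_shift f J Hp).
  assert (K : forall n, Rsum (fun i => f (J + i)%nat) n * (1 - q) <= f J - f (J + n)%nat).
  { induction n; simpl.
    - rewrite Nat.add_0_r. lra.
    - rewrite Nat.add_succ_r. assert (H := Hr (J + n)%nat ltac:(lia)). lra. }
  exists (f J / (1 - q)). intros n. apply Rmult_le_reg_r with (1 - q); [lra|].
  specialize (K n). specialize (Hp (J + n)%nat).
  replace (f J / (1 - q) * (1 - q)) with (f J) by (field; lra). lra.
Qed.

Lemma exp_mono x y : x <= y -> exp x <= exp y.
Proof. intros [H|H]; [left; apply exp_increasing, H | right; now rewrite H]. Qed.

(* Telescoping against n^{-a}. *)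
Lemma Rbdd_power p : 1 < p -> Rbdd (fun n => Rpower (INR (S n)) (- p)).
Proof.
  intros Hp. set (a := p - 1). assert (Ha : 0 < a) by (unfold a; lra).
  assert (Hpos : forall i, 0 <= Rpower (INR (S i)) (- p)) by (intros; left; apply exp_pos).
  apply (Rbdd_shift _ 1 Hpos).
  exists (/ a). intros n.
  assert (K : a * Rsum (fun i => Rpower (INR (S (1 + i))) (- p)) n <= 1 - Rpower (INR (S n)) (- a)).
  { induction n.
    - simpl. unfold Rpower. rewrite ln_1, !Rmult_0_r, exp_0. lra.
    - rewrite Rsum_S, Rmult_plus_distr_l.
      assert (H : a * Rpower (INR (S (1 + n))) (- p) <= Rpower (INR (S n)) (- a) - Rpower (INR (S (S n))) (- a)); [|lra].
      change (1 + n)%nat with (S n).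
      set (x := INR (S (S n))). assert (Hx : 1 < x) by (unfold x; rewrite !S_INR; assert (H := pos_INR n); lra).
      replace (INR (S n)) with (x - 1) by (unfold x; rewrite (S_INR (S n)); lra).
      replace (- p) with (- a + Ropp 1) by (unfold a; lra). rewrite Rpower_plus.
      replace (Rpower x (Ropp 1)) with (/ x) by (rewrite Rpower_Ropp, Rpower_1; lra).
      replace (Rpower (x - 1) (- a)) with (Rpower x (- a) * Rpower ((x - 1) / x) (- a)).
      + assert (Hx0 : 0 < Rpower x (- a)) by apply exp_pos.
        (* From ln(1 - 1/x) <= -1/x the power is at least exp(a/x), hence at least 1 + a/x; this
           bounds a x^(-p) by the difference of the values of t^(-a) at t = x - 1 and t = x. *)
        assert (Hl : 1 + a / x <= Rpower ((x - 1) / x) (- a)).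
        { unfold Rpower. apply Rle_trans with (exp (a / x)).
          - left. apply exp_ineq1. assert (0 < a / x) by (apply Rdiv_lt_0_compat; lra). lra.
          - assert (Hln : ln ((x - 1) / x) <= - (/ x)).
            { assert (Hq : 0 < (x - 1) / x) by (apply Rdiv_lt_0_compat; lra).
              assert (Hexp : (x - 1) / x <= exp (- / x)).
              { destruct (Req_dec (- / x) 0) as [E|E]; [assert (0 < / x) by (apply Rinv_0_lt_compat; lra); lra|].
                left. replace ((x - 1) / x) with (1 + - / x) by (field; lra). apply exp_ineq1. exact E. }
              rewrite <- (ln_exp (- / x)). apply ln_le; assumption. }
            apply exp_mono. unfold Rdiv. nra. }
        unfold Rdiv in *. nra.
      + rewrite Rpower_mult_distr; [f_equal; field; lra | lra | apply Rdiv_lt_0_compat; lra]. }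
  apply Rmult_le_reg_l with a; [exact Ha|]. rewrite Rinv_r by lra.
  assert (0 < Rpower (INR (S n)) (- a)) by apply exp_pos. lra.
Qed.

(** * Principal branches and sectors *)

Lemma Cexp_plus a b : Cexp (a + b)%C = (Cexp a * Cexp b)%C.
Proof.
  destruct a as [a1 a2], b as [b1 b2]. unfold Cexp, Cplus, Cmult. simpl.
  rewrite exp_plus, cos_plus, sin_plus. f_equal; ring.
Qed.

Lemma Cexp_0 : Cexp (RtoC 0) = RtoC 1.
Proof. unfold Cexp, RtoC. simpl. rewrite exp_0, cos_0, sin_0. f_equal; ring. Qed.

Lemma Cexp_RtoC (r : R) : Cexp (RtoC r) = RtoC (exp r).
Proof. unfold Cexp, RtoC. simpl. rewrite cos_0, sin_0. f_equal; ring. Qed.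

Lemma Cmod_Cexp z : Cmod (Cexp z) = exp (Re z).
Proof.
  unfold Cexp, Cmod. simpl.
  replace (_ + _) with (exp (Re z) * exp (Re z)).
  - apply sqrt_square. left; apply exp_pos.
  - assert (H := sin2_cos2 (Im z)). unfold Rsqr in H.
    replace (exp (Re z) * exp (Re z)) with (exp (Re z) * exp (Re z) * (sin (Im z) * sin (Im z) + cos (Im z) * cos (Im z))) by (rewrite H; ring). ring.
Qed.

Lemma Cexp_neq_0 z : Cexp z <> RtoC 0.
Proof. apply Cmod_gt_0. rewrite Cmod_Cexp. apply exp_pos. Qed.

Lemma Cexp_opp z : Cexp (- z)%C = (/ Cexp z)%C.
Proof.
  assert (H : (Cexp (- z) * Cexp z)%C = RtoC 1).
  { rewrite <- Cexp_plus. replace (- z + z)%C with (RtoC 0) by ring. apply Cexp_0. }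
  assert (H1 := Cexp_neq_0 z).
  replace (Cexp (- z)) with (Cexp (- z) * Cexp z * / Cexp z)%C by (field; exact H1).
  rewrite H. ring.
Qed.

Lemma Cexp_minus a b : Cexp (a - b)%C = (Cexp a / Cexp b)%C.
Proof. unfold Cminus. rewrite Cexp_plus, Cexp_opp. reflexivity. Qed.

Lemma Cexp_pow z n : Cexp (INR n * z)%C = (Cexp z ^ n)%C.
Proof.
  induction n.
  - simpl. replace (RtoC 0 * z)%C with (RtoC 0) by ring. apply Cexp_0.
  - rewrite S_INR, RtoC_plus. replace ((INR n + 1) * z)%C with (z + INR n * z)%C by ring.
    rewrite Cexp_plus, IHn. reflexivity.
Qed.

Lemma Carg_polar (r t : R) : 0 < r -> - PI < t <= PI -> Carg (r * cos t, r * sin t) = t.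
Proof.
  intros Hr Ht. unfold Carg.
  assert (Hm : Cmod (r * cos t, r * sin t) = r).
  { unfold Cmod. simpl.
    assert (H := sin2_cos2 t). unfold Rsqr in H.
    replace (_ + _) with (r * r * (sin t * sin t + cos t * cos t)) by ring. rewrite H, Rmult_1_r.
    apply sqrt_square. lra. }
  rewrite Hm. simpl. replace (r * cos t / r) with (cos t) by (field; lra).
  destruct (Rle_dec 0 (r * sin t)) as [H|H].
  - apply acos_cos. split; [|lra].
    destruct (Rle_lt_dec 0 t) as [|Hn]; [assumption|].
    assert (sin t < 0) by (apply sin_lt_0_var; lra). nra.
  - assert (Hn : t < 0).
    { destruct (Rlt_le_dec t 0) as [|Hp]; [assumption|].
      assert (0 <= sin t) by (apply sin_ge_0; lra). nra. }
    rewrite <- cos_neg, acos_cos by lra. ring.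
Qed.

Lemma Cpolar z : z <> RtoC 0 ->
  Re z = Cmod z * cos (Carg z) /\ Im z = Cmod z * sin (Carg z) /\ - PI < Carg z <= PI.
Proof.
  intros Hz. assert (Hm : 0 < Cmod z) by (apply Cmod_gt_0, Hz).
  assert (HR := re_le_Cmod z).
  assert (Hb : -1 <= Re z / Cmod z <= 1).
  { apply Rabs_le_between in HR. split.
    - apply Rmult_le_reg_r with (Cmod z); [exact Hm|]. unfold Rdiv. rewrite Rmult_assoc, Rinv_l by lra. lra.
    - apply Rmult_le_reg_r with (Cmod z); [exact Hm|]. unfold Rdiv. rewrite Rmult_assoc, Rinv_l by lra. lra. }
  assert (Hs : sqrt (1 - (Re z / Cmod z)²) = Rabs (Im z) / Cmod z).
  { replace (1 - (Re z / Cmod z)²) with ((Im z / Cmod z)²).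
    - rewrite sqrt_Rsqr_abs. unfold Rdiv. rewrite Rabs_mult. f_equal. apply Rabs_right.
      left. apply Rinv_0_lt_compat, Hm.
    - assert (H := Cmod2_alt z). unfold Rsqr.
      replace (1) with (Cmod z ^ 2 / Cmod z ^ 2) at 1 by (field; lra). rewrite H at 1. field. lra. }
  assert (HP := PI_RGT_0). assert (Hac := acos_bound (Re z / Cmod z)).
  unfold Carg. destruct (Rle_dec 0 (Im z)) as [H|H].
  - rewrite cos_acos, sin_acos, Hs by exact Hb. rewrite Rabs_right by lra.
    repeat split; try lra; field; lra.
  - rewrite cos_neg, sin_neg, cos_acos, sin_acos, Hs by exact Hb. rewrite Rabs_left by lra.
    repeat split; try lra; try (field; lra).
    (* The value -PI must be excluded: acos = PI would make the sine vanish, although Im z < 0. *)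
    destruct (Req_dec (acos (Re z / Cmod z)) PI) as [E|E]; [|lra].
    exfalso. assert (E2 := sin_acos _ Hb). rewrite Hs, E, sin_PI, Rabs_left in E2 by lra.
    assert (0 < - Im z / Cmod z) by (apply Rdiv_lt_0_compat; lra). lra.
Qed.

Lemma Cexp_Clog z : z <> RtoC 0 -> Cexp (Clog z) = z.
Proof.
  intros Hz. destruct (Cpolar z Hz) as [H1 [H2 _]].
  assert (Hm : 0 < Cmod z) by (apply Cmod_gt_0, Hz).
  unfold Cexp, Clog. simpl. rewrite exp_ln by exact Hm. rewrite <- H1, <- H2. destruct z; reflexivity.
Qed.

Lemma Clog_Cexp v : - PI < Im v <= PI -> Clog (Cexp v) = v.
Proof.
  intros H. unfold Clog. rewrite Cmod_Cexp, ln_exp. unfold Cexp.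
  rewrite Carg_polar; [destruct v; reflexivity | apply exp_pos | exact H].
Qed.

Lemma Clog_RtoC r : 0 < r -> Clog (RtoC r) = RtoC (ln r).
Proof.
  intros H. replace (RtoC r) with (Cexp (RtoC (ln r))) at 1.
  - apply Clog_Cexp. simpl. assert (HP := PI_RGT_0). lra.
  - rewrite Cexp_RtoC, exp_ln by exact H. reflexivity.
Qed.

Lemma Carg_scal r z : 0 < r -> Carg (RtoC r * z)%C = Carg z.
Proof.
  intros Hr.
  destruct (Ceq_dec z (RtoC 0)) as [->|Hz]; [rewrite Cmult_0_r; reflexivity|].
  assert (Hm : 0 < Cmod z) by (apply Cmod_gt_0, Hz).
  destruct (Cpolar z Hz) as [H1 [H2 H3]].
  replace (RtoC r * z)%C with ((r * Cmod z) * cos (Carg z), (r * Cmod z) * sin (Carg z)).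
  - apply Carg_polar; [nra | exact H3].
  - apply C_eq.
    + rewrite re_scal_l, H1. simpl. ring.
    + unfold Cmult, RtoC. simpl. fold (Im z) (Re z). rewrite H2. ring.
Qed.

Lemma Clog_scal r z : 0 < r -> z <> RtoC 0 -> Clog (RtoC r * z)%C = (ln r + Clog z)%C.
Proof.
  intros Hr Hz. unfold Clog. rewrite Carg_scal by exact Hr.
  rewrite Cmod_mult, Cmod_R, Rabs_right by lra.
  rewrite ln_mult by (try exact Hr; apply Cmod_gt_0, Hz).
  unfold Cplus, RtoC. simpl. f_equal. ring.
Qed.

Lemma slit_neq_0 z : slit_plane z -> z <> RtoC 0.
Proof. intros H E. apply H. subst. simpl. lra. Qed.

Lemma slit_of_Re z : 0 < Re z -> slit_plane z.
Proof. intros H [H1 _]. lra. Qed.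

Lemma slit_Carg z : slit_plane z -> - PI < Carg z < PI.
Proof.
  intros H. destruct (Cpolar z (slit_neq_0 z H)) as [H1 [H2 H3]].
  assert (Hm : 0 < Cmod z) by (apply Cmod_gt_0, slit_neq_0, H).
  destruct (Req_dec (Carg z) PI) as [E|E]; [|lra].
  exfalso. apply H. rewrite H1, H2, E, cos_PI, sin_PI. lra.
Qed.

Lemma Carg_slit z : z <> RtoC 0 -> Carg z < PI -> slit_plane z.
Proof.
  intros Hz Hlt [H1 H2]. unfold Carg in Hlt.
  assert (Hm : 0 < Cmod z) by (apply Cmod_gt_0, Hz).
  destruct (Rle_dec 0 (Im z)) as [H|H]; [|lra].
  assert (E : Re z = - Cmod z).
  { unfold Cmod. destruct z as [a b]. simpl in *. subst b.
    replace (a * (a * 1) + 0 * (0 * 1)) with (Rsqr a) by (unfold Rsqr; ring).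
    rewrite sqrt_Rsqr_abs, Rabs_left1; lra. }
  rewrite E in Hlt. replace (- Cmod z / Cmod z) with (- (1)) in Hlt by (field; lra).
  rewrite acos_opp, acos_1 in Hlt. lra.
Qed.

Lemma slit_scal r z : 0 < r -> slit_plane z -> slit_plane (RtoC r * z)%C.
Proof.
  intros Hr Hz [H1 H2]. apply Hz. rewrite re_scal_l in H1. unfold Cmult, RtoC in H2. simpl in H2.
  fold (Im z) (Re z) in H2. split; [nra|].
  assert (r * Im z = 0) by lra. apply Rmult_integral in H. lra.
Qed.

Lemma sector_scal d r z : 0 < r -> sector d z -> sector d (RtoC r * z)%C.
Proof. intros Hr [H1 H2]. split; [apply slit_scal; assumption | rewrite Carg_scal; assumption]. Qed.

(** Law of cosines together with cos(arg y) >= - cos d; the constant is c = sqrt((1 - cos d) / 2),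
    that is sin(d / 2). The uniform estimates in sectors start from this bound. *)
Lemma sector_lower d : 0 < d < PI ->
  exists c, 0 < c <= 1 /\ forall y t, sector d y -> 0 <= t -> c * (Cmod y + t) <= Cmod (y + RtoC t)%C.
Proof.
  intros Hd. set (q := (1 - cos d) / 2).
  assert (Hc : -1 < cos d < 1).
  { split.
    - rewrite <- cos_PI. apply cos_decreasing_1; lra.
    - rewrite <- cos_0. apply cos_decreasing_1; lra. }
  assert (Hq : 0 < q < 1) by (unfold q; lra).
  exists (sqrt q). split.
  - split; [apply sqrt_lt_R0; lra|]. rewrite <- sqrt_1. apply sqrt_le_1_alt. lra.
  - intros y t [Hy Ha] Ht.
    assert (Hz := slit_neq_0 y Hy). assert (Hm := Cmod_ge_0 y).
    destruct (Cpolar y Hz) as [H1 [H2 _]].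
    assert (Hcos : - cos d <= cos (Carg y)).
    { rewrite <- Rtrigo_facts.cos_pi_minus.
      assert (E : cos (Rabs (Carg y)) = cos (Carg y)).
      { unfold Rabs. destruct (Rcase_abs (Carg y)); [apply cos_neg | reflexivity]. }
      rewrite <- E. apply cos_decr_1; try lra; try apply Rabs_pos. }
    assert (E : Cmod (y + RtoC t)%C ^ 2 = Cmod y ^ 2 + t ^ 2 + 2 * t * Cmod y * cos (Carg y)).
    { rewrite !Cmod2_alt. rewrite re_plus. simpl (Re (RtoC t)).
      replace (Im (y + RtoC t)%C) with (Im y) by (unfold Cplus, RtoC; simpl; unfold Im; ring).
      rewrite H1, H2. ring. }
    apply Rsqr_incr_0_var; [|apply Cmod_ge_0].
    unfold Rsqr. replace (Cmod (y + RtoC t)%C * Cmod (y + RtoC t)%C) with (Cmod (y + RtoC t)%C ^ 2) by ring.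
    rewrite E. replace (sqrt q * (Cmod y + t) * (sqrt q * (Cmod y + t))) with ((sqrt q * sqrt q) * (Cmod y + t) ^ 2) by ring.
    rewrite sqrt_sqrt by lra. unfold q.
    assert (0 <= t * Cmod y) by (apply Rmult_le_pos; lra).
    assert (0 <= (Cmod y - t) ^ 2) by apply pow2_ge_0. nra.
Qed.

Lemma slit_plus y t : slit_plane y -> 0 <= t -> slit_plane (y + RtoC t)%C.
Proof.
  intros H Ht [H1 H2]. apply H. rewrite re_plus in H1. simpl in H1.
  unfold Cplus, RtoC in H2. simpl in H2. unfold Im. lra.
Qed.

(** A single point always lies in some closed subsector, so pointwise statements on the slit plane
    inherit the sector estimates. The minimum with PI / 2 keeps d below PI when the argument is
    0. *)
Lemma slit_sector y : slit_plane y -> exists d, 0 < d < PI /\ sector d y.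
Proof.
  intros H. assert (Ha := slit_Carg y H). assert (HP := PI_RGT_0).
  assert (Hab : Rabs (Carg y) < PI) by (apply Rabs_def1; lra).
  assert (Rabs (Carg y) >= 0) by (apply Rle_ge, Rabs_pos).
  exists (Rmin (PI / 2) (PI - Rabs (Carg y))). split.
  - unfold Rmin. destruct (Rle_dec _ _); lra.
  - split; [exact H|]. unfold Rmin. destruct (Rle_dec _ _); lra.
Qed.

(** * Complex-valued functions of a real variable *)

Definition is_Cder (g : R -> C) (t : R) (d : C) : Prop :=
  is_derive (fun s => Re (g s)) t (Re d) /\ is_derive (fun s => Im (g s)) t (Im d).

Lemma is_Cder_ext g h t d : (forall s, g s = h s) -> is_Cder g t d -> is_Cder h t d.
Proof.
  intros H [H1 H2]. split; eapply is_derive_ext; try eassumption; intros; simpl; rewrite H; reflexivity.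
Qed.

Lemma is_Cder_const c t : is_Cder (fun _ => c) t (RtoC 0).
Proof. split; apply (is_derive_const (V := R_NormedModule)). Qed.

Lemma is_Cder_RtoC (f : R -> R) (t d : R) : is_derive f t d -> is_Cder (fun s => RtoC (f s)) t (RtoC d).
Proof. intros H. split; [exact H | apply (is_derive_const (V := R_NormedModule) 0 t)]. Qed.

Lemma is_Cder_id t : is_Cder (fun s => RtoC s) t (RtoC 1).
Proof. apply is_Cder_RtoC. apply (is_derive_id (K := R_AbsRing)). Qed.

Lemma is_Cder_plus g h t d e : is_Cder g t d -> is_Cder h t e -> is_Cder (fun s => g s + h s)%C t (d + e)%C.
Proof.
  intros [H1 H2] [H3 H4]. split.
  - apply (is_derive_plus (V := R_NormedModule) _ _ _ _ _ H1 H3).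
  - apply (is_derive_plus (V := R_NormedModule) _ _ _ _ _ H2 H4).
Qed.

Lemma is_derive_Rmult f g (t a b : R) : is_derive f t a -> is_derive g t b ->
  is_derive (fun s => f s * g s) t (a * g t + f t * b).
Proof. intros H1 H2. apply (is_derive_mult (K := R_AbsRing) f g t a b H1 H2). intros; apply Rmult_comm. Qed.

Lemma is_derive_eq (f : R -> R) (t a b : R) : a = b -> is_derive f t a -> is_derive f t b.
Proof. intros ->; auto. Qed.

Lemma is_Cder_mult g h t d e : is_Cder g t d -> is_Cder h t e ->
  is_Cder (fun s => g s * h s)%C t (d * h t + g t * e)%C.
Proof.
  intros [H1 H2] [H3 H4]. split.
  - apply is_derive_ext with (fun s => Re (g s) * Re (h s) - Im (g s) * Im (h s)).
    { intros; simpl. symmetry. apply re_mult. }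
    rewrite re_plus, !re_mult.
    replace (Re d * Re (h t) - Im d * Im (h t) + (Re (g t) * Re e - Im (g t) * Im e)) with
      ((Re d * Re (h t) + Re (g t) * Re e) - (Im d * Im (h t) + Im (g t) * Im e)) by ring.
    apply (is_derive_minus (V := R_NormedModule)); apply is_derive_Rmult; assumption.
  - apply is_derive_ext with (fun s => Re (g s) * Im (h s) + Im (g s) * Re (h s)).
    { intros; simpl. symmetry. apply im_mult. }
    replace (Im (d * h t + g t * e)%C) with
      ((Re d * Im (h t) + Re (g t) * Im e) + (Im d * Re (h t) + Im (g t) * Re e)).
    + apply (is_derive_plus (V := R_NormedModule)); apply is_derive_Rmult; assumption.
    + replace (Im (d * h t + g t * e)%C) with (Im (d * h t)%C + Im (g t * e)%C) by reflexivity.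
      rewrite !im_mult. ring.
Qed.

Lemma is_Cder_scal c g t d : is_Cder g t d -> is_Cder (fun s => c * g s)%C t (c * d)%C.
Proof.
  intros H. replace (c * d)%C with (RtoC 0 * g t + c * d)%C by ring.
  apply is_Cder_mult; [apply is_Cder_const | exact H].
Qed.

Lemma is_Cder_opp g t d : is_Cder g t d -> is_Cder (fun s => - g s)%C t (- d)%C.
Proof.
  intros H. replace (- d)%C with (RtoC (-1) * d)%C by ring.
  apply is_Cder_ext with (fun s => RtoC (-1) * g s)%C; [intros; ring | apply is_Cder_scal, H].
Qed.

Lemma is_Cder_minus g h t d e : is_Cder g t d -> is_Cder h t e -> is_Cder (fun s => g s - h s)%C t (d - e)%C.
Proof. intros H1 H2. apply is_Cder_plus; [exact H1 | apply is_Cder_opp, H2]. Qed.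

Lemma is_Cder_Csum (f : R -> nat -> C) (f' : nat -> C) t n :
  (forall i, (i < n)%nat -> is_Cder (fun s => f s i) t (f' i)) ->
  is_Cder (fun s => Csum (f s) n) t (Csum f' n).
Proof.
  induction n; intros H; simpl.
  - apply is_Cder_const.
  - apply is_Cder_plus; [apply IHn; intros; apply H; lia | apply H; lia].
Qed.

Lemma is_Cder_eq g t d e : d = e -> is_Cder g t d -> is_Cder g t e.
Proof. intros ->; auto. Qed.

Lemma is_Cder_pow g t d n : is_Cder g t d -> is_Cder (fun s => g s ^ S n)%C t (INR (S n) * g t ^ n * d)%C.
Proof.
  intros H. induction n.
  - apply is_Cder_eq with d; [simpl; ring|]. apply is_Cder_ext with g; [intros; simpl; ring | exact H].
  - apply is_Cder_ext with (fun s => g s * g s ^ S n)%C; [intros; reflexivity|].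
    eapply is_Cder_eq; [|apply is_Cder_mult; [exact H | exact IHn]].
    rewrite (S_INR (S n)), RtoC_plus. rewrite !Cpow_S. ring.
Qed.

Lemma is_Cder_linear c d t : is_Cder (fun s => c + s * d)%C t d.
Proof.
  apply is_Cder_eq with (RtoC 0 + (RtoC 1 * d + RtoC t * RtoC 0))%C; [ring|].
  apply is_Cder_plus; [apply is_Cder_const|].
  apply is_Cder_mult; [apply is_Cder_id | apply is_Cder_const].
Qed.

Lemma is_Cder_Cexp g t d : is_Cder g t d -> is_Cder (fun s => Cexp (g s)) t (Cexp (g t) * d)%C.
Proof.
  intros [H1 H2].
  assert (E : is_derive (fun s => exp (Re (g s))) t (Re d * exp (Re (g t))))
    by (apply (is_derive_comp exp (fun s => Re (g s)) t _ _ (is_derive_exp _) H1)).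
  assert (Ec : is_derive (fun s => cos (Im (g s))) t (Im d * - sin (Im (g t))))
    by (apply (is_derive_comp cos (fun s => Im (g s)) t _ _ (is_derive_cos _) H2)).
  assert (Es : is_derive (fun s => sin (Im (g s))) t (Im d * cos (Im (g t))))
    by (apply (is_derive_comp sin (fun s => Im (g s)) t _ _ (is_derive_sin _) H2)).
  split.
  - rewrite re_mult. unfold Cexp. simpl.
    apply (is_derive_eq _ _ (Re d * exp (Re (g t)) * cos (Im (g t)) + exp (Re (g t)) * (Im d * - sin (Im (g t))))); [ring|].
    apply (is_derive_Rmult (fun s => exp (Re (g s))) (fun s => cos (Im (g s)))); assumption.
  - rewrite im_mult. unfold Cexp. simpl.
    apply (is_derive_eq _ _ (Re d * exp (Re (g t)) * sin (Im (g t)) + exp (Re (g t)) * (Im d * cos (Im (g t))))); [ring|].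
    apply (is_derive_Rmult (fun s => exp (Re (g s))) (fun s => sin (Im (g s)))); assumption.
Qed.

Lemma Cmod_sq_pos z : z <> RtoC 0 -> 0 < Re z * Re z + Im z * Im z.
Proof.
  intros H. assert (Hm : 0 < Cmod z) by (apply Cmod_gt_0, H).
  assert (E := Cmod2_alt z). nra.
Qed.

Lemma Carg_unique z t : z <> RtoC 0 -> - PI < t <= PI ->
  Re z = Cmod z * cos t -> Im z = Cmod z * sin t -> Carg z = t.
Proof.
  intros Hz Ht H1 H2. assert (Hm : 0 < Cmod z) by (apply Cmod_gt_0, Hz).
  rewrite <- (Carg_polar (Cmod z) t Hm Ht). rewrite <- H1, <- H2. destruct z; reflexivity.
Qed.

Lemma sqrt_ratio a m : a <> 0 -> 0 < m -> forall b, m * m = a * a + b * b -> sqrt (1 + (b / a)²) = m / Rabs a.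
Proof.
  intros Ha Hm b E. replace (1 + (b / a)²) with ((m / a)²).
  - rewrite sqrt_Rsqr_abs. unfold Rdiv. rewrite Rabs_mult, Rabs_inv, (Rabs_right m) by lra. reflexivity.
  - unfold Rsqr. replace (m / a * (m / a)) with (m * m / (a * a)) by (field; exact Ha). rewrite E. field. exact Ha.
Qed.

(** The half-planes Re > 0, Im > 0 and Im < 0 cover the slit plane, and on each of them the argument
    is an arctangent; [is_Cder_Clog] differentiates these three local formulas. *)
Lemma Carg_Re_pos z : 0 < Re z -> Carg z = atan (Im z / Re z).
Proof.
  intros H. assert (Hz : z <> RtoC 0) by (intros ->; simpl in H; lra).
  assert (Hm : 0 < Cmod z) by (apply Cmod_gt_0, Hz).
  assert (E : Cmod z * Cmod z = Re z * Re z + Im z * Im z) by (assert (E := Cmod2_alt z); lra).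
  assert (Hb := atan_bound (Im z / Re z)). assert (HP := PI_RGT_0).
  apply Carg_unique; [exact Hz | lra | |].
  - rewrite cos_atan, (sqrt_ratio _ (Cmod z)) by (auto; lra). rewrite Rabs_right by lra. field. lra.
  - rewrite sin_atan, (sqrt_ratio _ (Cmod z)) by (auto; lra). rewrite Rabs_right by lra. field. lra.
Qed.

Lemma Carg_Im_pos z : 0 < Im z -> Carg z = PI / 2 - atan (Re z / Im z).
Proof.
  intros H. assert (Hz : z <> RtoC 0) by (intros ->; simpl in H; lra).
  assert (Hm : 0 < Cmod z) by (apply Cmod_gt_0, Hz).
  assert (E : Cmod z * Cmod z = Im z * Im z + Re z * Re z) by (assert (E := Cmod2_alt z); lra).
  assert (Hb := atan_bound (Re z / Im z)). assert (HP := PI_RGT_0).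
  apply Carg_unique; [exact Hz | lra | |].
  - rewrite cos_shift, sin_atan, (sqrt_ratio _ (Cmod z)) by (auto; lra). rewrite Rabs_right by lra. field. lra.
  - rewrite sin_shift, cos_atan, (sqrt_ratio _ (Cmod z)) by (auto; lra). rewrite Rabs_right by lra. field. lra.
Qed.

Lemma Carg_Im_neg z : Im z < 0 -> Carg z = - (PI / 2) - atan (Re z / Im z).
Proof.
  intros H. assert (Hz : z <> RtoC 0) by (intros ->; simpl in H; lra).
  assert (Hm : 0 < Cmod z) by (apply Cmod_gt_0, Hz).
  assert (E : Cmod z * Cmod z = Im z * Im z + Re z * Re z) by (assert (E := Cmod2_alt z); lra).
  assert (Hb := atan_bound (Re z / Im z)). assert (HP := PI_RGT_0).
  replace (- (PI / 2) - atan (Re z / Im z)) with (- (PI / 2 - - atan (Re z / Im z))) by ring.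
  apply Carg_unique; [exact Hz | lra | |].
  - rewrite cos_neg, cos_shift, sin_neg, sin_atan, (sqrt_ratio _ (Cmod z)) by (auto; lra). rewrite Rabs_left by lra. field. lra.
  - rewrite sin_neg, sin_shift, cos_neg, cos_atan, (sqrt_ratio _ (Cmod z)) by (auto; lra). rewrite Rabs_left by lra. field. lra.
Qed.

Lemma derive_locally_pos (f : R -> R) (t d : R) : is_derive f t d -> 0 < f t -> locally t (fun s => 0 < f s).
Proof.
  intros H Hp. assert (Hc : continuous f t) by (apply (ex_derive_continuous (V := R_NormedModule)); exists d; exact H).
  exact (Hc (fun y : R => 0 < y) (open_gt 0 (f t) Hp)).
Qed.

Lemma derive_locally_neg (f : R -> R) (t d : R) : is_derive f t d -> f t < 0 -> locally t (fun s => f s < 0).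
Proof.
  intros H Hp. assert (Hc : continuous f t) by (apply (ex_derive_continuous (V := R_NormedModule)); exists d; exact H).
  exact (Hc (fun y : R => y < 0) (open_lt 0 (f t) Hp)).
Qed.

Lemma is_derive_div_fun (f g : R -> R) (t a b : R) : is_derive f t a -> is_derive g t b -> g t <> 0 ->
  is_derive (fun s => f s / g s) t ((a * g t - f t * b) / (g t * g t)).
Proof.
  intros H1 H2 H. eapply is_derive_eq; [|apply (is_derive_div f g t a b H1 H2 H)].
  field. exact H.
Qed.

Lemma is_derive_atan_fun (f : R -> R) (t a : R) : is_derive f t a ->
  is_derive (fun s => atan (f s)) t (a / (1 + f t * f t)).
Proof.
  intros H. eapply is_derive_eq; [|apply (is_derive_comp atan f t _ a (is_derive_atan _) H)].
  unfold scal. simpl. unfold mult. simpl. unfold Rsqr. field. nra.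
Qed.

Lemma Cdiv_parts d z : z <> RtoC 0 ->
  Re (d / z)%C = (Re d * Re z + Im d * Im z) / (Re z * Re z + Im z * Im z) /\
  Im (d / z)%C = (Im d * Re z - Re d * Im z) / (Re z * Re z + Im z * Im z).
Proof.
  intros Hz. assert (H := Cmod_sq_pos z Hz). destruct d as [d1 d2], z as [a b]. simpl in *.
  split; field; nra.
Qed.

Lemma is_Cder_Clog g t d : slit_plane (g t) -> is_Cder g t d -> is_Cder (fun s => Clog (g s)) t (d / g t)%C.
Proof.
  intros Hs [H1 H2]. assert (Hz := slit_neq_0 _ Hs). assert (Hq := Cmod_sq_pos _ Hz).
  destruct (Cdiv_parts d (g t) Hz) as [E1 E2].
  set (q := Re (g t) * Re (g t) + Im (g t) * Im (g t)) in *.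
  split.
  - rewrite E1.
    assert (Hd : is_derive (fun s => Re (g s) * Re (g s) + Im (g s) * Im (g s)) t (2 * (Re d * Re (g t) + Im d * Im (g t)))).
    { eapply is_derive_eq; [|apply (is_derive_plus (V := R_NormedModule)); apply is_derive_Rmult; eassumption].
      unfold plus; simpl. ring. }
    (* Writing ln |g| as half the logarithm of |g|^2 avoids differentiating the square root in
       [Cmod]. *)
    apply is_derive_ext_loc with (fun s => / 2 * ln (Re (g s) * Re (g s) + Im (g s) * Im (g s))).
    + assert (Hl := derive_locally_pos _ _ _ Hd Hq).
      revert Hl. apply filter_imp. intros s Hp. unfold Clog. simpl.
      set (u := Re (g s) * Re (g s) + Im (g s) * Im (g s)) in *.
      assert (Ec : Cmod (g s) = sqrt u).
      { unfold Cmod. f_equal. unfold u, Re, Im. ring. }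
      rewrite Ec. assert (Hsq : 0 < sqrt u) by (apply sqrt_lt_R0, Hp).
      rewrite <- (sqrt_sqrt u) at 1 by lra. rewrite ln_mult by assumption. lra.
    + eapply is_derive_eq; [|apply is_derive_scal; apply (is_derive_comp ln); [apply is_derive_ln; exact Hq | exact Hd]].
      cbn; unfold mult; cbn. fold q. field. lra.
  - rewrite E2.
    assert (Hcase : 0 < Re (g t) \/ 0 < Im (g t) \/ Im (g t) < 0).
    { destruct (Rlt_le_dec 0 (Re (g t))); [auto|]. right.
      destruct (Rtotal_order (Im (g t)) 0) as [|[E|]]; auto. exfalso. apply Hs. auto. }
    destruct Hcase as [H|[H|H]].
    + apply is_derive_ext_loc with (fun s => atan (Im (g s) / Re (g s))).
      * assert (Hl := derive_locally_pos _ _ _ H1 H).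
        revert Hl. apply filter_imp. intros s Hp. simpl. rewrite Carg_Re_pos by exact Hp. reflexivity.
      * eapply is_derive_eq; [|apply is_derive_atan_fun; apply is_derive_div_fun; try eassumption; lra].
        unfold q. simpl. field. repeat split; nra.
    + apply is_derive_ext_loc with (fun s => PI / 2 - atan (Re (g s) / Im (g s))).
      * assert (Hl := derive_locally_pos _ _ _ H2 H).
        revert Hl. apply filter_imp. intros s Hp. simpl. rewrite Carg_Im_pos by exact Hp. reflexivity.
      * eapply is_derive_eq; [|apply (is_derive_minus (V := R_NormedModule)); [apply (is_derive_const (V := R_NormedModule)) | apply is_derive_atan_fun; apply is_derive_div_fun; try eassumption; lra]].
        unfold minus, plus, opp, zero. simpl. unfold q. field. repeat split; nra.
    + apply is_derive_ext_loc with (fun s => - (PI / 2) - atan (Re (g s) / Im (g s))).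
      * assert (Hl := derive_locally_neg _ _ _ H2 H).
        revert Hl. apply filter_imp. intros s Hp. simpl. rewrite Carg_Im_neg by exact Hp. reflexivity.
      * eapply is_derive_eq; [|apply (is_derive_minus (V := R_NormedModule)); [apply (is_derive_const (V := R_NormedModule)) | apply is_derive_atan_fun; apply is_derive_div_fun; try eassumption; lra]].
        unfold minus, plus, opp, zero. simpl. unfold q. field. repeat split; nra.
Qed.

(* Project the increment [g b - g a] on its own direction and apply the real
   mean value theorem. *)
Lemma Cder_mean_value (g g' : R -> C) (phi phi' : R -> R) (a b : R) : a <= b ->
  (forall t, a <= t <= b -> is_Cder g t (g' t)) ->
  (forall t, a <= t <= b -> is_derive phi t (phi' t)) ->
  (forall t, a <= t <= b -> Cmod (g' t) <= phi' t) ->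
  Cmod (g b - g a)%C <= phi b - phi a.
Proof.
  intros Hab Hg Hphi Hle. destruct (Req_dec a b) as [<-|Hne].
  { replace (g a - g a)%C with (RtoC 0) by ring. rewrite Cmod_0. lra. }
  set (d := (g b - g a)%C).
  destruct (Ceq_dec d (RtoC 0)) as [E|Hd].
  - rewrite E, Cmod_0.
    destruct (MVT_cor2 phi phi' a b) as [c [Hc1 Hc2]]; [lra | intros; apply is_derive_Reals; auto|].
    rewrite Hc1. assert (0 <= phi' c) by (eapply Rle_trans; [apply Cmod_ge_0 | apply Hle; lra]). nra.
  - assert (Hm : 0 < Cmod d) by (apply Cmod_gt_0, Hd).
    set (xi := fun t => (Re d * Re (g t) + Im d * Im (g t)) - Cmod d * phi t).
    destruct (MVT_cor2 xi (fun t => (Re d * Re (g' t) + Im d * Im (g' t)) - Cmod d * phi' t) a b) as [c [Hc1 Hc2]].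
    + lra.
    + intros t Ht. apply is_derive_Reals. destruct (Hg t Ht) as [G1 G2].
      apply (is_derive_minus (V := R_NormedModule)).
      * apply (is_derive_plus (V := R_NormedModule)); apply is_derive_scal; assumption.
      * apply is_derive_scal; auto.
    + assert (Hneg : Re d * Re (g' c) + Im d * Im (g' c) <= Cmod d * phi' c).
      { apply Rle_trans with (Cmod d * Cmod (g' c)).
        - assert (E : Re d * Re (g' c) + Im d * Im (g' c) = Re (Cconj d * g' c)%C).
          { rewrite re_mult, re_conj, im_conj. ring. }
          rewrite E. eapply Rle_trans; [apply Rle_abs|]. eapply Rle_trans; [apply re_le_Cmod|].
          rewrite Cmod_mult, Cmod_conj. lra.
        - apply Rmult_le_compat_l; [lra|]. apply Hle. lra. }
      assert (Hd2 : Re d * Re (g b) + Im d * Im (g b) - (Re d * Re (g a) + Im d * Im (g a)) = Cmod d * Cmod d).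
      { assert (E := Cmod2_alt d). replace (Cmod d * Cmod d) with (Cmod d ^ 2) by ring. rewrite E.
        unfold d, Cminus, Cplus, Copp, Re, Im. simpl. ring. }
      unfold xi in Hc1. apply Rmult_le_reg_l with (Cmod d); [exact Hm|]. nra.
Qed.

(** Induction on n: the derivative in t of the remainder of order n + 1 is v times the remainder of
    order n. The real parameter t exists only to make this integration possible. *)
Lemma Cexp_taylor v n t : 0 <= t ->
  Cmod (Cexp (t * v) - Csum (fun j => (t * v) ^ j / INR (fact j))%C n)%C
    <= Cmod v ^ n * t ^ n / INR (fact n) * exp (t * Cmod v).
Proof.
  revert t. induction n; intros t Ht.
  - simpl. replace (Cexp (t * v) - 0)%C with (Cexp (t * v)) by ring. rewrite Cmod_Cexp.
    replace (1 * 1 / 1 * exp (t * Cmod v)) with (exp (t * Cmod v)) by field.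
    apply exp_mono. rewrite re_scal_l. apply Rmult_le_compat_l; [exact Ht|].
    eapply Rle_trans; [apply Rle_abs | apply re_le_Cmod].
  - set (g := fun s : R => (Cexp (s * v) - Csum (fun j => (s * v) ^ j / INR (fact j))%C (S n))%C).
    (* The exponential factor is frozen at the endpoint t, so that the majorant is a monomial in s
       with an obvious derivative. *)
    set (M := exp (t * Cmod v)).
    set (K0 := Cmod v ^ S n / INR (fact (S n)) * M).
    set (phi := fun s : R => K0 * s ^ S n).
    assert (Hf : forall m, INR (fact m) <> 0) by (intros; apply INR_fact_neq_0).
    assert (Hder : is_Cder (fun s => (s * v)%C) t v /\ forall s, is_Cder (fun s : R => (s * v)%C) s v).
    { split; [|intros s]; (apply is_Cder_ext with (fun s => RtoC 0 + s * v)%C; [intros; ring | apply is_Cder_linear]). }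
    assert (K : Cmod (g t - g 0)%C <= phi t - phi 0).
    { apply Cder_mean_value with (g' := fun s : R => (v * (Cexp (s * v) - Csum (fun j => (s * v) ^ j / INR (fact j)) n))%C)
        (phi' := fun s => K0 * (INR (S n) * s ^ n)).
      - exact Ht.
      - intros s Hs. unfold g.
        eapply is_Cder_eq; [|apply is_Cder_minus; [apply is_Cder_Cexp, Hder |
          apply is_Cder_ext with (fun s => (1 + Csum (fun j => / INR (fact (S j)) * (s * v) ^ S j) n)%C);
          [|apply is_Cder_plus; [apply is_Cder_const | apply is_Cder_Csum; intros i Hi; apply is_Cder_scal, is_Cder_pow, Hder]]]].
        + rewrite Cplus_0_l.
          replace (v * (Cexp (s * v) - Csum (fun j => (s * v) ^ j / INR (fact j)) n))%C with
            (Cexp (s * v) * v - v * Csum (fun j => (s * v) ^ j / INR (fact j)) n)%C by ring.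
          f_equal. f_equal. rewrite <- Csum_scal. apply Csum_ext. intros i _.
          replace (fact (S i)) with (S i * fact i)%nat by reflexivity. rewrite mult_INR, RtoC_mult.
          assert (RtoC (INR (fact i)) <> RtoC 0) by (intros E; apply RtoC_inj in E; apply (Hf i E)).
          assert (RtoC (INR (S i)) <> RtoC 0) by (intros E; apply RtoC_inj in E; apply (not_0_INR (S i)) in E; auto).
          field. auto.
        + intros u. rewrite Csum_S_l. f_equal; [simpl; field; apply C1_nz|]. apply Csum_ext. intros.
          unfold Cdiv. ring.
      - intros s Hs. unfold phi. auto_derive; [exact I|]. change (pred (S n)) with n. change (match n with O => 1 | S _ => INR n + 1 end) with (INR (S n)). ring.
      - intros s Hs. rewrite Cmod_mult.
        apply Rle_trans with (Cmod v * (Cmod v ^ n * s ^ n / INR (fact n) * exp (s * Cmod v))).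
        + apply Rmult_le_compat_l; [apply Cmod_ge_0 | apply IHn; lra].
        + replace (K0 * (INR (S n) * s ^ n)) with (Cmod v * (Cmod v ^ n * s ^ n / INR (fact n) * M)).
          2: { unfold K0. replace (fact (S n)) with (S n * fact n)%nat by reflexivity. rewrite mult_INR.
               simpl (Cmod v ^ S n). field. split; [apply Hf | apply not_0_INR; lia]. }
          apply Rmult_le_compat_l; [apply Cmod_ge_0|]. apply Rmult_le_compat_l.
          * apply Rmult_le_pos; [apply Rmult_le_pos; apply pow_le; [apply Cmod_ge_0 | lra] | left; apply Rinv_0_lt_compat, INR_fact_lt_0].
          * apply exp_mono. apply Rmult_le_compat_r; [apply Cmod_ge_0 | lra]. }
    replace (g 0) with (RtoC 0) in K.
    + replace (phi 0) with 0 in K by (unfold phi; simpl; ring).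
      replace (g t - 0)%C with (g t) in K by ring.
      replace (Cmod v ^ S n * t ^ S n / INR (fact (S n)) * M) with (phi t) by (unfold phi, K0, Rdiv; ring).
      unfold g in K at 1. lra.
    + unfold g. replace (RtoC 0 * v)%C with (RtoC 0) by ring. rewrite Cexp_0, Csum_S_l.
      rewrite Csum_0; [simpl; field; apply C1_nz|]. intros i _. simpl. unfold Cdiv. ring.
Qed.

Lemma Cexp_bound1 v : Cmod (Cexp v - 1)%C <= Cmod v * exp (Cmod v).
Proof.
  assert (H := Cexp_taylor v 1 1 ltac:(lra)). simpl in H.
  replace (1 * v)%C with v in H by ring. replace (Cexp v - (0 + 1 / 1))%C with (Cexp v - 1)%C in H by (field; apply C1_nz).
  replace (Cmod v * 1 * (1 * 1) / 1) with (Cmod v) in H by field. rewrite Rmult_1_l in H. exact H.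
Qed.

Lemma Cexp_bound2 v : Cmod (Cexp v - 1 - v)%C <= Cmod v ^ 2 * exp (Cmod v).
Proof.
  assert (H := Cexp_taylor v 2 1 ltac:(lra)). simpl in H.
  replace (1 * v)%C with v in H by ring.
  replace (Cexp v - (0 + 1 / 1 + v * 1 / 1))%C with (Cexp v - 1 - v)%C in H by (field; apply C1_nz).
  rewrite (Rmult_1_l (Cmod v)) in H. assert (0 <= Cmod v ^ 2 * exp (Cmod v)).
  { apply Rmult_le_pos; [apply pow2_ge_0 | left; apply exp_pos]. }
  eapply Rle_trans; [exact H|].
  apply Rle_trans with (Cmod v ^ 2 * exp (Cmod v) / 2); [right; simpl; field | lra].
Qed.

(** Along s w the remainder has derivative w (- s w)^p / (1 + s w), by the finite geometric sum; |1
    + s w| >= 1/2 yields the factor 2. *)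
Lemma Clog_taylor w p : Cmod w <= 1 / 2 ->
  Cmod (Clog (1 + w) - Csum (fun i => - ((- w) ^ S i / INR (S i)))%C p)%C <= 2 * Cmod w ^ S p.
Proof.
  intros Hw. set (g := fun s : R => (Clog (1 + s * w) - Csum (fun i => - ((- (s * w)) ^ S i / INR (S i))) p)%C).
  set (phi := fun s : R => 2 * Cmod w ^ S p * s).
  assert (Hre : forall s, 0 <= s <= 1 -> 1 / 2 <= Cmod (1 + s * w)%C /\ slit_plane (1 + s * w)%C).
  { intros s Hs.
    assert (Hsw : Cmod (s * w)%C <= 1 / 2).
    { rewrite Cmod_mult, Cmod_R, Rabs_right by lra. assert (H := Cmod_ge_0 w). nra. }
    split.
    - assert (H := Cmod_ge_sub 1 (s * w)%C). rewrite Cmod_1 in H. lra.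
    - apply slit_of_Re. rewrite re_plus. simpl (Re 1).
      assert (H := re_le_Cmod (s * w)%C). apply Rabs_le_between in H. simpl. simpl in H. lra. }
  assert (Hgeo : forall (x : C) m, ((1 + x) * Csum (fun i => (- x) ^ i) m = 1 - (- x) ^ m)%C).
  { intros x m. induction m; simpl; [ring|]. rewrite Cmult_plus_distr_l, IHm. ring. }
  assert (Hlin : forall s c, is_Cder (fun s => (1 + s * c)%C) s c) by (intros; apply is_Cder_linear).
  assert (K : Cmod (g 1 - g 0)%C <= phi 1 - phi 0).
  { apply Cder_mean_value with (g' := fun s : R => (w * ((- (s * w)) ^ p / (1 + s * w)))%C) (phi' := fun _ => 2 * Cmod w ^ S p).
    - lra.
    - intros s Hs. destruct (Hre s Hs) as [Hs1 Hs2]. assert (Hnz := slit_neq_0 _ Hs2). unfold g.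
      eapply is_Cder_eq; [|apply is_Cder_minus; [apply is_Cder_Clog; [exact Hs2 | apply Hlin] |
        apply is_Cder_Csum with (f' := fun i => (w * (- (s * w)) ^ i)%C)]].
      + rewrite Csum_scal. assert (G := Hgeo (s * w)%C p).
        assert (E : Csum (fun i => (- (s * w)) ^ i)%C p = ((1 - (- (s * w)) ^ p) / (1 + s * w))%C).
        { rewrite <- G. field. exact Hnz. }
        change (Csum (Cpow (- (s * w))) p) with (Csum (fun i => (- (s * w)) ^ i)%C p). rewrite E. field. exact Hnz.
      + intros i _.
        assert (RtoC (INR (S i)) <> RtoC 0) by (intros E; apply RtoC_inj in E; apply (not_0_INR (S i)) in E; auto).
        apply is_Cder_ext with (fun u => (- / INR (S i)) * (0 + u * (- w)) ^ S i)%C.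
        * intros u. replace (0 + u * - w)%C with (- (u * w))%C by ring. unfold Cdiv. ring.
        * eapply is_Cder_eq; [|apply is_Cder_scal, is_Cder_pow, is_Cder_linear].
          cbv beta. replace (0 + s * - w)%C with (- (s * w))%C by ring. field. exact H.
    - intros s Hs. unfold phi. generalize (2 * Cmod w ^ S p). intros B. auto_derive; [exact I | ring].
    - intros s Hs. destruct (Hre s Hs) as [Hs1 Hs2]. assert (Hnz := slit_neq_0 _ Hs2).
      rewrite Cmod_mult, Cmod_div by exact Hnz. rewrite Cmod_pow, Cmod_opp, Cmod_mult, Cmod_R, Rabs_right by lra.
      assert (Hw0 := Cmod_ge_0 w).
      assert (Hp : 0 <= (s * Cmod w) ^ p <= Cmod w ^ p).
      { split; [apply pow_le; nra | apply pow_incr; nra]. }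
      assert (Hi : 0 < / Cmod (1 + s * w)%C <= 2).
      { split; [apply Rinv_0_lt_compat; lra|]. replace 2 with (/ (1 / 2)) by field. apply Rinv_le_contravar; lra. }
      simpl. apply Rle_trans with (Cmod w * (Cmod w ^ p * 2)); [|right; ring].
      apply Rmult_le_compat_l; [exact Hw0|]. unfold Rdiv. apply Rmult_le_compat; lra. }
  assert (E1 : g 1 = (Clog (1 + w) - Csum (fun i => - ((- w) ^ S i / INR (S i)))%C p)%C).
  { unfold g. rewrite (Cmult_1_l w). reflexivity. }
  assert (E0 : g 0 = RtoC 0).
  { unfold g. rewrite Csum_0.
    - replace (1 + 0 * w)%C with (RtoC 1) by ring. rewrite Clog_RtoC, ln_1 by lra. ring.
    - intros. simpl. unfold Cdiv. ring. }
  rewrite E0 in K. replace (g 1 - 0)%C with (g 1) in K by ring. rewrite E1 in K. unfold phi in K. lra.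
Qed.

Arguments INR : simpl never.

Lemma Rbdd_inv_sq : Rbdd (fun m => / INR (S m) ^ 2).
Proof.
  destruct (Rbdd_power 2 ltac:(lra)) as [A HA]. exists A. intros n. rewrite <- (HA n) at 1. right.
  apply Rsum_ext. intros i _. rewrite Rpower_Ropp. f_equal.
  replace 2 with (INR 2) by reflexivity. rewrite Rpower_pow; [reflexivity|]. apply lt_0_INR. lia.
Qed.

(** * The digamma function as a limit *)

(** [C_lim] looks only along the horizontal line through z, so a second-order estimate for real
    increments h determines [C_derive]. *)
Lemma C_derive_real f z d (B r : R) : 0 < r ->
  (forall h : R, h <> 0 -> Rabs h < r -> Cmod (f (z + h)%C - f z - h * d)%C <= B * h ^ 2) ->
  C_derive f z = d.
Proof.
  intros Hr H.
  assert (K : forall eps, 0 < eps -> exists delta, 0 < delta /\ forall x : R, Rabs (x - fst z) < delta -> x <> fst z ->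
    Cmod ((f (x, snd z) - f z) / ((x, snd z) - z) - d)%C < eps).
  { intros eps He. exists (Rmin r (eps / (Rabs B + 1))).
    assert (HB := Rabs_pos B). assert (HB' := Rle_abs B).
    split. { apply Rmin_glb_lt; [exact Hr|]. apply Rdiv_lt_0_compat; lra. }
    intros x Hx Hne. set (h := x - fst z).
    assert (Hh : h <> 0) by (unfold h; lra).
    assert (Hh1 : Rabs h < r) by (eapply Rlt_le_trans; [exact Hx | apply Rmin_l]).
    assert (Hh2 : Rabs h < eps / (Rabs B + 1)) by (eapply Rlt_le_trans; [exact Hx | apply Rmin_r]).
    assert (E : (x, snd z) = (z + h)%C).
    { destruct z as [a b]. unfold h, Cplus, RtoC. simpl. f_equal; ring. }
    rewrite E. specialize (H h Hh Hh1).
    assert (HhC : RtoC h <> RtoC 0) by (intros E'; apply RtoC_inj in E'; auto).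
    replace ((f (z + h) - f z) / (z + h - z) - d)%C with ((f (z + h) - f z - h * d) / h)%C.
    2: { replace (z + h - z)%C with (RtoC h) by ring. field. exact HhC. }
    rewrite Cmod_div, Cmod_R by exact HhC.
    assert (Hp : 0 < Rabs h) by (apply Rabs_pos_lt, Hh).
    apply Rle_lt_trans with (B * Rabs h).
    - apply Rmult_le_reg_r with (Rabs h); [exact Hp|]. unfold Rdiv. rewrite Rmult_assoc, Rinv_l by lra.
      rewrite Rmult_1_r. replace (B * Rabs h * Rabs h) with (B * h ^ 2); [exact H|].
      rewrite <- (pow2_abs h). ring.
    - apply Rle_lt_trans with (Rabs B * Rabs h); [nra|].
      apply Rle_lt_trans with (Rabs B * (eps / (Rabs B + 1))); [nra|].
      apply Rmult_lt_reg_r with (Rabs B + 1); [lra|].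
      replace (Rabs B * (eps / (Rabs B + 1)) * (Rabs B + 1)) with (Rabs B * eps) by (field; lra). nra. }
  unfold C_derive, C_lim. destruct d as [d1 d2].
  rewrite (is_lim_unique _ _ d1), (is_lim_unique _ _ d2); [reflexivity | |].
  - apply is_lim_spec. intros eps. destruct (K eps (cond_pos eps)) as [delta [Hd HK]].
    exists (mkposreal delta Hd). intros x Hx Hne. eapply Rle_lt_trans; [|apply (HK x Hx Hne)].
    match goal with |- Rabs (snd ?u - d2) <= Cmod (?u - (d1, d2)) => apply (im_le_Cmod (u - (d1, d2))%C) end.
  - apply is_lim_spec. intros eps. destruct (K eps (cond_pos eps)) as [delta [Hd HK]].
    exists (mkposreal delta Hd). intros x Hx Hne. eapply Rle_lt_trans; [|apply (HK x Hx Hne)].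
    match goal with |- Rabs (fst ?u - d1) <= Cmod (?u - (d1, d2)) => apply (re_le_Cmod (u - (d1, d2))%C) end.
Qed.

Lemma RtoC_neq0 r : r <> 0 -> RtoC r <> RtoC 0.
Proof. intros H E. apply H, RtoC_inj, E. Qed.

Lemma INR_S_neq0 n : RtoC (INR (S n)) <> RtoC 0.
Proof. apply RtoC_neq0, not_0_INR. lia. Qed.

Lemma slit_lower z : slit_plane z -> exists c, 0 < c <= 1 /\ forall t, 0 <= t -> c * (Cmod z + t) <= Cmod (z + RtoC t)%C.
Proof.
  intros H. destruct (slit_sector z H) as [d [Hd Hs]]. destruct (sector_lower d Hd) as [c [Hc Hl]].
  exists c. split; [exact Hc|]. intros; apply Hl; assumption.
Qed.

Lemma slit_add_neq0 z t : slit_plane z -> 0 <= t -> (z + RtoC t)%C <> RtoC 0.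
Proof. intros H Ht. apply slit_neq_0, slit_plus; assumption. Qed.

Definition gamma_seq (z : C) (n : nat) : C := (INR (fact n) * Cpower (INR n) z / rising z n)%C.

(** The logarithmic derivative of [gamma_seq z n] with respect to z. *)
Definition digamma_seq (z : C) (n : nat) : C :=
  (ln (INR n) - Csum (fun m => / (z + INR m)) (S n))%C.

Lemma rising_neq_0 z n : slit_plane z -> rising z n <> RtoC 0.
Proof.
  intros H. induction n; simpl rising.
  - apply slit_neq_0, H.
  - apply Cmult_neq_0; [exact IHn|]. apply slit_add_neq0; [exact H | apply pos_INR].
Qed.

Lemma Cpower_INR n z : (0 < n)%nat -> Cpower (INR n) z = Cexp (z * ln (INR n))%C.
Proof. intros H. unfold Cpower. rewrite Clog_RtoC; [reflexivity|]. apply lt_0_INR, H. Qed.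

Lemma ln_step n : (0 < n)%nat -> 0 <= ln (INR (S n)) - ln (INR n) - / INR (S n) <= / INR n ^ 2.
Proof.
  intros Hn. assert (Hp : 0 < INR n) by (apply lt_0_INR, Hn).
  assert (HpS : INR (S n) = INR n + 1) by apply S_INR.
  assert (H1 : ln (INR (S n)) - ln (INR n) <= / INR n).
  { rewrite <- ln_div by lra. rewrite <- (ln_exp (/ INR n)). apply ln_le; [apply Rdiv_lt_0_compat; lra|].
    replace (INR (S n) / INR n) with (1 + / INR n) by (rewrite HpS; field; lra).
    left. apply exp_ineq1. assert (0 < / INR n) by (apply Rinv_0_lt_compat, Hp). lra. }
  assert (H2 : / INR (S n) <= ln (INR (S n)) - ln (INR n)).
  { replace (ln (INR (S n)) - ln (INR n)) with (- (ln (INR n) - ln (INR (S n)))) by ring.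
    rewrite <- ln_div by lra.
    assert (ln (INR n / INR (S n)) <= - / INR (S n)); [|lra].
    rewrite <- (ln_exp (- / INR (S n))). apply ln_le; [apply Rdiv_lt_0_compat; lra|].
    replace (INR n / INR (S n)) with (1 + - / INR (S n)) by (rewrite HpS; field; lra).
    left. apply exp_ineq1. assert (0 < / INR (S n)) by (apply Rinv_0_lt_compat; lra). lra. }
  split; [lra|].
  assert (/ INR n - / INR (S n) <= / INR n ^ 2); [|lra].
  rewrite HpS. replace (/ INR n - / (INR n + 1)) with (/ (INR n * (INR n + 1))) by (field; lra).
  apply Rinv_le_contravar; nra.
Qed.

(** With q = n + 1, consecutive terms differ by ln(1 + 1/q) - 1/(q + 1) plus z / ((q + 1)(z + q +
    1)), and both parts are O(q^(-2)). *)
Lemma digamma_seq_cv z : slit_plane z -> exists D, Ccv (digamma_seq z) D.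
Proof.
  intros Hz. destruct (slit_lower z Hz) as [c [Hc Hl]].
  set (f := fun n => (digamma_seq z (S (S n)) - digamma_seq z (S n))%C).
  destruct (Csum_abs_cv f (fun n => (1 + Cmod z / c) * / INR (S n) ^ 2)) as [l [Hcv _]].
  - intros n. unfold f, digamma_seq. rewrite (Csum_S _ (S (S n))).
    set (q := S n).
    replace (ln (INR (S q)) - (Csum (fun m => / (z + INR m)) (S q) + / (z + INR (S q))) - (ln (INR q) - Csum (fun m => / (z + INR m)) (S q)))%C
      with (RtoC (ln (INR (S q)) - ln (INR q) - / INR (S q)) + z / (INR (S q) * (z + INR (S q))))%C.
    + eapply Rle_trans; [apply Cmod_triangle|]. rewrite Rmult_plus_distr_r. apply Rplus_le_compat.
      * rewrite Cmod_R. assert (H := ln_step q ltac:(lia)). rewrite Rabs_right by lra. lra.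
      * rewrite Cmod_div, Cmod_mult, Cmod_R.
        2: { apply Cmult_neq_0; [apply INR_S_neq0 | apply slit_add_neq0; [exact Hz | apply pos_INR]]. }
        assert (Hq : 0 < INR q) by (apply lt_0_INR; lia). assert (HqS := S_INR q).
        assert (Hz0 := Cmod_ge_0 z). specialize (Hl (INR (S q)) (pos_INR _)).
        rewrite Rabs_right by (apply Rle_ge, pos_INR).
        replace (Cmod z / c * / INR q ^ 2) with (Cmod z * / (c * INR q ^ 2)) by (field; split; lra).
        apply Rmult_le_compat_l; [exact Hz0|]. apply Rinv_le_contravar; [apply Rmult_lt_0_compat; nra|].
        apply Rle_trans with (INR (S q) * (c * (Cmod z + INR (S q)))); [|apply Rmult_le_compat_l; [rewrite HqS; lra | exact Hl]].
        rewrite HqS. apply Rle_trans with (c * ((INR q + 1) * (Cmod z + (INR q + 1)))); [apply Rmult_le_compat_l; [lra | nra] | right; ring].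
    + rewrite !RtoC_minus, RtoC_inv by (apply not_0_INR; lia).
      assert (H1 := INR_S_neq0 q). assert (H2 : (z + INR (S q))%C <> RtoC 0) by (apply slit_add_neq0; [exact Hz | apply pos_INR]).
      field. auto.
  - apply Rbdd_scal; [|apply Rbdd_inv_sq]. assert (0 <= Cmod z / c); [|lra].
    apply Rmult_le_pos; [apply Cmod_ge_0 | left; apply Rinv_0_lt_compat; lra].
  - exists (digamma_seq z 1 + l)%C. apply Ccv_S. apply Ccv_ext with (fun n => digamma_seq z 1 + Csum f n)%C.
    + induction n; [simpl Csum; ring|]. rewrite Csum_S. unfold f at 2.
      replace (digamma_seq z (S n)) with (digamma_seq z 1 + Csum f n)%C by exact IHn. ring.
    + apply Ccv_plus; [apply Ccv_const | exact Hcv].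
Qed.

Lemma Cexp_continuous v : forall eps, 0 < eps -> exists delta, 0 < delta /\ forall w, Cmod (w - v)%C < delta -> Cmod (Cexp w - Cexp v)%C < eps.
Proof.
  intros eps He. set (M := Cmod (Cexp v) * exp 1). assert (HM : 0 < M).
  { unfold M. rewrite Cmod_Cexp. apply Rmult_lt_0_compat; apply exp_pos. }
  exists (Rmin 1 (eps / M)). split; [apply Rmin_glb_lt; [lra | apply Rdiv_lt_0_compat; assumption]|].
  intros w Hw.
  assert (H1 : Cmod (w - v)%C < 1) by (eapply Rlt_le_trans; [exact Hw | apply Rmin_l]).
  assert (H2 : Cmod (w - v)%C < eps / M) by (eapply Rlt_le_trans; [exact Hw | apply Rmin_r]).
  replace (Cexp w - Cexp v)%C with (Cexp v * (Cexp (w - v) - 1))%C.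
  2: { replace w with (v + (w - v))%C at 2 by ring. rewrite Cexp_plus. ring. }
  rewrite Cmod_mult. assert (H3 := Cexp_bound1 (w - v)%C). assert (H4 := Cmod_ge_0 (w - v)%C).
  assert (H5 : exp (Cmod (w - v)%C) <= exp 1) by (apply exp_mono; lra).
  assert (H6 := exp_pos (Cmod (w - v)%C)).
  assert (H7 : 0 < Cmod (Cexp v)) by (rewrite Cmod_Cexp; apply exp_pos).
  apply Rle_lt_trans with (M * Cmod (w - v)%C).
  - unfold M. rewrite Rmult_assoc. apply Rmult_le_compat_l; [lra|]. nra.
  - apply Rmult_lt_reg_r with (/ M); [apply Rinv_0_lt_compat, HM|].
    replace (M * Cmod (w - v) * / M) with (Cmod (w - v)%C) by (field; lra). exact H2.
Qed.

Lemma Ccv_Cexp u v : Ccv u v -> Ccv (fun n => Cexp (u n)) (Cexp v).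
Proof.
  intros H eps He. destruct (Cexp_continuous v eps He) as [delta [Hd Hc]].
  destruct (H delta Hd) as [n0 Hn]. exists n0. intros n Hle. apply Hc, Hn, Hle.
Qed.

Lemma Clog1_bound w : Cmod w <= 1 / 2 -> Cmod (Clog (1 + w) - w)%C <= 2 * Cmod w ^ 2.
Proof.
  intros H. assert (K := Clog_taylor w 1 H). simpl Csum in K. change (INR 1) with 1 in K.
  replace (0 + - (- w * 1 / 1))%C with w in K by (field; apply C1_nz). exact K.
Qed.

Lemma near1_neq0 w : Cmod w <= 1 / 2 -> (1 + w)%C <> RtoC 0.
Proof.
  intros H E. assert (K := Cmod_ge_sub 1 w). rewrite E, Cmod_0, Cmod_1 in K. lra.
Qed.

(** Ratios of consecutive terms are exponentials of summable quantities [e n], so the limit is a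
    nonzero term times an exponential and cannot vanish. The start N0 >= 2 |z| keeps z / n within
    the range of the logarithm estimate. *)
Lemma gamma_seq_cv z : slit_plane z -> exists g, g <> RtoC 0 /\ Ccv (gamma_seq z) g.
Proof.
  intros Hz. destruct (INR_unbounded (2 * Cmod z)) as [n1 Hn1]. set (N0 := S n1).
  assert (HN0 : 2 * Cmod z <= INR N0) by (unfold N0; rewrite S_INR; lra).
  assert (Hz0 := Cmod_ge_0 z).
  set (e := fun n => (z * RtoC (ln (INR (N0 + S n)) - ln (INR (N0 + n))) - Clog (1 + z / INR (N0 + S n)))%C).
  assert (Hw : forall n, Cmod (z / INR (N0 + S n))%C <= 1 / 2).
  { intros n. rewrite Cmod_div by (replace (N0 + S n)%nat with (S (N0 + n)) by lia; apply INR_S_neq0).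
    rewrite Cmod_R, Rabs_right by (apply Rle_ge, pos_INR).
    assert (INR N0 < INR (N0 + S n)) by (apply lt_INR; lia).
    assert (0 <= INR N0) by apply pos_INR.
    apply Rmult_le_reg_r with (INR (N0 + S n)); [lra|]. unfold Rdiv. rewrite Rmult_assoc, Rinv_l; lra. }
  destruct (Csum_abs_cv e (fun n => (Cmod z + 2 * Cmod z ^ 2) * / INR (S n) ^ 2)) as [l [Hl _]].
  - intros n. unfold e. set (q := (N0 + n)%nat). replace (N0 + S n)%nat with (S q) by (unfold q; lia).
    replace (z * RtoC (ln (INR (S q)) - ln (INR q)) - Clog (1 + z / INR (S q)))%C with
      (z * RtoC (ln (INR (S q)) - ln (INR q) - / INR (S q)) - (Clog (1 + z / INR (S q)) - z / INR (S q)))%C.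
    2: { rewrite !RtoC_minus, RtoC_inv by (apply not_0_INR; lia). field. apply INR_S_neq0. }
    assert (Hq : (0 < q)%nat) by (unfold q, N0; lia).
    eapply Rle_trans; [apply Cmod_minus_le|]. rewrite Rmult_plus_distr_r.
    assert (HSn : 0 < INR (S n) <= INR q) by (split; [apply lt_0_INR; lia | apply le_INR; unfold q, N0; lia]).
    apply Rplus_le_compat.
    + rewrite Cmod_mult, Cmod_R. apply Rmult_le_compat_l; [exact Hz0|].
      assert (H := ln_step q Hq). rewrite Rabs_right by lra.
      apply Rle_trans with (1 := proj2 H). apply Rinv_le_contravar; [nra|]. apply pow_incr. lra.
    + eapply Rle_trans; [apply Clog1_bound|].
      * specialize (Hw n). replace (N0 + S n)%nat with (S q) in Hw by (unfold q; lia). exact Hw.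
      * rewrite Rmult_assoc. apply Rmult_le_compat_l; [lra|].
        rewrite Cmod_div by apply INR_S_neq0. rewrite Cmod_R, Rabs_right by (apply Rle_ge, pos_INR).
        unfold Rdiv. rewrite Rpow_mult_distr. apply Rmult_le_compat_l; [apply pow2_ge_0|].
        rewrite pow_inv. apply Rinv_le_contravar; [nra|]. apply pow_incr. rewrite (S_INR q). lra.
  - apply Rbdd_scal; [nra | apply Rbdd_inv_sq].
  - assert (Hf : gamma_seq z N0 <> RtoC 0).
    { unfold gamma_seq, Cdiv. apply Cmult_neq_0.
      - apply Cmult_neq_0; [apply RtoC_neq0, INR_fact_neq_0 | apply Cexp_neq_0].
      - intros E. apply (rising_neq_0 z N0 Hz). apply Cmod_eq_0.
        assert (Hr := rising_neq_0 z N0 Hz). assert (K := Cmod_inv _ Hr). rewrite E, Cmod_0 in K.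
        symmetry in K. assert (0 < Cmod (rising z N0)) by (apply Cmod_gt_0, Hr). apply Rinv_0_lt_compat in H. lra. }
    exists (gamma_seq z N0 * Cexp l)%C. split; [apply Cmult_neq_0; [exact Hf | apply Cexp_neq_0]|].
    apply Ccv_unshift with N0.
    apply Ccv_ext with (fun n => gamma_seq z N0 * Cexp (Csum e n))%C; [|apply Ccv_scal, Ccv_Cexp, Hl].
    induction n; [simpl; rewrite Cexp_0; ring|].
    rewrite Csum_S, Cexp_plus, Cmult_assoc, IHn.
    unfold e. rewrite Cexp_minus. rewrite Cexp_Clog by (apply near1_neq0, Hw).
    rewrite (Nat.add_comm n N0). replace (S n + N0)%nat with (S (N0 + n)) by lia. replace (N0 + S n)%nat with (S (N0 + n)) by lia.
    set (q := (N0 + n)%nat). assert (Hq : (0 < q)%nat) by (unfold q, N0; lia).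
    unfold gamma_seq. rewrite !Cpower_INR by lia.
    replace (z * ln (INR (S q)))%C with (z * ln (INR q) + z * RtoC (ln (INR (S q)) - ln (INR q)))%C by (rewrite RtoC_minus; ring).
    rewrite Cexp_plus. replace (fact (S q)) with (S q * fact q)%nat by reflexivity. rewrite mult_INR, RtoC_mult.
    change (rising z (S q)) with (rising z q * (z + INR (S q)))%C.
    assert (H1 := INR_S_neq0 q). assert (H2 : (z + INR (S q))%C <> RtoC 0) by (apply slit_add_neq0; [exact Hz | apply pos_INR]).
    assert (H3 := rising_neq_0 z q Hz).
    clearbody q. field. repeat split; auto.
Qed.

(** The derivative of the limit is not obtained by differentiating under the limit. Instead Gamma(z
    + h) = Gamma(z) exp(h D - E) holds exactly for small real h, where E is the sum of Clog(1 + h/(z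
    + m)) - h/(z + m) and is O(h^2); a second-order expansion of the exponential then gives the
    derivative Gamma(z) D. *)
Lemma digamma_cv z : slit_plane z -> Ccv (digamma_seq z) (digamma z).
Proof.
  intros Hz. destruct (digamma_seq_cv z Hz) as [D HD]. destruct (gamma_seq_cv z Hz) as [g [Hg HG]].
  assert (Eg : Cgamma z = g) by (apply Ccv_CLim_seq, HG).
  destruct (slit_lower z Hz) as [c [Hc Hl]].
  assert (Hmz : 0 < Cmod z) by (apply Cmod_gt_0, slit_neq_0, Hz).
  destruct Rbdd_inv_sq as [A HA].
  assert (HA0 : 0 <= A) by (specialize (HA 0%nat); simpl in HA; exact HA).
  (* Chosen so that |z + m| >= p (m + 1) for all m; then |h| < p / 2 makes every h / (z + m) at most
     1/2 in modulus. *)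
  set (p := c * Rmin 1 (Cmod z)).
  assert (Hmin : 0 < Rmin 1 (Cmod z)) by (apply Rmin_glb_lt; lra).
  assert (Hp : 0 < p) by (unfold p; apply Rmult_lt_0_compat; lra).
  assert (Hlow : forall m, p * INR (S m) <= Cmod (z + INR m)%C).
  { intros m. eapply Rle_trans; [|apply Hl, pos_INR]. unfold p. rewrite Rmult_assoc.
    apply Rmult_le_compat_l; [lra|]. rewrite S_INR. assert (0 <= INR m) by apply pos_INR.
    assert (Rmin 1 (Cmod z) <= 1) by apply Rmin_l. assert (Rmin 1 (Cmod z) <= Cmod z) by apply Rmin_r. nra. }
  set (B0 := 2 / p ^ 2 * A).
  assert (HB0 : 0 <= B0). { unfold B0. apply Rmult_le_pos; [|exact HA0]. apply Rmult_le_pos; [lra|]. left. apply Rinv_0_lt_compat. nra. }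
  assert (Hd : C_derive Cgamma z = (g * D)%C).
  { set (r := Rmin 1 (p / 2)). assert (Hr : 0 < r) by (unfold r; apply Rmin_glb_lt; lra).
    set (B1 := Cmod g * ((Cmod D + B0) ^ 2 * exp (Cmod D + B0) + B0)).
    apply C_derive_real with (B := B1) (r := r); [exact Hr|].
    intros h Hh0 Hh.
    assert (Hh1 : Rabs h < 1) by (eapply Rlt_le_trans; [exact Hh | apply Rmin_l]).
    assert (Hh2 : Rabs h < p / 2) by (eapply Rlt_le_trans; [exact Hh | apply Rmin_r]).
    assert (Hw : forall m, Cmod (h / (z + INR m))%C <= Rabs h / (p * INR (S m)) /\ Rabs h / (p * INR (S m)) <= 1 / 2).
    { intros m. assert (HSm : 1 <= INR (S m)) by (rewrite S_INR; assert (H := pos_INR m); lra).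
      split.
      - rewrite Cmod_div, Cmod_R by (apply slit_add_neq0; [exact Hz | apply pos_INR]).
        apply Rmult_le_compat_l; [apply Rabs_pos|]. apply Rinv_le_contravar; [nra | apply Hlow].
      - apply Rmult_le_reg_r with (p * INR (S m)); [nra|]. unfold Rdiv. rewrite Rmult_assoc, Rinv_l by nra. nra. }
    (* A real shift can reach the cut only from a positive real z, and then |h| < p / 2 < p <= |z|
       prevents it. *)
    assert (Hzh : slit_plane (z + h)%C).
    { intros [H1 H2].
      assert (Hre : Re (z + h)%C = Re z + h) by (rewrite re_plus; reflexivity).
      assert (Him : Im (z + h)%C = Im z) by (unfold Cplus, RtoC, Im; simpl; ring).
      rewrite Hre in H1. rewrite Him in H2.
      assert (Hrz : 0 < Re z). { destruct (Rlt_le_dec 0 (Re z)); [assumption|]. exfalso. apply Hz. auto. }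
      assert (E : Cmod z = Re z). { rewrite <- (Rabs_right (Re z)) by lra. rewrite <- Cmod_R. f_equal. apply C_eq; [reflexivity | exact H2]. }
      apply Rabs_def2 in Hh2. assert (Rmin 1 (Cmod z) <= Cmod z) by apply Rmin_r.
      assert (p <= Cmod z) by (unfold p; nra). lra. }
    set (e := fun m => (Clog (1 + h / (z + INR m)) - h / (z + INR m))%C).
    destruct (Csum_abs_cv e (fun m => (2 / p ^ 2 * h ^ 2) * / INR (S m) ^ 2)) as [E [HE HEb]].
    { intros m. destruct (Hw m) as [W1 W2]. unfold e. eapply Rle_trans; [apply Clog1_bound; lra|].
      assert (Hpm : 0 < INR (S m)) by (apply lt_0_INR; lia).
      replace (2 / p ^ 2 * h ^ 2 * / INR (S m) ^ 2) with (2 * (Rabs h / (p * INR (S m))) ^ 2).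
      - apply Rmult_le_compat_l; [lra|]. apply pow_incr. split; [apply Cmod_ge_0 | exact W1].
      - rewrite <- (pow2_abs h). field. split; lra. }
    { apply Rbdd_scal; [|exists A; exact HA]. apply Rmult_le_pos; [|apply pow2_ge_0].
      apply Rmult_le_pos; [lra|]. left. apply Rinv_0_lt_compat. nra. }
    assert (HEh : Cmod E <= B0 * h ^ 2).
    { assert (K := HEb (B0 * h ^ 2)). specialize (K ltac:(intros n; rewrite Rsum_scal; unfold B0;
        replace (2 / p ^ 2 * A * h ^ 2) with (2 / p ^ 2 * h ^ 2 * A) by ring; apply Rmult_le_compat_l; [|apply HA];
        apply Rmult_le_pos; [|apply pow2_ge_0]; apply Rmult_le_pos; [lra|]; left; apply Rinv_0_lt_compat; nra) O).
      simpl in K. replace (E - 0)%C with E in K by ring. lra. }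
    assert (Hq : Cgamma (z + h)%C = (g * Cexp (h * D - E))%C).
    { apply Ccv_CLim_seq. apply Ccv_unshift with 1%nat.
      apply Ccv_ext with (fun n => gamma_seq z (n + 1) * Cexp (h * digamma_seq z (n + 1) - Csum e (S (n + 1))))%C.
      - intros n. replace (n + 1)%nat with (S n) by lia. unfold gamma_seq.
        assert (Hprod : forall q, (rising z q * Cexp (Csum (fun m => Clog (1 + h / (z + INR m))) (S q)) = rising (z + h) q)%C).
        { intros q. induction q.
          - simpl rising. simpl Csum. rewrite Cplus_0_l, Cexp_Clog by (apply near1_neq0; destruct (Hw O); lra).
            assert (H := slit_neq_0 z Hz). replace (z + INR 0)%C with z by (change (INR 0) with 0; ring). field. exact H.
          - rewrite Csum_S, Cexp_plus. rewrite Cexp_Clog by (apply near1_neq0; destruct (Hw (S q)); lra).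
            change (rising z (S q)) with (rising z q * (z + INR (S q)))%C.
            change (rising (z + h) (S q)) with (rising (z + h) q * (z + h + INR (S q)))%C.
            rewrite <- IHq. assert (H : (z + INR (S q))%C <> RtoC 0) by (apply slit_add_neq0; [exact Hz | apply pos_INR]).
            field. exact H. }
        fold (gamma_seq (z + h)%C (S n)). unfold gamma_seq. rewrite <- (Hprod (S n)).
        rewrite !Cpower_INR by lia. unfold e. rewrite Csum_minus. unfold digamma_seq.
        set (S1 := Csum (fun m => Clog (1 + h / (z + INR m)))%C (S (S n))).
        assert (ES : Csum (fun m => h / (z + INR m))%C (S (S n)) = (h * Csum (fun m => / (z + INR m)) (S (S n)))%C).
        { rewrite <- Csum_scal. reflexivity. }
        rewrite ES.
        match goal with |- context [Cexp (?u - ?v)] => replace (u - v)%C with (h * ln (INR (S n)) - S1)%C by ring end.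
        rewrite Cexp_minus. replace ((z + h) * ln (INR (S n)))%C with (z * ln (INR (S n)) + h * ln (INR (S n)))%C by ring.
        rewrite Cexp_plus. assert (H1 := Cexp_neq_0 S1). assert (H2 := rising_neq_0 z (S n) Hz). field. auto.
      - apply Ccv_mult; [apply Ccv_shift, HG|]. apply Ccv_Cexp. apply Ccv_minus.
        + apply Ccv_scal. apply Ccv_shift, HD.
        + apply Ccv_ext with (fun n => Csum e (n + 2)); [intros; f_equal; lia|]. apply Ccv_shift, HE. }
    rewrite Hq, Eg.
    replace (g * Cexp (h * D - E) - g - h * (g * D))%C with (g * ((Cexp (h * D - E) - 1 - (h * D - E)) - E))%C by ring.
    rewrite Cmod_mult. unfold B1. rewrite Rmult_assoc. apply Rmult_le_compat_l; [apply Cmod_ge_0|].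
    eapply Rle_trans; [apply Cmod_minus_le|]. rewrite Rmult_plus_distr_r. apply Rplus_le_compat; [|exact HEh].
    eapply Rle_trans; [apply Cexp_bound2|].
    assert (HD0 := Cmod_ge_0 D). assert (Hh0' := Rabs_pos h).
    assert (Hv : Cmod (h * D - E)%C <= Rabs h * (Cmod D + B0)).
    { eapply Rle_trans; [apply Cmod_minus_le|]. rewrite Cmod_mult, Cmod_R.
      rewrite <- (pow2_abs h) in HEh.
      assert (B0 * Rabs h ^ 2 <= B0 * Rabs h) by (apply Rmult_le_compat_l; [exact HB0 | nra]). lra. }
    assert (Hv0 := Cmod_ge_0 (h * D - E)%C).
    replace ((Cmod D + B0) ^ 2 * exp (Cmod D + B0) * h ^ 2) with ((Rabs h * (Cmod D + B0)) ^ 2 * exp (Cmod D + B0)).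
    - apply Rmult_le_compat; [apply pow2_ge_0 | left; apply exp_pos | apply pow_incr; lra |].
      apply exp_mono. nra.
    - rewrite <- (pow2_abs h). ring. }
  unfold digamma. rewrite Hd, Eg. replace (g * D / g)%C with D by (field; exact Hg). exact HD.
Qed.

(** * Binomial coefficients by Pascal's rule, and Bernoulli numbers *)

Fixpoint bin (n k : nat) : R :=
  match n, k with
  | _, O => 1
  | O, S _ => 0
  | S n', S k' => bin n' k' + bin n' (S k')
  end.

Lemma bin_0_r n : bin n 0 = 1.
Proof. destruct n; reflexivity. Qed.

Lemma bin_gt n k : (n < k)%nat -> bin n k = 0.
Proof.
  revert k. induction n; intros k H; destruct k; try lia; [reflexivity|].
  simpl. rewrite !IHn by lia. ring.
Qed.

Lemma bin_diag n : bin n n = 1.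
Proof. induction n; [reflexivity|]. simpl. rewrite IHn, bin_gt by lia. ring. Qed.

(** The restriction k <= n is essential: [Binomial.C] uses truncated subtraction and does not vanish
    for k > n, whereas [bin] does. *)
Lemma bin_C n k : (k <= n)%nat -> Binomial.C n k = bin n k.
Proof.
  revert k. induction n; intros k H.
  - replace k with O by lia. unfold Binomial.C. simpl. change (INR 1) with 1. field.
  - destruct k as [|k].
    + rewrite bin_0_r. unfold Binomial.C. rewrite Nat.sub_0_r. change (INR (fact 0)) with 1. field. apply INR_fact_neq_0.
    + simpl. destruct (Nat.eq_dec k n) as [->|Hk].
      * rewrite bin_diag, bin_gt by lia. unfold Binomial.C. rewrite Nat.sub_diag. change (INR (fact 0)) with 1. field. apply INR_fact_neq_0.
      * rewrite <- pascal by lia. rewrite !IHn by lia. reflexivity.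
Qed.

Lemma bin_absorb n k : INR (S n) * bin n k = INR (S k) * bin (S n) (S k).
Proof.
  revert k. induction n; intros k.
  - simpl. destruct k; change (INR 1) with 1; simpl; ring.
  - change (bin (S (S n)) (S k)) with (bin (S n) k + bin (S n) (S k)).
    rewrite Rmult_plus_distr_l, <- IHn. destruct k.
    + rewrite !bin_0_r, (S_INR (S n)). change (INR 1) with 1. ring.
    + assert (H := IHn k). rewrite (S_INR (S k)), Rmult_plus_distr_r, <- H.
      rewrite (S_INR (S n)). change (bin (S n) (S k)) with (bin n k + bin n (S k)). ring.
Qed.

Lemma bernoulli_upto_eq p i : (i <= p)%nat -> bernoulli_upto p i = bernoulli i.
Proof.
  induction p; intros H.
  - replace i with O by lia. reflexivity.
  - destruct (Nat.eq_dec i (S p)) as [->|Hi]; [reflexivity|].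
    simpl. destruct (Nat.leb_spec i p); [|lia]. apply IHp. lia.
Qed.

Lemma bernoulli_sum n : Rsum (fun j => bin (S (S n)) j * bernoulli j) (S (S n)) = 0.
Proof.
  rewrite Rsum_S.
  assert (E : bernoulli (S n) = - / INR (S (S n)) * Rsum (fun j => bin (S (S n)) j * bernoulli j) (S n)).
  { unfold bernoulli at 1. cbn [bernoulli_upto].
    destruct (Nat.leb_spec (S n) n) as [|_]; [lia|]. f_equal. rewrite Rsum_sum_n.
    apply Rsum_ext. intros i Hi. rewrite bernoulli_upto_eq by lia. rewrite bin_C by lia. reflexivity. }
  rewrite E. assert (H := bin_absorb (S n) n).
  assert (Hb : bin (S (S n)) (S n) = INR (S (S n))).
  { assert (Hn : INR (S n) <> 0) by (apply not_0_INR; lia).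
    apply Rmult_eq_reg_l with (INR (S n)); [|exact Hn]. rewrite <- H.
    replace (bin (S n) n) with (INR (S n)); [ring|]. clear. induction n; [reflexivity|].
    change (bin (S (S n)) (S n)) with (bin (S n) n + bin (S n) (S n)). rewrite bin_diag, <- IHn, (S_INR (S n)). reflexivity. }
  rewrite Hb. field. apply not_0_INR. lia.
Qed.

(** * The asymptotic expansion of the digamma function *)

Lemma digamma_shift z : slit_plane z -> digamma (z + 1)%C = (digamma z + / z)%C.
Proof.
  intros Hz. assert (Hz1 : slit_plane (z + 1)%C) by (apply slit_plus; [exact Hz | lra]).
  apply Ccv_unique with (digamma_seq (z + 1)%C); [apply digamma_cv, Hz1|].
  replace (digamma z + / z)%C with (digamma z + / z - 0)%C by ring.
  apply Ccv_ext with (fun n => digamma_seq z n + / z - / (z + INR (S n)))%C.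
  - intros n. unfold digamma_seq.
    assert (E : (Csum (fun m => / (z + 1 + INR m)) (S n) = Csum (fun m => / (z + INR m)) (S n) + / (z + INR (S n)) - / z)%C).
    { rewrite <- (Csum_S (fun m => / (z + INR m))%C (S n)), (Csum_S_l (fun m => / (z + INR m))%C (S n)). change (INR 0) with 0.
      replace (z + 0)%C with z by ring.
      replace (Csum (fun m => / (z + 1 + INR m)) (S n))%C with (Csum (fun i => / (z + INR (S i)))%C (S n)); [ring|].
      apply Csum_ext. intros i _. rewrite S_INR, RtoC_plus. f_equal. ring. }
    rewrite E. ring.
  - apply Ccv_minus; [apply Ccv_plus; [apply digamma_cv, Hz | apply Ccv_const]|].
    destruct (slit_lower z Hz) as [c [Hc Hl]].
    apply Ccv_squeeze with (fun n => / c * / INR (S n)).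
    + exists O. intros n _. replace (/ (z + INR (S n)) - 0)%C with (/ (z + INR (S n)))%C by ring.
      rewrite Cmod_inv by (apply slit_add_neq0; [exact Hz | apply pos_INR]).
      rewrite <- Rinv_mult. assert (0 < INR (S n)) by (apply lt_0_INR; lia).
      apply Rinv_le_contravar; [apply Rmult_lt_0_compat; lra|].
      eapply Rle_trans; [|apply Hl, pos_INR]. apply Rmult_le_compat_l; [lra|].
      assert (K := Cmod_ge_0 z). lra.
    + replace 0 with (/ c * 0) by ring. apply CV_mult; [intros eps He; exists O; intros; unfold R_dist; rewrite Rminus_diag, Rabs_R0; exact He|].
      intros eps He. destruct (INR_unbounded (/ eps)) as [n0 Hn0]. exists n0. intros n Hn.
      unfold R_dist. rewrite Rminus_0_r. assert (Hi : INR n0 <= INR n) by (apply le_INR; exact Hn).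
      assert (Hei : 0 < / eps) by (apply Rinv_0_lt_compat, He). rewrite S_INR.
      rewrite Rabs_right by (apply Rle_ge; left; apply Rinv_0_lt_compat; lra).
      rewrite <- (Rinv_inv eps). apply Rinv_lt_contravar; [apply Rmult_lt_0_compat; lra | lra].
Qed.

Lemma digamma_shift_n z L : slit_plane z -> digamma (z + INR L)%C = (digamma z + Csum (fun m => / (z + INR m)) L)%C.
Proof.
  intros Hz. induction L.
  - change (INR 0) with 0. simpl. replace (z + 0)%C with z by ring. ring.
  - rewrite S_INR, RtoC_plus, Cplus_assoc, digamma_shift, IHL by (apply slit_plus; [exact Hz | apply pos_INR]).
    rewrite Csum_S. ring.
Qed.

Lemma slit_one_plus_div y t : slit_plane y -> 0 <= t -> slit_plane (1 + t / y)%C.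
Proof.
  intros Hy Ht [H1 H2]. assert (Hz := slit_neq_0 y Hy).
  set (r := Re (1 + t / y)%C) in *.
  assert (E : (1 + t / y)%C = RtoC r) by (apply C_eq; [reflexivity | exact H2]).
  assert (E2 : (y + t)%C = (r * y)%C).
  { rewrite <- E. field. exact Hz. }
  assert (E3 : RtoC t = (RtoC (r - 1) * y)%C) by (rewrite RtoC_minus; transitivity ((y + t) - y)%C; [ring | rewrite E2; ring]).
  assert (Ere : t = (r - 1) * Re y) by (apply (f_equal Re) in E3; rewrite re_scal_l in E3; exact E3).
  assert (Eim : 0 = (r - 1) * Im y).
  { apply (f_equal Im) in E3. rewrite im_mult in E3. simpl in E3. rewrite Rmult_0_l, Rplus_0_r in E3. exact E3. }
  apply Hy. split.
  - nra.
  - symmetry in Eim. apply Rmult_integral in Eim. destruct Eim; [lra | assumption].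
Qed.

(** The difference of [Clog (y + s)] and [Clog (1 + s / y)] has derivative 0 in s and equals
    [Clog y] at s = 0; this replaces any discussion of branches. *)
Lemma Clog_add y t : slit_plane y -> 0 <= t -> Clog (y + RtoC t)%C = (Clog y + Clog (1 + t / y))%C.
Proof.
  intros Hy Ht. assert (Hz := slit_neq_0 y Hy).
  set (g := fun s : R => (Clog (y + s) - Clog (1 + s / y))%C).
  assert (K : Cmod (g t - g 0)%C <= 0 - 0).
  { apply (Cder_mean_value g (fun _ => RtoC 0) (fun _ => 0) (fun _ => 0) 0 t Ht).
    - intros s Hs. unfold g.
      assert (S1 : slit_plane (y + s)%C) by (apply slit_plus; tauto).
      assert (S2 : slit_plane (1 + s / y)%C) by (apply slit_one_plus_div; tauto).
      assert (D1 : is_Cder (fun u : R => (y + u)%C) s (RtoC 1))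
        by (apply is_Cder_ext with (fun u => (y + u * 1)%C); [intros; ring | apply is_Cder_linear]).
      assert (D2 : is_Cder (fun u : R => (1 + u / y)%C) s (/ y)%C) by apply is_Cder_linear.
      eapply is_Cder_eq; [|apply (is_Cder_minus _ _ _ _ _ (is_Cder_Clog _ _ _ S1 D1) (is_Cder_Clog _ _ _ S2 D2))].
      assert (N1 := slit_neq_0 _ S1). assert (N2 := slit_neq_0 _ S2). cbv beta.
      field. auto.
    - intros s _. apply (is_derive_const (V := R_NormedModule) 0 s).
    - intros. rewrite Cmod_0. lra. }
  assert (E : (g t - g 0)%C = RtoC 0) by (apply Cmod_eq_0; apply Rle_antisym; [lra | apply Cmod_ge_0]).
  assert (E0 : g 0 = Clog y).
  { unfold g. replace (y + 0)%C with y by ring. replace (1 + 0 / y)%C with (RtoC 1) by (field; exact Hz).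
    rewrite Clog_RtoC, ln_1 by lra. ring. }
  rewrite E0 in E. unfold g in E.
  transitivity ((Clog (y + t) - Clog (1 + t / y) - Clog y) + Clog y + Clog (1 + t / y))%C; [ring|]. rewrite E. ring.
Qed.

(* [papprox f a Q]: the [a n] are the Taylor coefficients of [f] at 0 up to order [Q]. *)
Definition papprox (f : C -> C) (a : nat -> C) (Q : nat) : Prop :=
  exists B, forall w, Cmod w <= 1 / 2 -> Cmod (f w - Csum (fun n => a n * w ^ n) (S Q))%C <= B * Cmod w ^ S Q.

Lemma papprox_plus f g a b Q : papprox f a Q -> papprox g b Q ->
  papprox (fun w => f w + g w)%C (fun n => a n + b n)%C Q.
Proof.
  intros [A HA] [B HB]. exists (A + B). intros w Hw.
  replace (Csum (fun n => (a n + b n) * w ^ n) (S Q))%C with (Csum (fun n => a n * w ^ n) (S Q) + Csum (fun n => b n * w ^ n) (S Q))%C.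
  2: { rewrite <- Csum_plus. apply Csum_ext. intros. ring. }
  specialize (HA w Hw). specialize (HB w Hw).
  match goal with |- Cmod (?f + ?g - (?a + ?b))%C <= _ => replace (f + g - (a + b))%C with ((f - a) + (g - b))%C by ring end.
  eapply Rle_trans; [apply Cmod_triangle|]. lra.
Qed.

Lemma papprox_scal c f a Q : papprox f a Q -> papprox (fun w => c * f w)%C (fun n => c * a n)%C Q.
Proof.
  intros [A HA]. exists (Cmod c * A). intros w Hw.
  replace (Csum (fun n => c * a n * w ^ n) (S Q))%C with (c * Csum (fun n => a n * w ^ n) (S Q))%C.
  2: { rewrite <- Csum_scal. apply Csum_ext. intros. ring. }
  specialize (HA w Hw).
  match goal with |- Cmod (?c * ?f - ?c * ?a)%C <= _ => replace (c * f - c * a)%C with (c * (f - a))%C by ring end.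
  rewrite Cmod_mult, Rmult_assoc. apply Rmult_le_compat_l; [apply Cmod_ge_0 | exact HA].
Qed.

Lemma papprox_ext f g a b Q : (forall w, f w = g w) -> (forall n, (n <= Q)%nat -> a n = b n) -> papprox f a Q -> papprox g b Q.
Proof.
  intros H1 H2 [A HA]. exists A. intros w Hw. rewrite <- H1.
  rewrite <- (Csum_ext (fun n => a n * w ^ n)%C); [apply HA, Hw|]. intros. rewrite H2 by lia. reflexivity.
Qed.

Lemma papprox_Csum (f : nat -> C -> C) (a : nat -> nat -> C) K Q : (forall j, (j < K)%nat -> papprox (f j) (a j) Q) ->
  papprox (fun w => Csum (fun j => f j w) K) (fun n => Csum (fun j => a j n) K) Q.
Proof.
  induction K; intros H.
  - exists 0. intros w Hw. simpl. rewrite Csum_0 by (intros; ring).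
    replace (0 - (0 + 0 * w ^ Q))%C with (RtoC 0) by ring. rewrite Cmod_0. lra.
  - apply papprox_plus; [apply IHK; intros; apply H; lia | apply H; lia].
Qed.

Lemma papprox_mono m Q : papprox (fun w => w ^ m)%C (fun n => if (n =? m)%nat then RtoC 1 else RtoC 0) Q.
Proof.
  destruct (le_lt_dec m Q) as [H|H].
  - exists 0. intros w _.
    assert (E : forall P, (m < P)%nat -> Csum (fun n => (if (n =? m)%nat then RtoC 1 else RtoC 0) * w ^ n)%C P = (w ^ m)%C).
    { induction P; intros HP; [lia|]. rewrite Csum_S. destruct (Nat.eqb_spec P m) as [->|Hne].
      - rewrite Csum_0; [ring|]. intros i Hi. destruct (Nat.eqb_spec i m); [lia | ring].
      - rewrite IHP by lia. ring. }
    rewrite E by lia. replace (w ^ m - w ^ m)%C with (RtoC 0) by ring. rewrite Cmod_0. lra.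
  - exists 1. intros w Hw. rewrite Csum_0.
    + replace (w ^ m - 0)%C with (w ^ m)%C by ring. rewrite Cmod_pow.
      replace m with (S Q + (m - S Q))%nat by lia. rewrite pow_add. rewrite Rmult_1_l.
      rewrite <- (Rmult_1_r (Cmod w ^ S Q)) at 2. apply Rmult_le_compat_l; [apply pow_le, Cmod_ge_0|].
      rewrite <- (pow1 (m - S Q)). apply pow_incr. assert (K := Cmod_ge_0 w). lra.
    + intros i Hi. destruct (Nat.eqb_spec i m); [lia | ring].
Qed.

(* Taylor coefficients at 0 of [(w / (1 + w)) ^ j]. *)
Fixpoint acoef (j n : nat) : R :=
  match j, n with
  | O, O => 1
  | O, S _ => 0
  | S _, O => 0
  | S j', S n' => acoef j' n' - (fix aux n := match n with O => 0 | S m => acoef j' m - aux m end) n'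
  end.

Lemma acoef_SS j n : acoef (S j) (S n) = acoef j n - acoef (S j) n.
Proof. destruct n; reflexivity. Qed.

Lemma acoef_bin j n : acoef (S j) (S n) = (-1) ^ (n + j) * bin n j.
Proof.
  revert j. induction n; intros j.
  - rewrite acoef_SS. destruct j; simpl; ring.
  - rewrite acoef_SS, IHn. destruct j.
    + rewrite !bin_0_r. simpl. ring.
    + rewrite IHn. replace (S n + S j)%nat with (S (S (n + j))) by lia. replace (n + S j)%nat with (S (n + j)) by lia.
      simpl. ring.
Qed.

(** With u = w / (1 + w), the recursion [acoef_SS] expresses (1 + w) u^(j+1) = w u^j. The error for
    j + 1 thus comes from the one for j after division by 1 + w, whose modulus is at least 1/2. *)
Lemma papprox_acoef j Q : papprox (fun w => (w / (1 + w)) ^ j)%C (fun n => RtoC (acoef j n)) Q.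
Proof.
  revert Q. induction j; intros Q.
  - apply papprox_ext with (fun w => w ^ 0)%C (fun n => if (n =? 0)%nat then RtoC 1 else RtoC 0); [intros; reflexivity | | apply papprox_mono].
    intros n _. destruct n; reflexivity.
  - destruct (IHj Q) as [B HB].
    exists (2 * (Rabs B * 1 + Rabs (acoef j Q) + Rabs (acoef (S j) Q))). intros w Hw.
    specialize (HB w Hw). assert (Hn := near1_neq0 w Hw).
    set (u := (w / (1 + w))%C) in *. set (Sj := Csum (fun n => acoef j n * w ^ n)%C (S Q)) in *.
    set (S1 := Csum (fun n => acoef (S j) n * w ^ n)%C (S Q)).
    assert (E : ((1 + w) * (u ^ S j - S1) = w * (u ^ j - Sj) + (acoef j Q - acoef (S j) Q) * w ^ S Q)%C).
    { assert (E1 : (S1 = w * (Sj - acoef j Q * w ^ Q) - w * (S1 - acoef (S j) Q * w ^ Q))%C).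
      { assert (Ea : (Sj - acoef j Q * w ^ Q = Csum (fun n => acoef j n * w ^ n) Q)%C) by (unfold Sj; rewrite Csum_S; ring).
        assert (Eb : (S1 - acoef (S j) Q * w ^ Q = Csum (fun n => acoef (S j) n * w ^ n) Q)%C) by (unfold S1; rewrite Csum_S; ring).
        rewrite Ea, Eb. unfold S1. rewrite Csum_S_l. rewrite <- !Csum_scal, <- Csum_minus.
        change (acoef (S j) 0) with 0. replace (RtoC 0 * w ^ 0)%C with (RtoC 0) by ring. rewrite Cplus_0_l.
        apply Csum_ext. intros i _. rewrite acoef_SS, RtoC_minus. simpl. ring. }
      replace ((1 + w) * (u ^ S j - S1))%C with (((1 + w) * u) * u ^ j - w * S1 - S1)%C by (simpl; ring).
      rewrite E1 at 2. replace ((1 + w) * u)%C with w by (unfold u; field; exact Hn). simpl. ring. }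
    assert (Hlow : 1 / 2 <= Cmod (1 + w)%C).
    { assert (K := Cmod_ge_sub 1 w). rewrite Cmod_1 in K. lra. }
    assert (Hmain : Cmod (1 + w)%C * Cmod (u ^ S j - S1)%C <= (Rabs B * 1 + Rabs (acoef j Q) + Rabs (acoef (S j) Q)) * Cmod w ^ S Q).
    { rewrite <- Cmod_mult, E. assert (Hp : 0 <= Cmod w ^ S Q) by (apply pow_le, Cmod_ge_0).
      eapply Rle_trans; [apply Cmod_triangle|]. rewrite !Rmult_plus_distr_r, Rplus_assoc. apply Rplus_le_compat.
      - rewrite Cmod_mult. rewrite Rmult_1_r.
        apply Rle_trans with (1 * (Rabs B * Cmod w ^ S Q)); [|lra]. apply Rmult_le_compat; try apply Cmod_ge_0; [lra|].
        eapply Rle_trans; [exact HB|]. apply Rmult_le_compat_r; [exact Hp | apply Rle_abs].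
      - rewrite Cmod_mult, Cmod_pow, <- RtoC_minus, Cmod_R, <- Rmult_plus_distr_r.
        apply Rmult_le_compat_r; [exact Hp|]. unfold Rminus. eapply Rle_trans; [apply Rabs_triang|]. rewrite Rabs_Ropp. lra. }
    assert (H0 := Cmod_ge_0 (u ^ S j - S1)%C). change (Csum (fun n => acoef (S j) n * w ^ n)%C (S Q)) with S1.
    nra.
Qed.

(** The coefficient of y^(-j) in the expansion of digamma y - log y, and by [zeta_nonpos] the value
    of zeta at 1 - j. The sign (-1)^j has an effect only at j = 1, since the other Bernoulli numbers
    of odd index vanish. *)
Definition dcoef (j : nat) : R := - ((-1) ^ j * bernoulli j / INR j).

(** The left side is the coefficient of w^n in log(1 + w) - w + sum of [dcoef] j ((w/(1+w))^j -
    w^j): the difference equation of digamma, written at w = 1/y, holds formally up to order K + 1.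
    It amounts to the Bernoulli recurrence. *)
Lemma dcoef_identity K n : (n <= S K)%nat ->
  (match n with O => 0 | S i => - ((-1) ^ S i / INR (S i)) end) - (if (n =? 1)%nat then 1 else 0)
   + Rsum (fun j => dcoef (S j) * (acoef (S j) n - (if (n =? S j)%nat then 1 else 0))) K = 0.
Proof.
  intros Hn. destruct n as [|n].
  - simpl. replace (Rsum _ K) with (Rsum (fun _ => 0 * 0) K); [rewrite Rsum_scal; ring|].
    apply Rsum_ext. intros. ring.
  - assert (E1 : Rsum (fun j => dcoef (S j) * (acoef (S j) (S n) - (if (S n =? S j)%nat then 1 else 0))) K
       = Rsum (fun j => dcoef (S j) * ((-1) ^ (n + j) * bin n j)) n).
    { replace K with (n + (K - n))%nat by lia. rewrite Rsum_app.
      replace (Rsum (fun i => _) (K - n)) with (Rsum (fun _ => 0 * 0) (K - n)).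
      - rewrite Rsum_scal, Rmult_0_l, Rplus_0_r. apply Rsum_ext. intros j Hj. rewrite acoef_bin.
        destruct (Nat.eqb_spec (S n) (S j)); [lia|]. ring.
      - apply Rsum_ext. intros j _. rewrite acoef_bin. destruct (Nat.eqb_spec (S n) (S (n + j))).
        + replace j with O by lia. rewrite Nat.add_0_r, bin_diag.
          replace (n + n)%nat with (2 * n)%nat by lia. rewrite pow_1_even. ring.
        + rewrite bin_gt by lia. ring. }
    rewrite E1. destruct n as [|n].
    + simpl. change (INR 1) with 1. field.
    + change (S (S n) =? 1)%nat with false. cbv iota.
      (* Absorption replaces bin(n+1, j) / (j+1) by bin(n+2, j+1) / (n+2); what appears is the
         Bernoulli recurrence without its term of index 0, hence the value -1. *)
      assert (E2 : Rsum (fun j => dcoef (S j) * ((-1) ^ (S n + j) * bin (S n) j)) (S n)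
         = (-1) ^ S (S n) * - / INR (S (S n)) * Rsum (fun j => bin (S (S n)) (S j) * bernoulli (S j)) (S n)).
      { rewrite <- Rsum_scal. apply Rsum_ext. intros j _. unfold dcoef.
        assert (H := bin_absorb (S n) j).
        assert (H1 : INR (S j) <> 0) by (apply not_0_INR; lia). assert (H2 : INR (S (S n)) <> 0) by (apply not_0_INR; lia).
        replace (bin (S n) j) with (INR (S j) * bin (S (S n)) (S j) / INR (S (S n))) by (rewrite <- H; field; exact H2).
        replace ((-1) ^ (S n + j)) with ((-1) ^ S n * (-1) ^ j) by (rewrite pow_add; reflexivity).
        assert (Hs : (-1) ^ j * (-1) ^ j = 1) by (rewrite <- pow_add; replace (j + j)%nat with (2 * j)%nat by lia; apply pow_1_even).
        simpl ((-1) ^ S j). simpl ((-1) ^ S (S n)). simpl ((-1) ^ S n).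
        transitivity (- ((-1) ^ j * (-1) ^ j) * (-1) ^ n * bernoulli (S j) * bin (S (S n)) (S j) / INR (S (S n))); [field; auto|].
        rewrite Hs. field. exact H2. }
      rewrite E2. assert (Hb := bernoulli_sum n). rewrite Rsum_S_l in Hb.
      change (bin (S (S n)) 0) with 1 in Hb. change (bernoulli 0) with 1 in Hb.
      replace (Rsum (fun j => bin (S (S n)) (S j) * bernoulli (S j)) (S n)) with (- (1)) by lra.
      field. apply not_0_INR. lia.
Qed.

(** The truncated expansion of digamma satisfies the functional equation digamma(y + 1) = digamma y
    + 1/y up to O(y^(-K-2)): with w = 1/y all Taylor coefficients of the defect through order K + 1
    vanish by [dcoef_identity]. *)
Lemma digamma_delta_bound K : exists B, 0 <= B /\ forall y, slit_plane y -> 2 <= Cmod y ->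
  Cmod (Clog (y + 1) - Clog y - / y + Csum (fun j => dcoef (S j) * (/ (y + 1) ^ S j - / y ^ S j)) K)%C
    <= B / Cmod y ^ S (S K).
Proof.
  set (f := fun w => ((Clog (1 + w) + - (1) * w ^ 1) + Csum (fun j => dcoef (S j) * ((w / (1 + w)) ^ S j + - (1) * w ^ S j)) K)%C).
  set (cl := fun n => match n with O => RtoC 0 | S i => RtoC (- ((-1) ^ S i / INR (S i))) end).
  assert (Hlog : papprox (fun w => Clog (1 + w)%C) cl (S K)).
  { exists 2. intros w Hw.
    replace (Csum (fun n => cl n * w ^ n)%C (S (S K))) with (Csum (fun i => - ((- w) ^ S i / INR (S i)))%C (S K));
      [apply (Clog_taylor w (S K) Hw)|].
    rewrite (Csum_S_l (fun n => cl n * w ^ n)%C). unfold cl at 1. replace (0 * w ^ 0)%C with (RtoC 0) by ring. rewrite Cplus_0_l.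
    apply Csum_ext. intros i _. unfold cl. rewrite RtoC_opp, RtoC_div, RtoC_pow by (apply not_0_INR; lia).
    replace (- w)%C with (RtoC (-1) * w)%C by ring. rewrite Cpow_mult_l. unfold Cdiv. ring. }
  assert (Hf := papprox_plus _ _ _ _ _
     (papprox_plus _ _ _ _ _ Hlog (papprox_scal (- (1))%C _ _ _ (papprox_mono 1 (S K))))
     (papprox_Csum (fun j w => dcoef (S j) * ((w / (1 + w)) ^ S j + - (1) * w ^ S j))%C _ K (S K)
        (fun j _ => papprox_scal (dcoef (S j)) _ _ _ (papprox_plus _ _ _ _ _ (papprox_acoef (S j) (S K))
            (papprox_scal (- (1))%C _ _ _ (papprox_mono (S j) (S K))))))).
  fold f in Hf.
  assert (Hf0 : papprox f (fun _ => RtoC 0) (S K)).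
  { eapply papprox_ext; [intros; reflexivity | | exact Hf].
    intros n Hn. cbv beta. assert (Hid := dcoef_identity K n Hn). apply (f_equal RtoC) in Hid.
    rewrite RtoC_plus, RtoC_minus, RtoC_Rsum in Hid. refine (eq_trans _ Hid).
    f_equal.
    - unfold cl. destruct n as [|[|n]]; simpl; try rewrite RtoC_opp; ring.
    - apply Csum_ext. intros j _. rewrite RtoC_mult, RtoC_minus. destruct (n =? S j)%nat; ring. }
  destruct Hf0 as [B HB]. exists (Rabs B). split; [apply Rabs_pos|]. intros y Hy Hy2.
  assert (Hz := slit_neq_0 y Hy).
  assert (Hw : Cmod (/ y)%C <= 1 / 2).
  { rewrite Cmod_inv by exact Hz. replace (1 / 2) with (/ 2) by field. apply Rinv_le_contravar; lra. }
  specialize (HB _ Hw). rewrite Csum_0 in HB by (intros; ring).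
  assert (Hz1 : (y + 1)%C <> RtoC 0) by (apply slit_add_neq0; [exact Hy | lra]).
  assert (E : (Clog (y + 1) - Clog y - / y + Csum (fun j => dcoef (S j) * (/ (y + 1) ^ S j - / y ^ S j)) K)%C = (f (/ y) - 0)%C).
  { unfold f. rewrite (Clog_add y 1 Hy) by lra. unfold Cdiv at 1. rewrite Cmult_1_l.
    replace (Csum (fun j => dcoef (S j) * (/ (y + 1) ^ S j - / y ^ S j)) K)%C with
      (Csum (fun j => dcoef (S j) * ((/ y / (1 + / y)) ^ S j + - (1) * (/ y) ^ S j)) K)%C; [simpl; ring|].
    apply Csum_ext. intros j _. replace (/ y / (1 + / y))%C with (/ (y + 1))%C.
    - rewrite !Cpow_inv by assumption. ring.
    - field. auto. }
  rewrite E. eapply Rle_trans; [exact HB|]. rewrite Cmod_inv, pow_inv by exact Hz. unfold Rdiv.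
  apply Rmult_le_compat_r; [|apply Rle_abs]. left. apply Rinv_0_lt_compat, pow_lt. lra.
Qed.

Lemma Un_cv_inv_INR : Un_cv (fun n => / INR n) 0.
Proof.
  intros eps He. destruct (INR_unbounded (/ eps)) as [n0 Hn0]. exists n0. intros n Hn.
  unfold R_dist. rewrite Rminus_0_r. assert (Hi : INR n0 <= INR n) by (apply le_INR; exact Hn).
  assert (Hei : 0 < / eps) by (apply Rinv_0_lt_compat, He).
  rewrite Rabs_right by (apply Rle_ge; left; apply Rinv_0_lt_compat; lra).
  rewrite <- (Rinv_inv eps). apply Rinv_lt_contravar; [apply Rmult_lt_0_compat; lra | lra].
Qed.

Lemma Un_cv_scal0 c u : Un_cv u 0 -> Un_cv (fun n => c * u n) 0.
Proof.
  intros H. replace 0 with (c * 0) by ring. apply CV_mult; [|exact H].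
  intros eps He; exists O; intros; unfold R_dist; rewrite Rminus_diag, Rabs_R0; exact He.
Qed.

Lemma Ccv_pow u a k : Ccv u a -> Ccv (fun n => u n ^ k)%C (a ^ k)%C.
Proof. intros H. induction k; simpl; [apply Ccv_const | apply Ccv_mult; assumption]. Qed.

Lemma Ccv_Csum_fin (f : nat -> nat -> C) (h : nat -> C) n :
  (forall i, (i < n)%nat -> Ccv (fun L => f L i) (h i)) -> Ccv (fun L => Csum (f L) n) (Csum h n).
Proof.
  induction n; intros H; simpl; [apply Ccv_const|].
  apply Ccv_plus; [apply IHn; intros; apply H; lia | apply H; lia].
Qed.

Lemma Ccv_inv_add y : slit_plane y -> Ccv (fun L => / (y + INR L))%C (RtoC 0).
Proof.
  intros Hy. destruct (slit_lower y Hy) as [c [Hc Hl]].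
  apply Ccv_squeeze with (fun n => / c * / INR n); [|apply Un_cv_scal0, Un_cv_inv_INR].
  exists 1%nat. intros n Hn. replace (/ (y + INR n) - 0)%C with (/ (y + INR n))%C by ring.
  rewrite Cmod_inv by (apply slit_add_neq0; [exact Hy | apply pos_INR]).
  rewrite <- Rinv_mult. assert (0 < INR n) by (apply lt_0_INR; lia).
  apply Rinv_le_contravar; [apply Rmult_lt_0_compat; lra|].
  eapply Rle_trans; [|apply Hl, pos_INR]. apply Rmult_le_compat_l; [lra|].
  assert (K := Cmod_ge_0 y). lra.
Qed.

Lemma Ccv_digamma_add y : slit_plane y -> Ccv (fun L => digamma (y + INR L) - ln (INR L))%C (RtoC 0).
Proof.
  intros Hy. replace (RtoC 0) with (digamma y - digamma y - 0)%C by ring.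
  apply Ccv_ext with (fun L => digamma y - digamma_seq y L - / (y + INR L))%C.
  - intros L. rewrite digamma_shift_n by exact Hy. unfold digamma_seq. rewrite Csum_S. ring.
  - apply Ccv_minus; [|apply Ccv_inv_add, Hy]. apply Ccv_minus; [apply Ccv_const | apply digamma_cv, Hy].
Qed.

Lemma Clog1_bound1 w : Cmod w <= 1 / 2 -> Cmod (Clog (1 + w))%C <= 2 * Cmod w.
Proof.
  intros H. assert (K := Clog1_bound w H). assert (H0 := Cmod_ge_0 w).
  replace (Clog (1 + w)) with ((Clog (1 + w) - w) + w)%C by ring.
  eapply Rle_trans; [apply Cmod_triangle|]. nra.
Qed.

Lemma Clog_add_INR y L : slit_plane y -> (0 < L)%nat -> Clog (y + INR L)%C = (ln (INR L) + Clog (1 + y / INR L))%C.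
Proof.
  intros Hy HL. assert (Hp : 0 < INR L) by (apply lt_0_INR, HL).
  assert (Hn : RtoC (INR L) <> RtoC 0) by (apply RtoC_neq0; lra).
  rewrite <- Clog_scal; [f_equal; field; exact Hn | exact Hp |].
  intros E. apply (slit_add_neq0 y (INR L) Hy (pos_INR _)).
  replace (y + INR L)%C with (INR L * (1 + y / INR L))%C by (field; exact Hn). rewrite E. ring.
Qed.

Lemma Ccv_Clog_add y : slit_plane y -> Ccv (fun L => Clog (y + INR L) - ln (INR L))%C (RtoC 0).
Proof.
  intros Hy. destruct (INR_unbounded (2 * Cmod y)) as [n0 Hn0].
  apply Ccv_squeeze with (fun n => (2 * Cmod y) * / INR n); [|apply Un_cv_scal0, Un_cv_inv_INR].
  exists (S n0). intros L HL.
  assert (Hp : 0 < INR L) by (apply lt_0_INR; lia).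
  assert (Hle : INR n0 <= INR L) by (apply le_INR; lia).
  rewrite Clog_add_INR by (try exact Hy; lia).
  replace (ln (INR L) + Clog (1 + y / INR L) - ln (INR L) - 0)%C with (Clog (1 + y / INR L)) by ring.
  assert (E : Cmod (y / INR L)%C = Cmod y * / INR L).
  { rewrite Cmod_div, Cmod_R, Rabs_right by (try apply RtoC_neq0; lra). reflexivity. }
  eapply Rle_trans; [apply Clog1_bound1|]; rewrite E; [|lra].
  apply Rmult_le_reg_r with (INR L); [exact Hp|]. rewrite Rmult_assoc, Rinv_l by lra. lra.
Qed.

Lemma inv_sq_tail Y n : 2 <= Y -> Rsum (fun m => / (Y + INR m) ^ 2) n <= 2 / Y.
Proof.
  intros HY.
  assert (H : Rsum (fun m => / (Y + INR m) ^ 2) n <= / (Y - 1) - / (Y - 1 + INR n)).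
  { induction n.
    - simpl. change (INR 0) with 0. rewrite Rplus_0_r. lra.
    - rewrite Rsum_S. assert (Hn := pos_INR n). rewrite S_INR.
      assert (K : / (Y + INR n) ^ 2 <= / (Y - 1 + INR n) - / (Y - 1 + (INR n + 1))); [|lra].
      replace (/ (Y - 1 + INR n) - / (Y - 1 + (INR n + 1))) with (/ ((Y - 1 + INR n) * (Y + INR n))) by (field; lra).
      apply Rinv_le_contravar; nra. }
  assert (0 <= / (Y - 1 + INR n)) by (left; apply Rinv_0_lt_compat; assert (Hn := pos_INR n); lra).
  assert (/ (Y - 1) <= 2 / Y).
  { apply Rmult_le_reg_r with (Y * (Y - 1)); [nra|]. replace (/ (Y - 1) * (Y * (Y - 1))) with Y by (field; lra).
    replace (2 / Y * (Y * (Y - 1))) with (2 * (Y - 1)) by (field; lra). lra. }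
  lra.
Qed.

(** The error [e L] of the truncated expansion at y + L tends to 0, so the error at y is the sum
    over m of the defects [D m]. By the sector bound these are O((|y| + m)^(-K-2)), and summation
    costs one power of |y|. *)
Lemma digamma_asymp K d : 0 < d < PI ->
  exists R0 B, 2 <= R0 /\ 0 <= B /\ forall y, sector d y -> R0 <= Cmod y ->
    Cmod (digamma y - Clog y - Csum (fun j => dcoef (S j) * / y ^ S j) K)%C <= B / Cmod y ^ S K.
Proof.
  intros Hd. destruct (sector_lower d Hd) as [c [Hc Hl]].
  destruct (digamma_delta_bound K) as [B [HB0 HB]].
  (* The radius 2 / c guarantees |y + m| >= c (|y| + m) >= 2, the range of [digamma_delta_bound];
     the factor 2 in the second constant comes from [inv_sq_tail]. *)
  exists (2 / c), (2 * B / c ^ S (S K)).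
  assert (H2c : 2 <= 2 / c). { apply Rmult_le_reg_r with c; [lra|]. unfold Rdiv. rewrite Rmult_assoc, Rinv_l; lra. }
  assert (Hcp : forall n, 0 < c ^ n) by (intros; apply pow_lt; lra).
  split; [exact H2c|]. split.
  { apply Rmult_le_pos; [lra|]. left. apply Rinv_0_lt_compat, Hcp. }
  intros y Hs HY. assert (Hy : slit_plane y) by apply Hs. set (Y := Cmod y) in *.
  set (e := fun L => (digamma (y + INR L) - Clog (y + INR L) - Csum (fun j => dcoef (S j) * / (y + INR L) ^ S j) K)%C).
  set (D := fun m => (Clog (y + INR m + 1) - Clog (y + INR m) - / (y + INR m) + Csum (fun j => dcoef (S j) * (/ (y + INR m + 1) ^ S j - / (y + INR m) ^ S j)) K)%C).
  assert (He : forall L, (e O - Csum D L = e L)%C).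
  { induction L; [simpl; ring|]. rewrite Csum_S.
    replace (e O - (Csum D L + D L))%C with ((e O - Csum D L) - D L)%C by ring. rewrite IHL.
    unfold e, D. rewrite S_INR, RtoC_plus, Cplus_assoc.
    rewrite (digamma_shift (y + INR L)) by (apply slit_plus; [exact Hy | apply pos_INR]).
    assert (E : (Csum (fun j => dcoef (S j) * (/ (y + INR L + 1) ^ S j - / (y + INR L) ^ S j)) K
       = Csum (fun j => dcoef (S j) * / (y + INR L + 1) ^ S j) K - Csum (fun j => dcoef (S j) * / (y + INR L) ^ S j) K)%C).
    { rewrite <- Csum_minus. apply Csum_ext. intros. ring. }
    rewrite E. ring. }
  assert (Hcv : Ccv e (RtoC 0)).
  { replace (RtoC 0) with (RtoC 0 - RtoC 0 - Csum (fun _ => RtoC 0) K)%C by (rewrite Csum_0 by reflexivity; ring).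
    unfold e. apply Ccv_minus.
    - apply Ccv_ext with (fun L => (digamma (y + INR L) - ln (INR L)) - (Clog (y + INR L) - ln (INR L)))%C; [intros; ring|].
      apply Ccv_minus; [apply Ccv_digamma_add, Hy | apply Ccv_Clog_add, Hy].
    - apply Ccv_Csum_fin. intros j _.
      replace (RtoC 0) with (dcoef (S j) * 0 ^ S j)%C by (simpl; ring). apply Ccv_scal.
      apply Ccv_ext with (fun L => (/ (y + INR L)) ^ S j)%C.
      + intros L. apply Cpow_inv, slit_add_neq0; [exact Hy | apply pos_INR].
      + apply Ccv_pow, Ccv_inv_add, Hy. }
  assert (HYpos : 0 < Y) by lra.
  assert (HD : forall L, Cmod (Csum D L) <= 2 * B / c ^ S (S K) / Y ^ S K).
  { intros L. apply Rle_trans with (Rsum (fun m => (B / c ^ S (S K) / Y ^ K) * / (Y + INR m) ^ 2) L).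
    - apply Cmod_Csum_le. intros m _. assert (Hm := pos_INR m).
      assert (Hlow := Hl y (INR m) Hs Hm). fold Y in Hlow.
      assert (Hge : 2 <= c * (Y + INR m)).
      { apply Rle_trans with (c * (2 / c)); [right; field; lra|]. apply Rmult_le_compat_l; lra. }
      eapply Rle_trans; [apply HB; [apply slit_plus; assumption | lra]|].
      unfold Rdiv. rewrite !Rmult_assoc. apply Rmult_le_compat_l; [exact HB0|].
      rewrite <- !Rinv_mult. apply Rinv_le_contravar.
      + apply Rmult_lt_0_compat; [apply Hcp|]. apply Rmult_lt_0_compat; apply pow_lt; lra.
      + apply Rle_trans with ((c * (Y + INR m)) ^ S (S K)); [|apply pow_incr; lra].
        rewrite Rpow_mult_distr. apply Rmult_le_compat_l; [left; apply Hcp|].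
        replace (S (S K)) with (K + 2)%nat by lia. rewrite pow_add. apply Rmult_le_compat_r; [apply pow2_ge_0|].
        apply pow_incr. lra.
    - rewrite Rsum_scal. eapply Rle_trans; [apply Rmult_le_compat_l; [|apply inv_sq_tail; lra]|].
      + apply Rmult_le_pos; [apply Rmult_le_pos; [exact HB0 | left; apply Rinv_0_lt_compat, Hcp] | left; apply Rinv_0_lt_compat, pow_lt; lra].
      + right. assert (Hq := Hcp (S (S K))). revert Hq. generalize (c ^ S (S K)). intros q Hq.
        simpl (Y ^ S K). field. repeat split; try apply pow_nonzero; lra. }
  replace (digamma y - Clog y - Csum (fun j => dcoef (S j) * / y ^ S j) K)%C with (e O).
  2: { unfold e. change (INR 0) with 0. replace (y + 0)%C with y by ring. reflexivity. }
  assert (Hsum : Ccv (Csum D) (e O)).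
  { replace (e O) with (e O - 0)%C by ring. apply Ccv_ext with (fun L => e O - e L)%C.
    - intros L. rewrite <- (He L). ring.
    - apply Ccv_minus; [apply Ccv_const | exact Hcv]. }
  apply Ccv_le with (Csum D); [exists O; intros; apply HD | exact Hsum].
Qed.

(** * Power series of bounded weighted l^1 norm *)

(* [f] is given on the closed disc of radius [r] around [s0] by a power series
   whose coefficients have weighted l^1 norm at most [A]. *)
Definition Wiener (s0 : C) (r A : R) (f : C -> C) : Prop :=
  exists a : nat -> C, (forall n, Rsum (fun j => Cmod (a j) * r ^ j) n <= A) /\
    forall h, Cmod h <= r -> Ccv (Csum (fun j => a j * h ^ j)%C) (f (s0 + h)%C).

Lemma Wiener_ext s0 r A f g : (forall h, Cmod h <= r -> f (s0 + h)%C = g (s0 + h)%C) -> Wiener s0 r A f -> Wiener s0 r A g.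
Proof.
  intros H [a [H1 H2]]. exists a. split; [exact H1|]. intros h Hh. rewrite <- H by exact Hh. auto.
Qed.

Lemma Wiener_le s0 r A B f : A <= B -> Wiener s0 r A f -> Wiener s0 r B f.
Proof. intros H [a [H1 H2]]. exists a. split; [|exact H2]. intros n. specialize (H1 n). lra. Qed.

Lemma Wiener_translate c s0 r A f : Wiener (s0 + c)%C r A f -> Wiener s0 r A (fun s => f (s + c)%C).
Proof.
  intros [a [H1 H2]]. exists a. split; [exact H1|]. intros h Hh.
  replace (s0 + h + c)%C with (s0 + c + h)%C by ring. auto.
Qed.

Lemma Ccv_eq u a b : a = b -> Ccv u a -> Ccv u b.
Proof. intros ->; auto. Qed.

Lemma Csum_head (f : nat -> C) m : (forall j, (m <= j)%nat -> f j = RtoC 0) -> Ccv (Csum f) (Csum f m).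
Proof.
  intros H. apply Ccv_unshift with m. apply Ccv_ext with (fun _ => Csum f m); [|apply Ccv_const].
  intros n. rewrite Nat.add_comm, Csum_app, (Csum_0 n); [ring|]. intros; apply H; lia.
Qed.

Lemma Rsum_head f m n : (forall j, (m <= j)%nat -> f j = 0) -> (forall j, 0 <= f j) -> Rsum f n <= Rsum f m.
Proof.
  intros H Hp. destruct (Nat.le_ge_cases n m) as [Hn|Hn]; [apply Rsum_mono; assumption|].
  replace n with (m + (n - m))%nat by lia. rewrite Rsum_app.
  rewrite (Rsum_ext (fun i => f (m + i)%nat) (fun _ => 0 * 0)); [rewrite Rsum_scal; lra|].
  intros; rewrite H by lia; ring.
Qed.

Lemma Wiener_const s0 r c : 0 <= r -> Wiener s0 r (Cmod c) (fun _ => c).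
Proof.
  intros Hr. exists (fun j => match j with O => c | S _ => RtoC 0 end). split.
  - intros n. eapply Rle_trans; [apply (Rsum_head _ 1)|].
    + intros [|j] Hj; [lia|]. rewrite Cmod_0. ring.
    + intros j. apply Rmult_le_pos; [apply Cmod_ge_0 | apply pow_le, Hr].
    + simpl. lra.
  - intros h _. eapply Ccv_eq; [|apply (Csum_head _ 1)].
    + simpl. ring.
    + intros [|j] Hj; [lia | ring].
Qed.

Lemma Wiener_mulX s0 r B g : 0 <= r -> Wiener s0 r B g -> Wiener s0 r (r * B) (fun s => (s - s0) * g s)%C.
Proof.
  intros Hr [b [H1 H2]]. exists (fun j => match j with O => RtoC 0 | S i => b i end). split.
  - intros [|n].
    + simpl. specialize (H1 O). simpl in H1. apply Rmult_le_pos; lra.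
    + rewrite Rsum_S_l, Cmod_0. specialize (H1 n).
      replace (Rsum (fun i => Cmod (b i) * r ^ S i) n) with (r * Rsum (fun j => Cmod (b j) * r ^ j) n).
      * assert (r * Rsum (fun j => Cmod (b j) * r ^ j) n <= r * B) by (apply Rmult_le_compat_l; assumption). lra.
      * rewrite <- Rsum_scal. apply Rsum_ext. intros. simpl. ring.
  - intros h Hh. replace (s0 + h - s0)%C with h by ring. apply Ccv_S.
    apply Ccv_ext with (fun n => h * Csum (fun j => b j * h ^ j) n)%C; [|apply Ccv_scal, H2, Hh].
    intros n. rewrite Csum_S_l, <- Csum_scal. replace (0 * h ^ 0)%C with (RtoC 0) by ring. rewrite Cplus_0_l.
    apply Csum_ext. intros. simpl. ring.
Qed.

Lemma Wiener_scal s0 r B c g : Wiener s0 r B g -> Wiener s0 r (Cmod c * B) (fun s => c * g s)%C.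
Proof.
  intros [b [H1 H2]]. exists (fun j => c * b j)%C. split.
  - intros n. rewrite (Rsum_ext _ (fun j => Cmod c * (Cmod (b j) * r ^ j))) by (intros; rewrite Cmod_mult; ring).
    rewrite Rsum_scal. apply Rmult_le_compat_l; [apply Cmod_ge_0 | apply H1].
  - intros h Hh. apply Ccv_ext with (fun n => c * Csum (fun j => b j * h ^ j) n)%C; [|apply Ccv_scal, H2, Hh].
    intros n. rewrite <- Csum_scal. apply Csum_ext. intros; ring.
Qed.

Lemma Wiener_plus s0 r A B f g : 0 <= r -> Wiener s0 r A f -> Wiener s0 r B g -> Wiener s0 r (A + B) (fun s => f s + g s)%C.
Proof.
  intros Hr [a [H1 H2]] [b [H3 H4]]. exists (fun j => a j + b j)%C. split.
  - intros n. eapply Rle_trans; [apply Rsum_le with (g := fun j => Cmod (a j) * r ^ j + Cmod (b j) * r ^ j)|].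
    + intros. rewrite <- Rmult_plus_distr_r. apply Rmult_le_compat_r; [apply pow_le, Hr | apply Cmod_triangle].
    + rewrite Rsum_plus. specialize (H1 n). specialize (H3 n). lra.
  - intros h Hh. apply Ccv_ext with (fun n => Csum (fun j => a j * h ^ j) n + Csum (fun j => b j * h ^ j) n)%C.
    + intros n. rewrite <- Csum_plus. apply Csum_ext. intros; ring.
    + apply Ccv_plus; auto.
Qed.

Lemma Wiener_bound s0 r A f h : Cmod h <= r -> Wiener s0 r A f -> Cmod (f (s0 + h)%C) <= A.
Proof.
  intros Hh [a [H1 H2]]. apply (Csum_cv_le (fun j => a j * h ^ j)%C (fun j => Cmod (a j) * r ^ j)); auto.
  intros j. rewrite Cmod_mult, Cmod_pow. apply Rmult_le_compat_l; [apply Cmod_ge_0|].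
  apply pow_incr. split; [apply Cmod_ge_0 | exact Hh].
Qed.

Lemma Un_cv_Cmod u l : Ccv u l -> Un_cv (fun n => Cmod (u n)) (Cmod l).
Proof.
  intros H eps He. destruct (H eps He) as [n0 Hn]. exists n0. intros n Hle. specialize (Hn n Hle).
  unfold R_dist. apply Rabs_def1.
  - assert (K := Cmod_triangle (u n - l) l). replace (u n - l + l)%C with (u n) in K by ring. lra.
  - assert (K := Cmod_triangle (l - u n) (u n)). replace (l - u n + u n)%C with l in K by ring.
    rewrite Cmod_sym in K. lra.
Qed.

Lemma Un_cv_Rsum_fin (f : nat -> nat -> R) (h : nat -> R) n :
  (forall i, (i < n)%nat -> Un_cv (fun L => f L i) (h i)) -> Un_cv (fun L => Rsum (f L) n) (Rsum h n).
Proof.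
  induction n; intros H; simpl.
  - intros eps He. exists O. intros. unfold R_dist. rewrite Rminus_diag, Rabs_R0. exact He.
  - apply (CV_plus (fun L => Rsum (f L) n) (fun L => f L n)); [apply IHn; intros; apply H; lia | apply H; lia].
Qed.

Lemma Un_cv_le_const u l B : (forall n, u n <= B) -> Un_cv u l -> l <= B.
Proof.
  intros H Hu. apply Rle_plus_epsilon. intros eps He. destruct (Hu eps He) as [n0 Hn].
  specialize (Hn n0 (le_n _)). unfold R_dist in Hn. apply Rabs_def2 in Hn. specialize (H n0). lra.
Qed.

Lemma Rsum_swap (f : nat -> nat -> R) n m :
  Rsum (fun i => Rsum (f i) m) n = Rsum (fun j => Rsum (fun i => f i j) n) m.
Proof.
  induction n; simpl.
  - rewrite (Rsum_ext _ (fun _ => 0 * 0)) by (intros; ring). rewrite Rsum_scal. ring.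
  - rewrite IHn, <- Rsum_plus. reflexivity.
Qed.

Lemma Rsum_single (f : nat -> R) j n : (forall i, 0 <= f i) -> (j < n)%nat -> f j <= Rsum f n.
Proof.
  intros H Hj. apply Rle_trans with (Rsum f (S j)); [|apply Rsum_mono; [exact H | lia]].
  rewrite Rsum_S. assert (0 <= Rsum f j) by (apply Rsum_nonneg; auto). lra.
Qed.

(** The counterpart of Weierstrass' theorem on sums of analytic functions: if the norms are
    summable, the coefficients of the sum are the column sums, by absolute convergence of the double
    series. No Cauchy integral is involved. *)
Lemma Wiener_sum s0 r (A : nat -> R) B (F : nat -> C -> C) f : 0 < r ->
  (forall i, Wiener s0 r (A i) (F i)) -> (forall n, Rsum A n <= B) ->
  (forall h, Cmod h <= r -> Ccv (Csum (fun i => F i (s0 + h)%C)) (f (s0 + h)%C)) ->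
  Wiener s0 r B f.
Proof.
  intros Hr HF HA Hf.
  set (a := fun i => proj1_sig (constructive_indefinite_description _ (HF i))).
  assert (Ha1 : forall i n, Rsum (fun j => Cmod (a i j) * r ^ j) n <= A i).
  { intros i. unfold a. destruct (constructive_indefinite_description _ (HF i)) as [x [Hx1 Hx2]]. exact Hx1. }
  assert (Ha2 : forall i h, Cmod h <= r -> Ccv (Csum (fun j => a i j * h ^ j)%C) (F i (s0 + h)%C)).
  { intros i. unfold a. destruct (constructive_indefinite_description _ (HF i)) as [x [Hx1 Hx2]]. exact Hx2. }
  clearbody a.
  assert (Hrj : forall j, 0 < r ^ j) by (intros; apply pow_lt, Hr).
  assert (Hterm : forall i j, 0 <= Cmod (a i j) * r ^ j) by (intros; apply Rmult_le_pos; [apply Cmod_ge_0 | left; auto]).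
  assert (Hbd : Rbdd A) by (exists B; exact HA).
  assert (Hcol : forall j, Ccv (Csum (fun i => a i j)) (CSeries (fun i => a i j))).
  { intros j. apply CSeries_correct with (fun i => / r ^ j * A i).
    - intros i. apply Rmult_le_reg_l with (r ^ j); [apply Hrj|]. rewrite <- Rmult_assoc, Rinv_r, Rmult_1_l by (specialize (Hrj j); lra).
      rewrite Rmult_comm. eapply Rle_trans; [|apply (Ha1 i (S j))]. apply (Rsum_single (fun j => Cmod (a i j) * r ^ j)); [apply Hterm | lia].
    - apply Rbdd_scal; [left; apply Rinv_0_lt_compat, Hrj | exact Hbd]. }
  exists (fun j => CSeries (fun i => a i j)). split.
  (* The norm bound is proved for finitely many rows I, where the two finite sums may be exchanged,
     and then passes to the limit in I. *)
  - intros n. apply Un_cv_le_const with (fun I => Rsum (fun j => Cmod (Csum (fun i => a i j) I) * r ^ j) n).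
    + intros I. apply Rle_trans with (Rsum (fun j => Rsum (fun i => Cmod (a i j) * r ^ j) I) n).
      * apply Rsum_le. intros j _.
        rewrite (Rsum_ext _ (fun i => r ^ j * Cmod (a i j))) by (intros; ring). rewrite Rsum_scal, Rmult_comm.
        apply Rmult_le_compat_l; [left; apply Hrj | apply Cmod_Csum].
      * rewrite Rsum_swap. eapply Rle_trans; [|apply (HA I)]. apply Rsum_le. intros; apply Ha1.
    + apply Un_cv_Rsum_fin. intros j _. apply (CV_mult (fun L => Cmod (Csum (fun i => a i j) L)) (fun _ => r ^ j)).
      * apply Un_cv_Cmod, Hcol.
      * intros eps He. exists O. intros. unfold R_dist. rewrite Rminus_diag, Rabs_R0. exact He.
  - intros h Hh. apply Csum_fubini with (u := fun i j => (a i j * h ^ j)%C) (g := fun i j => Cmod (a i j) * r ^ j)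
      (A := A) (r := fun i => F i (s0 + h)%C); auto.
    + intros i j. rewrite Cmod_mult, Cmod_pow. apply Rmult_le_compat_l; [apply Cmod_ge_0|].
      apply pow_incr. split; [apply Cmod_ge_0 | exact Hh].
    + intros j. apply Ccv_ext with (fun n => h ^ j * Csum (fun i => a i j) n)%C.
      * intros n. rewrite <- Csum_scal. apply Csum_ext. intros; ring.
      * rewrite Cmult_comm. apply Ccv_scal, Hcol.
Qed.

(** The product is the sum over i of a_i (s - s0)^i g(s), with norms |a_i| r^i B; [Wiener_sum] then
    gives submultiplicativity without forming Cauchy products. *)
Lemma Wiener_mult s0 r A B f g : 0 < r -> Wiener s0 r A f -> Wiener s0 r B g -> Wiener s0 r (A * B) (fun s => f s * g s)%C.
Proof.
  intros Hr [a [H1 H2]] Hg.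
  assert (HB : 0 <= B) by (destruct Hg as [b [Hb _]]; specialize (Hb O); exact Hb).
  apply Wiener_sum with (A := fun i => Cmod (a i) * (r ^ i * B)) (F := fun i s => (a i * ((s - s0) ^ i * g s))%C).
  - exact Hr.
  - intros i. apply Wiener_scal. induction i.
    + apply Wiener_ext with g; [intros; simpl; ring|]. apply Wiener_le with (2 := Hg). simpl. lra.
    + apply Wiener_ext with (fun s => (s - s0) * ((s - s0) ^ i * g s))%C; [intros; simpl; ring|].
      simpl. rewrite Rmult_assoc. apply Wiener_mulX; [lra | exact IHi].
  - intros n. rewrite (Rsum_ext _ (fun i => B * (Cmod (a i) * r ^ i))) by (intros; ring).
    rewrite Rsum_scal, Rmult_comm. apply Rmult_le_compat_r; auto.
  - intros h Hh. apply Ccv_ext with (fun n => g (s0 + h) * Csum (fun j => a j * h ^ j) n)%C.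
    + intros n. rewrite <- Csum_scal. apply Csum_ext. intros. replace (s0 + h - s0)%C with h by ring. ring.
    + rewrite Cmult_comm. apply Ccv_scal, H2, Hh.
Qed.

Lemma Wiener_affine s0 r c : 0 <= r -> Wiener s0 r (Cmod (s0 + c)%C + r) (fun s => s + c)%C.
Proof.
  intros Hr. apply Wiener_ext with (fun s => (s0 + c) + (s - s0) * 1)%C; [intros; ring|].
  apply Wiener_plus; [exact Hr | apply Wiener_const, Hr|].
  apply Wiener_le with (r * Cmod 1); [rewrite Cmod_1; lra|].
  apply (Wiener_mulX s0 r _ (fun _ => RtoC 1)); [exact Hr | apply Wiener_const, Hr].
Qed.

Lemma exp_series_bdd x n : 0 <= x -> Rsum (fun j => x ^ j / INR (fact j)) n <= exp x.
Proof.
  intros Hx. apply Rle_trans with (Rsum (fun j => x ^ j / INR (fact j)) (S n)).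
  - apply Rsum_mono; [|lia]. intros i. apply Rmult_le_pos; [apply pow_le, Hx | left; apply Rinv_0_lt_compat, INR_fact_lt_0].
  - assert (K := growing_ineq (fun n => sum_f_R0 (fun k => / INR (fact k) * x ^ k) n) (exp x)).
    assert (E : Rsum (fun j => x ^ j / INR (fact j)) (S n) = sum_f_R0 (fun k => / INR (fact k) * x ^ k) n).
    { clear. induction n; simpl; [unfold Rdiv; ring|]. simpl in IHn. rewrite IHn. unfold Rdiv. ring. }
    rewrite E. apply K.
    + intros m. rewrite tech5. assert (0 <= / INR (fact (S m)) * x ^ S m); [|lra].
      apply Rmult_le_pos; [left; apply Rinv_0_lt_compat, INR_fact_lt_0 | apply pow_le, Hx].
    + unfold exp. destruct (exist_exp x) as [l Hl]. exact Hl.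
Qed.

Lemma pow_fact_cv0 x : 0 <= x -> Un_cv (fun n => x ^ n / INR (fact n)) 0.
Proof.
  intros Hx. destruct (Rsum_cv_bdd (fun j => x ^ j / INR (fact j))) as [l [Hl _]].
  - intros i. apply Rmult_le_pos; [apply pow_le, Hx | left; apply Rinv_0_lt_compat, INR_fact_lt_0].
  - exists (exp x). intros; apply exp_series_bdd, Hx.
  - intros eps He. destruct (Hl (eps / 2)) as [n0 Hn]; [lra|]. exists n0. intros n Hle.
    assert (K1 := Hn n Hle). assert (K2 := Hn (S n) ltac:(lia)). rewrite Rsum_S in K2.
    unfold R_dist in *. rewrite Rminus_0_r. apply Rabs_def2 in K1. apply Rabs_def2 in K2. apply Rabs_def1; lra.
Qed.

Lemma Cexp_series v : Ccv (Csum (fun j => v ^ j / INR (fact j))%C) (Cexp v).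
Proof.
  apply Ccv_squeeze with (fun n => exp (Cmod v) * (Cmod v ^ n / INR (fact n))).
  - exists O. intros n _. assert (H := Cexp_taylor v n 1 ltac:(lra)). rewrite Cmult_1_l, Rmult_1_l, pow1, Rmult_1_r in H.
    rewrite Cmod_sym. rewrite Rmult_comm. exact H.
  - apply Un_cv_scal0, pow_fact_cv0, Cmod_ge_0.
Qed.

Lemma Wiener_exp s0 r (l : R) : 0 <= r ->
  Wiener s0 r (exp (l * Re s0 + Rabs l * r)) (fun s => Cexp (l * s)%C).
Proof.
  intros Hr. rewrite exp_plus. replace (exp (l * Re s0)) with (Cmod (Cexp (l * s0))) by (rewrite Cmod_Cexp, re_scal_l; reflexivity).
  apply Wiener_ext with (fun s => Cexp (l * s0) * Cexp (l * (s - s0)))%C.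
  { intros h _. rewrite <- Cexp_plus. f_equal. ring. }
  apply Wiener_scal. exists (fun j => RtoC l ^ j / INR (fact j))%C. split.
  - intros n. rewrite (Rsum_ext _ (fun j => (Rabs l * r) ^ j / INR (fact j))).
    + apply exp_series_bdd. apply Rmult_le_pos; [apply Rabs_pos | exact Hr].
    + intros j _. rewrite Cmod_div by (apply RtoC_neq0, INR_fact_neq_0). rewrite Cmod_pow, !Cmod_R, Rpow_mult_distr.
      rewrite (Rabs_right (INR _)) by (apply Rle_ge, pos_INR). unfold Rdiv. ring.
  - intros h _. replace (s0 + h - s0)%C with h by ring.
    apply Ccv_ext with (Csum (fun j => (l * h) ^ j / INR (fact j))%C); [|apply Cexp_series].
    intros n. apply Csum_ext. intros j _. rewrite Cpow_mult_l. unfold Cdiv. ring.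
Qed.

Lemma Wiener_inv s0 r c : 0 <= r -> 2 * r <= Cmod (s0 - c)%C -> s0 <> c ->
  exists A, Wiener s0 r A (fun s => / (s - c))%C.
Proof.
  intros Hr H Hne. set (d := (s0 - c)%C) in *.
  assert (Hd : d <> RtoC 0). { unfold d. intros E. apply Hne. transitivity (s0 - c + c)%C; [ring | rewrite E; ring]. }
  assert (Hm : 0 < Cmod d) by (apply Cmod_gt_0, Hd).
  exists (/ Cmod d * 2).
  assert (Hgeo : forall x n, 0 <= x <= 1 / 2 -> Rsum (fun j => x ^ j) n <= 2).
  { intros x n Hx. assert (E : (1 - x) * Rsum (fun j => x ^ j) n = 1 - x ^ n).
    { induction n; [simpl; ring|]. rewrite Rsum_S, Rmult_plus_distr_l, IHn. simpl. ring. }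
    assert (0 <= x ^ n) by (apply pow_le; lra). assert (0 <= Rsum (fun j => x ^ j) n) by (apply Rsum_nonneg; intros; apply pow_le; lra). nra. }
  exists (fun j => / d * (- / d) ^ j)%C. split.
  - intros n. rewrite (Rsum_ext _ (fun j => / Cmod d * (r / Cmod d) ^ j)).
    + rewrite Rsum_scal. apply Rmult_le_compat_l; [left; apply Rinv_0_lt_compat, Hm|]. apply Hgeo. split.
      * apply Rmult_le_pos; [exact Hr | left; apply Rinv_0_lt_compat, Hm].
      * apply Rmult_le_reg_r with (Cmod d); [exact Hm|]. unfold Rdiv. rewrite Rmult_assoc, Rinv_l; lra.
    + intros j _. rewrite Cmod_mult, Cmod_pow, Cmod_opp, Cmod_inv by exact Hd. unfold Rdiv. rewrite Rpow_mult_distr. ring.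
  - intros h Hh. set (x := (- / d * h)%C).
    assert (Hx : Cmod x <= 1 / 2).
    { unfold x. rewrite Cmod_mult, Cmod_opp, Cmod_inv by exact Hd. apply Rmult_le_reg_l with (Cmod d); [exact Hm|].
      rewrite <- Rmult_assoc, Rinv_r by lra. lra. }
    assert (Hx1 : (1 - x)%C <> RtoC 0).
    { intros E. assert (K := near1_neq0 (- x)%C). rewrite Cmod_opp in K. apply (K Hx). exact E. }
    assert (Hdh : (d + h)%C <> RtoC 0).
    { intros E. apply Hx1. unfold x. replace (1 - - / d * h)%C with (/ d * (d + h))%C by (field; exact Hd). rewrite E. ring. }
    replace (/ (s0 + h - c))%C with (/ d * (/ (1 - x)) - / d * / (1 - x) * 0)%C.
    2: { replace (s0 + h - c)%C with (d + h)%C by (unfold d; ring).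
         replace (1 - x)%C with ((d + h) / d)%C by (unfold x; field; exact Hd). field. auto. }
    apply Ccv_ext with (fun n => / d * / (1 - x) - / d * / (1 - x) * x ^ n)%C.
    + induction n; [simpl; ring|]. rewrite Csum_S, <- IHn.
      replace (/ d * (- / d) ^ n * h ^ n)%C with (/ d * x ^ n)%C by (unfold x; rewrite Cpow_mult_l; ring).
      simpl. field. auto.
    + apply Ccv_minus; [apply Ccv_const|]. apply Ccv_scal. apply Ccv_squeeze with (fun n => (1 / 2) ^ n).
      * exists O. intros n _. replace (x ^ n - 0)%C with (x ^ n)%C by ring. rewrite Cmod_pow.
        apply pow_incr. split; [apply Cmod_ge_0 | exact Hx].
      * intros eps He. destruct (pow_lt_1_zero (1 / 2) ltac:(rewrite Rabs_right; lra) eps He) as [n0 Hn].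
        exists n0. intros n Hle. unfold R_dist. rewrite Rminus_0_r. apply Hn, Hle.
Qed.

Lemma Wiener_analytic s0 r A f : 0 < r -> Wiener s0 r A f -> analytic_at f s0.
Proof.
  intros Hr [a [H1 H2]]. exists a, r. split; [exact Hr|]. intros w Hw. apply Ccv_is_pseries.
  replace (f w) with (f (s0 + (w - s0))%C) by (f_equal; ring). apply H2. lra.
Qed.

(** Convergence at radius r / 2 bounds the individual terms, and halving the radius once more turns
    the weighted norm into a geometric series of ratio 1/2. *)
Lemma analytic_Wiener s0 f : analytic_at f s0 -> exists r A, 0 < r /\ Wiener s0 r A f.
Proof.
  intros [a [r [Hr H]]].
  assert (Hcv : forall h, Cmod h < r -> Ccv (Csum (fun j => a j * h ^ j)%C) (f (s0 + h)%C)).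
  { intros h Hh. apply Ccv_is_pseries. replace h with (s0 + h - s0)%C at 1 by ring. apply H.
    replace (s0 + h - s0)%C with h by ring. exact Hh. }
  set (rho := r / 2). assert (Hrho : 0 < rho < r) by (unfold rho; lra).
  assert (Hb := Hcv (RtoC rho) ltac:(rewrite Cmod_R, Rabs_right; lra)).
  destruct (Ccv_bounded _ _ Hb) as [B [HB0 HB]].
  assert (Ht : forall j, Cmod (a j) * rho ^ j <= 2 * B).
  { intros j. assert (E : (a j * RtoC rho ^ j = Csum (fun j => a j * RtoC rho ^ j) (S j) - Csum (fun j => a j * RtoC rho ^ j) j)%C) by (rewrite Csum_S; ring).
    replace (Cmod (a j) * rho ^ j) with (Cmod (a j * RtoC rho ^ j)%C) by (rewrite Cmod_mult, Cmod_pow, Cmod_R, Rabs_right by lra; reflexivity).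
    rewrite E. eapply Rle_trans; [apply Cmod_minus_le|]. assert (K1 := HB (S j)). assert (K2 := HB j). lra. }
  exists (rho / 2), (4 * B). split; [lra|]. exists a. split.
  - intros n. apply Rle_trans with (Rsum (fun j => (2 * B) * (1 / 2) ^ j) n).
    + apply Rsum_le. intros j _. replace (rho / 2) with (rho * (1 / 2)) by field. rewrite Rpow_mult_distr, <- Rmult_assoc.
      apply Rmult_le_compat_r; [apply pow_le; lra | apply Ht].
    + rewrite Rsum_scal. replace (4 * B) with (2 * B * 2) by ring. apply Rmult_le_compat_l; [lra|].
      assert (E : Rsum (fun j => (1 / 2) ^ j) n = 2 - 2 * (1 / 2) ^ n).
      { induction n; [simpl; ring|]. rewrite Rsum_S, IHn. simpl. lra. }
      change (Rsum (fun j => (1 / 2) ^ j) n <= 2). rewrite E. assert (0 <= (1 / 2) ^ n) by (apply pow_le; lra). lra.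
  - intros h Hh. apply Hcv. lra.
Qed.

(** * The identity theorem *)

Definition vanishes_near (f : C -> C) (s : C) : Prop := exists e, 0 < e /\ forall h, Cmod h < e -> f (s + h)%C = RtoC 0.

(** About the new centre the function s - s0 has norm |h0| + (r - |h0|) = r, so each power keeps its
    old norm r^j and the bound A survives unchanged. *)
Lemma Wiener_recenter s0 r A f h0 : Cmod h0 < r -> Wiener s0 r A f -> Wiener (s0 + h0)%C (r - Cmod h0) A f.
Proof.
  intros Hh0 [a [H1 H2]]. assert (Hr : 0 < r - Cmod h0) by lra. assert (H0 := Cmod_ge_0 h0).
  apply Wiener_sum with (A := fun j => Cmod (a j) * r ^ j) (F := fun j s => (a j * (s - s0) ^ j)%C); [exact Hr | | exact H1 |].
  - intros j. apply Wiener_scal. induction j.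
    + apply Wiener_le with (Cmod 1); [rewrite Cmod_1; simpl; lra|]. apply (Wiener_const _ _ 1). lra.
    + simpl. apply (Wiener_mult _ _ _ _ (fun s => s - s0)%C); [exact Hr | | exact IHj].
      replace r with (Cmod (s0 + h0 + - s0)%C + (r - Cmod h0)) at 2.
      * apply Wiener_affine. lra.
      * replace (s0 + h0 + - s0)%C with h0 by ring. ring.
  - intros h Hh. replace (s0 + h0 + h)%C with (s0 + (h0 + h))%C by ring.
    apply Ccv_ext with (Csum (fun j => a j * (h0 + h) ^ j)%C).
    + intros n. apply Csum_ext. intros. replace (s0 + (h0 + h) - s0)%C with (h0 + h)%C by ring. reflexivity.
    + apply H2. eapply Rle_trans; [apply Cmod_triangle|]. lra.
Qed.

(** The coefficients vanish one after the other: if a_j = 0 for j < m, then at a small real x the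
    term a_m x^m is minus the remaining tail, which is O(x^(m+1)). *)
Lemma Wiener_vanish s0 r A f : 0 < r -> Wiener s0 r A f -> vanishes_near f s0 ->
  forall h, Cmod h <= r -> f (s0 + h)%C = RtoC 0.
Proof.
  intros Hr [a [H1 H2]] [e [He Hv]].
  assert (Hz : forall m, a m = RtoC 0).
  { intros m. induction m as [m IH] using lt_wf_ind.
    apply Cmod_eq_0. apply Rle_antisym; [|apply Cmod_ge_0].
    assert (HA : 0 <= A) by (specialize (H1 O); exact H1).
    apply Rle_plus_epsilon. intros eps Heps.
    set (Q := A / r ^ S m). assert (Hrm : 0 < r ^ S m) by (apply pow_lt, Hr).
    assert (HQ : 0 <= Q) by (unfold Q; apply Rmult_le_pos; [exact HA | left; apply Rinv_0_lt_compat, Hrm]).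
    (* The three bounds place x where f vanishes, inside the disc of convergence, and so low that
       the estimate x Q of |a_m| is at most eps. *)
    set (x := Rmin (Rmin (e / 2) r) (eps / (Q + 1))).
    assert (Hx0 : 0 < x). { unfold x. repeat apply Rmin_glb_lt; try lra. apply Rdiv_lt_0_compat; lra. }
    assert (Hx1 : x <= e / 2) by (eapply Rle_trans; [apply Rmin_l | apply Rmin_l]).
    assert (Hx2 : x <= r) by (eapply Rle_trans; [apply Rmin_l | apply Rmin_r]).
    assert (Hx3 : x <= eps / (Q + 1)) by apply Rmin_r.
    assert (Hmx : Cmod (RtoC x) = x) by (rewrite Cmod_R, Rabs_right; lra).
    assert (Hc := H2 (RtoC x) ltac:(lra)). rewrite Hv in Hc by lra.
    assert (Hxm : 0 < x ^ m) by (apply pow_lt, Hx0).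
    assert (K : Cmod (a m) * x ^ m <= x ^ S m * Q).
    { assert (Hc' : Ccv (fun n => Csum (fun i => a (S m + i)%nat * RtoC x ^ (S m + i))%C n) (- (a m * RtoC x ^ m))%C).
      { replace (- (a m * RtoC x ^ m))%C with (0 - a m * RtoC x ^ m)%C by ring.
        apply Ccv_ext with (fun n => Csum (fun j => a j * RtoC x ^ j) (n + S m) - a m * RtoC x ^ m)%C.
        - intros n. rewrite (Nat.add_comm n), Csum_app, Csum_S, (Csum_0 m); [ring|]. intros i Hi. rewrite IH by exact Hi. ring.
        - apply Ccv_minus; [apply Ccv_shift, Hc | apply Ccv_const]. }
      replace (Cmod (a m) * x ^ m) with (Cmod (- (a m * RtoC x ^ m))%C) by (rewrite Cmod_opp, Cmod_mult, Cmod_pow, Hmx; reflexivity).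
      apply (Ccv_le _ _ (x ^ S m * Q)) in Hc'; [exact Hc'|]. exists O. intros n _.
      eapply Rle_trans; [apply Cmod_Csum_le with (g := fun i => (x ^ S m * / r ^ S m) * (Cmod (a (S m + i)%nat) * r ^ (S m + i)))|].
      - intros i _. rewrite Cmod_mult, Cmod_pow, Hmx, !pow_add.
        replace (x ^ S m * / r ^ S m * (Cmod (a (S m + i)%nat) * (r ^ S m * r ^ i))) with (Cmod (a (S m + i)%nat) * (x ^ S m * r ^ i)) by (field; lra).
        apply Rmult_le_compat_l; [apply Cmod_ge_0|]. apply Rmult_le_compat_l; [apply pow_le; lra|]. apply pow_incr. lra.
      - rewrite Rsum_scal. unfold Q. replace (x ^ S m * (A / r ^ S m)) with (x ^ S m * / r ^ S m * A) by (unfold Rdiv; ring).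
        apply Rmult_le_compat_l; [apply Rmult_le_pos; [apply pow_le; lra | left; apply Rinv_0_lt_compat, Hrm]|].
        assert (E := Rsum_app (fun j => Cmod (a j) * r ^ j) (S m) n). assert (K := H1 (S m + n)%nat).
        assert (0 <= Rsum (fun j => Cmod (a j) * r ^ j) (S m)) by (apply Rsum_nonneg; intros; apply Rmult_le_pos; [apply Cmod_ge_0 | apply pow_le; lra]).
        lra. }
    simpl (x ^ S m) in K. assert (K2 : Cmod (a m) <= x * Q) by nra.
    assert (K3 : x * (Q + 1) <= eps).
    { apply Rle_trans with (eps / (Q + 1) * (Q + 1)); [apply Rmult_le_compat_r; lra | right; field; lra]. }
    nra. }
  intros h Hh. apply Ccv_unique with (Csum (fun j => a j * h ^ j)%C); [apply H2, Hh|].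
  apply Ccv_ext with (fun _ => RtoC 0); [|apply Ccv_const]. intros n. symmetry. apply Csum_0. intros. rewrite Hz. ring.
Qed.

(** Let T be the supremum of the parameters up to which f vanishes near the segment. The power
    series at the point of parameter T, recentred at a slightly earlier point, vanishes on a disc
    reaching beyond T, so T = 1 and the endpoint is covered. *)
Lemma identity_segment f p q :
  (forall t : R, 0 <= t <= 1 -> analytic_at f (p + t * (q - p))%C) ->
  vanishes_near f p -> f q = RtoC 0.
Proof.
  intros Han Hp. set (g := fun t : R => (p + t * (q - p))%C) in *.
  set (E := fun t => 0 <= t <= 1 /\ forall u, 0 <= u <= t -> vanishes_near f (g u)).
  assert (HE0 : E 0). { split; [lra|]. intros u Hu. replace u with 0 by lra. unfold g. replace (p + 0 * (q - p))%C with p by ring. exact Hp. }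
  destruct (completeness E) as [T [HT1 HT2]].
  - exists 1. intros t [Ht _]. lra.
  - exists 0. exact HE0.
  - assert (HT : 0 <= T <= 1) by (split; [apply HT1, HE0 | apply HT2; intros t [Ht _]; lra]).
    destruct (analytic_Wiener _ _ (Han T HT)) as [r [A [Hr HW]]].
    set (L := Cmod (q - p)%C). assert (HL : 0 <= L) by apply Cmod_ge_0.
    (* A parameter change below eta moves the point by at most r / 4. The disc about the earlier
       point has radius at least 3 r / 4, enough for the two displacements and a neighbourhood of
       radius r / 4. *)
    set (eta := r / (4 * (L + 1))). assert (Heta : 0 < eta) by (unfold eta; apply Rdiv_lt_0_compat; lra).
    assert (HetaL : eta * L <= r / 4).
    { unfold eta. apply Rmult_le_reg_r with (4 * (L + 1)); [lra|].
      replace (r / (4 * (L + 1)) * L * (4 * (L + 1))) with (r * L) by (field; lra). nra. }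
    assert (Hex : exists t, E t /\ T - eta < t).
    { apply NNPP. intros Hn. assert (T <= T - eta); [|lra]. apply HT2. intros t Ht.
      destruct (Rle_lt_dec t (T - eta)); [assumption|]. exfalso. apply Hn. exists t. auto. }
    destruct Hex as [t0 [[Ht01 Ht02] Ht0]].
    assert (Ht0T : t0 <= T) by (apply HT1; split; assumption).
    assert (Hg : forall u v, (g u - g v)%C = (RtoC (u - v) * (q - p))%C) by (intros; unfold g; rewrite RtoC_minus; ring).
    assert (Hgm : forall u v, Cmod (g u - g v)%C = Rabs (u - v) * L) by (intros; rewrite Hg, Cmod_mult, Cmod_R; reflexivity).
    set (h0 := (g t0 - g T)%C).
    assert (Hh0 : Cmod h0 <= r / 4).
    { unfold h0. rewrite Hgm. apply Rle_trans with (eta * L); [|exact HetaL]. apply Rmult_le_compat_r; [exact HL|].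
      apply Rabs_le. lra. }
    assert (HW2 := Wiener_recenter (g T) r A f h0 ltac:(lra) HW).
    replace (g T + h0)%C with (g t0) in HW2 by (unfold h0; ring).
    assert (Hv := Wiener_vanish (g t0) (r - Cmod h0) A f ltac:(lra) HW2 (Ht02 t0 ltac:(lra))).
    assert (Hall : forall u, Rabs (u - T) < eta -> vanishes_near f (g u)).
    { intros u Hu. exists (r / 4). split; [lra|]. intros h Hh.
      replace (g u + h)%C with (g t0 + ((g u - g T) - h0 + h))%C by (unfold h0; ring). apply Hv.
      eapply Rle_trans; [apply Cmod_triangle|]. assert (K := Cmod_minus_le (g u - g T) h0).
      assert (K2 : Cmod (g u - g T)%C <= r / 4).
      { rewrite Hgm. apply Rle_trans with (eta * L); [apply Rmult_le_compat_r; lra | exact HetaL]. }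
      lra. }
    assert (HallT : forall t, t < T + eta -> forall u, 0 <= u <= t -> vanishes_near f (g u)).
    { intros t Ht u Hu. destruct (Rle_lt_dec u t0); [apply Ht02; lra|]. apply Hall. apply Rabs_def1; lra. }
    destruct (Req_dec T 1) as [->|HT1'].
    + destruct (HallT 1 ltac:(lra) 1 ltac:(lra)) as [e [He Hv1]].
      specialize (Hv1 (RtoC 0)). rewrite Cmod_0 in Hv1. specialize (Hv1 He). rewrite <- Hv1. f_equal. unfold g. ring.
    + exfalso. set (t := Rmin 1 (T + eta / 2)).
      assert (T < t) by (unfold t; apply Rmin_glb_lt; lra).
      assert (E t). { split; [split; [lra | apply Rmin_l]|]. apply HallT. unfold t. eapply Rle_lt_trans; [apply Rmin_r | lra]. }
      assert (t <= T) by (apply HT1; assumption). lra.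
Qed.

(** * The binomial series with complex exponent *)

Fixpoint bc (alpha : C) (j : nat) : C :=
  match j with O => RtoC 1 | S i => (bc alpha i * ((alpha - INR i) / INR (S i)))%C end.

(** The rising factorial x (x + 1) ... (x + j - 1) over j!, which majorizes |[bc alpha j]| when
    |alpha| = x. *)
Fixpoint rb (x : R) (j : nat) : R :=
  match j with O => 1 | S i => rb x i * ((x + INR i) / INR (S i)) end.

Lemma rb_nonneg x j : 0 <= x -> 0 <= rb x j.
Proof.
  intros Hx. induction j; simpl; [lra|]. apply Rmult_le_pos; [exact IHj|].
  apply Rmult_le_pos; [assert (H := pos_INR j); lra | left; apply Rinv_0_lt_compat, lt_0_INR; lia].
Qed.

Lemma Cmod_bc alpha j : Cmod (bc alpha j) <= rb (Cmod alpha) j.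
Proof.
  induction j; simpl; [rewrite Cmod_1; lra|].
  rewrite Cmod_mult, Cmod_div by apply INR_S_neq0. rewrite Cmod_R, (Rabs_right (INR (S j))) by (apply Rle_ge, pos_INR).
  assert (H := pos_INR j). apply Rmult_le_compat; [apply Cmod_ge_0 | | exact IHj |].
  - apply Rmult_le_pos; [apply Cmod_ge_0 | left; apply Rinv_0_lt_compat, lt_0_INR; lia].
  - apply Rmult_le_compat_r; [left; apply Rinv_0_lt_compat, lt_0_INR; lia|].
    eapply Rle_trans; [apply Cmod_minus_le|]. rewrite Cmod_R, Rabs_right; lra.
Qed.

(** The weight 1/2 is the radius on which the binomial series is used. The additional factor j + 1
    absorbs the differentiation in [binomial_series] and the linear growth of the norms in
    [Wiener_Zf]. *)
Lemma rb_bdd x : 0 <= x -> Rbdd (fun j => INR (S j) * rb x j * (1 / 2) ^ j).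
Proof.
  (* With n = j + 1 the ratio of consecutive terms is (n + 1)(x + j) / (2 n^2), which is at most 3/4
     once j >= 2 x + 4. *)
  intros Hx. destruct (INR_unbounded (2 * x + 4)) as [J HJ].
  apply Rbdd_ratio with (J := J) (q := 3 / 4); [lra | |].
  - intros j. repeat apply Rmult_le_pos; [apply pos_INR | apply rb_nonneg, Hx | apply pow_le; lra].
  - intros j Hj. simpl rb. simpl ((1 / 2) ^ S j).
    assert (HJj : INR J <= INR j) by (apply le_INR; exact Hj).
    assert (Hb := rb_nonneg x j Hx). assert (Hp : 0 <= (1 / 2) ^ j) by (apply pow_le; lra).
    rewrite (S_INR (S j)). set (n := INR (S j)). assert (En : n = INR j + 1) by apply S_INR.
    assert (Hn : 0 < n) by lra.
    replace ((n + 1) * (rb x j * ((x + INR j) / n)) * (1 / 2 * (1 / 2) ^ j)) with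
      (((n + 1) * (x + INR j) / n / 2) * (rb x j * (1 / 2) ^ j)) by (field; lra).
    replace (3 / 4 * (n * rb x j * (1 / 2) ^ j)) with ((3 / 4 * n) * (rb x j * (1 / 2) ^ j)) by ring.
    apply Rmult_le_compat_r; [apply Rmult_le_pos; assumption|].
    apply Rmult_le_reg_r with (4 * n); [lra|].
    replace ((n + 1) * (x + INR j) / n / 2 * (4 * n)) with (2 * (n + 1) * (x + INR j)) by (field; lra).
    rewrite En. nra.
Qed.

Lemma Rbdd_terms_cv0 f : (forall i, 0 <= f i) -> Rbdd f -> Un_cv f 0.
Proof.
  intros Hp Hb. destruct (Rsum_cv_bdd f Hp Hb) as [l [Hl _]].
  intros eps He. destruct (Hl (eps / 2)) as [n0 Hn]; [lra|]. exists n0. intros n Hle.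
  assert (K1 := Hn n Hle). assert (K2 := Hn (S n) ltac:(lia)). rewrite Rsum_S in K2.
  unfold R_dist in *. rewrite Rminus_0_r. apply Rabs_def2 in K1. apply Rabs_def2 in K2. apply Rabs_def1; lra.
Qed.

Lemma ln_abs_bound u : Rabs u <= 1 / 2 -> Rabs (ln (1 + u)) <= 1.
Proof.
  intros Hu. apply Rabs_le_between in Hu. apply Rabs_le. split.
  - rewrite <- (ln_exp (- (1))). apply ln_le; [apply exp_pos|].
    assert (H := exp_ineq1 1 ltac:(lra)). rewrite exp_Ropp.
    apply Rle_trans with (/ 2); [apply Rinv_le_contravar; lra | lra].
  - apply Rle_trans with (ln (exp 1)); [|rewrite ln_exp; lra]. apply ln_le; [lra|]. assert (H := exp_ineq1 1 ltac:(lra)). lra.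
Qed.

Lemma is_Cder_ln_affine (t s : R) : 0 < 1 + t * s -> is_Cder (fun s => RtoC (ln (1 + t * s))) s (RtoC (t / (1 + t * s))).
Proof.
  intros H. apply is_Cder_RtoC. auto_derive; [exact H | field; lra].
Qed.

(** The partial sum at t s is multiplied by (1 + t s)^(-alpha), and s moves from 0 to 1. By the
    identity [Hode] the derivative of the product collapses to one term, governed by the first
    omitted coefficient, and this tends to 0 by [rb_bdd]. *)
Lemma binomial_series alpha t : Rabs t <= 1 / 2 ->
  Ccv (Csum (fun j => bc alpha j * RtoC t ^ j)%C) (Cexp (alpha * ln (1 + t))%C).
Proof.
  intros Ht. set (x := Cmod alpha). assert (Hx : 0 <= x) by apply Cmod_ge_0.
  assert (Hts : forall s, 0 <= s <= 1 -> Rabs (t * s) <= 1 / 2).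
  { intros s Hs. rewrite Rabs_mult, (Rabs_right s) by lra. assert (H := Rabs_pos t). nra. }
  set (E := fun s : R => Cexp (- alpha * ln (1 + t * s))%C).
  assert (HE : forall s, 0 <= s <= 1 -> Cmod (E s) <= exp x).
  { intros s Hs. unfold E. rewrite Cmod_Cexp. apply exp_mono. eapply Rle_trans; [apply Rle_abs|].
    eapply Rle_trans; [apply re_le_Cmod|]. rewrite Cmod_mult, Cmod_opp, Cmod_R. fold x.
    assert (H := ln_abs_bound _ (Hts s Hs)). nra. }
  set (F := fun m s => Csum (fun j => bc alpha j * RtoC (t * s) ^ j)%C m).
  assert (Hpoly : forall m s, is_Cder (fun s => F (S m) s) s (t * Csum (fun j => INR (S j) * bc alpha (S j) * RtoC (t * s) ^ j) m)%C).
  { intros m s. unfold F.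
    apply is_Cder_ext with (fun s => (1 + Csum (fun j => bc alpha (S j) * (0 + s * t) ^ S j) m)%C).
    - intros u. rewrite (Csum_S_l (fun j => bc alpha j * RtoC (t * u) ^ j)%C). simpl bc at 2.
      replace (1 * RtoC (t * u) ^ 0)%C with (RtoC 1) by (simpl; ring). f_equal. apply Csum_ext. intros.
      rewrite RtoC_mult. replace (0 + u * t)%C with (t * u)%C by ring. reflexivity.
    - apply is_Cder_eq with (0 + Csum (fun j => bc alpha (S j) * (INR (S j) * (0 + s * t) ^ j * t)) m)%C.
      + rewrite Cplus_0_l, <- Csum_scal. apply Csum_ext. intros. rewrite RtoC_mult. replace (0 + s * t)%C with (t * s)%C by ring. ring.
      + apply is_Cder_plus; [apply is_Cder_const|]. apply is_Cder_Csum. intros i _. apply is_Cder_scal.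
        apply (is_Cder_pow (fun s => 0 + s * t)%C). apply is_Cder_linear. }
  assert (Hode : forall m (u : C), ((1 + u) * Csum (fun j => INR (S j) * bc alpha (S j) * u ^ j) m - alpha * Csum (fun j => bc alpha j * u ^ j) (S m)
       = - (INR (S m) * bc alpha (S m) * u ^ m))%C).
  { intros m u. induction m.
    - simpl Csum. simpl bc. change (INR 1) with 1. change (INR 0) with 0. simpl. field.
    - rewrite Csum_S. rewrite (Csum_S _ (S m)).
      transitivity (((1 + u) * Csum (fun j => INR (S j) * bc alpha (S j) * u ^ j) m - alpha * Csum (fun j => bc alpha j * u ^ j) (S m))
         + (1 + u) * (INR (S m) * bc alpha (S m) * u ^ m) - alpha * (bc alpha (S m) * u ^ S m))%C; [ring|].
      rewrite IHm. change (bc alpha (S (S m))) with (bc alpha (S m) * ((alpha - INR (S m)) / INR (S (S m))))%C.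
      assert (H := INR_S_neq0 (S m)). simpl (u ^ S m)%C. field. exact H. }
  assert (Hmain : forall m, Cmod (E 1 * F (S m) 1 - 1)%C <= (2 * exp x) * (INR (S (S m)) * rb x (S m) * (1 / 2) ^ S m)).
  { intros m. set (g := fun s => (E s * F (S m) s)%C).
    set (M := 2 * exp x * (INR (S (S m)) * rb x (S m) * (1 / 2) ^ S m)).
    assert (K : Cmod (g 1 - g 0)%C <= M * 1 - M * 0).
    { apply (Cder_mean_value g (fun s => - (E s * (t / RtoC (1 + t * s)) * (INR (S m) * bc alpha (S m) * RtoC (t * s) ^ m)))%C (fun s => M * s) (fun _ => M) 0 1); [lra | | |].
      - intros s Hs. assert (Hb := Hts s Hs). apply Rabs_le_between in Hb.
        assert (Hpos : 0 < 1 + t * s) by lra.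
        assert (Hnz : RtoC (1 + t * s) <> RtoC 0) by (apply RtoC_neq0; lra).
        unfold g.
        eapply is_Cder_eq; [|apply is_Cder_mult; [unfold E; apply is_Cder_Cexp, is_Cder_scal, is_Cder_ln_affine; exact Hpos | apply Hpoly]].
        cbv beta. fold (E s). rewrite RtoC_div by lra.
        assert (O := Hode m (RtoC (t * s))). fold (F (S m) s) in O. rewrite <- RtoC_plus in O.
        set (P := Csum (fun j => INR (S j) * bc alpha (S j) * RtoC (t * s) ^ j)%C m) in *.
        replace (INR (S m) * bc alpha (S m) * RtoC (t * s) ^ m)%C with (alpha * F (S m) s - RtoC (1 + t * s) * P)%C.
        + field. exact Hnz.
        + transitivity (- (RtoC (1 + t * s) * P - alpha * F (S m) s))%C; [ring|]. rewrite O. ring.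
      - intros s Hs. auto_derive; [exact I | ring].
      - intros s Hs. assert (Hb := Hts s Hs). assert (Hb' := Hb). apply Rabs_le_between in Hb'.
        rewrite Cmod_opp, !Cmod_mult, Cmod_div by (apply RtoC_neq0; lra). rewrite !Cmod_R, Cmod_pow, Cmod_R.
        rewrite (Rabs_right (1 + t * s)), (Rabs_right (INR (S m))) by (try apply Rle_ge, pos_INR; lra).
        assert (H1 := HE s Hs). assert (H2 := Cmod_bc alpha (S m)). fold x in H2.
        assert (H3 : Rabs t / (1 + t * s) <= 1).
        { apply Rmult_le_reg_r with (1 + t * s); [lra|]. unfold Rdiv. rewrite Rmult_assoc, Rinv_l; lra. }
        assert (H3' : 0 <= Rabs t / (1 + t * s)) by (apply Rmult_le_pos; [apply Rabs_pos | left; apply Rinv_0_lt_compat; lra]).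
        assert (H4 : Rabs (t * s) ^ m <= (1 / 2) ^ m) by (apply pow_incr; split; [apply Rabs_pos | exact Hb]).
        assert (H4' : 0 <= Rabs (t * s) ^ m) by (apply pow_le, Rabs_pos).
        assert (Hpm : 0 <= (1 / 2) ^ m) by (apply pow_le; lra).
        assert (Hrb := rb_nonneg x (S m) Hx). assert (HI := pos_INR (S m)). assert (Hexp := exp_pos x).
        assert (HbC := Cmod_ge_0 (bc alpha (S m))). assert (HEC := Cmod_ge_0 (E s)).
        unfold M. rewrite (S_INR (S m)). simpl ((1 / 2) ^ S m).
        replace (2 * exp x * ((INR (S m) + 1) * rb x (S m) * (1 / 2 * (1 / 2) ^ m))) with
          ((exp x * 1) * (((INR (S m) + 1) * rb x (S m)) * (1 / 2) ^ m)) by field.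
        apply Rmult_le_compat.
        + apply Rmult_le_pos; assumption.
        + apply Rmult_le_pos; [apply Rmult_le_pos|]; assumption.
        + apply Rmult_le_compat; assumption.
        + apply Rmult_le_compat; [apply Rmult_le_pos; assumption | assumption | | assumption].
          apply Rmult_le_compat; try assumption; lra. }
    assert (E0 : g 0 = RtoC 1).
    { unfold g, E, F. rewrite Rmult_0_r, Rplus_0_r, ln_1. replace (- alpha * 0)%C with (RtoC 0) by ring. rewrite Cexp_0.
      rewrite (Csum_S_l (fun j => bc alpha j * RtoC 0 ^ j)%C), Csum_0; [simpl; ring|]. intros. simpl. ring. }
    rewrite E0 in K. unfold g in K. lra. }
  assert (HEne : E 1 <> RtoC 0) by apply Cexp_neq_0.
  assert (HEi : Cexp (alpha * ln (1 + t))%C = (/ E 1)%C).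
  { unfold E. rewrite <- Cexp_opp. f_equal. rewrite Rmult_1_r. ring. }
  apply Ccv_S. apply Ccv_ext with (fun m => / E 1 * (E 1 * F (S m) 1))%C.
  - intros m. unfold F. rewrite Rmult_1_r. field. exact HEne.
  - rewrite HEi. apply Ccv_eq with (/ E 1 * 1)%C; [ring|]. apply Ccv_scal.
    apply Ccv_squeeze with (fun m => (2 * exp x) * (INR (S (S m)) * rb x (S m) * (1 / 2) ^ S m)).
    + exists O. intros n _. apply Hmain.
    + apply (Un_cv_scal0 _ (fun m => INR (S (S m)) * rb x (S m) * (1 / 2) ^ S m)).
      assert (H0 := Rbdd_terms_cv0 _ (fun j => Rmult_le_pos _ _ (Rmult_le_pos _ _ (pos_INR (S j)) (rb_nonneg x j Hx)) (pow_le (1 / 2) j ltac:(lra))) (rb_bdd x Hx)).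
      intros eps He. destruct (H0 eps He) as [n0 Hn]. exists n0. intros n Hle. apply (Hn (S n)). lia.
Qed.

(** * Analytic continuation of the zeta function *)

Lemma Re_add_INR s n : Re (s + INR n)%C = Re s + INR n.
Proof. rewrite re_plus. reflexivity. Qed.

(** The power (n + 1)^(-s), with the exponent in the form l s that [Wiener_exp] expects. *)
Definition dterm (s : C) (n : nat) : C := Cexp (RtoC (- ln (INR (S n))) * s)%C.

Definition dirichlet (s : C) : C := CSeries (dterm s).

Lemma Cpower_dterm s n : Cpower (INR (S n)) (- s)%C = dterm s n.
Proof. rewrite Cpower_INR by lia. unfold dterm. f_equal. rewrite RtoC_opp. ring. Qed.

Lemma Cmod_dterm s n : Cmod (dterm s n) = Rpower (INR (S n)) (- Re s).
Proof. unfold dterm, Rpower. rewrite Cmod_Cexp, re_scal_l. f_equal. ring. Qed.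

Lemma dirichlet_cv s : 1 < Re s -> Ccv (Csum (dterm s)) (dirichlet s).
Proof.
  intros Hs. apply CSeries_correct with (fun n => Rpower (INR (S n)) (- Re s)).
  - intros i. rewrite Cmod_dterm. lra.
  - apply Rbdd_power, Hs.
Qed.

(** The coefficient of (s + 2 i - 1) v^(-s-2i) in (v - 1/2)^(1-s) - (v + 1/2)^(1-s). A centred
    difference keeps only odd orders, and binom(1-s, 2i+1) is expressed through binom(1-s, 2i) so
    that the factor s + 2 i - 1, the one cancelling the pole of zeta(s + 2 i), splits off. *)
Definition qc (i : nat) (s : C) : C := ((/ 4) ^ i * bc (1 - s) (2 * i) / INR (S (2 * i)))%C.

Lemma qc_0 s : qc 0 s = RtoC 1.
Proof. unfold qc. simpl. change (INR 1) with 1. field. Qed.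

Lemma Csum_pairs f n : Csum (fun i => f (2 * i)%nat + f (S (2 * i)))%C n = Csum f (2 * n).
Proof.
  induction n; [reflexivity|]. rewrite Csum_S, IHn. replace (2 * S n)%nat with (S (S (2 * n))) by lia.
  rewrite !(Csum_S f). ring.
Qed.

Lemma Rsum_pairs f n : Rsum (fun i => f (2 * i)%nat + f (S (2 * i))) n = Rsum f (2 * n).
Proof.
  induction n; [reflexivity|]. rewrite Rsum_S, IHn. replace (2 * S n)%nat with (S (S (2 * n))) by lia.
  rewrite !(Rsum_S f). ring.
Qed.

Lemma Un_cv_Rpower_neg a : 0 < a -> Un_cv (fun n => Rpower (INR (S n)) (- a)) 0.
Proof.
  intros Ha eps He. destruct (INR_unbounded (exp (- ln eps / a))) as [n0 Hn0]. exists n0. intros n Hn.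
  unfold R_dist. rewrite Rminus_0_r, Rabs_right by (apply Rle_ge; left; apply exp_pos).
  unfold Rpower. rewrite <- (exp_ln eps He). apply exp_increasing.
  assert (H : - ln eps / a < ln (INR (S n))).
  { rewrite <- (ln_exp (- ln eps / a)). apply ln_increasing; [apply exp_pos|].
    assert (INR n0 <= INR (S n)) by (apply le_INR; lia). lra. }
  apply (Rmult_lt_compat_l a) in H; [|exact Ha]. replace (a * (- ln eps / a)) with (- ln eps) in H by (field; lra). lra.
Qed.

Lemma dterm_shift s n i : dterm (s + INR i)%C n = (dterm s n * (/ INR (S n)) ^ i)%C.
Proof.
  unfold dterm. rewrite Cmult_plus_distr_l, Cexp_plus. f_equal.
  rewrite Cmult_comm, Cexp_pow. f_equal. rewrite Cexp_RtoC, exp_Ropp, exp_ln by (apply lt_0_INR; lia).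
  rewrite RtoC_inv by (apply not_0_INR; lia). reflexivity.
Qed.

Lemma zeta_row s n :
  Ccv (Csum (fun i => qc i s * (s + INR (2 * i) - 1) * dterm (s + INR (2 * i)) n)%C)
    (Cexp ((1 - s) * ln (INR n + 1 / 2)) - Cexp ((1 - s) * ln (INR (S n) + 1 / 2)))%C.
Proof.
  set (v := INR (S n)). assert (Hv : 1 <= v) by (unfold v; rewrite S_INR; assert (H := pos_INR n); lra).
  assert (Hvn : RtoC v <> RtoC 0) by (apply RtoC_neq0; lra).
  (* For n = 0 the value t = 1/2 is attained, which is why [binomial_series] includes the
     endpoint. *)
  set (t := / (2 * v)). assert (Ht : 0 < t <= 1 / 2).
  { unfold t. split; [apply Rinv_0_lt_compat; lra|]. replace (1 / 2) with (/ 2) by field. apply Rinv_le_contravar; lra. }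
  set (al := (1 - s)%C).
  assert (B1 := binomial_series al (- t) ltac:(rewrite Rabs_left; lra)).
  assert (B2 := binomial_series al t ltac:(rewrite Rabs_right; lra)).
  assert (B := Ccv_scal (Cexp (al * ln v)) _ _ (Ccv_minus _ _ _ _ B1 B2)).
  assert (Hev : forall u : R, 0 < u -> (Cexp (al * ln v) * Cexp (al * ln u) = Cexp (al * ln (v * u)))%C).
  { intros u Hu. rewrite <- Cexp_plus. f_equal. rewrite ln_mult, RtoC_plus by lra. ring. }

  replace (Cexp (al * ln v) * (Cexp (al * ln (1 + - t)) - Cexp (al * ln (1 + t))))%C with
    (Cexp (al * ln (INR n + 1 / 2)) - Cexp (al * ln (v + 1 / 2)))%C in B.
  2: { transitivity (Cexp (al * ln v) * Cexp (al * ln (1 + - t)) - Cexp (al * ln v) * Cexp (al * ln (1 + t)))%C; [|ring].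
       rewrite !Hev by lra. unfold t. replace (v * (1 + - / (2 * v))) with (INR n + 1 / 2) by (unfold v; rewrite S_INR; field; unfold v in Hv; rewrite S_INR in Hv; lra).
       replace (v * (1 + / (2 * v))) with (v + 1 / 2) by (field; lra). reflexivity. }
  (* Even powers cancel between the series at -t and at t; passing to partial sums of even length
     lets [Csum_pairs] join each even index to the following odd one. *)
  assert (B' : Ccv (fun m => Csum (fun j => Cexp (al * ln v) * (bc al j * (RtoC (- t) ^ j - RtoC t ^ j)))%C (2 * m))
     (Cexp (al * ln (INR n + 1 / 2)) - Cexp (al * ln (v + 1 / 2)))%C).
  { intros eps He. destruct (B eps He) as [n0 Hn]. exists n0. intros m Hm. specialize (Hn (2 * m)%nat ltac:(lia)).
    replace (Csum (fun j => Cexp (al * ln v) * (bc al j * (RtoC (- t) ^ j - RtoC t ^ j)))%C (2 * m)) with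
     (Cexp (al * ln v) * (Csum (fun j => bc al j * RtoC (- t) ^ j) (2 * m) - Csum (fun j => bc al j * RtoC t ^ j) (2 * m)))%C; [exact Hn|].
    rewrite <- Csum_minus, <- Csum_scal. apply Csum_ext. intros; ring. }
  revert B'. apply Ccv_ext. intros m. rewrite <- Csum_pairs. apply Csum_ext. intros i _.
  assert (Hneg : forall j, (RtoC (- t) ^ j = RtoC (-1) ^ j * RtoC t ^ j)%C).
  { intros j. rewrite <- Cpow_mult_l. f_equal. rewrite <- RtoC_mult. f_equal. ring. }
  rewrite !Hneg. assert (Hm1 : (RtoC (-1) ^ (2 * i))%C = RtoC 1) by (rewrite <- RtoC_pow, pow_1_even; reflexivity).
  assert (Hhalf : ((/ 2) ^ (2 * i))%C = ((/ 4) ^ i)%C) by (rewrite Cpow_mult_r; f_equal; simpl; field).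
  rewrite dterm_shift. unfold qc. fold al. fold v.
  assert (Hal : Cexp (al * ln v) = (v * dterm s n)%C).
  { unfold dterm. fold v. rewrite <- (exp_ln v) at 2 by lra. rewrite <- Cexp_RtoC, <- Cexp_plus. f_equal. unfold al. rewrite RtoC_opp. ring. }
  rewrite Hal. replace (RtoC t) with (/ 2 * / v)%C by (unfold t; rewrite RtoC_inv, RtoC_mult by lra; field; exact Hvn).
  assert (HI := INR_S_neq0 (2 * i)). rewrite <- Hhalf. clear Hhalf. set (m' := (2 * i)%nat) in *. clearbody m'.
  change (RtoC (-1) ^ S m')%C with (RtoC (-1) * RtoC (-1) ^ m')%C.
  change (bc al (S m')) with (bc al m' * ((al - INR m') / INR (S m')))%C.
  change ((/ 2 * / v) ^ S m')%C with ((/ 2 * / v) * (/ 2 * / v) ^ m')%C.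
  rewrite Hm1, Cpow_mult_l. unfold al. set (w := ((/ v) ^ m')%C). set (h2 := ((/ 2) ^ m')%C).
  field. split; [exact HI | exact Hvn].
Qed.

(** The rows [zeta_row] are summed over n. The left ends telescope to (1/2)^(1-s) = 2^(s-1), since
    (n + 1/2)^(1-s) tends to 0 for Re s > 1, and the columns are Dirichlet series at s + 2 i. *)
Lemma zeta_recursion s : 1 < Re s ->
  Ccv (Csum (fun i => qc i s * ((s + INR (2 * i) - 1) * dirichlet (s + INR (2 * i))))%C) (Cexp ((s - 1) * ln 2)).
Proof.
  intros Hs. set (x := Cmod (1 - s)%C). assert (Hx : 0 <= x) by apply Cmod_ge_0.
  destruct (rb_bdd x Hx) as [B HB].
  set (f := fun j => INR (S j) * rb x j * (1 / 2) ^ j) in *.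
  assert (Hf : forall j, 0 <= f j).
  { intros j. unfold f. repeat apply Rmult_le_pos; [apply pos_INR | apply rb_nonneg, Hx | apply pow_le; lra]. }
  apply Csum_fubini with (u := fun n i => (qc i s * (s + INR (2 * i) - 1) * dterm (s + INR (2 * i)) n)%C)
    (g := fun n i => 2 * f (S (2 * i)) * Rpower (INR (S n)) (- Re s))
    (A := fun n => 2 * B * Rpower (INR (S n)) (- Re s))
    (r := fun n => (Cexp ((1 - s) * ln (INR n + 1 / 2)) - Cexp ((1 - s) * ln (INR (S n) + 1 / 2)))%C).
  - intros n i. rewrite dterm_shift, Cmult_assoc, Cmod_mult, Cmod_mult, Cmod_dterm.
    assert (Hp : 0 <= Rpower (INR (S n)) (- Re s)) by (left; apply exp_pos).
    assert (Hone : Cmod ((/ INR (S n)) ^ (2 * i))%C <= 1).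
    { rewrite Cmod_pow, Cmod_inv by apply INR_S_neq0. rewrite <- (pow1 (2 * i)). apply pow_incr.
      rewrite Cmod_R, Rabs_right by (apply Rle_ge, pos_INR). assert (H := pos_INR n). rewrite S_INR.
      split; [left; apply Rinv_0_lt_compat; lra|]. rewrite <- Rinv_1 at 2. apply Rinv_le_contravar; lra. }
    assert (Hone0 := Cmod_ge_0 ((/ INR (S n)) ^ (2 * i))%C).
    assert (Hq : Cmod (qc i s * (s + INR (2 * i) - 1))%C <= 2 * f (S (2 * i))).
    { replace (qc i s * (s + INR (2 * i) - 1))%C with (- (RtoC ((/ 4) ^ i) * bc (1 - s) (S (2 * i))))%C.
      - rewrite Cmod_opp, Cmod_mult, Cmod_R, Rabs_right by (apply Rle_ge, pow_le; lra).
        assert (Hb := Cmod_bc (1 - s) (S (2 * i))). fold x in Hb. unfold f.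
        change ((1 / 2) ^ S (2 * i)) with (1 / 2 * (1 / 2) ^ (2 * i)). rewrite (pow_mult (1 / 2) 2 i). replace ((1 / 2) ^ 2) with (/ 4) by field.
        assert (H4 : 0 <= (/ 4) ^ i) by (apply pow_le; lra).
        assert (HbC := Cmod_ge_0 (bc (1 - s) (S (2 * i)))).
        assert (HS : 1 <= INR (S (S (2 * i)))) by (rewrite (S_INR (S (2 * i))); assert (H := pos_INR (S (2 * i))); lra).
        apply Rle_trans with ((/ 4) ^ i * rb x (S (2 * i))); [apply Rmult_le_compat_l; assumption|].
        replace (2 * (INR (S (S (2 * i))) * rb x (S (2 * i)) * (1 / 2 * (/ 4) ^ i))) with
          (((/ 4) ^ i * rb x (S (2 * i))) * INR (S (S (2 * i)))) by field.
        rewrite <- (Rmult_1_r ((/ 4) ^ i * rb x (S (2 * i)))) at 1. apply Rmult_le_compat_l; [|exact HS].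
        apply Rmult_le_pos; [exact H4 | apply rb_nonneg, Hx].
      - unfold qc. change (bc (1 - s) (S (2 * i))) with (bc (1 - s) (2 * i) * ((1 - s - INR (2 * i)) / INR (S (2 * i))))%C. rewrite RtoC_pow, RtoC_inv by lra.
        assert (HI := INR_S_neq0 (2 * i)). field. exact HI. }
    assert (Hq0 := Cmod_ge_0 (qc i s * (s + INR (2 * i) - 1))%C).
    rewrite <- (Rmult_1_r (2 * f (S (2 * i)) * Rpower (INR (S n)) (- Re s))).
    apply Rmult_le_compat; [apply Rmult_le_pos; assumption | exact Hone0 | | exact Hone].
    apply Rmult_le_compat_r; assumption.
  - intros n m. rewrite (Rsum_ext _ (fun i => (2 * Rpower (INR (S n)) (- Re s)) * f (S (2 * i)))) by (intros; ring).
    rewrite Rsum_scal. replace (2 * B * Rpower (INR (S n)) (- Re s)) with (2 * Rpower (INR (S n)) (- Re s) * B) by ring.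
    apply Rmult_le_compat_l; [apply Rmult_le_pos; [lra | left; apply exp_pos]|].
    eapply Rle_trans; [|apply (HB (2 * m)%nat)]. rewrite <- Rsum_pairs. apply Rsum_le. intros i _.
    specialize (Hf (2 * i)%nat). lra.
  - apply Rbdd_scal; [|apply Rbdd_power, Hs]. specialize (HB O). simpl in HB. lra.
  - intros n. apply zeta_row.
  - intros i. apply Ccv_ext with (fun n => qc i s * (s + INR (2 * i) - 1) * Csum (dterm (s + INR (2 * i))) n)%C.
    + intros n. rewrite <- Csum_scal. reflexivity.
    + rewrite Cmult_assoc. apply Ccv_scal. apply dirichlet_cv. rewrite Re_add_INR. assert (H := pos_INR (2 * i)). lra.
  - apply Ccv_ext with (fun n => Cexp ((s - 1) * ln 2) - Cexp ((1 - s) * ln (INR n + 1 / 2)))%C.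
    + induction n.
      * simpl. change (INR 0) with 0. rewrite Rplus_0_l. unfold Rdiv. rewrite Rmult_1_l, ln_Rinv, RtoC_opp by lra.
        replace ((1 - s) * - ln 2)%C with ((s - 1) * ln 2)%C by ring. ring.
      * rewrite Csum_S, <- IHn. ring.
    + apply Ccv_eq with (Cexp ((s - 1) * ln 2) - 0)%C; [ring|]. apply Ccv_minus; [apply Ccv_const|].
      apply Ccv_S. apply Ccv_squeeze with (fun n => Rpower (INR (S n)) (- (Re s - 1))).
      * exists O. intros n _.
        replace (Cexp ((1 - s) * ln (INR (S n) + 1 / 2)) - 0)%C with (Cexp ((1 - s) * ln (INR (S n) + 1 / 2)))%C by ring.
        rewrite Cmod_Cexp. unfold Rpower. apply exp_mono. rewrite re_scal_r.
        replace (Re (1 - s)%C) with (- (Re s - 1)) by (unfold Cminus; rewrite re_plus, re_opp; simpl; ring).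
        assert (Hln : ln (INR (S n)) <= ln (INR (S n) + 1 / 2)) by (apply ln_le; [apply lt_0_INR; lia | lra]).
        nra.
      * apply Un_cv_Rpower_neg. lra.
Qed.

(* [Zf M] is [(s - 1) * zeta s], continued to the half-plane [1 - 2 * M < Re s]. *)
Fixpoint Zf (M : nat) (s : C) : C :=
  match M with
  | O => ((s - 1) * dirichlet s)%C
  | S M' => (Cexp ((s - 1) * ln 2) - CSeries (fun i => qc (S i) s * Zf M' (s + INR (2 * S i))))%C
  end.

(** For M = 0 this is [zeta_recursion] solved for its term i = 0. In the induction step the
    arguments s + 2 (i + 1) lie at least one level further to the right, where the hypothesis
    applies. *)
Lemma Zf_S M s : 1 - 2 * INR M < Re s -> Zf (S M) s = Zf M s.
Proof.
  revert s. induction M; intros s Hs.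
  - change (INR 0) with 0 in Hs. assert (H := zeta_recursion s ltac:(lra)).
    simpl. assert (H1 : Ccv (Csum (fun i => qc (S i) s * ((s + INR (2 * S i) - 1) * dirichlet (s + INR (2 * S i))))%C)
       (Cexp ((s - 1) * ln 2) - (s - 1) * dirichlet s)%C).
    { apply Ccv_S in H. apply Ccv_ext with (fun n => Csum (fun i => qc i s * ((s + INR (2 * i) - 1) * dirichlet (s + INR (2 * i))))%C (S n) - (s - 1) * dirichlet s)%C.
      - intros n. rewrite Csum_S_l. rewrite qc_0. change (INR (2 * 0)) with 0. replace (s + 0)%C with s by ring. ring.
      - apply Ccv_minus; [exact H | apply Ccv_const]. }
    replace (CSeries (fun i => _)) with (Cexp ((s - 1) * ln 2) - (s - 1) * dirichlet s)%C; [ring|].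
    symmetry. apply Ccv_CSeries. exact H1.
  - change (Zf (S (S M)) s) with (Cexp ((s - 1) * ln 2) - CSeries (fun i => qc (S i) s * Zf (S M) (s + INR (2 * S i))))%C.
    change (Zf (S M) s) with (Cexp ((s - 1) * ln 2) - CSeries (fun i => qc (S i) s * Zf M (s + INR (2 * S i))))%C.
    f_equal. f_equal. f_equal. apply functional_extensionality. intros i. rewrite IHM; [reflexivity|].
    rewrite S_INR in Hs. rewrite Re_add_INR, mult_INR, (S_INR i). assert (H := pos_INR i). change (INR 2) with 2. lra.
Qed.

Lemma Wiener_bc s0 r j : 0 < r -> Wiener s0 r (rb (Cmod (1 - s0)%C + r) j) (fun s => bc (1 - s) j).
Proof.
  intros Hr. induction j.
  - simpl. apply Wiener_le with (Cmod 1); [rewrite Cmod_1; lra|]. apply (Wiener_const _ _ 1). lra.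
  - simpl. apply Wiener_mult; [exact Hr | exact IHj|].
    apply Wiener_ext with (fun s => - / INR (S j) * (s + (INR j - 1)))%C.
    { intros h _. assert (H := INR_S_neq0 j). field. exact H. }
    assert (Hp : 0 < INR (S j)) by (apply lt_0_INR; lia).
    apply Wiener_le with (Cmod (- / INR (S j))%C * (Cmod (s0 + (INR j - 1))%C + r)).
    + rewrite Cmod_opp, Cmod_inv by apply INR_S_neq0. rewrite Cmod_R, Rabs_right by lra. unfold Rdiv. rewrite Rmult_comm.
      apply Rmult_le_compat_r; [left; apply Rinv_0_lt_compat, Hp|].
      replace (s0 + (INR j - 1))%C with (INR j - (1 - s0))%C by ring.
      assert (K := Cmod_minus_le (INR j) (1 - s0)%C). rewrite Cmod_R, (Rabs_right (INR j)) in K by (apply Rle_ge, pos_INR). lra.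
    + apply Wiener_scal, Wiener_affine. lra.
Qed.

Lemma Wiener_qc s0 r i : 0 < r -> Wiener s0 r ((1 / 2) ^ (2 * i) * rb (Cmod (1 - s0)%C + r) (2 * i)) (fun s => qc i s).
Proof.
  intros Hr. apply Wiener_ext with (fun s => ((/ 4) ^ i / INR (S (2 * i))) * bc (1 - s) (2 * i))%C.
  { intros h _. unfold qc. field. apply INR_S_neq0. }
  eapply Wiener_le; [|apply Wiener_scal, Wiener_bc, Hr].
  apply Rmult_le_compat_r; [apply rb_nonneg; assert (H := Cmod_ge_0 (1 - s0)%C); lra|].
  rewrite pow_mult. replace ((1 / 2) ^ 2) with (/ 4) by field.
  rewrite Cmod_div by apply INR_S_neq0. rewrite Cmod_pow, Cmod_inv by (apply RtoC_neq0; lra).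
  rewrite !Cmod_R, (Rabs_right 4), (Rabs_right (INR _)) by (try apply Rle_ge, pos_INR; lra).
  assert (H4 : 0 <= (/ 4) ^ i) by (apply pow_le; lra).
  unfold Rdiv. rewrite <- (Rmult_1_r ((/ 4) ^ i)) at 2. apply Rmult_le_compat_l; [exact H4|].
  rewrite <- Rinv_1. apply Rinv_le_contravar; [lra|]. rewrite S_INR. assert (H := pos_INR (2 * i)). lra.
Qed.

Lemma Wiener_dirichlet p r : 1 < p -> 0 < r -> exists B, 0 <= B /\ forall s0, p + r <= Re s0 -> Wiener s0 r B dirichlet.
Proof.
  intros Hp Hr. destruct (Rbdd_power p Hp) as [B HB]. exists B. split; [specialize (HB O); exact HB|].
  intros s0 Hs0. apply Wiener_sum with (A := fun n => Rpower (INR (S n)) (- p)) (F := fun n s => dterm s n); [exact Hr | | exact HB |].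
  - intros n. unfold dterm. eapply Wiener_le; [|apply Wiener_exp; lra]. unfold Rpower. apply exp_mono.
    assert (Hl : 0 <= ln (INR (S n))). { rewrite <- ln_1. apply ln_le; [lra|]. rewrite S_INR. assert (H := pos_INR n). lra. }
    rewrite Rabs_Ropp, Rabs_right by lra. nra.
  - intros h Hh. apply dirichlet_cv. rewrite re_plus. assert (K := re_le_Cmod h). apply Rabs_le_between in K. lra.
Qed.

(** All shifted centres s0 + 2 i are treated at once, with norms growing linearly in i because of
    the factor s - 1: this is what the next level needs in order to sum over i. At the shifts i >= 1
    the new level agrees with the old one, so only the centre s0 itself requires the series. *)
Lemma Wiener_Zf M : forall s0 r, 0 < r -> 1 - 2 * INR M < Re s0 - r ->
  exists A, 0 <= A /\ forall i, Wiener (s0 + INR (2 * i))%C r (A * INR (S i)) (Zf M).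
Proof.
  induction M; intros s0 r Hr Hs.
  - change (INR 0) with 0 in Hs. destruct (Wiener_dirichlet (Re s0 - r) r ltac:(lra) Hr) as [B [HB HW]].
    assert (Hc := Cmod_ge_0 (s0 + - (1))%C).
    exists ((Cmod (s0 + - (1))%C + r + 2) * B). split; [apply Rmult_le_pos; lra|]. intros i.
    assert (Hi := pos_INR (2 * i)). assert (Hi' := pos_INR i).
    apply Wiener_le with ((Cmod (s0 + INR (2 * i) + - (1))%C + r) * B).
    + rewrite (Rmult_assoc _ B), (Rmult_comm B), <- Rmult_assoc. apply Rmult_le_compat_r; [exact HB|].
      replace (s0 + INR (2 * i) + - (1))%C with ((s0 + - (1)) + INR (2 * i))%C by ring.
      assert (K := Cmod_triangle (s0 + - (1)) (INR (2 * i))). rewrite Cmod_R, (Rabs_right (INR (2 * i))) in K by lra.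
      rewrite mult_INR in *. change (INR 2) with 2 in *. rewrite S_INR. nra.
    + change (Zf 0) with (fun s => (s + - (1)) * dirichlet s)%C. apply Wiener_mult; [exact Hr | apply Wiener_affine; lra|].
      apply HW. rewrite Re_add_INR. lra.
  - rewrite S_INR in Hs.
    destruct (IHM (s0 + INR 2)%C r Hr) as [A [HA HW]]. { rewrite Re_add_INR. change (INR 2) with 2. lra. }
    set (x := Cmod (1 - s0)%C + r). assert (Hx : 0 <= x) by (unfold x; assert (H := Cmod_ge_0 (1 - s0)%C); lra).
    destruct (rb_bdd x Hx) as [B HB]. set (f := fun j => INR (S j) * rb x j * (1 / 2) ^ j) in *.
    assert (Hf : forall j, 0 <= f j).
    { intros j. unfold f. repeat apply Rmult_le_pos; [apply pos_INR | apply rb_nonneg, Hx | apply pow_le; lra]. }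
    assert (HB0 : 0 <= B) by (specialize (HB O); exact HB).
    set (F := fun i s => (qc (S i) s * Zf M (s + INR (2 * S i)))%C).
    set (a := fun i => (1 / 2) ^ (2 * S i) * rb x (2 * S i) * (A * INR (S i))).
    assert (HF : forall i, Wiener s0 r (a i) (F i)).
    { intros i. unfold F, a. apply Wiener_mult; [exact Hr | apply Wiener_qc, Hr|].
      apply Wiener_translate. replace (s0 + INR (2 * S i))%C with (s0 + INR 2 + INR (2 * i))%C; [apply HW|].
      replace (2 * S i)%nat with (2 + 2 * i)%nat by lia. rewrite plus_INR, RtoC_plus. ring. }
    assert (Ha : forall n, Rsum a n <= A * B).
    { intros n. apply Rle_trans with (Rsum (fun i => A * f (2 * S i)%nat) n).
      - apply Rsum_le. intros i _. unfold a, f.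
        replace (A * (INR (S (2 * S i)) * rb x (2 * S i) * (1 / 2) ^ (2 * S i))) with ((1 / 2) ^ (2 * S i) * rb x (2 * S i) * (A * INR (S (2 * S i)))) by ring.
        apply Rmult_le_compat_l; [apply Rmult_le_pos; [apply pow_le; lra | apply rb_nonneg, Hx]|].
        apply Rmult_le_compat_l; [exact HA|]. apply le_INR. lia.
      - rewrite Rsum_scal. apply Rmult_le_compat_l; [exact HA|]. eapply Rle_trans; [|apply (HB (2 * S n)%nat)].
        rewrite <- Rsum_pairs, Rsum_S_l. assert (H0 := Hf (2 * 0)%nat). assert (H1 := Hf (S (2 * 0))).
        assert (Rsum (fun i => f (2 * S i)%nat) n <= Rsum (fun i => f (2 * S i)%nat + f (S (2 * S i))) n); [|lra].
        apply Rsum_le. intros i _. assert (H2 := Hf (S (2 * S i))). lra. }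
    set (E0 := exp (Rabs (ln 2) * (Cmod s0 + 1 + r))).
    (* E0 bounds 2^(s-1), A B bounds the series at the centre s0, and A covers the shifted
       centres. *)
    exists (E0 + A * B + A). assert (HE0 : 0 < E0) by apply exp_pos.
    assert (HAB : 0 <= A * B) by (apply Rmult_le_pos; assumption).
    split; [lra|]. intros i. destruct i as [|i].
    + change (INR (2 * 0)) with 0. change (INR 1) with 1. replace (s0 + 0)%C with s0 by ring.
      apply Wiener_le with (E0 + Cmod (RtoC (-1)) * (A * B)).
      { rewrite Cmod_R, Rabs_left by lra. lra. }
      apply Wiener_ext with (fun s => Cexp ((s - 1) * ln 2) + RtoC (-1) * CSeries (fun i => F i s))%C.
      { intros h _. change (Zf (S M) (s0 + h)%C) with (Cexp ((s0 + h - 1) * ln 2) - CSeries (fun i => F i (s0 + h)))%C. ring. }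
      apply Wiener_plus; [lra | |].
      * apply Wiener_ext with (fun s => Cexp (ln 2 * (s + - (1))))%C; [intros; f_equal; ring|].
        apply (Wiener_translate (- (1))%C s0 r _ (fun s => Cexp (ln 2 * s)%C)).
        eapply Wiener_le; [|apply Wiener_exp; lra]. unfold E0. apply exp_mono.
        assert (K := re_le_Cmod (s0 + - (1))%C). assert (K2 := Cmod_triangle s0 (- (1))). rewrite Cmod_opp, Cmod_1 in K2.
        assert (Hl := Rabs_pos (ln 2)). assert (Hr1 := Rle_abs (ln 2 * Re (s0 + - (1))%C)). rewrite Rabs_mult in Hr1. nra.
      * apply Wiener_scal. apply Wiener_sum with (A := a) (F := F); [exact Hr | exact HF | exact Ha |].
        intros h Hh. apply CSeries_correct with a; [|exists (A * B); exact Ha].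
        intros i. apply (Wiener_bound s0 r); [exact Hh | apply HF].
    + apply Wiener_ext with (Zf M).
      * intros h Hh. symmetry. apply Zf_S. assert (K := re_le_Cmod h). apply Rabs_le_between in K.
        rewrite re_plus, Re_add_INR, mult_INR, (S_INR i). change (INR 2) with 2. assert (H := pos_INR i). lra.
      * replace (s0 + INR (2 * S i))%C with (s0 + INR 2 + INR (2 * i))%C.
        2: { replace (2 * S i)%nat with (2 + 2 * i)%nat by lia. rewrite plus_INR, RtoC_plus. ring. }
        eapply Wiener_le; [|apply HW]. rewrite (S_INR (S i)). assert (H := pos_INR (S i)). nra.
Qed.

Lemma Zf_add M k s : 1 - 2 * INR M < Re s -> Zf (M + k) s = Zf M s.
Proof.
  intros Hs. induction k; [rewrite Nat.add_0_r; reflexivity|].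
  rewrite Nat.add_succ_r, Zf_S; [exact IHk|]. rewrite plus_INR. assert (H := pos_INR k). lra.
Qed.

(** Any M with 1 - 2 M < Re s serves equally well: by [Zcont_eq] the value of [Zcont] does not
    depend on the choice made here. *)
Definition level (s : C) : nat :=
  proj1_sig (constructive_indefinite_description _ (INR_unbounded (1 - Re s))).

Lemma level_spec s : 1 - 2 * INR (level s) < Re s.
Proof.
  unfold level. destruct (constructive_indefinite_description _ _) as [n Hn]. simpl.
  assert (H := pos_INR n). lra.
Qed.

Definition Zcont (s : C) : C := Zf (level s) s.

Lemma Zcont_eq M s : 1 - 2 * INR M < Re s -> Zcont s = Zf M s.
Proof.
  intros H. unfold Zcont. assert (H1 := level_spec s).
  destruct (Nat.le_ge_cases M (level s)) as [Hl|Hl].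
  - replace (level s) with (M + (level s - M))%nat by lia. apply Zf_add, H.
  - replace M with (level s + (M - level s))%nat by lia. symmetry. apply Zf_add, H1.
Qed.

Lemma Zcont_recursion s :
  Zcont s = (Cexp ((s - 1) * ln 2) - CSeries (fun i => qc (S i) s * Zcont (s + INR (2 * S i))))%C.
Proof.
  assert (H := level_spec s). set (M := level s) in *.
  rewrite (Zcont_eq (S M)) by (rewrite S_INR; lra). simpl Zf. f_equal. f_equal. f_equal.
  apply functional_extensionality. intros i. f_equal. symmetry. apply Zcont_eq.
  change (S (i + S (i + 0)))%nat with (2 * S i)%nat. rewrite Re_add_INR. assert (K := pos_INR (2 * S i)). lra.
Qed.

Lemma Zcont_dirichlet s : 1 < Re s -> Zcont s = ((s - 1) * dirichlet s)%C.
Proof. intros H. rewrite (Zcont_eq 0); [reflexivity|]. change (INR 0) with 0. lra. Qed.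

Definition zeta0 (s : C) : C := (Zcont s * / (s - 1))%C.

Lemma Cminus_neq0 (a b : C) : a <> b -> (a - b)%C <> RtoC 0.
Proof. intros H E. apply H. transitivity (a - b + b)%C; [ring | rewrite E; ring]. Qed.

Lemma zeta0_dirichlet s : 1 < Re s -> zeta0 s = dirichlet s.
Proof.
  intros H. unfold zeta0. rewrite Zcont_dirichlet by exact H. field. apply Cminus_neq0.
  intros ->. simpl in H. lra.
Qed.

Lemma Wiener_zeta0 s : s <> RtoC 1 -> exists r A, 0 < r /\ Wiener s r A zeta0.
Proof.
  intros Hs. assert (Hm : 0 < Cmod (s - 1)%C) by (apply Cmod_gt_0, Cminus_neq0, Hs).
  set (r := Rmin 1 (Cmod (s - 1)%C / 2)).
  assert (Hr : 0 < r) by (apply Rmin_glb_lt; lra).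
  destruct (INR_unbounded (1 - Re s + r)) as [M HM].
  assert (HM0 := pos_INR M).
  destruct (Wiener_Zf M s r Hr ltac:(lra)) as [A [HA HW]]. specialize (HW O).
  change (INR (2 * 0)) with 0 in HW. replace (s + 0)%C with s in HW by ring.
  destruct (Wiener_inv s r (RtoC 1)) as [B HB]; [lra | | exact Hs|].
  { unfold r. assert (K := Rmin_r 1 (Cmod (s - 1)%C / 2)). lra. }
  exists r, (A * INR 1 * B). split; [exact Hr|]. unfold zeta0.
  apply Wiener_mult; [exact Hr | | exact HB].
  apply Wiener_ext with (2 := HW). intros h Hh. symmetry. apply Zcont_eq.
  rewrite re_plus. assert (K := re_le_Cmod h). apply Rabs_le_between in K. lra.
Qed.

Lemma zeta0_spec : is_riemann_zeta zeta0.
Proof.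
  split.
  - intros s Hs. destruct (Wiener_zeta0 s Hs) as [r [A [Hr HW]]]. apply Wiener_analytic with r A; assumption.
  - intros s Hs. apply Ccv_is_series. rewrite zeta0_dirichlet by exact Hs.
    apply Ccv_ext with (Csum (dterm s)); [|apply dirichlet_cv, Hs].
    intros n. apply Csum_ext. intros. symmetry. apply Cpower_dterm.
Qed.

Lemma zeta_spec : is_riemann_zeta zeta.
Proof. unfold zeta. apply epsilon_spec. exists zeta0. exact zeta0_spec. Qed.

Lemma zeta_dirichlet s : 1 < Re s -> zeta s = dirichlet s.
Proof.
  intros Hs. apply Ccv_unique with (Csum (fun n => Cpower (INR (S n)) (- s)%C)).
  - apply Ccv_is_series, zeta_spec, Hs.
  - apply Ccv_ext with (Csum (dterm s)); [|apply dirichlet_cv, Hs].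
    intros n. apply Csum_ext. intros. symmetry. apply Cpower_dterm.
Qed.

Lemma zeta_real_cv p : 1 < p -> Ccv (Csum (fun n => RtoC (Rpower (INR (S n)) (- p)))) (zeta (RtoC p)).
Proof.
  intros Hp. rewrite zeta_dirichlet by exact Hp.
  apply Ccv_ext with (Csum (dterm (RtoC p))); [|apply dirichlet_cv; exact Hp].
  intros n. apply Csum_ext. intros i _. unfold dterm, Rpower. rewrite <- RtoC_mult, Cexp_RtoC. f_equal. f_equal. ring.
Qed.

Lemma Wiener_shrink s r r' A f : 0 <= r' <= r -> Wiener s r A f -> Wiener s r' A f.
Proof.
  intros Hr [a [H1 H2]]. exists a. split.
  - intros n. eapply Rle_trans; [|apply (H1 n)]. apply Rsum_le. intros. apply Rmult_le_compat_l; [apply Cmod_ge_0|].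
    apply pow_incr. exact Hr.
  - intros h Hh. apply H2. lra.
Qed.

Lemma analytic_at_minus f g s : analytic_at f s -> analytic_at g s -> analytic_at (fun z => f z - g z)%C s.
Proof.
  intros Hf Hg. destruct (analytic_Wiener _ _ Hf) as [r1 [A1 [Hr1 W1]]]. destruct (analytic_Wiener _ _ Hg) as [r2 [A2 [Hr2 W2]]].
  set (r := Rmin r1 r2). assert (Hr : 0 < r) by (apply Rmin_glb_lt; assumption).
  apply Wiener_analytic with r (A1 + Cmod (RtoC (-1)) * A2); [exact Hr|].
  apply Wiener_ext with (fun z => f z + RtoC (-1) * g z)%C; [intros; ring|].
  apply Wiener_plus; [lra | |].
  - apply Wiener_shrink with (2 := W1). split; [lra | apply Rmin_l].
  - apply Wiener_scal, Wiener_shrink with (2 := W2). split; [lra | apply Rmin_r].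
Qed.

(** Both continuations agree with the Dirichlet series near 2 + 2 i. The segment from there to x
    meets the real axis only at its endpoint x < 1, hence avoids the point 1 where [zeta] is
    unspecified. *)
Lemma zeta_eq_zeta0 (x : R) : x < 1 -> zeta (RtoC x) = zeta0 (RtoC x).
Proof.
  intros Hx. set (p := (2, 2) : C). set (f := fun z => (zeta z - zeta0 z)%C).
  assert (H : f (RtoC x) = RtoC 0).
  { apply identity_segment with p.
    - intros t Ht. assert (Hne : (p + t * (RtoC x - p))%C <> RtoC 1).
      { intros E. assert (Him := f_equal Im E). assert (Hre := f_equal Re E).
        unfold p in Him, Hre. simpl in Him, Hre. assert (t = 1) by lra. subst. lra. }
      apply analytic_at_minus; [apply zeta_spec, Hne | apply zeta0_spec, Hne].
    - exists 1. split; [lra|]. intros h Hh. unfold f.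
      assert (Hr : 1 < Re (p + h)%C).
      { rewrite re_plus. unfold p. simpl. assert (K := re_le_Cmod h). apply Rabs_le_between in K. simpl in K. lra. }
      rewrite zeta_dirichlet, zeta0_dirichlet by exact Hr. ring. }
  unfold f in H. transitivity (zeta (RtoC x) - zeta0 (RtoC x) + zeta0 (RtoC x))%C; [ring | rewrite H; ring].
Qed.

(** * Zeta values at the nonpositive integers *)

Lemma bin_fact a b : bin (a + b) a * INR (fact a) * INR (fact b) = INR (fact (a + b)).
Proof.
  revert b. induction a; intros b.
  - simpl. rewrite bin_0_r. change (INR 1) with 1. ring.
  - induction b.
    + rewrite Nat.add_0_r, bin_diag. change (INR (fact 0)) with 1. ring.
    + change (S a + S b)%nat with (S (a + S b)). change (bin (S (a + S b)) (S a)) with (bin (a + S b) a + bin (a + S b) (S a)).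
      assert (H1 := IHa (S b)). replace (a + S b)%nat with (S a + b)%nat in * by lia.
      change (fact (S (S a + b))) with (S (S a + b) * fact (S a + b))%nat.
      change (fact (S a)) with (S a * fact a)%nat in *. change (fact (S b)) with (S b * fact b)%nat in *.
      rewrite !mult_INR in *. rewrite (S_INR (S a + b)), plus_INR.
      transitivity (INR (S a) * (bin (S a + b) a * INR (fact a) * (INR (S b) * INR (fact b)))
         + INR (S b) * (bin (S a + b) (S a) * (INR (S a) * INR (fact a)) * INR (fact b))); [ring|].
      rewrite H1, IHb. rewrite (S_INR b). ring.
Qed.

Lemma bin_sym a b : bin (a + b) a = bin (a + b) b.
Proof.
  assert (H1 := bin_fact a b). assert (H2 := bin_fact b a). rewrite (Nat.add_comm b a) in H2.
  assert (Ha := INR_fact_lt_0 a). assert (Hb := INR_fact_lt_0 b).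
  apply Rmult_eq_reg_r with (INR (fact a) * INR (fact b)); [|apply Rgt_not_eq, Rmult_lt_0_compat; assumption]. lra.
Qed.

Lemma bin_tri i n k : bin (i + n) (i + k) * bin (i + k) i = bin (i + n) i * bin n k.
Proof.
  destruct (le_lt_dec k n) as [H|H]; [|rewrite (bin_gt n k), (bin_gt (i + n)) by lia; ring].
  replace n with (k + (n - k))%nat by lia. set (r := (n - k)%nat).
  assert (E1 := bin_fact (i + k) r). assert (E2 := bin_fact i k). assert (E3 := bin_fact i (k + r)). assert (E4 := bin_fact k r).
  rewrite <- Nat.add_assoc in E1.
  assert (F1 := INR_fact_lt_0 i). assert (F2 := INR_fact_lt_0 k). assert (F3 := INR_fact_lt_0 r).
  assert (F4 := INR_fact_lt_0 (i + k)). assert (F5 := INR_fact_lt_0 (k + r)).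
  apply Rmult_eq_reg_r with (INR (fact i) * INR (fact k) * INR (fact r)); [|apply Rgt_not_eq; repeat apply Rmult_lt_0_compat; assumption].
  transitivity (bin (i + (k + r)) (i + k) * (bin (i + k) i * INR (fact i) * INR (fact k)) * INR (fact r)); [ring|].
  rewrite E2, E1. transitivity (bin (i + (k + r)) i * INR (fact i) * (bin (k + r) k * INR (fact k) * INR (fact r))); [|ring].
  rewrite E4, E3. reflexivity.
Qed.

Lemma bin_step q j : INR (S j) * bin q (S j) = (INR q - INR j) * bin q j.
Proof.
  destruct (le_lt_dec j q) as [H|H].
  2: { rewrite !bin_gt by lia. ring. }
  destruct (Nat.eq_dec j q) as [->|Hne]; [rewrite bin_gt by lia; ring|].
  replace q with (S j + (q - S j))%nat by lia. set (r := (q - S j)%nat).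
  assert (E1 := bin_fact (S j) r). assert (E2 := bin_fact j (S r)).
  replace (j + S r)%nat with (S j + r)%nat in E2 by lia. rewrite <- E2 in E1.
  change (fact (S j)) with (S j * fact j)%nat in E1. change (fact (S r)) with (S r * fact r)%nat in E1.
  rewrite !mult_INR in E1.
  assert (F1 := INR_fact_lt_0 j). assert (F2 := INR_fact_lt_0 r).
  apply Rmult_eq_reg_r with (INR (fact j) * INR (fact r)); [|apply Rgt_not_eq, Rmult_lt_0_compat; assumption].
  transitivity (bin (S j + r) (S j) * (INR (S j) * INR (fact j)) * INR (fact r)); [ring|]. rewrite E1.
  rewrite plus_INR, !S_INR. ring.
Qed.

Lemma bc_INR q j : bc (RtoC (INR q)) j = RtoC (bin q j).
Proof.
  induction j; [rewrite bin_0_r; reflexivity|].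
  simpl bc. rewrite IHj. assert (H := bin_step q j). assert (Hn := INR_S_neq0 j).
  assert (E : bin q (S j) = bin q j * ((INR q - INR j) / INR (S j))).
  { apply Rmult_eq_reg_l with (INR (S j)); [|apply not_0_INR; lia]. rewrite H. field. apply not_0_INR. lia. }
  rewrite E, RtoC_mult, RtoC_div, RtoC_minus by (apply not_0_INR; lia). reflexivity.
Qed.

Lemma binomial_bin x n : (1 + x) ^ n = Rsum (fun i => bin n i * x ^ i) (S n).
Proof.
  induction n.
  - simpl. ring.
  - rewrite (Rsum_S_l (fun i => bin (S n) i * x ^ i)). change (bin (S n) 0) with 1.
    rewrite (Rsum_ext _ (fun i => x * (bin n i * x ^ i) + bin n (S i) * x ^ S i)) by (intros; simpl; ring).
    rewrite Rsum_plus, Rsum_scal, <- IHn.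
    assert (E := Rsum_S_l (fun i => bin n i * x ^ i) (S n)). cbv beta in E. rewrite bin_0_r in E.
    rewrite Rsum_S, (bin_gt n (S n)), <- IHn in E by lia. simpl. simpl in E. lra.
Qed.

Lemma Rsum_rev f n : Rsum f n = Rsum (fun i => f (n - 1 - i)%nat) n.
Proof.
  induction n; [reflexivity|].
  rewrite Rsum_S, (Rsum_S_l (fun i => f (S n - 1 - i)%nat)). replace (S n - 1 - 0)%nat with n by lia.
  rewrite IHn. rewrite Rplus_comm. f_equal. apply Rsum_ext. intros i Hi. f_equal. lia.
Qed.

Lemma bernoulli_sum_rev n : Rsum (fun k => bin n (S k) * bernoulli (n - 1 - k)) n = if (n =? 1)%nat then 1 else 0.
Proof.
  rewrite Rsum_rev.
  rewrite (Rsum_ext _ (fun j => bin n j * bernoulli j)).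
  - destruct n as [|[|n]]; [reflexivity | simpl; unfold bernoulli; simpl; ring | apply bernoulli_sum].
  - intros i Hi. replace (n - 1 - (n - 1 - i))%nat with i by lia. f_equal.
    replace n with (i + (n - i))%nat by lia. rewrite (bin_sym i (n - i)). f_equal. lia.
Qed.

(* The identity [int_x^(x+1) B_q(u) du = x^q] between Bernoulli polynomials. *)
Lemma bernoulli_poly_integral q x :
  Rsum (fun m => bin q m * bernoulli (q - m) * (((1 + x) ^ S m - x ^ S m) / INR (S m))) (S q) = x ^ q.
Proof.
  set (e := fun m i => if (i <=? m)%nat then bin (S m) i * x ^ i else 0).
  assert (He : forall m, (m < S q)%nat -> (1 + x) ^ S m - x ^ S m = Rsum (e m) (S q)).
  { intros m Hm. rewrite binomial_bin, Rsum_S, bin_diag. replace (S q) with (S m + (q - m))%nat by lia.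
    rewrite Rsum_app, (Rsum_ext (fun i => e m (S m + i)%nat) (fun _ => 0 * 0)).
    - rewrite Rsum_scal. rewrite (Rsum_ext (e m) (fun i => bin (S m) i * x ^ i)); [ring|].
      intros i Hi. unfold e. destruct (Nat.leb_spec i m); [reflexivity | lia].
    - intros i _. unfold e. destruct (Nat.leb_spec (S m + i) m); [lia | ring]. }
  rewrite (Rsum_ext _ (fun m => Rsum (fun i => (bin q m * bernoulli (q - m) / INR (S m)) * e m i) (S q))).
  2: { intros m Hm. rewrite Rsum_scal, <- He by exact Hm. unfold Rdiv. ring. }
  rewrite Rsum_swap.
  (* After the exchange of sums, the coefficient of x^i is a multiple of the Bernoulli recurrence
     for n = q + 1 - i, which vanishes unless n = 1; only x^q remains. *)
  rewrite (Rsum_ext _ (fun i => (bin (S q) i * x ^ i / INR (S q)) * (if (S q - i =? 1)%nat then 1 else 0))).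
  - rewrite Rsum_S. replace (S q - q =? 1)%nat with true by (symmetry; apply Nat.eqb_eq; lia).
    rewrite (Rsum_ext _ (fun _ => 0 * 0)).
    + rewrite Rsum_scal. assert (E := bin_sym 1 q). change (1 + q)%nat with (S q) in E. rewrite <- E.
      assert (E1 := bin_step (S q) 0). rewrite bin_0_r in E1. change (INR 1) with 1 in E1. change (INR 0) with 0 in E1.
      replace (bin (S q) 1) with (INR (S q)) by lra. field. apply not_0_INR. lia.
    + intros i Hi. destruct (Nat.eqb_spec (S q - i) 1); [lia | ring].
  - intros i Hi. set (n := (S q - i)%nat). rewrite <- bernoulli_sum_rev.
    replace (S q) with (i + n)%nat at 1 by (unfold n; lia). rewrite Rsum_app.
    rewrite (Rsum_ext (fun j => (bin q j * bernoulli (q - j) / INR (S j)) * e j i) (fun _ => 0 * 0)).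
    2: { intros j Hj. unfold e. destruct (Nat.leb_spec i j); [lia | ring]. }
    rewrite Rsum_scal, Rmult_0_l, Rplus_0_l, <- Rsum_scal. apply Rsum_ext. intros k Hk.
    unfold e. destruct (Nat.leb_spec i (i + k)); [|lia].
    replace (q - (i + k))%nat with (n - 1 - k)%nat by (unfold n; lia).
    assert (T := bin_tri i n (S k)). replace (i + n)%nat with (S q) in T by (unfold n; lia).
    replace (i + S k)%nat with (S (i + k)) in T by lia.
    assert (Ab := bin_absorb q (i + k)).
    assert (H1 : INR (S q) <> 0) by (apply not_0_INR; lia). assert (H2 : INR (S (i + k)) <> 0) by (apply not_0_INR; lia).
    replace (bin q (i + k)) with (INR (S (i + k)) * bin (S q) (S (i + k)) / INR (S q)) by (rewrite <- Ab; field; exact H1).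
    transitivity (bernoulli (n - 1 - k) * x ^ i / INR (S q) * (bin (S q) (S (i + k)) * bin (S (i + k)) i)); [field; auto|].
    rewrite T. field. exact H1.
Qed.

(** At x = -1/2 the identity [bernoulli_poly_integral] loses its odd indices m, because (1/2)^(m+1)
    = (-1/2)^(m+1) there. What is left has the coefficients [qc] at s = 1 - q. *)
Lemma bernoulli_central q :
  Rsum (fun i => (/ 4) ^ i * bin q (2 * i) / INR (S (2 * i)) * bernoulli (q - 2 * i)) (S q) = (- / 2) ^ q.
Proof.
  rewrite <- (bernoulli_poly_integral q (- / 2)).
  set (f := fun m => bin q m * bernoulli (q - m) * (((1 + - / 2) ^ S m - (- / 2) ^ S m) / INR (S m))).
  assert (Hf : forall k, Rsum f (S q + k) = Rsum f (S q)).
  { intros k. rewrite Rsum_app, (Rsum_ext (fun i => f (S q + i)%nat) (fun _ => 0 * 0)); [rewrite Rsum_scal; ring|].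
    intros i _. unfold f. rewrite bin_gt by lia. ring. }
  rewrite <- (Hf (S q)). replace (S q + S q)%nat with (2 * S q)%nat by lia. rewrite <- Rsum_pairs.
  apply Rsum_ext. intros i _. unfold f.
  assert (Hn : forall m, (- / 2) ^ m = (-1) ^ m * (/ 2) ^ m) by (intros m; rewrite <- Rpow_mult_distr; f_equal; ring).
  rewrite !Hn. replace (1 + - / 2) with (/ 2) by field.
  assert (Hm1 : (-1) ^ (2 * i) = 1) by apply pow_1_even.
  assert (H4 : (/ 2) ^ (2 * i) = (/ 4) ^ i) by (rewrite pow_mult; f_equal; field).
  assert (H1 : INR (S (2 * i)) <> 0) by (apply not_0_INR; lia). assert (H2 : INR (S (S (2 * i))) <> 0) by (apply not_0_INR; lia).
  set (m := (2 * i)%nat) in *. clearbody m.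
  change ((-1) ^ S (S m)) with (-1 * (-1 * (-1) ^ m)). change ((-1) ^ S m) with (-1 * (-1) ^ m).
  change ((/ 2) ^ S (S m)) with (/ 2 * (/ 2 * (/ 2) ^ m)). change ((/ 2) ^ S m) with (/ 2 * (/ 2) ^ m).
  rewrite Hm1, H4. field. auto.
Qed.

Lemma bernoulli_central_sign q :
  Rsum (fun i => (/ 4) ^ i * bin q (2 * i) / INR (S (2 * i)) * ((-1) ^ (q - 2 * i) * bernoulli (q - 2 * i))) (S q) = (/ 2) ^ q.
Proof.
  rewrite (Rsum_ext _ (fun i => (-1) ^ q * ((/ 4) ^ i * bin q (2 * i) / INR (S (2 * i)) * bernoulli (q - 2 * i)))).
  - rewrite Rsum_scal, bernoulli_central, <- Rpow_mult_distr. f_equal. ring.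
  - intros i _. destruct (le_lt_dec (2 * i) q) as [H|H].
    + replace ((-1) ^ q) with ((-1) ^ (q - 2 * i)); [ring|].
      replace q with ((q - 2 * i) + 2 * i)%nat at 2 by lia. rewrite pow_add, pow_1_even. ring.
    + rewrite bin_gt by exact H. unfold Rdiv. ring.
Qed.

(** In [bernoulli_central_sign] with q = 2 n + 3 the intermediate odd indices vanish by induction,
    and the term with B_1 = -1/2 already equals the right side (1/2)^q; so B_q must be 0. *)
Lemma bernoulli_odd n : bernoulli (S (2 * S n)) = 0.
Proof.
  induction n as [n IH] using lt_wf_ind.
  assert (H := bernoulli_central_sign (S (2 * S n))). set (q := S (2 * S n)) in *.
  set (f := fun i => (/ 4) ^ i * bin q (2 * i) / INR (S (2 * i)) * ((-1) ^ (q - 2 * i) * bernoulli (q - 2 * i))) in *.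
  assert (E : Rsum f (S q) = f O + f (S n)).
  { replace (S q) with (S (S n) + (S q - S (S n)))%nat by (unfold q; lia).
    rewrite Rsum_app, (Rsum_ext (fun i => f (S (S n) + i)%nat) (fun _ => 0 * 0)).
    - rewrite Rsum_scal, Rsum_S, Rsum_S_l, (Rsum_ext (fun i => f (S i)) (fun _ => 0 * 0)).
      + rewrite Rsum_scal. ring.
      + intros i Hi. unfold f. replace (q - 2 * S i)%nat with (S (2 * S (n - S i))) by (unfold q; lia).
        rewrite IH by lia. ring.
    - intros i _. unfold f. rewrite bin_gt by (unfold q; lia). unfold Rdiv. ring. }
  rewrite E in H. unfold f in H. replace (2 * 0)%nat with O in H by reflexivity.
  rewrite bin_0_r, Nat.sub_0_r in H. change (INR 1) with 1 in H.
  replace (q - 2 * S n)%nat with 1%nat in H by (unfold q; lia).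
  assert (Hb : bin q (2 * S n) = INR (S (2 * S n))).
  { unfold q. assert (Hs := bin_sym 1 (2 * S n)). change (1 + 2 * S n)%nat with (S (2 * S n)) in Hs. rewrite <- Hs.
    assert (E1 := bin_step (S (2 * S n)) 0). rewrite bin_0_r in E1. change (INR 1) with 1 in E1. change (INR 0) with 0 in E1. lra. }
  rewrite Hb in H.
  assert (B1 : bernoulli 1 = - / 2).
  { assert (K := bernoulli_sum 0). rewrite !Rsum_S in K. simpl bin in K. change (bernoulli 0) with 1 in K. simpl Rsum in K. lra. }
  rewrite B1 in H.
  assert (H2 : (/ 2) ^ q = / 2 * (/ 4) ^ S n) by (unfold q; rewrite <- tech_pow_Rmult, pow_mult; f_equal; f_equal; field).
  rewrite H2 in H. assert (HI : INR (S (2 * S n)) <> 0) by (apply not_0_INR; lia).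
  replace ((/ 4) ^ S n * INR (S (2 * S n)) / INR (S (2 * S n)) * ((-1) ^ 1 * - / 2)) with (/ 2 * (/ 4) ^ S n) in H by (simpl; field; exact HI).
  assert (H3 : (-1) ^ q * bernoulli q = 0) by (simpl ((/ 4) ^ 0) in H; lra).
  apply Rmult_integral in H3. destruct H3 as [H3|H3]; [|exact H3]. exfalso. revert H3. apply pow_nonzero. lra.
Qed.

(** At s = 1 - q the coefficients [qc] contain ordinary binomial coefficients, so the series in the
    recursion is finite, and the recursion becomes [bernoulli_central_sign]. The value q = 0 gives
    the residue 1 of zeta. *)
Lemma Zcont_value q : Zcont (1 - INR q)%C = RtoC ((-1) ^ q * bernoulli q).
Proof.
  induction q as [q IH] using lt_wf_ind. rewrite Zcont_recursion.
  set (g := fun i => (/ 4) ^ i * bin q (2 * i) / INR (S (2 * i)) * ((-1) ^ (q - 2 * i) * bernoulli (q - 2 * i))).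
  assert (Hqc : forall i, qc i (1 - INR q)%C = RtoC ((/ 4) ^ i * bin q (2 * i) / INR (S (2 * i)))).
  { intros i. unfold qc. replace (1 - (1 - INR q))%C with (RtoC (INR q)) by ring. rewrite bc_INR.
    rewrite RtoC_div, RtoC_mult, RtoC_pow, RtoC_inv by (try (apply not_0_INR; lia); lra). reflexivity. }
  assert (Hs : CSeries (fun i => qc (S i) (1 - INR q) * Zcont (1 - INR q + INR (2 * S i)))%C = RtoC (Rsum (fun i => g (S i)) q)).
  { apply Ccv_CSeries. rewrite RtoC_Rsum.
    rewrite <- (Csum_ext (fun i => qc (S i) (1 - INR q) * Zcont (1 - INR q + INR (2 * S i)))%C).
    - apply Csum_head. intros j Hj. rewrite Hqc, bin_gt by lia. unfold Rdiv. rewrite Rmult_0_r, Rmult_0_l. ring.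
    - intros i Hi. rewrite Hqc. unfold g. destruct (le_lt_dec (2 * S i) q) as [H|H].
      + replace (1 - INR q + INR (2 * S i))%C with (1 - INR (q - 2 * S i))%C by (rewrite minus_INR, RtoC_minus by exact H; ring).
        rewrite IH by lia. rewrite <- RtoC_mult. reflexivity.
      + rewrite bin_gt by exact H. unfold Rdiv. rewrite Rmult_0_r, !Rmult_0_l. ring. }
  rewrite Hs. replace (Cexp ((1 - INR q - 1) * ln 2)) with (RtoC ((/ 2) ^ q)).
  - rewrite <- RtoC_minus. f_equal. assert (H := bernoulli_central_sign q). fold g in H. rewrite Rsum_S_l in H.
    assert (G0 : g O = (-1) ^ q * bernoulli q).
    { unfold g. change (2 * 0)%nat with O. rewrite bin_0_r, Nat.sub_0_r. change (INR 1) with 1. rewrite pow_O. field. }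
    lra.
  - replace ((1 - INR q - 1) * ln 2)%C with (INR q * RtoC (- ln 2))%C by (rewrite RtoC_opp; ring).
    rewrite Cexp_pow, Cexp_RtoC, exp_Ropp, exp_ln by lra. apply RtoC_pow.
Qed.

Lemma zeta_nonpos q : (1 <= q)%nat -> zeta (1 - INR q)%C = RtoC (dcoef q).
Proof.
  intros Hq. assert (Hp : 0 < INR q) by (apply lt_0_INR; lia).
  rewrite <- RtoC_minus, zeta_eq_zeta0 by lra. unfold zeta0. rewrite RtoC_minus, Zcont_value.
  unfold dcoef. rewrite RtoC_opp, RtoC_div by lra.
  assert (RtoC (INR q) <> RtoC 0) by (apply RtoC_neq0; lra). field. split; [exact H|].
  intros E. apply H. transitivity (- (1 - INR q - 1))%C; [ring | rewrite E; ring].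
Qed.

Lemma bernoulli_1 : bernoulli 1 = - / 2.
Proof.
  assert (K := bernoulli_sum 0). rewrite !Rsum_S in K. simpl bin in K. change (bernoulli 0) with 1 in K. simpl Rsum in K. lra.
Qed.

Lemma dcoef_1 : dcoef 1 = - / 2.
Proof. unfold dcoef. rewrite bernoulli_1. change (INR 1) with 1. simpl. field. Qed.

Lemma dcoef_even n : dcoef (2 * n) = - (bernoulli (2 * n) / INR (2 * n)).
Proof. unfold dcoef. rewrite pow_1_even. unfold Rdiv. ring. Qed.

Lemma dcoef_odd n : dcoef (S (2 * S n)) = 0.
Proof. unfold dcoef. rewrite bernoulli_odd. unfold Rdiv. ring. Qed.

(** * The expansion at infinity *)

Lemma Rpower_pow_mult x a j : 0 < x -> Rpower x a ^ j = Rpower x (INR j * a).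
Proof. intros Hx. rewrite <- Rpower_pow by apply exp_pos. rewrite Rpower_mult. f_equal. ring. Qed.

(** Since n^N >= 1, every n^N x lies in the sector of x and beyond the same radius, so one
    application of [digamma_asymp] serves all n. The errors sum to O(|x|^(-M-1)) because k + (M + 1)
    N > 1. *)
Lemma scriptF_expansion_infty (k N : R) (M : nat) (delta : R) : 0 < k -> 0 < N -> 1 < k + N -> 0 < delta < PI ->
  exists R0 B, forall x, sector delta x -> R0 < Cmod x ->
    Cmod (scriptF k N x - Csum (fun j => dcoef (S j) * zeta (RtoC (k + INR (S j) * N)) * / x ^ S j) M)%C <= B / Cmod x ^ S M.
Proof.
  intros Hk HN HkN Hd. destruct (digamma_asymp M delta Hd) as [R0 [B [HR0 [HB HA]]]].
  assert (Hp : forall j, 1 < k + INR (S j) * N).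
  { intros j. rewrite S_INR. assert (H := pos_INR j). nra. }
  destruct (Rbdd_power _ (Hp M)) as [T HT].
  exists R0, (B * T). intros x Hs Hx. assert (Hxs : slit_plane x) by apply Hs. assert (Hx0 := slit_neq_0 x Hxs).
  assert (Hmx : 0 < Cmod x) by lra.
  set (y := fun n => (RtoC (Rpower (INR (S n)) N) * x)%C).
  assert (Hv : forall n, 1 <= INR (S n)) by (intros n; rewrite S_INR; assert (H := pos_INR n); lra).
  assert (Hr : forall n, 1 <= Rpower (INR (S n)) N).
  { intros n. rewrite <- (Rpower_O (INR (S n))) by (specialize (Hv n); lra). apply Rle_Rpower; [apply Hv | lra]. }
  assert (Hy0 : forall n, y n <> RtoC 0) by (intros n; apply Cmult_neq_0; [apply RtoC_neq0; specialize (Hr n); lra | exact Hx0]).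
  assert (Hmy : forall n, Cmod (y n) = Rpower (INR (S n)) N * Cmod x).
  { intros n. unfold y. rewrite Cmod_mult, Cmod_R, Rabs_right by (specialize (Hr n); lra). reflexivity. }
  assert (HRk : forall n, 0 < Rpower (INR (S n)) k) by (intros; apply exp_pos).
  set (f := fun n => ((digamma (y n) - Clog (y n)) / Rpower (INR (S n)) k)%C).
  set (h := fun n => (Csum (fun j => dcoef (S j) * / y n ^ S j) M / Rpower (INR (S n)) k)%C).
  set (b := fun n => B / Cmod x ^ S M * Rpower (INR (S n)) (- (k + INR (S M) * N))).
  assert (Herr : forall n, Cmod (f n - h n)%C <= b n).
  { intros n. unfold f, h.
    replace ((digamma (y n) - Clog (y n)) / Rpower (INR (S n)) k - Csum (fun j => dcoef (S j) * / y n ^ S j) M / Rpower (INR (S n)) k)%C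
      with ((digamma (y n) - Clog (y n) - Csum (fun j => dcoef (S j) * / y n ^ S j) M) / Rpower (INR (S n)) k)%C by (unfold Cdiv; ring).
    specialize (HRk n). specialize (Hr n).
    rewrite Cmod_div, Cmod_R, Rabs_right by (try apply RtoC_neq0; lra).
    assert (HAn : Cmod (digamma (y n) - Clog (y n) - Csum (fun j => dcoef (S j) * / y n ^ S j) M)%C <= B / Cmod (y n) ^ S M).
    { apply HA; [apply sector_scal; [lra | exact Hs] | rewrite Hmy; nra]. }
    apply Rle_trans with (B / Cmod (y n) ^ S M / Rpower (INR (S n)) k).
    - apply Rmult_le_compat_r; [left; apply Rinv_0_lt_compat, HRk | exact HAn].
    - right. unfold b. rewrite Hmy, Rpow_mult_distr, Rpower_pow_mult by (specialize (Hv n); lra).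
      rewrite Rpower_Ropp, Rpower_plus. assert (H1 : 0 < Rpower (INR (S n)) (INR (S M) * N)) by apply exp_pos.
      assert (Hpx : 0 < Cmod x ^ S M) by (apply pow_lt, Hmx). field. repeat split; lra. }
  destruct (Csum_abs_cv (fun n => f n - h n)%C b Herr) as [E [HE HEb]].
  { apply Rbdd_scal; [|exists T; exact HT]. apply Rmult_le_pos; [exact HB | left; apply Rinv_0_lt_compat, pow_lt, Hmx]. }
  assert (Hh : Ccv (Csum h) (Csum (fun j => dcoef (S j) * zeta (RtoC (k + INR (S j) * N)) * / x ^ S j) M)%C).
  { apply Ccv_ext with (fun n => Csum (fun j => dcoef (S j) * / x ^ S j * Csum (fun i => RtoC (Rpower (INR (S i)) (- (k + INR (S j) * N)))) n)%C M).
    - intros n. rewrite (Csum_ext _ (fun j => Csum (fun i => dcoef (S j) * / x ^ S j * RtoC (Rpower (INR (S i)) (- (k + INR (S j) * N)))) n)%C)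
        by (intros; rewrite Csum_scal; reflexivity).
      rewrite Csum_swap. apply Csum_ext. intros i _. unfold h. unfold Cdiv. rewrite Cmult_comm, <- Csum_scal.
      apply Csum_ext. intros j _. specialize (Hr i). specialize (HRk i). specialize (Hv i).
      unfold y. rewrite Cpow_mult_l, <- RtoC_pow, Rpower_pow_mult by lra.
      rewrite Rpower_Ropp, Rpower_plus.
      assert (H1 : 0 < Rpower (INR (S i)) (INR (S j) * N)) by apply exp_pos.
      rewrite RtoC_inv, RtoC_mult by (apply Rgt_not_eq, Rmult_lt_0_compat; assumption).
      assert (N1 : RtoC (Rpower (INR (S i)) k) <> RtoC 0) by (apply RtoC_neq0; lra).
      assert (N2 : RtoC (Rpower (INR (S i)) (INR (S j) * N)) <> RtoC 0) by (apply RtoC_neq0; lra).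
      assert (N3 : (x ^ S j)%C <> RtoC 0) by (apply Cpow_nz, Hx0).
      revert N3. generalize (x ^ S j)%C. intros xj N3. field. auto.
    - apply Ccv_Csum_fin. intros j _. eapply Ccv_eq; [|apply Ccv_scal, zeta_real_cv, Hp]. ring. }
  assert (HF : Ccv (Csum f) (E + Csum (fun j => dcoef (S j) * zeta (RtoC (k + INR (S j) * N)) * / x ^ S j) M)%C).
  { apply Ccv_ext with (fun n => Csum (fun n => f n - h n)%C n + Csum h n)%C; [|apply Ccv_plus; assumption].
    intros n. rewrite Csum_minus. ring. }
  assert (EF : scriptF k N x = (E + Csum (fun j => dcoef (S j) * zeta (RtoC (k + INR (S j) * N)) * / x ^ S j) M)%C)
    by (apply Ccv_CSeries; exact HF).
  rewrite EF. match goal with |- Cmod (?e + ?s - ?s)%C <= _ => replace (e + s - s)%C with e by ring end.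
  assert (K := HEb (B * T / Cmod x ^ S M)).
  assert (K0 : forall n, Rsum b n <= B * T / Cmod x ^ S M).
  { intros n. unfold b. rewrite Rsum_scal. replace (B * T / Cmod x ^ S M) with (B / Cmod x ^ S M * T) by (unfold Rdiv; ring).
    apply Rmult_le_compat_l; [|apply HT]. apply Rmult_le_pos; [exact HB | left; apply Rinv_0_lt_compat, pow_lt, Hmx]. }
  specialize (K K0 O). simpl Rsum in K. simpl Csum in K. replace (E - 0)%C with E in K by ring. lra.
Qed.

Lemma scriptF_at_infty (k N : R) : 0 < k -> 0 < N -> 1 < k + N ->
    expansion_at_infty (scriptF k N)
      (fun x => - (1 / (2 * x)) * zeta (k + N))%C
      (fun n => - (bernoulli (2 * n) / INR (2 * n)
                   * zeta (k + INR (2 * n) * N)))%C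
      (fun n x => / x ^ (2 * n))%C.
Proof.
  intros Hk HN HkN delta Hd M.
  (* Order 2 M + 1 consists of the term in 1/x and M pairs whose odd members vanish; the error
     |x|^(-2M-2) is the first omitted gauge function. *)
  destruct (scriptF_expansion_infty k N (S (2 * M)) delta Hk HN HkN Hd) as [R0 [B HB]].
  exists B. exists (Rmax R0 1). intros x Hx Hs.
  assert (HR0 : R0 < Cmod x) by (eapply Rle_lt_trans; [apply Rmax_l | exact Hx]).
  assert (Hx0 := slit_neq_0 x (proj1 Hs)). assert (Hx2 : (2 * x)%C <> RtoC 0) by (apply Cmult_neq_0; [apply RtoC_neq0; lra | exact Hx0]).
  specialize (HB x Hs HR0).
  replace (2 * S M)%nat with (S (S (2 * M))) by lia.
  rewrite Cmod_inv, Cmod_pow by (apply Cpow_nz, Hx0).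
  eapply Rle_trans; [|exact HB]. right. f_equal. f_equal.
  rewrite Csum_S_l, Csum_sum_n_m, <- Csum_pairs. f_equal.
  - rewrite dcoef_1. change (INR 1) with 1. rewrite Rmult_1_l, RtoC_plus, RtoC_opp, RtoC_inv by lra. simpl. field. exact Hx0.
  - apply Csum_ext. intros i _.
    replace (S (S (S (2 * i)))) with (S (2 * S i)) by lia. rewrite dcoef_odd.
    replace (S (S (2 * i))) with (2 * S i)%nat by lia. rewrite dcoef_even.
    rewrite RtoC_opp, RtoC_div, RtoC_plus, RtoC_mult by (apply not_0_INR; lia). ring.
Qed.

(** * Partial fractions over the roots of [rho ^ N = - w] *)

Definition root (N : nat) (w : C) (l : nat) : C :=
  Cexp ((Clog w + RtoC (PI * (2 * INR l + 1)) * Ci) / INR N)%C.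

(** The negative of [root N w l], written with the exponent whose imaginary part lies between -PI
    and PI for l < N, so that its principal logarithm can be read off. *)
Definition mroot (N : nat) (w : C) (l : nat) : C :=
  Cexp ((Clog w + RtoC (PI * (2 * INR l + 1 - INR N)) * Ci) / INR N)%C.

Lemma Cexp_PI : Cexp (RtoC PI * Ci)%C = RtoC (-1).
Proof.
  unfold Cexp. replace (Re (RtoC PI * Ci)%C) with 0 by (simpl; ring). replace (Im (RtoC PI * Ci)%C) with PI by (simpl; ring).
  rewrite exp_0, cos_PI, sin_PI. unfold RtoC. f_equal; ring.
Qed.

Lemma Cexp_nat_PI n : Cexp (RtoC (PI * INR n) * Ci)%C = RtoC ((-1) ^ n).
Proof.
  rewrite RtoC_mult. replace (PI * INR n * Ci)%C with (INR n * (PI * Ci))%C by ring.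
  rewrite Cexp_pow, Cexp_PI. symmetry. apply RtoC_pow.
Qed.

Lemma mroot_root N w l : (1 <= N)%nat -> mroot N w l = (- root N w l)%C.
Proof.
  intros HN. assert (HNn : RtoC (INR N) <> RtoC 0) by (apply RtoC_neq0, not_0_INR; lia).
  unfold mroot, root.
  replace ((Clog w + RtoC (PI * (2 * INR l + 1 - INR N)) * Ci) / INR N)%C with
    ((Clog w + RtoC (PI * (2 * INR l + 1)) * Ci) / INR N - RtoC PI * Ci)%C.
  - rewrite Cexp_minus, Cexp_PI. field.
  - rewrite !RtoC_mult, !RtoC_minus. field. exact HNn.
Qed.

Lemma root_neq_0 N w l : root N w l <> RtoC 0.
Proof. apply Cexp_neq_0. Qed.

Lemma root_pow_N N w l : (1 <= N)%nat -> w <> RtoC 0 -> (root N w l ^ N)%C = (- w)%C.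
Proof.
  intros HN Hw. assert (HNn : RtoC (INR N) <> RtoC 0) by (apply RtoC_neq0, not_0_INR; lia).
  unfold root. rewrite <- Cexp_pow.
  replace (INR N * ((Clog w + RtoC (PI * (2 * INR l + 1)) * Ci) / INR N))%C with (Clog w + RtoC (PI * INR (S (2 * l))) * Ci)%C.
  - rewrite Cexp_plus, Cexp_nat_PI, Cexp_Clog by exact Hw. rewrite <- tech_pow_Rmult, pow_1_even, Rmult_1_r. ring.
  - rewrite S_INR, mult_INR. change (INR 2) with 2. field. exact HNn.
Qed.

Lemma Clog_mroot N w l : (l < N)%nat -> slit_plane w ->
  Clog (mroot N w l) = ((Clog w + RtoC (PI * (2 * INR l + 1 - INR N)) * Ci) / INR N)%C.
Proof.
  intros Hl Hw. apply Clog_Cexp.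
  assert (Hp : 0 < INR N) by (apply lt_0_INR; lia).
  assert (E : Im ((Clog w + RtoC (PI * (2 * INR l + 1 - INR N)) * Ci) / INR N)%C = (Carg w + PI * (2 * INR l + 1 - INR N)) / INR N).
  { unfold Cdiv. rewrite <- RtoC_inv by lra. rewrite im_mult. simpl. field. lra. }
  rewrite E. assert (Ha := slit_Carg w Hw). assert (HP := PI_RGT_0).
  assert (Hl0 := pos_INR l). assert (Hl1 : INR l + 1 <= INR N) by (rewrite <- S_INR; apply le_INR; lia).
  split.
  - apply Rmult_lt_reg_r with (INR N); [exact Hp|]. unfold Rdiv. rewrite Rmult_assoc, Rinv_l by lra. nra.
  - apply Rmult_le_reg_r with (INR N); [exact Hp|]. unfold Rdiv. rewrite Rmult_assoc, Rinv_l by lra. nra.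
Qed.

Lemma Carg_mroot N w l : (l < N)%nat -> slit_plane w ->
  Carg (mroot N w l) = (Carg w + PI * (2 * INR l + 1 - INR N)) / INR N.
Proof.
  intros Hl Hw. assert (Hp : 0 < INR N) by (apply lt_0_INR; lia).
  change (Im (Clog (mroot N w l)) = (Carg w + PI * (2 * INR l + 1 - INR N)) / INR N).
  rewrite Clog_mroot by assumption. unfold Cdiv. rewrite <- RtoC_inv by lra. rewrite im_mult. simpl. field. lra.
Qed.

Lemma Cmod_mroot N w l : (l < N)%nat -> w <> RtoC 0 -> Cmod (mroot N w l) ^ N = Cmod w.
Proof.
  intros Hl Hw. rewrite mroot_root by lia. rewrite Cmod_opp, <- Cmod_pow, root_pow_N by (try lia; exact Hw). apply Cmod_opp.
Qed.

(** The extreme indices l = 0 and l = N - 1 come closest to the cut, and division of the argument by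
    N leaves the distance d / N. *)
Lemma sector_mroot N w l d : (l < N)%nat -> 0 < d -> sector d w -> sector (d / INR N) (mroot N w l).
Proof.
  intros Hl Hd0 [Hw Ha]. assert (Hp : 0 < INR N) by (apply lt_0_INR; lia). assert (HP := PI_RGT_0).
  assert (Hl0 := pos_INR l). assert (Hl1 : INR l + 1 <= INR N) by (rewrite <- S_INR; apply le_INR; lia).
  apply Rabs_le_between in Ha.
  assert (Hb : Rabs (Carg (mroot N w l)) <= PI - d / INR N).
  { rewrite Carg_mroot by assumption. apply Rabs_le. split.
    - apply Rmult_le_reg_r with (INR N); [exact Hp|]. unfold Rdiv. rewrite Rmult_assoc, Rinv_l by lra.
      replace (- (PI - d * / INR N) * INR N) with (d - PI * INR N) by (field; lra). nra.
    - apply Rmult_le_reg_r with (INR N); [exact Hp|]. unfold Rdiv. rewrite Rmult_assoc, Rinv_l by lra.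
      replace ((PI - d * / INR N) * INR N) with (PI * INR N - d) by (field; lra). nra. }
  split; [|exact Hb]. apply Carg_slit; [apply Cexp_neq_0|].
  apply Rabs_le_between in Hb. assert (0 < d / INR N) by (apply Rdiv_lt_0_compat; assumption). lra.
Qed.

Lemma Cgeom (q : C) n : ((q - 1) * Csum (fun l => q ^ l) n = q ^ n - 1)%C.
Proof.
  induction n; [simpl; ring|]. rewrite Csum_S, Cmult_plus_distr_l, IHn. simpl. ring.
Qed.

(** A geometric sum whose ratio q = exp(-2 PI i j / N) is an N-th root of unity other than 1. *)
Lemma root_sum_zero N w j : (1 <= N)%nat -> (j mod N <> 0)%nat -> Csum (fun l => / root N w l ^ j)%C N = RtoC 0.
Proof.
  intros HN Hj. assert (Hp : 0 < INR N) by (apply lt_0_INR; lia). assert (HPI := PI_RGT_0).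
  assert (HNn : RtoC (INR N) <> RtoC 0) by (apply RtoC_neq0; lra).
  set (q := Cexp (RtoC (- (2 * PI * INR j / INR N)) * Ci)%C).
  set (A := Cexp (- (INR j * ((Clog w + RtoC PI * Ci) / INR N)))%C).
  assert (Hterm : forall l, (/ root N w l ^ j)%C = (A * q ^ l)%C).
  { intros l. unfold root, A, q. rewrite <- Cexp_pow, <- Cexp_opp, <- Cexp_pow, <- Cexp_plus. f_equal.
    rewrite !RtoC_opp, RtoC_div, !RtoC_mult, RtoC_plus, RtoC_mult by lra. field. exact HNn. }
  rewrite (Csum_ext _ (fun l => A * q ^ l)%C) by (intros; apply Hterm). rewrite Csum_scal.
  assert (HqN : (q ^ N)%C = RtoC 1).
  { unfold q. rewrite <- Cexp_pow.
    replace (INR N * (RtoC (- (2 * PI * INR j / INR N)) * Ci))%C with (- (RtoC (PI * INR (2 * j)) * Ci))%C.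
    - rewrite Cexp_opp, Cexp_nat_PI, pow_1_even. field.
    - rewrite mult_INR. change (INR 2) with 2. rewrite RtoC_opp, RtoC_div, !RtoC_mult by lra. field. exact HNn. }
  assert (Hq1 : (q - 1)%C <> RtoC 0).
  { set (b := (j mod N)%nat) in *. assert (Hb : (0 < b < N)%nat) by (split; [lia | apply Nat.mod_upper_bound; lia]).
    assert (Eq : q = Cexp (RtoC (- (2 * PI * INR b / INR N)) * Ci)%C).
    { unfold q. assert (Ej : INR j = INR N * INR (j / N) + INR b).
      { rewrite <- mult_INR, <- plus_INR. f_equal. apply Nat.div_mod. lia. }
      rewrite Ej. replace (RtoC (- (2 * PI * (INR N * INR (j / N) + INR b) / INR N)) * Ci)%C with
        (- (RtoC (PI * INR (2 * (j / N))) * Ci) + RtoC (- (2 * PI * INR b / INR N)) * Ci)%C.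
      - rewrite Cexp_plus, Cexp_opp, Cexp_nat_PI, pow_1_even. field.
      - rewrite (mult_INR 2). change (INR 2) with 2. rewrite !RtoC_opp, !RtoC_div, !RtoC_mult, RtoC_plus, RtoC_mult by lra. field. exact HNn. }
    intros E. assert (Hre := f_equal Re E). rewrite Eq in Hre. unfold Cexp in Hre.
    (* Here q = exp(-2 i th) with b = j mod N; q = 1 would force sin th = 0, although 0 < th <
       PI. *)
    set (th := PI * INR b / INR N).
    assert (Hth : 0 < th < PI).
    { assert (0 < INR b) by (apply lt_0_INR; lia). assert (INR b < INR N) by (apply lt_INR; lia).
      unfold th. split; [apply Rdiv_lt_0_compat; nra|].
      apply Rmult_lt_reg_r with (INR N); [exact Hp|]. unfold Rdiv. rewrite Rmult_assoc, Rinv_l by lra. nra. }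
    assert (Hs : 0 < sin th) by (apply sin_gt_0; lra).
    unfold Cminus in Hre. rewrite re_plus in Hre. simpl in Hre.
    replace (- (2 * PI * INR b / INR N) * 0 - 0 * 1) with 0 in Hre by ring.
    replace (- (2 * PI * INR b / INR N) * 1 + 0 * 0) with (- (2 * th)) in Hre by (unfold th; field; lra).
    rewrite exp_0, cos_neg, cos_2a in Hre. assert (K := sin2_cos2 th). unfold Rsqr in K. nra. }
  assert (Hgeo : ((q - 1) * Csum (fun l => q ^ l) N)%C = RtoC 0).
  { rewrite Cgeom, HqN. ring. }
  change ((A * Csum (fun l => q ^ l) N)%C = RtoC 0).
  replace (Csum (fun l => q ^ l)%C N) with (RtoC 0); [ring|].
  transitivity (/ (q - 1) * ((q - 1) * Csum (fun l => q ^ l) N))%C; [rewrite Hgeo; ring | field; exact Hq1].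
Qed.

Lemma root_sum_multiple N w i : (1 <= N)%nat -> w <> RtoC 0 ->
  Csum (fun l => / root N w l ^ (i * N))%C N = (INR N * (- / w) ^ i)%C.
Proof.
  intros HN Hw. rewrite (Csum_ext _ (fun _ => (- / w) ^ i)%C).
  - apply Csum_const.
  - intros l _. rewrite Nat.mul_comm, Cpow_mult_r, root_pow_N by assumption.
    rewrite <- Cpow_inv.
    + f_equal. field. exact Hw.
    + intros E. apply Hw. transitivity (- - w)%C; [ring | rewrite E; ring].
Qed.

Lemma INR_plus_mroot_neq0 N w l n : (l < N)%nat -> slit_plane w -> (INR n + mroot N w l)%C <> RtoC 0.
Proof.
  intros Hl Hw. destruct (slit_sector w Hw) as [d [Hd Hs]].
  assert (K := sector_mroot N w l d Hl ltac:(lra) Hs). rewrite Cplus_comm.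
  apply slit_add_neq0; [apply K | apply pos_INR].
Qed.

Lemma Cdiff_pow (a b : C) N : ((a - b) * Csum (fun i => a ^ i * b ^ (N - 1 - i)) N = a ^ N - b ^ N)%C.
Proof.
  induction N; [simpl; ring|].
  rewrite Csum_S. replace (S N - 1 - N)%nat with O by lia.
  rewrite (Csum_ext _ (fun i => b * (a ^ i * b ^ (N - 1 - i)))%C).
  - rewrite Csum_scal, Cmult_plus_distr_l.
    transitivity (b * ((a - b) * Csum (fun i => a ^ i * b ^ (N - 1 - i)) N) + (a - b) * a ^ N)%C; [simpl; ring|].
    rewrite IHN. simpl. ring.
  - intros i Hi. replace (S N - 1 - i)%nat with (S (N - 1 - i)) by lia. simpl. ring.
Qed.

(** With rho^N = -w, the reciprocal of n - rho is the sum of n^i rho^(N-1-i) divided by n^N + w.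
    Summation over the roots kills every exponent not divisible by N; since 0 < kap + i + 1 < 2 N,
    only i = N - 1 - kap survives. *)
Lemma partial_fractions N kap w n : (kap < N)%nat -> slit_plane w -> (0 < n)%nat ->
  Csum (fun l => / root N w l ^ kap * / (INR n + mroot N w l))%C N
   = (INR N * (INR n ^ (N - 1 - kap) / (INR n ^ N + w)))%C.
Proof.
  intros Hk Hw Hn. assert (Hw0 := slit_neq_0 w Hw).
  assert (Hnw : (INR n ^ N + w)%C <> RtoC 0).
  { rewrite <- RtoC_pow, Cplus_comm. apply slit_add_neq0; [exact Hw | apply pow_le, pos_INR]. }
  rewrite (Csum_ext _ (fun l => Csum (fun i => (- w * INR n ^ i / (INR n ^ N + w)) * / root N w l ^ (S (kap + i))) N)%C).
  - rewrite Csum_swap. rewrite (Csum_ext _ (fun i => if (i =? N - 1 - kap)%nat then (INR N * (INR n ^ (N - 1 - kap) / (INR n ^ N + w)))%C else RtoC 0)).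
    + assert (G : forall P (v : C) m, (m < P)%nat -> Csum (fun i => if (i =? m)%nat then v else RtoC 0) P = v).
      { intros P v m. induction P; intros HP; [lia|]. rewrite Csum_S. destruct (Nat.eqb_spec P m) as [->|Hne].
        - rewrite Csum_0; [ring|]. intros i Hi. destruct (Nat.eqb_spec i m); [lia | reflexivity].
        - rewrite IHP by lia. ring. }
      apply G. lia.
    + intros i Hi. rewrite Csum_scal. destruct (Nat.eqb_spec i (N - 1 - kap)) as [->|Hne].
      * replace (S (kap + (N - 1 - kap))) with (1 * N)%nat by lia. rewrite root_sum_multiple by (try lia; exact Hw0). simpl. field. auto.
      * rewrite root_sum_zero; [ring | lia|].
        intros E. apply Nat.Div0.mod_divides in E. destruct E as [c E].
        destruct c as [|[|c]]; [lia | lia|]. assert (2 * N <= N * S (S c))%nat by nia. lia.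
  - intros l Hl. assert (Hr := root_neq_0 N w l). assert (Hy := INR_plus_mroot_neq0 N w l n Hl Hw).
    rewrite mroot_root in * by lia. set (rho := root N w l) in *.
    assert (HrN : (rho ^ N)%C = (- w)%C) by (apply root_pow_N; [lia | exact Hw0]).
    assert (K := Cdiff_pow (INR n) rho N). rewrite HrN in K.
    replace (INR n ^ N - - w)%C with (INR n ^ N + w)%C in K by ring.
    rewrite (Csum_ext _ (fun i => (/ rho ^ kap / (INR n ^ N + w)) * (INR n ^ i * rho ^ (N - 1 - i)))%C).
    + rewrite Csum_scal. set (G := Csum (fun i => INR n ^ i * rho ^ (N - 1 - i))%C N) in *.
      assert (Hrk := Cpow_nz rho kap Hr).
      assert (EG : G = ((INR n ^ N + w) / (INR n + - rho))%C).
      { rewrite <- K. replace (INR n - rho)%C with (INR n + - rho)%C by ring. field. exact Hy. }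
      rewrite EG. field. auto.
    + intros i Hi.
      assert (E : (rho ^ (N - 1 - i) * (rho * rho ^ i))%C = (- w)%C).
      { rewrite <- HrN. replace N with (N - 1 - i + S i)%nat at 2 by lia. rewrite Cpow_add_r. reflexivity. }
      assert (E2 : (- w / (rho * rho ^ i))%C = (rho ^ (N - 1 - i))%C).
      { rewrite <- E. field. split; [apply Cpow_nz, Hr | exact Hr]. }
      rewrite <- E2. replace (S (kap + i)) with (kap + S i)%nat by lia. rewrite Cpow_add_r. simpl.
      assert (H1 := Cpow_nz rho kap Hr). assert (H2 := Cpow_nz rho i Hr). field. auto.
Qed.

Lemma dcoef_sign j : (-1) ^ S (S j) * dcoef (S (S j)) = dcoef (S (S j)).
Proof.
  destruct (Nat.Even_or_Odd (S (S j))) as [[m E]|[m E]].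
  - rewrite E, pow_1_even. ring.
  - destruct m as [|m]; [lia|]. replace (S (S j)) with (S (2 * S m)) by lia. rewrite dcoef_odd. ring.
Qed.

(** Adding 1/y changes the coefficient -1/2 of 1/y into 1/2; the factor (-1)^j in the statement does
    just this, as [dcoef] vanishes at the other odd indices. *)
Lemma digamma1_asymp K d : 0 < d < PI ->
  exists R0 B, 2 <= R0 /\ 0 <= B /\ forall y, sector d y -> R0 <= Cmod y ->
    Cmod (digamma (y + 1) - Clog y - Csum (fun j => RtoC ((-1) ^ S j * dcoef (S j)) * / y ^ S j) K)%C <= B / Cmod y ^ S K.
Proof.
  intros Hd. destruct (digamma_asymp K d Hd) as [R0 [B [HR0 [HB HA]]]].
  exists R0, (B + 1). split; [exact HR0|]. split; [lra|]. intros y Hs HY.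
  specialize (HA y Hs HY). assert (Hy0 := slit_neq_0 y (proj1 Hs)).
  rewrite digamma_shift by apply Hs.
  assert (Hp : 0 < Cmod y ^ S K) by (apply pow_lt; lra).
  (* For K = 0 the summand 1/y goes into the error, which explains the constant B + 1. *)
  destruct K as [|K].
  - simpl Csum in *. rewrite pow_1 in *.
    replace (digamma y + / y - Clog y - 0)%C with ((digamma y - Clog y - 0) + / y)%C by ring.
    eapply Rle_trans; [apply Cmod_triangle|]. rewrite Cmod_inv by exact Hy0. unfold Rdiv in *. lra.
  - apply Rle_trans with (B / Cmod y ^ S (S K)).
    2: { apply Rmult_le_compat_r; [left; apply Rinv_0_lt_compat, Hp | lra]. }
    eapply Rle_trans; [|exact HA]. right. f_equal. rewrite !(Csum_S_l _ K).
    rewrite (Csum_ext (fun i => RtoC ((-1) ^ S (S i) * dcoef (S (S i))) * / y ^ S (S i))%C (fun i => dcoef (S (S i)) * / y ^ S (S i))%C)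
      by (intros; rewrite dcoef_sign; reflexivity).
    rewrite dcoef_1. replace ((-1) ^ 1 * - / 2) with (1 - / 2) by field. rewrite RtoC_minus, RtoC_opp.
    simpl (y ^ 1)%C. rewrite Cmult_1_r. ring.
Qed.

Definition Sterm (k N : nat) (w : C) (n : nat) : C :=
  (/ INR (S n) ^ k * (w / (w + INR (S n) ^ N)))%C.

(** Since n^(-k) w / (w + n^N) = n^(-k) - n^(N-k) / (w + n^N), the second part is a partial fraction
    with [kap] = k - 1, and its sum over n is a difference of digamma values. *)
Lemma Sterm_sum (k N P : nat) (w : C) : (1 <= k <= N)%nat -> slit_plane w ->
  Csum (Sterm k N w) P =
   (Csum (fun n => / INR (S n) ^ k)%C P
    - / INR N * Csum (fun l => / root N w l ^ (k - 1) * (digamma (mroot N w l + 1 + INR P) - digamma (mroot N w l + 1))) N)%C.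
Proof.
  intros Hk Hw. assert (HNn : RtoC (INR N) <> RtoC 0) by (apply RtoC_neq0, not_0_INR; lia).
  rewrite (Csum_ext _ (fun n => / INR (S n) ^ k - / INR N * Csum (fun l => / root N w l ^ (k - 1) * / (INR (S n) + mroot N w l)) N)%C).
  - rewrite Csum_minus, Csum_scal, Csum_swap. f_equal. f_equal. apply Csum_ext. intros l Hl. rewrite Csum_scal. f_equal.
    destruct (slit_sector w Hw) as [d [Hd Hs]].
    assert (Hm : slit_plane (mroot N w l)) by (apply (sector_mroot N w l d Hl); [lra | exact Hs]).
    rewrite (digamma_shift_n _ P) by (apply slit_plus; [exact Hm | lra]).
    replace (digamma (mroot N w l + 1) + Csum (fun m => / (mroot N w l + 1 + INR m)) P - digamma (mroot N w l + 1))%C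
      with (Csum (fun m => / (mroot N w l + 1 + INR m)) P)%C by ring.
    apply Csum_ext. intros i _. f_equal. rewrite S_INR, RtoC_plus. ring.
  - intros n _. rewrite partial_fractions by (try exact Hw; lia). unfold Sterm.
    assert (Hn := INR_S_neq0 n).
    assert (Hnw : (INR (S n) ^ N + w)%C <> RtoC 0).
    { rewrite <- RtoC_pow, Cplus_comm. apply slit_add_neq0; [exact Hw | apply pow_le, pos_INR]. }
    assert (Hwn : (w + INR (S n) ^ N)%C <> RtoC 0) by (rewrite Cplus_comm; exact Hnw).
    assert (E : (INR (S n) ^ N = INR (S n) ^ (N - 1 - (k - 1)) * INR (S n) ^ k)%C) by (rewrite <- Cpow_add_r; f_equal; lia).
    rewrite E in *. assert (H1 := Cpow_nz (INR (S n)) k Hn). field. auto.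
Qed.

(** In the applications c0 is zeta k for k > 1 and Euler's constant for k = 1. The growth ln P of
    the digamma values cancels for k > 1, because the sum of rho^(1-k) over the roots is 0; for k =
    1 it compensates the harmonic sum. *)
Lemma S_exact (k N : nat) (w c0 : C) : (1 <= k <= N)%nat -> slit_plane w ->
  Ccv (fun P => Csum (fun n => / INR (S n) ^ k) P - (if (k =? 1)%nat then RtoC (ln (INR P)) else 0))%C c0 ->
  Ccv (Csum (Sterm k N w)) (c0 + / INR N * Csum (fun l => / root N w l ^ (k - 1) * digamma (mroot N w l + 1)) N)%C.
Proof.
  intros Hk Hw Hc0. assert (HNn : RtoC (INR N) <> RtoC 0) by (apply RtoC_neq0, not_0_INR; lia).
  assert (Hm : forall l, (l < N)%nat -> slit_plane (mroot N w l + 1)%C).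
  { intros l Hl. destruct (slit_sector w Hw) as [d [Hd Hs]]. apply slit_plus; [|lra].
    apply (sector_mroot N w l d Hl); [lra | exact Hs]. }
  apply Ccv_ext with (fun P => (Csum (fun n => / INR (S n) ^ k) P - (if (k =? 1)%nat then RtoC (ln (INR P)) else 0))
     - / INR N * (Csum (fun l => / root N w l ^ (k - 1) * (digamma (mroot N w l + 1 + INR P) - ln (INR P))) N
         - Csum (fun l => / root N w l ^ (k - 1) * digamma (mroot N w l + 1)) N))%C.
  - intros P. rewrite Sterm_sum by assumption.
    assert (Hln : (Csum (fun l => / root N w l ^ (k - 1) * ln (INR P)) N = INR N * (if (k =? 1)%nat then RtoC (ln (INR P)) else 0))%C).
    { rewrite (Csum_ext _ (fun l => ln (INR P) * / root N w l ^ (k - 1))%C) by (intros; ring). rewrite Csum_scal.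
      destruct (Nat.eqb_spec k 1) as [->|Hne].
      - rewrite (Csum_ext _ (fun _ => RtoC 1)) by (intros; simpl; field). rewrite Csum_const. ring.
      - rewrite root_sum_zero; [ring | lia | rewrite Nat.mod_small; lia]. }
    assert (E1 : forall f g h : nat -> C, Csum (fun l => f l * (g l - h l))%C N = (Csum (fun l => f l * g l) N - Csum (fun l => f l * h l) N)%C).
    { intros. rewrite <- Csum_minus. apply Csum_ext. intros; ring. }
    rewrite !E1, Hln. field. exact HNn.
  - eapply Ccv_eq; [|apply Ccv_minus; [exact Hc0 | apply Ccv_scal; apply Ccv_minus; [apply Ccv_Csum_fin with (h := fun _ => RtoC 0) | apply Ccv_const]]].
    + rewrite (Csum_0 N (fun _ => RtoC 0)) by reflexivity. ring.
    + intros l Hl. apply Ccv_eq with (/ root N w l ^ (k - 1) * 0)%C; [ring|]. apply Ccv_scal, Ccv_digamma_add, Hm, Hl.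
Qed.

Lemma Csum_multiples (F : nat -> C) N M : (1 <= N)%nat -> (forall t, (t mod N <> 0)%nat -> F t = RtoC 0) ->
  Csum F (M * N) = Csum (fun i => F (i * N)%nat) M.
Proof.
  intros HN HF. induction M; [reflexivity|].
  replace (S M * N)%nat with (M * N + N)%nat by lia. rewrite Csum_app, IHM, Csum_S. f_equal.
  destruct N as [|N']; [lia|]. rewrite Csum_S_l, Nat.add_0_r, Csum_0; [ring|].
  intros i Hi. apply HF. rewrite Nat.add_comm, Nat.Div0.mod_add, Nat.mod_small; lia.
Qed.

(** The contribution to S(w) of the leading terms [Clog (mroot N w l)] of the digamma values. It is
    Clog w / N for k = 1 and a multiple of w^(-(k-1)/N) for k >= 2. *)
Definition L0 (k N : nat) (w : C) : C := (/ INR N * Csum (fun l => / root N w l ^ (k - 1) * Clog (mroot N w l)) N)%C.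

Lemma zeta_dcoef (k N i : nat) : (1 <= k <= N)%nat -> (1 <= i)%nat ->
  zeta (INR k - INR i * INR N)%C = RtoC (dcoef (i * N - (k - 1))).
Proof.
  intros Hk Hi. assert (Hle : (N <= i * N)%nat) by nia.
  rewrite <- zeta_nonpos by lia. f_equal.
  rewrite minus_INR, mult_INR by lia. rewrite (minus_INR k 1) by lia. change (INR 1) with 1.
  rewrite !RtoC_minus, RtoC_mult. ring.
Qed.

Lemma S_asymp (k N M : nat) (d : R) (c0 : C) : (1 <= k <= N)%nat -> 0 < d < PI ->
  Ccv (fun P => Csum (fun n => / INR (S n) ^ k) P - (if (k =? 1)%nat then RtoC (ln (INR P)) else 0))%C c0 ->
  exists R0 B, 0 < R0 /\ 0 <= B /\ forall w, sector d w -> R0 <= Cmod w ->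
    exists s, Ccv (Csum (Sterm k N w)) s /\
      Cmod (s - (c0 + L0 k N w + Csum (fun i => zeta (INR k - INR (S i) * INR N) * (- / w) ^ S i) M))%C <= B / Cmod w ^ S M.
Proof.
  (* K is chosen so that kap + K + 1 = (M + 1) N: as |y_l|^N = |w|, the digamma error divided by
     |rho|^kap is exactly of order |w|^(-M-1). *)
  intros Hk Hd Hc0. set (kap := (k - 1)%nat). set (K := (S M * N - k)%nat).
  assert (HN1 : 1 <= INR N) by (change 1 with (INR 1); apply le_INR; lia).
  assert (HNn : RtoC (INR N) <> RtoC 0) by (apply RtoC_neq0; lra).
  assert (HSN : (N <= S M * N)%nat) by nia.
  assert (HdN : 0 < d / INR N < PI).
  { split; [apply Rdiv_lt_0_compat; lra|]. apply Rmult_lt_reg_r with (INR N); [lra|]. unfold Rdiv. rewrite Rmult_assoc, Rinv_l by lra.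
    assert (HP := PI_RGT_0). nra. }
  destruct (digamma1_asymp K (d / INR N) HdN) as [R1 [B [HR1 [HB HA]]]].
  exists (R1 ^ N), B. split; [apply pow_lt; lra|]. split; [exact HB|]. intros w Hs HwR.
  assert (Hw : slit_plane w) by apply Hs. assert (Hw0 := slit_neq_0 w Hw).
  eexists. split; [apply S_exact; [exact Hk | exact Hw | exact Hc0]|]. fold kap.
  set (y := mroot N w). set (rho := root N w).
  assert (Hy : forall l, (l < N)%nat -> sector (d / INR N) (y l)) by (intros l Hl; apply sector_mroot; [exact Hl | lra | exact Hs]).
  assert (HyN : forall l, (l < N)%nat -> Cmod (y l) ^ N = Cmod w) by (intros l Hl; apply Cmod_mroot; assumption).
  assert (Hyr : forall l, Cmod (y l) = Cmod (rho l)) by (intros l; unfold y, rho; rewrite mroot_root by lia; apply Cmod_opp).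
  assert (HyR : forall l, (l < N)%nat -> R1 <= Cmod (y l)).
  { intros l Hl. destruct (Rle_lt_dec R1 (Cmod (y l))) as [|Hlt]; [assumption|]. exfalso.
    assert (Cmod (y l) ^ N < R1 ^ N); [|rewrite HyN in H by exact Hl; lra].
    assert (Hg : forall p, (1 <= p)%nat -> Cmod (y l) ^ p < R1 ^ p).
    { assert (H0 := Cmod_ge_0 (y l)). intros p Hp. destruct p; [lia|]. clear Hp. induction p; [simpl; lra|].
      change (Cmod (y l) * Cmod (y l) ^ S p < R1 * R1 ^ S p).
      assert (0 <= Cmod (y l) ^ S p) by (apply pow_le; lra). nra. }
    apply Hg. lia. }
  assert (Hmain : (L0 k N w + Csum (fun i => zeta (INR k - INR (S i) * INR N) * (- / w) ^ S i) M
     = / INR N * Csum (fun l => / rho l ^ kap * (Clog (y l) + Csum (fun j => RtoC ((-1) ^ S j * dcoef (S j)) * / y l ^ S j) K)) N)%C).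
  { rewrite (Csum_ext (fun l => / rho l ^ kap * (Clog (y l) + Csum (fun j => RtoC ((-1) ^ S j * dcoef (S j)) * / y l ^ S j) K))%C
       (fun l => / rho l ^ kap * Clog (y l) + Csum (fun j => dcoef (S j) * / rho l ^ (kap + S j)) K)%C).
    - rewrite Csum_plus, Cmult_plus_distr_l. unfold L0. fold kap rho y. f_equal.
      rewrite Csum_swap, <- Csum_scal.
      (* The terms are indexed by the exponent t = kap + j + 1 of 1/rho and padded with zeros below
         k, so that the sum has (M + 1) N terms and [Csum_multiples] applies. The multiple t = 0
         falls into the padding. *)
      set (F := fun t => if (t <? k)%nat then RtoC 0 else (/ INR N * (dcoef (t - kap) * Csum (fun l => / rho l ^ t) N))%C).
      transitivity (Csum F (S M * N)).
      + rewrite Csum_multiples; [|lia|].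
        * rewrite Csum_S_l. unfold F at 1. replace (0 * N <? k)%nat with true by (symmetry; apply Nat.ltb_lt; lia).
          rewrite Cplus_0_l. apply Csum_ext. intros i _. unfold F.
          assert (N <= S i * N)%nat by nia. replace (S i * N <? k)%nat with false by (symmetry; apply Nat.ltb_ge; lia).
          unfold rho. rewrite root_sum_multiple by (try lia; exact Hw0). rewrite zeta_dcoef by lia. fold kap. field. exact HNn.
        * intros t Ht. unfold F. destruct (t <? k)%nat; [reflexivity|]. unfold rho. rewrite root_sum_zero by (try lia; exact Ht). ring.
      + replace (S M * N)%nat with (k + K)%nat by (unfold K; lia). rewrite Csum_app, Csum_0, Cplus_0_l.
        * apply Csum_ext. intros j _. unfold F. replace (k + j <? k)%nat with false by (symmetry; apply Nat.ltb_ge; lia).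
          replace (k + j - kap)%nat with (S j) by (unfold kap; lia). rewrite Csum_scal.
          replace (kap + S j)%nat with (k + j)%nat by (unfold kap; lia). ring.
        * intros i Hi. unfold F. replace (i <? k)%nat with true by (symmetry; apply Nat.ltb_lt; lia). reflexivity.
    - intros l Hl. rewrite Cmult_plus_distr_l, <- Csum_scal. f_equal. apply Csum_ext. intros j _.
      unfold y. rewrite mroot_root by lia. fold (rho l). assert (Hr := root_neq_0 N w l). fold (rho l) in Hr.
      replace (- rho l)%C with (RtoC (-1) * rho l)%C by ring. rewrite (Cpow_mult_l (RtoC (-1))), <- RtoC_pow, RtoC_mult, Cpow_add_r.
      assert (Hm1 : (-1) ^ S j * (-1) ^ S j = 1) by (rewrite <- pow_add; replace (S j + S j)%nat with (2 * S j)%nat by lia; apply pow_1_even).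
      assert (Hm0 : RtoC ((-1) ^ S j) <> RtoC 0) by (apply RtoC_neq0, pow_nonzero; lra).
      assert (H1 := Cpow_nz _ kap Hr). assert (H2 := Cpow_nz _ (S j) Hr).
      revert Hm0 H1 H2. generalize (RtoC ((-1) ^ S j)) (rho l ^ kap)%C (rho l ^ S j)%C. intros a b c Ha Hb Hc. field. auto. }
  replace (c0 + L0 k N w + Csum (fun i => zeta (INR k - INR (S i) * INR N) * (- / w) ^ S i) M)%C with
    (c0 + (L0 k N w + Csum (fun i => zeta (INR k - INR (S i) * INR N) * (- / w) ^ S i) M))%C by ring.
  rewrite Hmain.
  match goal with |- Cmod (c0 + ?a * ?u - (c0 + ?a * ?v))%C <= _ => replace (c0 + a * u - (c0 + a * v))%C with (a * (u - v))%C by ring end.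
  rewrite <- Csum_minus, Cmod_mult, Cmod_inv by exact HNn. rewrite Cmod_R, Rabs_right by lra.
  apply Rle_trans with (/ INR N * Rsum (fun _ => B / Cmod w ^ S M) N).
  - apply Rmult_le_compat_l; [left; apply Rinv_0_lt_compat; lra|]. apply Cmod_Csum_le. intros l Hl.
    match goal with |- Cmod (?a * ?u - ?a * ?v)%C <= _ => replace (a * u - a * v)%C with (a * (u - v))%C by ring end.
    match goal with |- Cmod (?a * (?u - (?p + ?q)))%C <= _ => replace (u - (p + q))%C with (u - p - q)%C by ring end.
    rewrite Cmod_mult, Cmod_inv, Cmod_pow by (apply Cpow_nz, root_neq_0). rewrite <- Hyr.
    assert (K1 := HA (y l) (Hy l Hl) (HyR l Hl)). assert (K2 := HyR l Hl). fold (y l).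
    assert (Hpk : 0 < Cmod (y l) ^ kap) by (apply pow_lt; lra).
    apply Rle_trans with (/ Cmod (y l) ^ kap * (B / Cmod (y l) ^ S K)).
    + apply Rmult_le_compat_l; [left; apply Rinv_0_lt_compat, Hpk | exact K1].
    + right. rewrite <- (HyN l Hl), <- pow_mult. replace (N * S M)%nat with (kap + S K)%nat by (unfold kap, K; lia).
      rewrite pow_add. assert (0 < Cmod (y l) ^ S K) by (apply pow_lt; lra). field. split; lra.
  - right. clear - HN1. assert (E : forall p c, Rsum (fun _ => c) p = INR p * c).
    { intros p c. induction p; [simpl; change (INR 0) with 0; ring|]. rewrite Rsum_S, IHp, S_INR. ring. }
    rewrite E. generalize (B / Cmod w ^ S M). intros q. field. lra.
Qed.

Lemma Csum_odd N : Csum (fun l => RtoC (2 * INR l + 1 - INR N)) N = RtoC 0.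
Proof.
  assert (E : forall n c, Csum (fun l => RtoC (2 * INR l + 1 - c)) n = RtoC (INR n * (INR n - c))).
  { intros n c. induction n; [change (INR 0) with 0; rewrite Rmult_0_l; reflexivity|].
    rewrite Csum_S, IHn, <- RtoC_plus. f_equal. rewrite S_INR. ring. }
  rewrite E. f_equal. ring.
Qed.

(** The numbers 2 l + 1 - N are symmetric about 0, so the imaginary shifts of the logarithms
    cancel. *)
Lemma L0_1 N w : (1 <= N)%nat -> slit_plane w -> L0 1 N w = (Clog w / INR N)%C.
Proof.
  intros HN Hw. assert (HNn : RtoC (INR N) <> RtoC 0) by (apply RtoC_neq0, not_0_INR; lia).
  unfold L0. rewrite (Csum_ext _ (fun l => Clog w / INR N + RtoC PI * Ci / INR N * RtoC (2 * INR l + 1 - INR N))%C).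
  - rewrite Csum_plus, Csum_const, Csum_scal, Csum_odd. field. exact HNn.
  - intros l Hl. rewrite Clog_mroot by assumption. simpl. rewrite RtoC_mult. field. exact HNn.
Qed.

Lemma Csum_geom_weighted (q : C) n :
  ((q - 1) * Csum (fun l => INR l * q ^ l) n = INR n * q ^ n - q * Csum (fun l => q ^ l) n)%C.
Proof.
  induction n; [simpl; change (INR 0) with 0; ring|].
  rewrite !Csum_S, Cmult_plus_distr_l, IHn, S_INR, RtoC_plus. simpl. ring.
Qed.

Lemma Cexp_Ci t : Cexp (RtoC t * Ci)%C = (cos t + sin t * Ci)%C.
Proof.
  unfold Cexp, Ci, RtoC, Cmult, Cplus. simpl.
  replace (t * 0 - 0 * 1) with 0 by ring. replace (t * 1 + 0 * 0) with t by ring. rewrite exp_0. f_equal; ring.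
Qed.

(** The weights rho_l^(1-k) are a geometric progression of ratio q = exp(-2 i al) with al = PI (k-1)
    / N. Their plain sum is 0, so only the part of the logarithm linear in l survives; sum l q^l = N
    / (q - 1), and q - 1 = -2 i sin(al) exp(-i al) brings in the sine. *)
Lemma L0_ge2 k N w : (2 <= k <= N)%nat -> slit_plane w ->
  L0 k N w = (- (PI / INR N / sin (PI / INR N * (INR k - 1))) * Cexp (- ((INR k - 1) / INR N * Clog w)))%C.
Proof.
  intros Hk Hw. assert (HNn : RtoC (INR N) <> RtoC 0) by (apply RtoC_neq0, not_0_INR; lia).
  assert (HN0 : INR N <> 0) by (apply not_0_INR; lia).
  assert (HNp : 0 < INR N) by (apply lt_0_INR; lia).
  set (kap := (k - 1)%nat). assert (Ekap : INR k - 1 = INR kap) by (unfold kap; rewrite minus_INR by lia; reflexivity).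
  rewrite <- RtoC_minus, Ekap. set (al := PI / INR N * INR kap).
  assert (Hal : 0 < al < PI).
  { assert (HP := PI_RGT_0). assert (0 < INR kap) by (apply lt_0_INR; unfold kap; lia). assert (INR kap < INR N) by (apply lt_INR; unfold kap; lia).
    unfold al. split; [apply Rmult_lt_0_compat; [apply Rdiv_lt_0_compat; lra | lra]|].
    replace (PI / INR N * INR kap) with (PI * (INR kap / INR N)) by (field; lra).
    rewrite <- (Rmult_1_r PI) at 2. apply Rmult_lt_compat_l; [lra|]. apply Rmult_lt_reg_r with (INR N); [lra|].
    unfold Rdiv. rewrite Rmult_assoc, Rinv_l; lra. }
  assert (Hsin : 0 < sin al) by (apply sin_gt_0; lra).
  assert (HsinC : RtoC (sin al) <> RtoC 0) by (apply RtoC_neq0; lra).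
  set (W := Cexp (- (INR kap / INR N * Clog w))%C).
  set (e1 := Cexp (RtoC (- al) * Ci)%C). set (q := (e1 * e1)%C).
  assert (Hroot : forall l, (/ root N w l ^ kap)%C = (W * e1 * q ^ l)%C).
  { intros l. unfold root, q, e1, W. rewrite <- Cexp_pow, <- Cexp_opp, <- !Cexp_plus, <- Cexp_pow, <- Cexp_plus. f_equal.
    unfold al. rewrite RtoC_opp, !RtoC_mult, RtoC_plus, RtoC_mult, RtoC_div by exact HN0. field. exact HNn. }
  assert (HW : W <> RtoC 0) by apply Cexp_neq_0. assert (He1 : e1 <> RtoC 0) by apply Cexp_neq_0.
  assert (HS0 : Csum (fun l => q ^ l)%C N = RtoC 0).
  { assert (K := root_sum_zero N w kap ltac:(lia) ltac:(rewrite Nat.mod_small; unfold kap; lia)).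
    rewrite (Csum_ext _ (fun l => W * e1 * q ^ l)%C), Csum_scal in K by (intros; apply Hroot).
    change (Csum (Cpow q) N) with (Csum (fun l => q ^ l)%C N) in K.
    transitivity (/ (W * e1) * (W * e1 * Csum (fun l => q ^ l) N))%C; [field; auto | rewrite K; ring]. }
  assert (HqN : (q ^ N)%C = RtoC 1).
  { assert (K := Cgeom q N). rewrite HS0 in K. transitivity (q ^ N - 1 + 1)%C; [ring | rewrite <- K; ring]. }
  assert (Hq1 : (q - 1 = - (2 * Ci * sin al) * e1)%C).
  { assert (Einv : (e1 * (cos al + sin al * Ci))%C = RtoC 1).
    { unfold e1. rewrite <- Cexp_Ci, <- Cexp_plus, RtoC_opp. replace (- al * Ci + al * Ci)%C with (RtoC 0) by ring. apply Cexp_0. }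
    transitivity (e1 * e1 - e1 * (cos al + sin al * Ci))%C; [rewrite Einv; reflexivity|].
    replace e1 with (cos al - sin al * Ci)%C at 2; [ring|].
    unfold e1. rewrite Cexp_Ci, cos_neg, sin_neg, RtoC_opp. ring. }
  assert (HCi : Ci <> RtoC 0) by apply Ci_nz.
  assert (H2 : RtoC 2 <> RtoC 0) by (apply RtoC_neq0; lra).
  assert (HT : Csum (fun l => INR l * q ^ l)%C N = (INR N / (q - 1))%C).
  { assert (K := Csum_geom_weighted q N). rewrite HS0, HqN in K.
    assert (Hqn : (q - 1)%C <> RtoC 0).
    { rewrite Hq1. apply Cmult_neq_0; [|exact He1]. intros E. apply (Cmult_neq_0 (2 * Ci) (sin al)); [apply Cmult_neq_0; assumption | exact HsinC|].
      transitivity (- - (2 * Ci * sin al))%C; [ring | rewrite E; ring]. }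
    transitivity (/ (q - 1) * ((q - 1) * Csum (fun l => INR l * q ^ l) N))%C; [field; exact Hqn | rewrite K; field; exact Hqn]. }
  unfold L0. fold kap.
  rewrite (Csum_ext _ (fun l => (W * e1 * ((Clog w + PI * (1 - INR N) * Ci) / INR N)) * q ^ l + (W * e1 * (2 * PI * Ci / INR N)) * (INR l * q ^ l))%C).
  - rewrite Csum_plus, !Csum_scal. change (Csum (Cpow q) N) with (Csum (fun l => q ^ l)%C N).
    rewrite HS0, HT, Hq1.
    assert (HCi2 : (Ci * Ci)%C = RtoC (-1)) by (unfold Ci, Cmult, RtoC; simpl; f_equal; ring).
    field. repeat split; auto.
  - intros l Hl. rewrite Hroot, Clog_mroot by assumption.
    rewrite RtoC_mult, RtoC_minus, RtoC_plus, RtoC_mult. field. exact HNn.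
Qed.

Lemma slit_inv x : slit_plane x -> slit_plane (/ x)%C /\ Clog (/ x)%C = (- Clog x)%C.
Proof.
  intros Hx. assert (Hx0 := slit_neq_0 x Hx). assert (Ha := slit_Carg x Hx).
  assert (E : (/ x)%C = Cexp (- Clog x)%C) by (rewrite Cexp_opp, Cexp_Clog by exact Hx0; reflexivity).
  assert (El : Clog (/ x)%C = (- Clog x)%C) by (rewrite E; apply Clog_Cexp; simpl; lra).
  split; [|exact El]. apply Carg_slit.
  - rewrite E. apply Cexp_neq_0.
  - assert (K := f_equal Im El). simpl in K. rewrite K. lra.
Qed.

Lemma sector_inv d x : sector d x -> sector d (/ x)%C.
Proof.
  intros [Hx Ha]. destruct (slit_inv x Hx) as [H1 H2]. split; [exact H1|].
  assert (K := f_equal Im H2). simpl in K. rewrite K, Rabs_Ropp. exact Ha.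
Qed.

Lemma slit_div r x : 0 < r -> slit_plane x -> slit_plane (r / x)%C /\ Clog (r / x)%C = (ln r - Clog x)%C.
Proof.
  intros Hr Hx. destruct (slit_inv x Hx) as [H1 H2]. split; [apply slit_scal; assumption|].
  unfold Cdiv. rewrite Clog_scal, H2 by (try exact Hr; apply slit_neq_0, H1). ring.
Qed.

Lemma sector_div d r x : 0 < r -> sector d x -> sector d (r / x)%C.
Proof. intros Hr Hx. apply sector_scal; [exact Hr | apply sector_inv, Hx]. Qed.

(** * Stieltjes constants *)

Lemma Un_cv_of_increments (a g : nat -> R) : (forall n, Rabs (a (S n) - a n) <= g n) -> Rbdd g -> exists l, Un_cv a l.
Proof.
  intros H Hg. destruct (Csum_abs_cv (fun n => RtoC (a (S n) - a n)) g) as [l [Hl _]]; [intros; rewrite Cmod_R; apply H | exact Hg|].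
  exists (a O + Re l). assert (K := Ccv_Re _ _ Hl).
  intros eps He. destruct (K eps He) as [n0 Hn]. exists n0. intros n Hle. specialize (Hn n Hle).
  rewrite <- RtoC_Rsum in Hn. simpl in Hn.
  assert (E : Rsum (fun i => a (S i) - a i) n = a n - a O).
  { clear. induction n; simpl; [ring | rewrite IHn; ring]. }
  rewrite E in Hn. unfold R_dist in *. replace (a n - (a O + Re l)) with (a n - a O - Re l) by ring. exact Hn.
Qed.

Lemma ln_le_power x a : 0 < a -> 0 < x -> ln x <= Rpower x a / a.
Proof.
  intros Ha Hx. apply Rmult_le_reg_l with a; [exact Ha|]. replace (a * (Rpower x a / a)) with (Rpower x a) by (field; lra).
  unfold Rpower. assert (H : a * ln x + 1 <= exp (a * ln x)); [|lra].
  destruct (Req_dec (a * ln x) 0) as [E|E]; [rewrite E, exp_0; lra|].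
  rewrite Rplus_comm. left. apply exp_ineq1, E.
Qed.

Lemma stieltjes_cv j l :
  Un_cv (fun n => Rsum (fun i => ln (INR (S i)) ^ j / INR (S i)) n - ln (INR n) ^ S j / INR (S j)) l ->
  stieltjes j = l.
Proof.
  intros H. unfold stieltjes. rewrite (is_lim_seq_unique _ l); [reflexivity|].
  apply is_lim_seq_Reals. intros eps He. destruct (H eps He) as [n0 Hn]. exists n0. intros n Hle.
  rewrite (Rsum_sum_n_m (fun i => ln (INR i) ^ j / INR i)). apply Hn, Hle.
Qed.

Lemma stieltjes_0 : Un_cv (fun n => Rsum (fun i => / INR (S i)) n - ln (INR n)) (stieltjes 0).
Proof.
  destruct (Un_cv_of_increments (fun n => Rsum (fun i => / INR (S i)) (S n) - ln (INR (S n))) (fun n => / INR (S n) ^ 2)) as [l Hl].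
  - intros n. rewrite (Rsum_S _ (S n)). assert (H := ln_step (S n) ltac:(lia)). apply Rabs_le. lra.
  - apply Rbdd_inv_sq.
  - assert (Hl' : Un_cv (fun n => Rsum (fun i => / INR (S i)) n - ln (INR n)) l).
    { intros eps He. destruct (Hl eps He) as [n0 Hn]. exists (S n0). intros n Hle. destruct n as [|n]; [lia|]. apply Hn. lia. }
    rewrite (stieltjes_cv 0 l); [exact Hl'|].
    intros eps He. destruct (Hl' eps He) as [n0 Hn]. exists n0. intros n Hle. specialize (Hn n Hle).
    rewrite (Rsum_ext _ (fun i => / INR (S i))) by (intros; simpl; unfold Rdiv; ring).
    replace (ln (INR n) ^ 1 / INR 1) with (ln (INR n)) by (change (INR 1) with 1; field). exact Hn.
Qed.

Lemma stieltjes_1 : Un_cv (fun n => Rsum (fun i => ln (INR (S i)) / INR (S i)) n - ln (INR n) ^ 2 / 2) (stieltjes 1).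
Proof.
  destruct (Un_cv_of_increments (fun n => Rsum (fun i => ln (INR (S i)) / INR (S i)) (S n) - ln (INR (S n)) ^ 2 / 2)
     (fun n => 8 * Rpower (INR (S n)) (- (3 / 2)) + 2 * / INR (S n) ^ 2)) as [l Hl].
  - intros n. rewrite (Rsum_S _ (S n)). set (u := INR (S n)). set (v := INR (S (S n))).
    assert (Hu : 1 <= u) by (unfold u; rewrite S_INR; assert (H := pos_INR n); lra).
    assert (Hv : v = u + 1) by apply S_INR.
    assert (H := ln_step (S n) ltac:(lia)). fold u v in H. set (d := ln v - ln u) in *.
    assert (Hu2 : 0 < / u ^ 2) by (apply Rinv_0_lt_compat, pow_lt; lra).
    assert (Hvi : 0 < / v <= / u) by (split; [apply Rinv_0_lt_compat; lra | apply Rinv_le_contravar; lra]).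
    (* In this form both parts are small: |1/v - d| <= u^(-2) while ln v = O(u^(1/2)), and d <= 2/u.
       The increments are therefore O(u^(-3/2)). *)
    replace (Rsum (fun i => ln (INR (S i)) / INR (S i)) (S n) + ln v / v - ln v ^ 2 / 2 - (Rsum (fun i => ln (INR (S i)) / INR (S i)) (S n) - ln u ^ 2 / 2))
      with (ln v * (/ v - d) + d ^ 2 / 2) by (unfold d; field; lra).
    assert (Hlv0 : 0 <= ln v) by (rewrite <- ln_1; apply ln_le; lra).
    assert (Hlv : ln v <= 4 * Rpower u (1 / 2)).
    { apply Rle_trans with (Rpower v (1 / 2) / (1 / 2)); [apply ln_le_power; lra|].
      assert (K : Rpower v (1 / 2) <= 2 * Rpower u (1 / 2)).
      { apply Rle_trans with (Rpower (4 * u) (1 / 2)); [apply Rle_Rpower_l; lra|].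
        rewrite <- Rpower_mult_distr by lra. replace (Rpower 4 (1 / 2)) with 2; [lra|].
        replace 4 with (2 ^ 2) by ring. rewrite <- Rpower_pow by lra. rewrite Rpower_mult.
        change (INR 2) with 2. replace (2 * (1 / 2)) with 1 by field. rewrite Rpower_1; lra. }
      lra. }
    assert (Hdu : d <= 2 * / u).
    { assert (/ u ^ 2 <= / u) by (apply Rinv_le_contravar; nra). lra. }
    assert (Hd0 : 0 < d) by lra.
    eapply Rle_trans; [apply Rabs_triang|]. apply Rplus_le_compat.
    + rewrite Rabs_mult, (Rabs_right (ln v)) by lra. rewrite Rabs_left1 by lra.
      apply Rle_trans with (4 * Rpower u (1 / 2) * / u ^ 2); [apply Rmult_le_compat; lra|].
      replace (Rpower u (- (3 / 2))) with (Rpower u (1 / 2) * / u ^ 2).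
      * assert (0 <= Rpower u (1 / 2) * / u ^ 2) by (apply Rmult_le_pos; [left; apply exp_pos | lra]). lra.
      * rewrite <- Rpower_pow by lra. change (INR 2) with 2. rewrite <- Rpower_Ropp, <- Rpower_plus. f_equal. field.
    + rewrite Rabs_right by (apply Rle_ge; nra).
      apply Rle_trans with ((2 * / u) ^ 2 / 2); [|right; field; lra].
      assert (d ^ 2 <= (2 * / u) ^ 2) by (apply pow_incr; lra). lra.
  - apply Rbdd_plus; apply Rbdd_scal; try lra; [apply Rbdd_power; lra | apply Rbdd_inv_sq].
  - assert (Hl' : Un_cv (fun n => Rsum (fun i => ln (INR (S i)) / INR (S i)) n - ln (INR n) ^ 2 / 2) l).
    { intros eps He. destruct (Hl eps He) as [n0 Hn]. exists (S n0). intros n Hle. destruct n as [|n]; [lia|]. apply Hn. lia. }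
    rewrite (stieltjes_cv 1 l); [exact Hl'|].
    intros eps He. destruct (Hl' eps He) as [n0 Hn]. exists n0. intros n Hle. specialize (Hn n Hle).
    rewrite (Rsum_ext _ (fun i => ln (INR (S i)) / INR (S i))) by (intros; rewrite pow_1; reflexivity).
    change (INR 2) with 2. exact Hn.
Qed.

Lemma INR_S_ge1 n : 1 <= INR (S n).
Proof. rewrite S_INR. assert (H := pos_INR n). lra. Qed.

Lemma Rpower_nat_neg n k : Rpower (INR (S n)) (- INR k) = / INR (S n) ^ k.
Proof. rewrite Rpower_Ropp, Rpower_pow; [reflexivity | apply lt_0_INR; lia]. Qed.

Lemma zeta_nat_cv k : (2 <= k)%nat -> Ccv (Csum (fun n => / INR (S n) ^ k)%C) (zeta (INR k)).
Proof.
  intros Hk. apply Ccv_ext with (Csum (fun n => RtoC (Rpower (INR (S n)) (- INR k)))).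
  - intros n. apply Csum_ext. intros i _. rewrite Rpower_nat_neg, RtoC_inv, RtoC_pow by (apply pow_nonzero, not_0_INR; lia). reflexivity.
  - apply zeta_real_cv. apply Rlt_le_trans with (INR 2); [change (INR 2) with 2; lra | apply le_INR, Hk].
Qed.

(** * Summing the reflected partial fractions *)

Definition ynx (N : nat) (x : C) (n : nat) : C := (INR (S n) ^ N * x)%C.

Definition Fterm (k N : nat) (x : C) (n : nat) : C :=
  ((digamma (ynx N x n) - Clog (ynx N x n)) / INR (S n) ^ k)%C.

Lemma ynx_scal N x n : ynx N x n = (RtoC (INR (S n) ^ N) * x)%C.
Proof. unfold ynx. rewrite RtoC_pow. reflexivity. Qed.

Lemma INR_S_pow_ge1 n N : 1 <= INR (S n) ^ N.
Proof. apply pow_R1_Rle, INR_S_ge1. Qed.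

Lemma sector_ynx d N x n : sector d x -> sector d (ynx N x n).
Proof. intros H. rewrite ynx_scal. apply sector_scal; [assert (K := INR_S_pow_ge1 n N); lra | exact H]. Qed.

Lemma slit_ynx N x n : slit_plane x -> slit_plane (ynx N x n).
Proof. intros H. rewrite ynx_scal. apply slit_scal; [assert (K := INR_S_pow_ge1 n N); lra | exact H]. Qed.

Lemma Cmod_ynx N x n : Cmod (ynx N x n) = INR (S n) ^ N * Cmod x.
Proof. rewrite ynx_scal, Cmod_mult, Cmod_R, Rabs_right by (assert (K := INR_S_pow_ge1 n N); lra). reflexivity. Qed.

Lemma Clog_ynx N x n : slit_plane x -> Clog (ynx N x n) = (INR N * ln (INR (S n)) + Clog x)%C.
Proof.
  intros Hx. rewrite ynx_scal, Clog_scal by (try (apply slit_neq_0, Hx); assert (K := INR_S_pow_ge1 n N); lra).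
  rewrite ln_pow by (apply lt_0_INR; lia). rewrite RtoC_mult. reflexivity.
Qed.

Lemma scriptF_nat k N x : scriptF (INR k) (INR N) x = CSeries (Fterm k N x).
Proof.
  unfold scriptF. f_equal. apply functional_extensionality. intros n. unfold Fterm, ynx.
  rewrite !Rpower_pow by (apply lt_0_INR; lia). rewrite !RtoC_pow. reflexivity.
Qed.

(** From the index where |n^N x| >= R0 on, digamma y - log y is O(1/y), so the terms are
    O(n^(-N-k)), which is at worst O(n^(-2)). *)
Lemma Fterm_cv k N x : (1 <= k)%nat -> (1 <= N)%nat -> slit_plane x -> Ccv (Csum (Fterm k N x)) (scriptF (INR k) (INR N) x).
Proof.
  intros Hk HN Hx. rewrite scriptF_nat. apply CSeries_correct with (fun n => Cmod (Fterm k N x n)); [intros; lra|].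
  destruct (slit_sector x Hx) as [d [Hd Hs]]. destruct (digamma_asymp 0 d Hd) as [R0 [B [HR0 [HB HA]]]].
  assert (Hmx : 0 < Cmod x) by (apply Cmod_gt_0, slit_neq_0, Hx).
  destruct (INR_unbounded (R0 / Cmod x)) as [n0 Hn0].
  apply (Rbdd_shift _ n0); [intros; apply Cmod_ge_0|].
  apply Rbdd_le with (fun i => B / Cmod x * / INR (S i) ^ 2).
  2: { apply Rbdd_scal; [|apply Rbdd_inv_sq]. apply Rmult_le_pos; [exact HB | left; apply Rinv_0_lt_compat, Hmx]. }
  intros i. set (n := (n0 + i)%nat). set (y := ynx N x n). set (v := INR (S n)).
  assert (Hv : 1 <= v) by apply INR_S_ge1.
  assert (Hvi : INR (S i) <= v) by (apply le_INR; unfold n; lia). assert (Hi := INR_S_ge1 i).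
  assert (Hvn : INR n0 <= v) by (apply le_INR; unfold n; lia).
  assert (HvN : v <= v ^ N) by (rewrite <- (pow_1 v) at 1; apply Rle_pow; assumption).
  assert (Hvk : v <= v ^ k) by (rewrite <- (pow_1 v) at 1; apply Rle_pow; assumption).
  assert (Hy : Cmod y = v ^ N * Cmod x) by apply Cmod_ynx.
  assert (HyR : R0 <= Cmod y).
  { rewrite Hy. apply Rle_trans with (v * Cmod x); [|apply Rmult_le_compat_r; lra].
    apply Rle_trans with (R0 / Cmod x * Cmod x); [right; field; lra | apply Rmult_le_compat_r; lra]. }
  specialize (HA y (sector_ynx d N x n Hs) HyR). simpl Csum in HA. rewrite pow_1 in HA.
  unfold Fterm. fold y v. replace (digamma y - Clog y)%C with (digamma y - Clog y - 0)%C by ring.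
  rewrite <- RtoC_pow, Cmod_div, Cmod_R, Rabs_right by (try apply RtoC_neq0; lra).
  apply Rle_trans with (B / Cmod y / v ^ k); [apply Rmult_le_compat_r; [left; apply Rinv_0_lt_compat; lra | exact HA]|].
  rewrite Hy. replace (B / (v ^ N * Cmod x) / v ^ k) with (B / Cmod x * / (v ^ N * v ^ k)) by (field; repeat split; lra).
  apply Rmult_le_compat_l; [apply Rmult_le_pos; [exact HB | left; apply Rinv_0_lt_compat, Hmx]|].
  apply Rinv_le_contravar; [apply pow_lt; lra|]. simpl. rewrite Rmult_1_r. apply Rmult_le_compat; lra.
Qed.

(** Valid exactly for every L and fixed x, so that the limit in L can be evaluated independently on
    both sides afterwards. *)
Lemma F_decomposition k N x (s : nat -> C) L : (1 <= k)%nat -> (1 <= N)%nat -> slit_plane x ->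
  (forall m, Ccv (Csum (Sterm k N (INR (S m) / x))) (s m)) ->
  Ccv (Csum (fun n => (digamma (ynx N x n + INR L + 1) - Clog (ynx N x n)) / INR (S n) ^ k)%C)
    (scriptF (INR k) (INR N) x + zeta (INR k + INR N) / x + Csum (fun m => / INR (S m) * s m) L)%C.
Proof.
  intros Hk HN Hx Hs. assert (Hx0 := slit_neq_0 x Hx).
  apply Ccv_ext with (fun P => Csum (Fterm k N x) P + / x * Csum (fun n => / INR (S n) ^ (k + N)) P + Csum (fun m => / INR (S m) * Csum (Sterm k N (INR (S m) / x)) P) L)%C.
  - intros P. rewrite <- Csum_scal.
    rewrite (Csum_ext (fun m => / INR (S m) * Csum (Sterm k N (INR (S m) / x)) P)%C (fun m => Csum (fun n => / INR (S m) * Sterm k N (INR (S m) / x) n) P)%C)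
      by (intros; rewrite Csum_scal; reflexivity).
    rewrite Csum_swap, <- !Csum_plus. apply Csum_ext. intros n _.
    set (y := ynx N x n). assert (Hy : slit_plane y) by (apply slit_ynx, Hx).
    assert (Hn := INR_S_neq0 n). assert (Hnk := Cpow_nz _ k Hn). assert (HnN := Cpow_nz _ N Hn).
    replace (y + INR L + 1)%C with (y + INR (S L))%C by (rewrite S_INR, RtoC_plus; ring).
    rewrite digamma_shift_n, Csum_S_l by exact Hy. change (INR 0) with 0.
    rewrite (Csum_ext (fun m => / INR (S m) * Sterm k N (INR (S m) / x) n)%C (fun m => / INR (S n) ^ k * / (y + INR (S m)))%C).
    + rewrite Csum_scal, Cpow_add_r. unfold Fterm. fold y. replace (y + 0)%C with y by ring.
      replace (/ x * / (INR (S n) ^ k * INR (S n) ^ N))%C with (/ y / INR (S n) ^ k)%C by (unfold y, ynx; field; auto).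
      field. split; [apply slit_neq_0, Hy | exact Hnk].
    + intros m _. unfold Sterm. assert (Hm := INR_S_neq0 m).
      assert (H1 : (y + INR (S m))%C <> RtoC 0) by (apply slit_add_neq0; [exact Hy | apply pos_INR]).
      assert (H2 : (INR (S m) / x + INR (S n) ^ N)%C <> RtoC 0).
      { intros E. apply H1. unfold y, ynx. transitivity (x * (INR (S m) / x + INR (S n) ^ N))%C; [field; exact Hx0 | rewrite E; ring]. }
      replace (INR (S m) / x / (INR (S m) / x + INR (S n) ^ N))%C with (INR (S m) / (y + INR (S m)))%C.
      * field. auto.
      * unfold y, ynx in *. field. split; [exact Hx0 | rewrite Cplus_comm; exact H1].
  - apply Ccv_plus; [apply Ccv_plus|].
    + apply Fterm_cv; assumption.
    + apply Ccv_eq with (/ x * zeta (RtoC (INR (k + N))))%C; [rewrite plus_INR, RtoC_plus; unfold Cdiv; ring|].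
      apply Ccv_scal. apply zeta_nat_cv. lia.
    + apply Ccv_Csum_fin. intros m _. apply Ccv_scal, Hs.
Qed.

(** The part c0 + L0 of S(m/x) is subtracted because its sum against 1/m diverges; the divergence
    cancels later against the sum containing digamma(y + L + 1). The powers (-x/m)^i / m sum to
    zeta(1 + i), and the errors to O(|x|^(M+1)). *)
Lemma tail_sum (k N M : nat) (d : R) (c0 : C) : (1 <= k <= N)%nat -> 0 < d < PI ->
  Ccv (fun P => Csum (fun n => / INR (S n) ^ k) P - (if (k =? 1)%nat then RtoC (ln (INR P)) else 0))%C c0 ->
  exists r T, 0 < r /\ 0 <= T /\ forall x, sector d x -> Cmod x < r ->
    exists (s : nat -> C) (E : C),
      (forall m, Ccv (Csum (Sterm k N (INR (S m) / x))) (s m)) /\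
      Cmod E <= T * Cmod x ^ S M /\
      Ccv (fun L => Csum (fun m => / INR (S m) * s m) L - Csum (fun m => / INR (S m) * (c0 + L0 k N (INR (S m) / x))) L)%C
        (Csum (fun i => zeta (INR k - INR (S i) * INR N) * zeta (1 + INR (S i)) * (- x) ^ S i) M + E)%C.
Proof.
  intros Hk Hd Hc0. destruct (S_asymp k N M d c0 Hk Hd Hc0) as [R0 [B [HR0 [HB HA]]]].
  destruct Rbdd_inv_sq as [Q HQ]. assert (HQ0 : 0 <= Q) by (specialize (HQ O); exact HQ).
  (* The radius 1 / R0 puts all points m/x with m >= 1 in the range of [S_asymp]; Q bounds the sum
     of m^(-2). *)
  exists (/ R0), (B * Q). split; [apply Rinv_0_lt_compat, HR0|]. split; [apply Rmult_le_pos; assumption|].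
  intros x Hs Hxr. assert (Hx : slit_plane x) by apply Hs. assert (Hx0 := slit_neq_0 x Hx).
  assert (Hmx : 0 < Cmod x) by (apply Cmod_gt_0, Hx0).
  assert (Hw : forall m, sector d (INR (S m) / x)%C) by (intros m; apply sector_div; [apply lt_0_INR; lia | exact Hs]).
  assert (Hmw : forall m, Cmod (INR (S m) / x)%C = INR (S m) / Cmod x).
  { intros m. rewrite Cmod_div, Cmod_R, Rabs_right by (try exact Hx0; apply Rle_ge, pos_INR). reflexivity. }
  assert (HwR : forall m, R0 <= Cmod (INR (S m) / x)%C).
  { intros m. rewrite Hmw. assert (H1 := INR_S_ge1 m). apply Rmult_le_reg_r with (Cmod x); [exact Hmx|].
    unfold Rdiv. rewrite Rmult_assoc, Rinv_l by lra.
    apply Rle_trans with (R0 * / R0); [apply Rmult_le_compat_l; lra | rewrite Rinv_r; lra]. }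
  set (s := fun m => proj1_sig (constructive_indefinite_description _ (HA _ (Hw m) (HwR m)))).
  assert (Hs1 : forall m, Ccv (Csum (Sterm k N (INR (S m) / x))) (s m)).
  { intros m. unfold s. destruct (constructive_indefinite_description _ _) as [u [Hu1 Hu2]]. exact Hu1. }
  assert (Hs2 : forall m, Cmod (s m - (c0 + L0 k N (INR (S m) / x) + Csum (fun i => zeta (INR k - INR (S i) * INR N) * (- / (INR (S m) / x)) ^ S i) M))%C <= B / Cmod (INR (S m) / x)%C ^ S M).
  { intros m. unfold s. destruct (constructive_indefinite_description _ _) as [u [Hu1 Hu2]]. exact Hu2. }
  clearbody s.
  set (e := fun m => (s m - (c0 + L0 k N (INR (S m) / x) + Csum (fun i => zeta (INR k - INR (S i) * INR N) * (- / (INR (S m) / x)) ^ S i) M))%C) in *.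
  assert (He : forall m, Cmod (/ INR (S m) * e m)%C <= (B * Cmod x ^ S M) * / INR (S m) ^ 2).
  { intros m. rewrite Cmod_mult, Cmod_inv by apply INR_S_neq0. rewrite Cmod_R, Rabs_right by (apply Rle_ge, pos_INR).
    assert (H1 := INR_S_ge1 m). assert (K := Hs2 m). fold (e m) in K. rewrite Hmw in K.
    assert (Hp : INR (S m) <= INR (S m) ^ S M) by (rewrite <- (pow_1 (INR (S m))) at 1; apply Rle_pow; [exact H1 | lia]).
    assert (Hpx : 0 < Cmod x ^ S M) by (apply pow_lt, Hmx).
    apply Rle_trans with (/ INR (S m) * (B * Cmod x ^ S M * / INR (S m))).
    - apply Rmult_le_compat_l; [left; apply Rinv_0_lt_compat; lra|]. eapply Rle_trans; [exact K|].
      unfold Rdiv. rewrite Rpow_mult_distr, pow_inv.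
      replace (B * / (INR (S m) ^ S M * / Cmod x ^ S M)) with (B * Cmod x ^ S M * / INR (S m) ^ S M) by (field; split; lra).
      apply Rmult_le_compat_l; [apply Rmult_le_pos; lra | apply Rinv_le_contravar; lra].
    - right. field. lra. }
  assert (HBx : 0 <= B * Cmod x ^ S M) by (apply Rmult_le_pos; [exact HB | apply pow_le; lra]).
  destruct (Csum_abs_cv _ _ He) as [E [HE HEb]]; [apply Rbdd_scal; [exact HBx | exists Q; exact HQ]|].
  exists s, E. split; [exact Hs1|]. split.
  - assert (K := HEb (B * Q * Cmod x ^ S M)).
    assert (K0 : forall n, Rsum (fun m => B * Cmod x ^ S M * / INR (S m) ^ 2) n <= B * Q * Cmod x ^ S M).
    { intros n. rewrite Rsum_scal. replace (B * Q * Cmod x ^ S M) with (B * Cmod x ^ S M * Q) by ring. apply Rmult_le_compat_l; [exact HBx | apply HQ]. }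
    specialize (K K0 O). simpl Rsum in K. simpl Csum in K. replace (E - 0)%C with E in K by ring. lra.
  - apply Ccv_ext with (fun L => Csum (fun i => zeta (INR k - INR (S i) * INR N) * (- x) ^ S i * Csum (fun m => / INR (S m) ^ (1 + S i)) L) M + Csum (fun m => / INR (S m) * e m) L)%C.
    + intros L. rewrite (Csum_ext _ (fun i => Csum (fun m => zeta (INR k - INR (S i) * INR N) * (- x) ^ S i * / INR (S m) ^ (1 + S i)) L)%C) by (intros; rewrite Csum_scal; reflexivity).
      rewrite Csum_swap, <- Csum_minus, <- Csum_plus. apply Csum_ext. intros m _. unfold e.
      assert (Hm := INR_S_neq0 m).
      rewrite (Csum_ext (fun i => zeta (INR k - INR (S i) * INR N) * (- x) ^ S i * / INR (S m) ^ (1 + S i))%C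
         (fun i => / INR (S m) * (zeta (INR k - INR (S i) * INR N) * (- / (INR (S m) / x)) ^ S i))%C); [rewrite Csum_scal; ring|].
      intros i _. replace (- / (INR (S m) / x))%C with (- x * / INR (S m))%C by (field; auto).
      rewrite Cpow_mult_l, Cpow_inv by exact Hm. change (1 + S i)%nat with (S (S i)). rewrite (Cpow_S _ (S i)).
      assert (Hp := Cpow_nz _ (S i) Hm). revert Hp. generalize (INR (S m) ^ S i)%C. intros p Hp. field. auto.
    + apply Ccv_plus; [|exact HE]. apply Ccv_Csum_fin. intros i _.
      apply Ccv_eq with (zeta (INR k - INR (S i) * INR N) * (- x) ^ S i * zeta (RtoC (INR (1 + S i))))%C.
      { rewrite plus_INR, RtoC_plus. change (INR 1) with 1. ring. }
      apply Ccv_scal, zeta_nat_cv. lia.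
Qed.

(** What [scriptB] contributes for k = N: the powers x^((N-1)/N) and x^(1/N) multiply to x, the sign
    is (-1)^(2N+1), and the zeta value is at 2. *)
Definition Bterm (k N : nat) (x : C) : C := if (k =? N)%nat then (- zeta 2 * x)%C else RtoC 0.

Lemma Cpower_plus x a b : Cpower x (a + b)%C = (Cpower x a * Cpower x b)%C.
Proof. unfold Cpower. rewrite <- Cexp_plus. f_equal. ring. Qed.

Lemma Cpower_1 x : x <> RtoC 0 -> Cpower x 1 = x.
Proof. intros H. unfold Cpower. rewrite Cmult_1_l. apply Cexp_Clog, H. Qed.

Lemma scriptB_eq k N x : (1 <= k <= N)%nat -> x <> RtoC 0 ->
  (Cpower x ((INR k - 1) / INR N) * scriptB k N x)%C = Bterm k N x.
Proof.
  intros Hk Hx. unfold scriptB, Bterm. destruct (Nat.eqb_spec k N) as [->|Hne]; [|ring].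
  assert (HN : RtoC (INR N) <> RtoC 0) by (apply RtoC_neq0, not_0_INR; lia).
  replace ((-1) ^ (N + N + 1))%C with (RtoC (-1)).
  2: { rewrite <- RtoC_pow. replace (N + N + 1)%nat with (S (2 * N)) by lia. rewrite <- tech_pow_Rmult, pow_1_even. f_equal. ring. }
  replace (1 + INR N / INR N)%C with (RtoC 2) by (field; exact HN).
  transitivity (- (Cpower x ((INR N - 1) / INR N) * Cpower x (1 / INR N)) * zeta 2)%C; [ring|].
  rewrite <- Cpower_plus. replace ((INR N - 1) / INR N + 1 / INR N)%C with (RtoC 1) by (field; exact HN).
  rewrite Cpower_1 by exact Hx. ring.
Qed.

Lemma scriptB_1 N x : (1 <= N)%nat -> x <> RtoC 0 -> scriptB 1 N x = Bterm 1 N x.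
Proof.
  intros HN Hx. rewrite <- scriptB_eq by (try exact Hx; lia).
  replace ((INR 1 - 1) / INR N)%C with (RtoC 0).
  - unfold Cpower. replace (0 * Clog x)%C with (RtoC 0) by ring. rewrite Cexp_0. ring.
  - change (INR 1) with 1. unfold Cdiv. ring.
Qed.

(** By parity: zeta(k - m N) is [dcoef] q with q = m N - (k - 1), nonzero for q >= 2 only if q is
    even, and for even q the sign (-1)^k (-1)^(m(N+1)) is -(-1)^m. The exception q = 1 means k = N
    and m = 1; there the sign is wrong and zeta(0) = -1/2, so the correction is twice the term,
    namely [Bterm]. *)
Lemma expansion_sum (k N M : nat) (x : C) : (1 <= k <= N)%nat ->
  (Bterm k N x + Csum (fun i => ((-1) ^ k * ((-1) ^ (S i * (N + 1)) * zeta (INR k - INR (S i) * INR N) * zeta (1 + INR (S i)))) * x ^ S i) (S M))%C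
   = (- Csum (fun i => zeta (INR k - INR (S i) * INR N) * zeta (1 + INR (S i)) * (- x) ^ S i) (S M))%C.
Proof.
  intros Hk.
  set (a := fun i => (((-1) ^ k * ((-1) ^ (S i * (N + 1)) * zeta (INR k - INR (S i) * INR N) * zeta (1 + INR (S i)))) * x ^ S i)%C).
  set (b := fun i => (zeta (INR k - INR (S i) * INR N) * zeta (1 + INR (S i)) * (- x) ^ S i)%C).
  assert (Hneg : forall j, ((- x) ^ j = RtoC ((-1) ^ j) * x ^ j)%C).
  { intros j. replace (- x)%C with (RtoC (-1) * x)%C by ring. rewrite Cpow_mult_l, <- RtoC_pow. reflexivity. }
  assert (Hodd : forall m, (-1) ^ S (2 * m) = -1) by (intros m; rewrite <- tech_pow_Rmult, pow_1_even; ring).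
  assert (Hgen : forall i, (S i * N - (k - 1) <> 1)%nat -> a i = (- b i)%C).
  { intros i Hi. unfold a, b. rewrite zeta_dcoef by lia. rewrite Hneg, <- !RtoC_pow. set (q := (S i * N - (k - 1))%nat) in *.
    assert (HqN : (N <= S i * N)%nat) by nia.
    assert (Hq : (2 <= q)%nat) by (unfold q; unfold q in Hi; lia).
    destruct (Nat.Even_or_Odd q) as [[m E]|[m E]].
    - assert (Hs : (-1) ^ k * (-1) ^ (S i * (N + 1)) = - (-1) ^ S i).
      { replace (S i * (N + 1))%nat with (q + (k - 1) + S i)%nat by (unfold q; lia). rewrite !pow_add, E, pow_1_even.
        transitivity (((-1) ^ k * (-1) ^ (k - 1)) * (-1) ^ S i); [ring|]. rewrite <- pow_add.
        replace (k + (k - 1))%nat with (S (2 * (k - 1))) by lia. rewrite Hodd. ring. }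
      transitivity (RtoC ((-1) ^ k * (-1) ^ (S i * (N + 1))) * dcoef q * zeta (1 + INR (S i)) * x ^ S i)%C; [rewrite RtoC_mult; ring|].
      rewrite Hs, RtoC_opp. ring.
    - destruct m as [|m]; [lia|]. replace q with (S (2 * S m)) by lia. rewrite dcoef_odd. ring. }
  unfold Bterm. destruct (Nat.eqb_spec k N) as [->|Hne].
  - rewrite (Csum_S_l a), (Csum_S_l b). rewrite (Csum_ext (fun i => a (S i)) (fun i => RtoC (-1) * b (S i))%C).
    + rewrite Csum_scal. unfold a, b at 2. rewrite zeta_dcoef by lia. replace (1 * N - (N - 1))%nat with 1%nat by lia.
      rewrite dcoef_1, <- !RtoC_pow. replace (1 * (N + 1))%nat with (N + 1)%nat by lia.
      assert (Hs : (-1) ^ N * (-1) ^ (N + 1) = -1).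
      { rewrite <- pow_add. replace (N + (N + 1))%nat with (S (2 * N)) by lia. apply Hodd. }
      replace (1 + INR 1)%C with (RtoC 2) by (change (INR 1) with 1; ring).
      replace (RtoC ((-1) ^ N) * (RtoC ((-1) ^ (N + 1)) * RtoC (- / 2) * zeta 2) * x ^ 1)%C with
        (RtoC ((-1) ^ N * (-1) ^ (N + 1)) * RtoC (- / 2) * zeta 2 * x ^ 1)%C by (rewrite RtoC_mult; ring).
      rewrite Hs, RtoC_opp, RtoC_inv by lra. simpl. field.
    + intros i Hi. rewrite Hgen by nia. ring.
  - rewrite (Csum_ext a (fun i => RtoC (-1) * b i)%C); [rewrite Csum_scal; ring|].
    intros i _. rewrite Hgen by nia. ring.
Qed.

(** A second-order estimate in h is summed over n. With l = ln n, the factors l^2 and exp(|h| l) for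
    |h| < 1/4 cost n^(1/4) each up to the constant 64, and p >= 2 still leaves the summable
    n^(-3/2). *)
Lemma zeta_derivative p : 2 <= p ->
  exists D, Ccv (Csum (fun n => RtoC (ln (INR (S n)) * Rpower (INR (S n)) (- p)))) D /\ C_derive zeta (RtoC p) = (- D)%C.
Proof.
  intros Hp.
  assert (Hln0 : forall n, 0 <= ln (INR (S n))) by (intros n; rewrite <- ln_1; apply ln_le; [lra | apply INR_S_ge1]).
  assert (Hln : forall n, ln (INR (S n)) <= 8 * Rpower (INR (S n)) (1 / 8)).
  { intros n. eapply Rle_trans; [apply (ln_le_power _ (1 / 8)); [lra | apply lt_0_INR; lia]|]. right. field. }
  assert (Hmono : forall n a b, a <= b -> Rpower (INR (S n)) a <= Rpower (INR (S n)) b).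
  { intros n a b Hab. destruct (Req_dec (INR (S n)) 1) as [E|E].
    - rewrite E. unfold Rpower. rewrite ln_1, !Rmult_0_r. lra.
    - apply Rle_Rpower; [|exact Hab]. apply INR_S_ge1. }
  destruct (Csum_abs_cv (fun n => RtoC (ln (INR (S n)) * Rpower (INR (S n)) (- p))) (fun n => 8 * Rpower (INR (S n)) (- (3 / 2)))) as [D [HD _]].
  { intros n. rewrite Cmod_R, Rabs_right.
    - apply Rle_trans with (8 * Rpower (INR (S n)) (1 / 8) * Rpower (INR (S n)) (- p)).
      + apply Rmult_le_compat_r; [left; apply exp_pos | apply Hln].
      + rewrite Rmult_assoc, <- Rpower_plus. apply Rmult_le_compat_l; [lra|]. apply Hmono. lra.
    - apply Rle_ge, Rmult_le_pos; [apply Hln0 | left; apply exp_pos]. }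
  { apply Rbdd_scal; [lra | apply Rbdd_power; lra]. }
  exists D. split; [exact HD|].
  destruct (Rbdd_power (3 / 2) ltac:(lra)) as [Q HQ].
  apply C_derive_real with (B := 64 * Q) (r := 1 / 4); [lra|].
  intros h Hh0 Hh. rewrite <- RtoC_plus.
  apply Rabs_def2 in Hh.
  assert (H1 := zeta_real_cv (p + h) ltac:(lra)). assert (H2 := zeta_real_cv p ltac:(lra)).
  assert (H := Ccv_minus _ _ _ _ (Ccv_minus _ _ _ _ H1 H2) (Ccv_scal (- h)%C _ _ HD)).
  replace (zeta (RtoC (p + h)) - zeta (RtoC p) - h * - D)%C with (zeta (RtoC (p + h)) - zeta (RtoC p) - - h * D)%C by ring.
  apply Ccv_le with (2 := H). exists O. intros n _.
  rewrite <- Csum_scal, <- !Csum_minus.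
  eapply Rle_trans; [apply Cmod_Csum_le with (g := fun n => (64 * h ^ 2) * Rpower (INR (S n)) (- (3 / 2)))|].
  - intros i _. set (l := ln (INR (S i))). assert (Hl0 : 0 <= l) by apply Hln0.
    rewrite <- RtoC_opp, <- RtoC_mult, <- !RtoC_minus, Cmod_R.
    replace (Rpower (INR (S i)) (- (p + h)) - Rpower (INR (S i)) (- p) - - h * (l * Rpower (INR (S i)) (- p)))
      with (Rpower (INR (S i)) (- p) * (exp (- h * l) - 1 - - h * l)).
    2: { replace (Rpower (INR (S i)) (- (p + h))) with (Rpower (INR (S i)) (- p) * exp (- h * l)); [ring|].
         unfold Rpower. fold l. rewrite <- exp_plus. f_equal. ring. }
    rewrite Rabs_mult, Rabs_right by (left; apply exp_pos).
    assert (K := Cexp_bound2 (RtoC (- h * l))). rewrite Cexp_RtoC, <- !RtoC_minus, !Cmod_R in K.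
    assert (Ea : Rabs (- h * l) = Rabs h * l) by (rewrite Rabs_mult, Rabs_Ropp, (Rabs_right l); [reflexivity | lra]).
    rewrite Ea in K. assert (Hah : Rabs h <= 1 / 4) by (apply Rabs_le; lra).
    assert (Hexp : exp (Rabs h * l) <= Rpower (INR (S i)) (1 / 4)) by (unfold Rpower; fold l; apply exp_mono; nra).
    assert (Hl8 : l ^ 2 <= 64 * Rpower (INR (S i)) (1 / 4)).
    { apply Rle_trans with ((8 * Rpower (INR (S i)) (1 / 8)) ^ 2); [apply pow_incr; split; [exact Hl0 | apply Hln]|].
      right. replace (1 / 4) with (1 / 8 + 1 / 8) by field. rewrite Rpower_plus. ring. }
    apply Rle_trans with (Rpower (INR (S i)) (- p) * ((h ^ 2 * (64 * Rpower (INR (S i)) (1 / 4))) * Rpower (INR (S i)) (1 / 4))).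
    + apply Rmult_le_compat_l; [left; apply exp_pos|]. eapply Rle_trans; [exact K|].
      rewrite Rpow_mult_distr, pow2_abs. apply Rmult_le_compat; [|left; apply exp_pos | | exact Hexp].
      * apply Rmult_le_pos; apply pow2_ge_0.
      * apply Rmult_le_compat_l; [apply pow2_ge_0 | exact Hl8].
    + replace (Rpower (INR (S i)) (- p) * (h ^ 2 * (64 * Rpower (INR (S i)) (1 / 4)) * Rpower (INR (S i)) (1 / 4))) with
        (64 * h ^ 2 * (Rpower (INR (S i)) (- p) * Rpower (INR (S i)) (1 / 4) * Rpower (INR (S i)) (1 / 4))) by ring.
      apply Rmult_le_compat_l; [assert (K2 := pow2_ge_0 h); lra|]. rewrite <- !Rpower_plus. apply Hmono. lra.
  - rewrite Rsum_scal. replace (64 * Q * h ^ 2) with (64 * h ^ 2 * Q) by ring.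
    apply Rmult_le_compat_l; [assert (K2 := pow2_ge_0 h); lra | apply HQ].
Qed.

(** * The expansion at 0 for k > 1 *)

Lemma Cmod_Clog_sub_ln v (r lo hi : R) : 0 < lo -> 0 < r -> lo * r <= Cmod v -> Cmod v <= hi * r -> 1 <= hi ->
  v <> RtoC 0 -> Cmod (Clog v - ln r)%C <= Rabs (ln lo) + ln hi + PI.
Proof.
  intros Hlo Hr H1 H2 Hhi Hv. assert (HP := PI_RGT_0).
  assert (Hm : 0 < Cmod v) by (apply Cmod_gt_0, Hv).
  assert (Hhi0 : 0 <= ln hi) by (rewrite <- ln_1; apply ln_le; lra).
  eapply Rle_trans; [apply Cmod_le_abs|].
  replace (Re (Clog v - ln r)%C) with (ln (Cmod v) - ln r) by (unfold Clog; simpl; ring).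
  replace (Im (Clog v - ln r)%C) with (Carg v) by (unfold Clog; simpl; ring).
  destruct (Cpolar v Hv) as [_ [_ Ha]].
  apply Rplus_le_compat; [|apply Rabs_le; lra].
  assert (E1 : ln lo + ln r <= ln (Cmod v)) by (rewrite <- ln_mult by assumption; apply ln_le; [nra | exact H1]).
  assert (E2 : ln (Cmod v) <= ln hi + ln r) by (rewrite <- ln_mult by lra; apply ln_le; assumption).
  assert (K := Rabs_pos (ln lo)). assert (K2 := Rle_abs (- ln lo)). rewrite Rabs_Ropp in K2.
  apply Rabs_le. lra.
Qed.

Lemma Rabs_Carg z : z <> RtoC 0 -> cos (Rabs (Carg z)) = Re z / Cmod z /\ 0 <= Rabs (Carg z) <= PI.
Proof.
  intros Hz. assert (Hm : 0 < Cmod z) by (apply Cmod_gt_0, Hz). destruct (Cpolar z Hz) as [H1 [H2 H3]]. split.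
  - replace (cos (Rabs (Carg z))) with (cos (Carg z)).
    + rewrite H1 at 1. field. lra.
    + unfold Rabs. destruct (Rcase_abs (Carg z)); [symmetry; apply cos_neg | reflexivity].
  - split; [apply Rabs_pos | apply Rabs_le; lra].
Qed.

(** Adding t >= 0 turns the point towards the positive axis, as Re / Cmod, the cosine of the
    argument, does not decrease. Squares are compared separately according to the signs of Re y and
    Re y + t. *)
Lemma sector_add d y t : sector d y -> 0 <= t -> sector d (y + RtoC t)%C.
Proof.
  intros [Hy Ha] Ht. assert (Hv : slit_plane (y + RtoC t)%C) by (apply slit_plus; assumption). split; [exact Hv|].
  assert (Hy0 := slit_neq_0 _ Hy). assert (Hv0 := slit_neq_0 _ Hv).
  destruct (Rabs_Carg _ Hy0) as [C1 B1]. destruct (Rabs_Carg _ Hv0) as [C2 B2].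
  apply Rle_trans with (2 := Ha).
  destruct (Rle_lt_dec (Rabs (Carg (y + RtoC t)%C)) (Rabs (Carg y))) as [|Hlt]; [assumption|]. exfalso.
  assert (K : cos (Rabs (Carg (y + RtoC t)%C)) < cos (Rabs (Carg y))) by (apply cos_decreasing_1; lra).
  rewrite C1, C2 in K.
  assert (Hmy : 0 < Cmod y) by (apply Cmod_gt_0, Hy0). assert (Hmv : 0 < Cmod (y + RtoC t)%C) by (apply Cmod_gt_0, Hv0).
  assert (Hre : Re (y + RtoC t)%C = Re y + t) by (rewrite re_plus; reflexivity).
  assert (Him : Im (y + RtoC t)%C = Im y) by (unfold Cplus, RtoC, Im; simpl; ring).
  assert (E1 := Cmod2_alt y). assert (E2 := Cmod2_alt (y + RtoC t)%C). rewrite Hre, Him in E2. rewrite Hre in K.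
  set (p := Cmod y) in *. set (q := Cmod (y + RtoC t)%C) in *. set (a := Re y) in *. set (b := Im y) in *.
  assert (K2 : (a + t) * p < a * q).
  { apply (Rmult_lt_compat_r (p * q)) in K; [|apply Rmult_lt_0_compat; assumption].
    replace ((a + t) / q * (p * q)) with ((a + t) * p) in K by (field; lra). replace (a / p * (p * q)) with (a * q) in K by (field; lra). exact K. }
  destruct (Rle_lt_dec 0 a) as [Ha0|Ha0].
  - assert (Hsq : ((a + t) * p) ^ 2 < (a * q) ^ 2) by (assert (0 <= (a + t) * p) by (apply Rmult_le_pos; lra); nra).
    rewrite !Rpow_mult_distr, E1, E2 in Hsq.
    assert (0 <= b ^ 2) by apply pow2_ge_0. assert (a ^ 2 <= (a + t) ^ 2) by (apply pow_incr; lra). nra.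
  - destruct (Rle_lt_dec 0 (a + t)) as [Hat|Hat]; [assert (0 <= (a + t) * p) by (apply Rmult_le_pos; lra); nra|].
    assert (Haq : 0 < (- a) * q) by (apply Rmult_lt_0_compat; lra).
    assert (Hsq : ((- a) * q) ^ 2 < ((- (a + t)) * p) ^ 2) by (assert ((- a) * q < (- (a + t)) * p) by lra; nra).
    rewrite !Rpow_mult_distr, E1, E2 in Hsq.
    assert (0 <= b ^ 2) by apply pow2_ge_0. assert ((- (a + t)) ^ 2 <= (- a) ^ 2) by (apply pow_incr; lra). nra.
Qed.

Lemma ln_INR_nonneg n : 0 <= ln (INR (S n)).
Proof. rewrite <- ln_1. apply ln_le; [lra | apply INR_S_ge1]. Qed.

Lemma Rbdd_ln_sq : Rbdd (fun n => ln (INR (S n)) / INR (S n) ^ 2).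
Proof.
  apply Rbdd_le with (fun n => 2 * Rpower (INR (S n)) (- (3 / 2))).
  - intros n. assert (Hn := INR_S_ge1 n).
    assert (H := ln_le_power (INR (S n)) (1 / 2) ltac:(lra) ltac:(lra)).
    replace (Rpower (INR (S n)) (- (3 / 2))) with (Rpower (INR (S n)) (1 / 2) * / INR (S n) ^ 2).
    + assert (Hp : 0 < / INR (S n) ^ 2) by (apply Rinv_0_lt_compat, pow_lt; lra).
      unfold Rdiv. rewrite <- Rmult_assoc. apply Rmult_le_compat_r; [lra|]. lra.
    + rewrite <- Rpower_pow by lra. change (INR 2) with 2. rewrite <- Rpower_Ropp, <- Rpower_plus. f_equal. field.
  - apply Rbdd_scal; [lra | apply Rbdd_power; lra].
Qed.

(** Tannery's theorem in n: digamma(y + L + 1) - ln L tends to 0 for each n. For all large L it is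
    bounded by a constant plus N ln n, because |y + L| lies between c L and (1 + |y|) L; the weight
    n^(-k) with k >= 2 makes this summable. *)
Lemma G_limit_ge2 k N x (G : nat -> C) D : (2 <= k)%nat -> (1 <= N)%nat -> slit_plane x ->
  (forall L, Ccv (Csum (fun n => (digamma (ynx N x n + INR L + 1) - Clog (ynx N x n)) / INR (S n) ^ k)%C) (G L)) ->
  Ccv (Csum (fun n => RtoC (ln (INR (S n)) * Rpower (INR (S n)) (- INR k)))) D ->
  Ccv (fun L => G L - ln (INR L) * zeta (INR k))%C (- (Clog x * zeta (INR k)) - INR N * D)%C.
Proof.
  intros Hk HN Hx HG HD. destruct (slit_sector x Hx) as [d [Hd Hs]].
  destruct (sector_lower d Hd) as [c [Hc Hl]].
  destruct (digamma1_asymp 0 d Hd) as [R0 [B [HR0 [HB HA]]]].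
  destruct (INR_unbounded (R0 / c)) as [n0 Hn0].
  assert (Hmx : 0 < Cmod x) by (apply Cmod_gt_0, slit_neq_0, Hx). assert (HP := PI_RGT_0).
  set (A0 := B + Rabs (ln c) + ln (1 + Cmod x) + PI + Cmod (Clog x)).
  assert (Hz := zeta_nat_cv k Hk).
  assert (HNp := pos_INR N).
  assert (HA0 : 0 <= A0).
  { unfold A0. assert (H1 := Rabs_pos (ln c)). assert (H2 := Cmod_ge_0 (Clog x)).
    assert (0 <= ln (1 + Cmod x)) by (rewrite <- ln_1; apply ln_le; lra). lra. }
  apply Ccv_dominated with (f := fun L n => ((digamma (ynx N x n + INR L + 1) - ln (INR L) - Clog (ynx N x n)) / INR (S n) ^ k)%C)
    (h := fun n => (- Clog (ynx N x n) / INR (S n) ^ k)%C)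
    (g := fun n => A0 * / INR (S n) ^ 2 + (2 * INR N) * (ln (INR (S n)) / INR (S n) ^ 2)).
  - intros n. assert (Hy : slit_plane (ynx N x n + 1)%C) by (apply slit_plus; [apply slit_ynx, Hx | lra]).
    apply Ccv_ext with (fun L => / INR (S n) ^ k * ((digamma (ynx N x n + 1 + INR L) - ln (INR L)) - Clog (ynx N x n)))%C.
    + intros L. replace (ynx N x n + INR L + 1)%C with (ynx N x n + 1 + INR L)%C by ring. unfold Cdiv. ring.
    + eapply Ccv_eq; [|apply Ccv_scal, Ccv_minus; [apply Ccv_digamma_add, Hy | apply Ccv_const]]. unfold Cdiv. ring.
  - exists (S n0). intros L n HL. set (y := ynx N x n). set (v := (y + INR L)%C).
    assert (HLn : INR n0 <= INR L) by (apply le_INR; lia).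
    assert (HL1 : 1 <= INR L) by (change 1 with (INR 1); apply le_INR; lia).
    assert (Hys : sector d y) by (apply sector_ynx, Hs).
    assert (Hvl := Hl y (INR L) Hys ltac:(lra)). fold v in Hvl.
    assert (Hym : Cmod y = INR (S n) ^ N * Cmod x) by apply Cmod_ynx.
    assert (HnN := INR_S_pow_ge1 n N). assert (Hn1 := INR_S_ge1 n).
    assert (Hy0 := Cmod_ge_0 y).
    assert (Hv0 : v <> RtoC 0) by (apply slit_add_neq0; [apply Hys | lra]).
    assert (HvR : R0 <= Cmod v).
    { eapply Rle_trans; [|exact Hvl]. apply Rle_trans with (c * INR L); [|apply Rmult_le_compat_l; lra].
      apply Rle_trans with (c * (R0 / c)); [right; field; lra | apply Rmult_le_compat_l; lra]. }
    assert (Hvs : sector d v) by (apply sector_add; [exact Hys | lra]).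
    specialize (HA v Hvs HvR). simpl Csum in HA. rewrite pow_1 in HA.
    assert (K1 : Cmod (digamma (v + 1) - Clog v)%C <= B).
    { replace (digamma (v + 1) - Clog v)%C with (digamma (v + 1) - Clog v - 0)%C by ring. eapply Rle_trans; [exact HA|].
      rewrite <- (Rmult_1_r B) at 2. apply Rmult_le_compat_l; [exact HB|]. rewrite <- Rinv_1. apply Rinv_le_contravar; lra. }
    assert (K2 : Cmod (Clog v - ln (INR L))%C <= Rabs (ln c) + ln (1 + Cmod y) + PI).
    { apply Cmod_Clog_sub_ln; try lra; [nra | | exact Hv0].
      unfold v. eapply Rle_trans; [apply Cmod_triangle|]. rewrite Cmod_R, Rabs_right by lra. nra. }
    assert (K3 : Cmod (Clog y) <= INR N * ln (INR (S n)) + Cmod (Clog x)).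
    { unfold y. rewrite Clog_ynx by exact Hx. eapply Rle_trans; [apply Cmod_triangle|].
      rewrite <- RtoC_mult, Cmod_R, Rabs_right; [lra|]. apply Rle_ge, Rmult_le_pos; [exact HNp | apply ln_INR_nonneg]. }
    assert (K4 : ln (1 + Cmod y) <= INR N * ln (INR (S n)) + ln (1 + Cmod x)).
    { rewrite <- ln_pow, <- ln_mult by (try apply pow_lt; lra). apply ln_le; [lra|]. rewrite Hym. nra. }
    replace (digamma (v + 1) - ln (INR L) - Clog y)%C with ((digamma (v + 1) - Clog v) + (Clog v - ln (INR L)) - Clog y)%C by ring.
    set (Z := ((digamma (v + 1) - Clog v) + (Clog v - ln (INR L)) - Clog y)%C).
    assert (K5 : Cmod Z <= A0 + 2 * INR N * ln (INR (S n))).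
    { unfold Z. eapply Rle_trans; [apply Cmod_minus_le|].
      assert (K6 := Cmod_triangle (digamma (v + 1) - Clog v) (Clog v - ln (INR L))). unfold A0. lra. }
    assert (Hnk : INR (S n) ^ 2 <= INR (S n) ^ k) by (apply Rle_pow; assumption).
    assert (Hn2 : 0 < INR (S n) ^ 2) by (apply pow_lt; lra).
    rewrite <- RtoC_pow, Cmod_div, Cmod_R, Rabs_right by (try apply RtoC_neq0; lra).
    replace (A0 * / INR (S n) ^ 2 + 2 * INR N * (ln (INR (S n)) / INR (S n) ^ 2)) with ((A0 + 2 * INR N * ln (INR (S n))) * / INR (S n) ^ 2)
      by (unfold Rdiv; ring).
    apply Rmult_le_compat; [apply Cmod_ge_0 | left; apply Rinv_0_lt_compat; lra | exact K5 | apply Rinv_le_contravar; lra].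
  - apply Rbdd_plus; apply Rbdd_scal; [exact HA0 | apply Rbdd_inv_sq | lra | apply Rbdd_ln_sq].
  - intros L. apply Ccv_ext with (fun P => Csum (fun n => (digamma (ynx N x n + INR L + 1) - Clog (ynx N x n)) / INR (S n) ^ k) P
       - ln (INR L) * Csum (fun n => / INR (S n) ^ k) P)%C.
    + intros P. rewrite <- Csum_scal, <- Csum_minus. apply Csum_ext. intros. unfold Cdiv. ring.
    + apply Ccv_minus; [apply HG | apply Ccv_scal, Hz].
  - apply Ccv_ext with (fun P => - (Clog x * Csum (fun n => / INR (S n) ^ k) P) - INR N * Csum (fun n => RtoC (ln (INR (S n)) * Rpower (INR (S n)) (- INR k))) P)%C.
    + intros P. replace (- (Clog x * Csum (fun n => / INR (S n) ^ k) P))%C with ((- Clog x) * Csum (fun n => / INR (S n) ^ k) P)%C by ring.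
      rewrite <- !Csum_scal, <- Csum_minus. apply Csum_ext. intros n _.
      rewrite Clog_ynx, Rpower_nat_neg, RtoC_mult, RtoC_inv, RtoC_pow by (try exact Hx; apply pow_nonzero, not_0_INR; lia).
      unfold Cdiv. ring.
    + apply Ccv_minus; [|apply Ccv_scal, HD]. apply Ccv_opp, Ccv_scal, Hz.
Qed.

(** Balls of C are squares, and the modulus is at most the sum of the two coordinates; hence the
    half radius. *)
Lemma ball_0_Cmod x (r : posreal) : ball (RtoC 0) (r / 2) x -> Cmod x < r.
Proof.
  intros [H1 H2]. change (Rabs (Re x - 0) < r / 2) in H1. change (Rabs (Im x - 0) < r / 2) in H2. rewrite Rminus_0_r in H1, H2.
  assert (H := Cmod_le_abs x). lra.
Qed.

(** For M = 0 the correction [Bterm] is itself of the order x of the error, so |zeta 2| enters the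
    constant; for M >= 1 it is absorbed by [expansion_sum]. *)
Lemma expansion_remainder k N M x E T : (1 <= k <= N)%nat -> 0 <= T -> Cmod E <= T * Cmod x ^ S M ->
  Cmod (- E - Csum (fun i => zeta (INR k - INR (S i) * INR N) * zeta (1 + INR (S i)) * (- x) ^ S i) M
    - (Bterm k N x + Csum (fun i => ((-1) ^ k * ((-1) ^ (S i * (N + 1)) * zeta (INR k - INR (S i) * INR N) * zeta (1 + INR (S i)))) * x ^ S i) M))%C
  <= (T + Cmod (zeta 2)) * Cmod x ^ S M.
Proof.
  intros Hk HT HE. assert (Hz := Cmod_ge_0 (zeta 2)). assert (Hp : 0 <= Cmod x ^ S M) by (apply pow_le, Cmod_ge_0).
  destruct M as [|M].
  - rewrite pow_1 in *. cbn [Csum]. replace (- E - RtoC 0 - (Bterm k N x + RtoC 0))%C with (- (E + Bterm k N x))%C by ring.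
    rewrite Cmod_opp. eapply Rle_trans; [apply Cmod_triangle|]. rewrite Rmult_plus_distr_r. apply Rplus_le_compat; [exact HE|].
    unfold Bterm. destruct (k =? N)%nat.
    + rewrite Cmod_mult, Cmod_opp. lra.
    + rewrite Cmod_0. apply Rmult_le_pos; assumption.
  - rewrite expansion_sum by exact Hk.
    match goal with |- Cmod ?z <= _ => replace z with (- E)%C by ring end.
    rewrite Cmod_opp. eapply Rle_trans; [exact HE|]. apply Rmult_le_compat_r; [exact Hp | lra].
Qed.

Lemma scriptF_at_0_gt1 k N : (1 < k)%nat -> (k <= N)%nat ->
    expansion_at_0 (scriptF (INR k) (INR N))
      (fun x =>
         - (zeta (INR k + INR N) / x)
         - (stieltjes 0 + Clog x) * zeta (INR k)
         + INR N * C_derive zeta (INR k)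
         + PI / INR N
           * (zeta (1 + (INR k - 1) / INR N) / sin (PI / INR N * (INR k - 1)))
           * Cpower x ((INR k - 1) / INR N)
         + Cpower x ((INR k - 1) / INR N) * scriptB k N x)%C
      (fun m => (-1) ^ k * ((-1) ^ (m * (N + 1))
                * zeta (INR k - INR m * INR N) * zeta (1 + INR m)))%C
      (fun m x => x ^ m)%C.
Proof.
  intros Hk HkN d Hd M.
  assert (HN0 : INR N <> 0) by (apply not_0_INR; lia). assert (HNp : 0 < INR N) by (apply lt_0_INR; lia).
  assert (Hk2 : 2 <= INR k) by (change 2 with (INR 2); apply le_INR; lia).
  assert (Hz := zeta_nat_cv k ltac:(lia)).
  assert (Hc0 : Ccv (fun P => Csum (fun n => / INR (S n) ^ k) P - (if (k =? 1)%nat then RtoC (ln (INR P)) else 0))%C (zeta (INR k))).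
  { replace (k =? 1)%nat with false by (symmetry; apply Nat.eqb_neq; lia).
    apply Ccv_ext with (Csum (fun n => / INR (S n) ^ k)%C); [intros; ring | exact Hz]. }
  destruct (tail_sum k N M d (zeta (INR k)) ltac:(lia) Hd Hc0) as [r [T [Hr [HT HA]]]].
  destruct (zeta_derivative (INR k) Hk2) as [D [HD1 HD2]].
  set (beta := (INR k - 1) / INR N).
  assert (Hbeta : 0 < beta) by (unfold beta; apply Rdiv_lt_0_compat; lra).
  assert (Ebeta : ((INR k - 1) / INR N)%C = RtoC beta) by (unfold beta; rewrite RtoC_div, RtoC_minus by exact HN0; reflexivity).
  set (cc := (PI / INR N / sin (PI / INR N * (INR k - 1)))%C).
  exists (T + Cmod (zeta 2)).
  exists (mkposreal (r / 2) ltac:(lra)). intros x Hball Hne Hs.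
  assert (Hxr : Cmod x < r).
  { apply (ball_0_Cmod x (mkposreal r Hr)), Hball. }
  assert (Hx : slit_plane x) by apply Hs. assert (Hx0 := slit_neq_0 x Hx).
  destruct (HA x Hs Hxr) as [s [E [Hs1 [HE Hs2]]]].
  assert (HG := fun L => F_decomposition k N x s L ltac:(lia) ltac:(lia) Hx Hs1).
  assert (HGl := G_limit_ge2 k N x _ D ltac:(lia) ltac:(lia) Hx HG HD1).
  set (Phi := (scriptF (INR k) (INR N) x + zeta (INR k + INR N) / x)%C) in *.
  set (P := Cpower x ((INR k - 1) / INR N)).
  assert (HL0 : forall m, L0 k N (INR (S m) / x)%C = (- cc * P * RtoC (Rpower (INR (S m)) (- beta))%R)%C).
  { intros m. destruct (slit_div (INR (S m)) x ltac:(apply lt_0_INR; lia) Hx) as [W1 W2].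
    rewrite L0_ge2, W2 by (try exact W1; lia). fold cc. rewrite <- Cmult_assoc. f_equal.
    unfold P, Cpower. rewrite Ebeta. unfold Rpower. rewrite <- Cexp_RtoC, <- Cexp_plus. f_equal.
    rewrite RtoC_mult, RtoC_opp. ring. }
  set (S1 := Csum (fun i => zeta (INR k - INR (S i) * INR N) * zeta (1 + INR (S i)) * (- x) ^ S i)%C M) in *.
  (* The sum of zeta k / m and the term ln L zeta k combine to Euler's constant times zeta k, and
     the sum of L0 / m is a multiple of zeta(1 + beta). Comparison with [HGl] then determines
     [Phi]. *)
  assert (Hlim : Ccv (fun L => Phi + Csum (fun m => / INR (S m) * s m) L - ln (INR L) * zeta (INR k))%C
     (Phi + (S1 + E) + (zeta (INR k) * stieltjes 0 - cc * P * zeta (RtoC (1 + beta))))%C).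
  { apply Ccv_ext with (fun L => Phi + (Csum (fun m => / INR (S m) * s m) L - Csum (fun m => / INR (S m) * (zeta (INR k) + L0 k N (INR (S m) / x))) L)
        + (zeta (INR k) * RtoC (Rsum (fun i => / INR (S i)) L - ln (INR L))%R - cc * P * Csum (fun m => RtoC (Rpower (INR (S m)) (- (1 + beta)))%R) L))%C.
    - intros L.
      assert (E1 : Csum (fun m => / INR (S m) * (zeta (INR k) + L0 k N (INR (S m) / x)))%C L
        = (zeta (INR k) * Csum (fun i => RtoC (/ INR (S i))%R) L - cc * P * Csum (fun m => RtoC (Rpower (INR (S m)) (- (1 + beta)))%R) L)%C).
      { rewrite <- !Csum_scal, <- Csum_minus. apply Csum_ext. intros m _. rewrite HL0.
        replace (- (1 + beta)) with (- beta + Ropp 1) by ring. rewrite Rpower_plus, (Rpower_Ropp _ 1), Rpower_1 by (apply lt_0_INR; lia).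
        rewrite RtoC_mult, RtoC_inv by (apply not_0_INR; lia). ring. }
      rewrite E1, RtoC_minus, RtoC_Rsum. ring.
    - apply Ccv_plus; [apply Ccv_plus; [apply Ccv_const | exact Hs2]|]. apply Ccv_minus; apply Ccv_scal.
      + apply Ccv_RtoC, stieltjes_0.
      + apply zeta_real_cv. lra. }
  assert (Heq := Ccv_unique _ _ _ Hlim HGl).
  assert (HF : scriptF (INR k) (INR N) x = (- (zeta (INR k + INR N) / x) - (stieltjes 0 + Clog x) * zeta (INR k) - INR N * D
      + cc * zeta (RtoC (1 + beta)) * P - S1 - E)%C).
  { replace (scriptF (INR k) (INR N) x) with (Phi - zeta (INR k + INR N) / x)%C by (unfold Phi; ring).
    transitivity ((Phi + (S1 + E) + (zeta (INR k) * stieltjes 0 - cc * P * zeta (RtoC (1 + beta)))) - (S1 + E) - (zeta (INR k) * stieltjes 0 - cc * P * zeta (RtoC (1 + beta))) - zeta (INR k + INR N) / x)%C; [ring|].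
    rewrite Heq. ring. }
  rewrite HF, Csum_sum_n_m, HD2. replace (P * scriptB k N x)%C with (Bterm k N x) by (symmetry; apply scriptB_eq; [lia | exact Hx0]).
  replace (1 + (INR k - 1) / INR N)%C with (RtoC (1 + beta)) by (rewrite Ebeta, RtoC_plus; reflexivity).
  replace (PI / INR N * (zeta (RtoC (1 + beta)) / sin (PI / INR N * (INR k - 1))) * P)%C with (cc * zeta (RtoC (1 + beta)) * P)%C by (unfold cc, Cdiv; ring).
  rewrite Cmod_pow.
  match goal with |- Cmod ?z <= _ => replace z with (- E - S1 - (Bterm k N x + Csum (fun i => (-1) ^ k * ((-1) ^ (S i * (N + 1)) * zeta (INR k - INR (S i) * INR N) * zeta (1 + INR (S i))) * x ^ S i) M))%C by ring end.
  apply expansion_remainder; [lia | exact HT | exact HE].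
Qed.

(** * The expansion at 0 for k = 1 *)

Definition Ilog (N : nat) (w : C) : C := CSeries (fun n => / INR (S n) * Clog (1 + w / INR (S n) ^ N))%C.

Lemma Ilog_cv N w : (1 <= N)%nat -> Ccv (Csum (fun n => / INR (S n) * Clog (1 + w / INR (S n) ^ N))%C) (Ilog N w).
Proof.
  intros HN. set (f := (fun n => / INR (S n) * Clog (1 + w / INR (S n) ^ N))%C).
  apply CSeries_correct with (fun n => Cmod (f n)); [intros; lra|].
  destruct (INR_unbounded (2 * Cmod w)) as [n0 Hn0]. assert (Hw := Cmod_ge_0 w).
  apply (Rbdd_shift _ n0); [intros; apply Cmod_ge_0|].
  apply Rbdd_le with (fun i => 2 * Cmod w * / INR (S i) ^ 2); [|apply Rbdd_scal; [lra | apply Rbdd_inv_sq]].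
  intros i. unfold f. set (v := INR (S (n0 + i))).
  assert (Hi := INR_S_ge1 i). assert (Hvi : INR (S i) <= v) by (apply le_INR; lia).
  assert (Hvn : INR n0 <= v) by (apply le_INR; lia).
  assert (HvN : v <= v ^ N) by (rewrite <- (pow_1 v) at 1; apply Rle_pow; [lra | exact HN]).
  assert (Hm : Cmod (w / v ^ N)%C = Cmod w * / v ^ N).
  { rewrite <- RtoC_pow, Cmod_div, Cmod_R, Rabs_right by (try apply RtoC_neq0; lra). reflexivity. }
  assert (Hle : Cmod w * / v ^ N <= Cmod w * / v) by (apply Rmult_le_compat_l; [exact Hw | apply Rinv_le_contravar; lra]).
  rewrite Cmod_mult, <- RtoC_inv, Cmod_R, Rabs_right by (try apply Rle_ge, Rlt_le, Rinv_0_lt_compat; lra).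
  assert (Hh : Cmod w * / v <= 1 / 2) by (apply (Rmult_le_reg_r v); [lra|]; rewrite Rmult_assoc, Rinv_l; lra).
  assert (H := Clog1_bound1 (w / v ^ N)%C ltac:(rewrite Hm; lra)). rewrite Hm in H.
  assert (Hv0 : 0 < / v) by (apply Rinv_0_lt_compat; lra).
  apply Rle_trans with (/ v * (2 * (Cmod w * / v))); [apply Rmult_le_compat_l; lra|].
  replace (/ v * (2 * (Cmod w * / v))) with (2 * Cmod w * / v ^ 2) by (field; lra).
  apply Rmult_le_compat_l; [lra|]. apply Rinv_le_contravar; [apply pow_lt; lra | apply pow_incr; lra].
Qed.

(** The quantity whose limit at infinity is kappa, the constant term for N = 1. *)
Definition Kfun (y : C) : C := (Ilog 1 y - Clog y ^ 2 / 2 - stieltjes 0 * Clog y)%C.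

Lemma sector_Cexp d v : 0 < d -> Rabs (Im v) <= PI - d -> sector d (Cexp v) /\ Clog (Cexp v) = v.
Proof.
  intros Hd Hv. assert (H := Rabs_le_between (Im v) (PI - d)). destruct H as [H _]. specialize (H Hv).
  assert (E : Clog (Cexp v) = v) by (apply Clog_Cexp; lra). split; [|exact E].
  assert (Ea : Carg (Cexp v) = Im v) by (transitivity (Im (Clog (Cexp v))); [reflexivity | rewrite E; reflexivity]).
  split; [apply Carg_slit; [apply Cexp_neq_0 | lra] | rewrite Ea; exact Hv].
Qed.

Lemma Ccv_le_seq u a B (e : nat -> R) : (exists n0, forall n, (n0 <= n)%nat -> Cmod (u n) <= B + e n) -> Un_cv e 0 -> Ccv u a -> Cmod a <= B.
Proof.
  intros [n0 H] He Hu. apply le_epsilon. intros eps Heps. apply (Ccv_le u); [|exact Hu].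
  destruct (He eps Heps) as [n1 Hn1]. exists (n0 + n1)%nat. intros n Hn. specialize (H n ltac:(lia)). specialize (Hn1 n ltac:(lia)).
  unfold R_dist in Hn1. rewrite Rminus_0_r in Hn1. assert (K := Rle_abs (e n)). lra.
Qed.

(* Along the curve Cexp (Clog y + t b), with b = Clog y' - Clog y, the logarithmic derivative is the constant b,
   and the derivative of [Kfun] is b (digamma (1 + y) - Clog y) which is O(b / |y|). *)
Lemma Kfun_curve d : 0 < d < PI -> exists R0 B, 1 <= R0 /\ 0 <= B /\ forall y y' rho, sector d y -> sector d y' ->
  R0 <= rho -> rho <= Cmod y -> rho <= Cmod y' -> Cmod (Kfun y' - Kfun y)%C <= Cmod (Clog y' - Clog y)%C * (B / rho).
Proof.
  intros Hd. destruct (digamma1_asymp 0 d Hd) as [R0 [B [HR0 [HB HA]]]]. destruct (sector_lower d Hd) as [c [Hc Hl]].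
  exists R0, B. split; [lra|]. split; [exact HB|]. intros y y' rho Hy Hy' Hrho H1 H2.
  assert (Hy0 : y <> RtoC 0) by apply slit_neq_0, Hy. assert (Hy0' : y' <> RtoC 0) by apply slit_neq_0, Hy'.
  set (b := (Clog y' - Clog y)%C). set (u := fun t : R => (Clog y + t * b)%C). set (g := fun t : R => Cexp (u t)).
  set (Rm := Cmod y + Cmod y').
  assert (Hre : forall t, Re (u t) = (1 - t) * ln (Cmod y) + t * ln (Cmod y')) by (intros t; unfold u, b, Clog; simpl; ring).
  assert (Him : forall t, Im (u t) = (1 - t) * Carg y + t * Carg y') by (intros t; unfold u, b, Clog; simpl; ring).
  (* Both the argument and ln |g t| interpolate linearly between the endpoints, so the curve stays
     in the sector and in the annulus between rho and [Rm]. *)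
  assert (Hu : forall t, 0 <= t <= 1 -> sector d (g t) /\ rho <= Cmod (g t) <= Rm).
  { intros t Ht. destruct Hy as [_ Hya]. destruct Hy' as [_ Hya']. split.
    - apply sector_Cexp; [lra|]. rewrite Him. apply Rabs_le_between in Hya. apply Rabs_le_between in Hya'. apply Rabs_le. nra.
    - unfold g. rewrite Cmod_Cexp, Hre.
      assert (L1 : ln rho <= ln (Cmod y)) by (apply ln_le; lra). assert (L2 : ln rho <= ln (Cmod y')) by (apply ln_le; lra).
      assert (L3 : ln (Cmod y) <= ln Rm) by (apply ln_le; unfold Rm; lra). assert (L4 : ln (Cmod y') <= ln Rm) by (apply ln_le; unfold Rm; lra).
      split; [rewrite <- (exp_ln rho) at 1 by lra | rewrite <- (exp_ln Rm) by (unfold Rm; lra)]; apply exp_mono; nra. }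
  set (ga := stieltjes 0).
  (* The excess at partial sum P: the deviation of the harmonic sum from ln P + gamma, plus that of
     digamma(g t + P + 1) from ln P, which splits into B / (c P) by the digamma expansion and 2 Rm /
     P from Clog(1 + g t / P). *)
  set (e := fun P => Rabs (Rsum (fun i => / INR (S i)) P - ln (INR P) - ga) + (B / c + 2 * Rm) * / INR P).
  assert (He : Un_cv (fun P => Cmod b * e P) 0).
  { apply Un_cv_scal0. replace 0 with (Rabs (ga - ga) + 0) by (rewrite Rminus_diag, Rabs_R0; ring). apply CV_plus.
    - apply cv_cvabs. apply CV_minus; [apply stieltjes_0 | ]. intros ep Hep. exists O. intros. unfold R_dist. rewrite Rminus_diag, Rabs_R0. exact Hep.
    - apply Un_cv_scal0, Un_cv_inv_INR. }
  (* The mean value inequality is applied to partial sums and P tends to infinity afterwards, so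
     that no series is differentiated term by term. *)
  set (Kp := fun P (t : R) => (Csum (fun n => / INR (S n) * Clog (1 + g t / INR (S n) ^ 1)) P - u t * u t / 2 - ga * u t)%C).
  destruct (INR_unbounded (R0 / c + 2 * Rm)) as [P0 HP0].
  apply Ccv_le_seq with (u := fun P => (Kp P 1 - Kp P 0)%C) (e := fun P => Cmod b * e P); [|exact He|].
  - exists (S P0). intros P HP.
    assert (HPn : INR P0 <= INR P) by (apply le_INR; lia). assert (HP1 : 1 <= INR P) by (change 1 with (INR 1); apply le_INR; lia).
    assert (HR0c : 0 < R0 / c) by (apply Rdiv_lt_0_compat; lra).
    assert (HRm : 0 < Rm) by (unfold Rm; lra).
    set (H_P := Rsum (fun i => / INR (S i)) P) in *.
    set (dK := fun t => (b * ((digamma (g t + 1) - u t) + (H_P - ga - digamma (g t + 1 + INR P))))%C).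
    replace (Cmod b * (B / rho) + Cmod b * e P) with (Cmod b * (B / rho + e P) * 1 - Cmod b * (B / rho + e P) * 0) by ring.
    apply (Cder_mean_value (Kp P) dK (fun t => Cmod b * (B / rho + e P) * t) (fun _ => Cmod b * (B / rho + e P))); [lra| | |].
    + intros t Ht. destruct (Hu t Ht) as [Hsg Hmg]. assert (Hsl : slit_plane (g t)) by apply Hsg.
      assert (Hud : is_Cder u t b) by (apply is_Cder_linear).
      assert (Hgd : is_Cder g t (g t * b)%C) by (apply is_Cder_Cexp, Hud).
      apply is_Cder_eq with (Csum (fun n => / INR (S n) * ((/ INR (S n) * (g t * b)) / (1 + g t / INR (S n) ^ 1))) P - (/ 2 * (b * u t + u t * b)) - ga * b)%C.
      * unfold dK. rewrite (digamma_shift_n (g t + 1) P) by (apply slit_plus; [exact Hsl | lra]).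
        unfold H_P. rewrite RtoC_Rsum.
        transitivity (b * (Csum (fun n => RtoC (/ INR (S n))%R - / (g t + 1 + INR n)) P - u t - ga))%C.
        -- replace (b * (Csum (fun n => RtoC (/ INR (S n))%R - / (g t + 1 + INR n)) P - u t - ga))%C
             with (b * Csum (fun n => RtoC (/ INR (S n))%R - / (g t + 1 + INR n)) P - b * u t - ga * b)%C by ring.
           rewrite <- Csum_scal. f_equal. f_equal; [|field].
           apply Csum_ext. intros n _. rewrite RtoC_inv by (apply not_0_INR; lia).
           assert (Hn := INR_S_neq0 n). assert (Hgn := slit_add_neq0 (g t) (INR (S n)) Hsl (pos_INR _)).
           rewrite Cpow_1_r. replace (g t + 1 + INR n)%C with (g t + INR (S n))%C by (rewrite S_INR, RtoC_plus; ring).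
           field. repeat split; try assumption.
        -- rewrite Csum_minus. ring.
      * unfold Kp. apply is_Cder_minus; [apply is_Cder_minus|].
        -- apply is_Cder_Csum. intros n _. apply is_Cder_scal.
           apply is_Cder_Clog with (g := fun s => (1 + g s / INR (S n) ^ 1)%C).
           ++ rewrite Cpow_1_r. replace (1 + g t / INR (S n))%C with (RtoC (/ INR (S n)) * (g t + INR (S n)))%C.
              ** apply slit_scal; [apply Rinv_0_lt_compat, lt_0_INR; lia | apply slit_plus; [exact Hsl | apply pos_INR]].
              ** rewrite RtoC_inv by (apply not_0_INR; lia). field. apply INR_S_neq0.
           ++ apply is_Cder_ext with (fun s => 1 + / INR (S n) * g s)%C; [intros; rewrite Cpow_1_r; unfold Cdiv; ring|].
              eapply is_Cder_eq; [|apply is_Cder_plus; [apply is_Cder_const | apply is_Cder_scal, Hgd]]. ring.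
        -- apply is_Cder_ext with (fun s => / 2 * (u s * u s))%C; [intros; unfold Cdiv; ring|]. apply is_Cder_scal, is_Cder_mult; exact Hud.
        -- apply is_Cder_scal, Hud.
    + intros t Ht. apply is_derive_eq with (Cmod b * (B / rho + e P) * 1); [ring|]. auto_derive; [exact I | ring].
    + intros t Ht. destruct (Hu t Ht) as [Hsg Hmg]. unfold dK. rewrite Cmod_mult. apply Rmult_le_compat_l; [apply Cmod_ge_0|].
      eapply Rle_trans; [apply Cmod_triangle|].
      assert (Hul : Clog (g t) = u t).
      { apply (sector_Cexp d); [lra|]. destruct Hy as [_ Hya]. destruct Hy' as [_ Hya']. rewrite Him. apply Rabs_le_between in Hya. apply Rabs_le_between in Hya'. apply Rabs_le. nra. }
      set (v := (g t + INR P)%C).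
      assert (Hvl := Hl (g t) (INR P) Hsg ltac:(lra)). fold v in Hvl.
      assert (HcP : c * INR P <= Cmod v) by nra.
      assert (HvR : R0 <= Cmod v).
      { apply Rle_trans with (c * (R0 / c)); [right; field; lra|]. apply Rle_trans with (2 := HcP). apply Rmult_le_compat_l; lra. }
      assert (A1 := HA (g t) Hsg ltac:(lra)). assert (A2 := HA v ltac:(apply sector_add; [exact Hsg | lra]) HvR).
      cbn [Csum] in A1, A2. rewrite pow_1 in A1, A2. rewrite Hul in A1.
      apply Rplus_le_compat.
      * replace (digamma (g t + 1) - u t)%C with (digamma (g t + 1) - u t - RtoC 0)%C by ring. eapply Rle_trans; [exact A1|].
        apply Rmult_le_compat_l; [exact HB|]. apply Rinv_le_contravar; lra.
      * replace (H_P - ga - digamma (g t + 1 + INR P))%C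
          with (RtoC (H_P - ln (INR P) - ga)%R - ((digamma (v + 1) - Clog v - RtoC 0) + Clog (1 + g t / INR P)))%C.
        -- eapply Rle_trans; [apply Cmod_minus_le|]. unfold e. apply Rplus_le_compat; [rewrite Cmod_R; apply Rle_refl|].
           eapply Rle_trans; [apply Cmod_triangle|]. rewrite Rmult_plus_distr_r. apply Rplus_le_compat.
           ++ eapply Rle_trans; [exact A2|]. replace (B / c * / INR P) with (B * / (c * INR P)) by (field; lra).
              apply Rmult_le_compat_l; [exact HB|]. apply Rinv_le_contravar; nra.
           ++ assert (Hgm : Cmod (g t / INR P)%C = Cmod (g t) * / INR P).
              { rewrite Cmod_div, Cmod_R, Rabs_right by (try apply RtoC_neq0; lra). reflexivity. }
              assert (HPi : 0 < / INR P) by (apply Rinv_0_lt_compat; lra).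
              assert (Hg2 : Cmod (g t) * / INR P <= Rm * / INR P) by (apply Rmult_le_compat_r; lra).
              assert (Hg3 : Rm * / INR P <= 1 / 2) by (apply (Rmult_le_reg_r (INR P)); [lra|]; rewrite Rmult_assoc, Rinv_l; lra).
              eapply Rle_trans; [apply Clog1_bound1; rewrite Hgm; lra|]. rewrite Hgm. lra.
        -- assert (Ev := Clog_add_INR (g t) P ltac:(apply Hsg) ltac:(lia)). fold v in Ev. rewrite Ev.
           replace (g t + 1 + INR P)%C with (v + 1)%C by (unfold v; ring). rewrite !RtoC_minus. ring.
  - assert (G1 : g 1 = y') by (unfold g; replace (u 1) with (Clog y') by (unfold u, b; ring); apply Cexp_Clog, Hy0').
    assert (G0 : g 0 = y) by (unfold g; replace (u 0) with (Clog y) by (unfold u, b; ring); apply Cexp_Clog, Hy0).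
    unfold Kp. rewrite G1, G0. apply Ccv_minus.
    + replace (u 1) with (Clog y') by (unfold u, b; ring). unfold Kfun.
      replace (Clog y' ^ 2 / 2)%C with (Clog y' * Clog y' / 2)%C by (rewrite Cpow_S, Cpow_1_r; reflexivity).
      apply Ccv_minus; [apply Ccv_minus|]; try apply Ccv_const. apply Ilog_cv. lia.
    + replace (u 0) with (Clog y) by (unfold u, b; ring). unfold Kfun.
      replace (Clog y ^ 2 / 2)%C with (Clog y * Clog y / 2)%C by (rewrite Cpow_S, Cpow_1_r; reflexivity).
      apply Ccv_minus; [apply Ccv_minus|]; try apply Ccv_const. apply Ilog_cv. lia.
Qed.

Definition to_infinity (v : nat -> C) : Prop := forall A, exists L0, forall L, (L0 <= L)%nat -> A <= Cmod (v L).

Lemma sector_RtoC d r : d <= PI -> 0 < r -> sector d (RtoC r).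
Proof.
  intros Hd Hr. split; [apply slit_of_Re; exact Hr|].
  replace (Carg (RtoC r)) with (Im (Clog (RtoC r))) by reflexivity. rewrite Clog_RtoC by exact Hr. simpl. rewrite Rabs_R0. lra.
Qed.

Lemma Csum_telescope (f : nat -> C) n : Csum (fun i => f (S i) - f i)%C n = (f n - f O)%C.
Proof. induction n as [|n IH]; simpl; [ring | rewrite IH; ring]. Qed.

(** Between consecutive integers the logarithm changes by at most 1/m, so [Kfun_curve] bounds the
    increments by B m^(-2). *)
Lemma Kfun_INR_cv : exists kap, Ccv (fun n => Kfun (INR n)) kap.
Proof.
  assert (HP := PI_RGT_0).
  destruct (Kfun_curve (PI / 2) ltac:(lra)) as [R0 [B [HR0 [HB HK]]]].
  destruct (INR_unbounded R0) as [n0 Hn0].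
  destruct (Csum_abs_cv (fun i => Kfun (INR (n0 + S i)) - Kfun (INR (n0 + i)))%C (fun i => B * / INR (S i) ^ 2)) as [l [Hl _]].
  - intros i. set (m := (n0 + i)%nat). replace (n0 + S i)%nat with (S m) by (unfold m; lia).
    assert (Hn01 : (1 <= n0)%nat) by (apply INR_le; change (INR 1) with 1; lra).
    assert (Hm : INR (S i) <= INR m) by (apply le_INR; unfold m; lia). assert (Hi := INR_S_ge1 i).
    assert (Hm0 : INR n0 <= INR m) by (apply le_INR; unfold m; lia). assert (Hs : INR (S m) = INR m + 1) by apply S_INR.
    eapply Rle_trans.
    + apply (HK (RtoC (INR m)) (RtoC (INR (S m))) (INR m)).
      * apply sector_RtoC; lra.
      * apply sector_RtoC; lra.
      * lra.
      * rewrite Cmod_R, Rabs_right; lra.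
      * rewrite Cmod_R, Rabs_right; lra.
    + rewrite !Clog_RtoC, <- RtoC_minus, Cmod_R by lra.
      assert (Hln : Rabs (ln (INR (S m)) - ln (INR m)) <= / INR m).
      { assert (ln (INR m) <= ln (INR (S m))) by (apply ln_le; lra).
        rewrite Rabs_right by lra. rewrite <- ln_div by lra.
        replace (INR (S m) / INR m) with (1 + / INR m) by (rewrite Hs; field; lra).
        assert (Hp : 0 < / INR m) by (apply Rinv_0_lt_compat; lra).
        rewrite <- (ln_exp (/ INR m)) at 2. apply ln_le; [lra|]. left. apply exp_ineq1. lra. }
      assert (Hp : 0 < / INR m) by (apply Rinv_0_lt_compat; lra).
      apply Rle_trans with (/ INR m * (B / INR m)); [apply Rmult_le_compat_r; [apply Rmult_le_pos; lra | exact Hln]|].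
      replace (/ INR m * (B / INR m)) with (B * / INR m ^ 2) by (field; lra).
      apply Rmult_le_compat_l; [exact HB|]. apply Rinv_le_contravar; [apply pow_lt; lra | apply pow_incr; lra].
  - apply Rbdd_scal; [exact HB | apply Rbdd_inv_sq].
  - exists (l + Kfun (INR n0))%C. apply Ccv_unshift with n0.
    apply Ccv_ext with (fun n => Csum (fun i => Kfun (INR (n0 + S i)) - Kfun (INR (n0 + i)))%C n + Kfun (INR n0))%C.
    + intros n. rewrite (Csum_telescope (fun i => Kfun (INR (n0 + i)))), Nat.add_0_r, (Nat.add_comm n). ring.
    + apply Ccv_plus; [exact Hl | apply Ccv_const].
Qed.

(** A point w of the sector is compared with the integer n = floor |w|: |Clog w - ln n| <= ln 2 +
    PI, so [Kfun_curve] gives a difference O(1/n), and one kappa serves all sectors. Membership in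
    the sector is asked of v (S L) only, because the sequence L / x to which this is applied starts
    at 0. *)
Lemma Kfun_cv : exists kap, forall d v, 0 < d < PI -> (forall L, sector d (v (S L))) -> to_infinity v -> Ccv (fun L => Kfun (v L)) kap.
Proof.
  destruct Kfun_INR_cv as [kap Hkap]. exists kap. intros d v Hd Hs Hv. assert (HP := PI_RGT_0).
  destruct (Kfun_curve d Hd) as [R0 [B [HR0 [HB HK]]]].
  intros eps Heps. destruct (Hkap (eps / 2) ltac:(lra)) as [n1 Hn1].
  set (T := (ln 2 + PI) * B). assert (HT : 0 <= T).
  { assert (0 < ln 2) by (rewrite <- ln_1; apply ln_increasing; lra). apply Rmult_le_pos; lra. }
  destruct (Hv (INR n1 + R0 + 4 * T / eps + 2)) as [L1 HL1]. exists (S L1). intros L HL.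
  specialize (HL1 L ltac:(lia)). set (w := v L) in *.
  assert (Hsw : sector d w) by (unfold w; destruct L as [|L]; [lia | apply Hs]).
  assert (H4 : 0 <= 4 * T / eps) by (apply Rmult_le_pos; [lra | left; apply Rinv_0_lt_compat, Heps]).
  assert (Hn1p := pos_INR n1).
  destruct (nfloor_ex (Cmod w) (Cmod_ge_0 w)) as [n [Hna Hnb]].
  assert (Hnn : INR n1 + R0 + 4 * T / eps + 1 < INR n) by lra.
  assert (Hnn1 : (n1 <= n)%nat) by (apply INR_le; lra).
  specialize (Hn1 n Hnn1).
  assert (H := HK (RtoC (INR n)) w (INR n) ltac:(apply sector_RtoC; lra) Hsw ltac:(lra) ltac:(rewrite Cmod_R, Rabs_right; lra) Hna).
  assert (HC : Cmod (Clog w - Clog (RtoC (INR n)))%C <= ln 2 + PI).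
  { rewrite Clog_RtoC by lra.
    replace (ln 2 + PI) with (Rabs (ln 1) + ln 2 + PI) by (rewrite ln_1, Rabs_R0; ring).
    apply Cmod_Clog_sub_ln; try lra. apply slit_neq_0, Hsw. }
  assert (HBn : 0 <= B / INR n) by (apply Rmult_le_pos; [exact HB | left; apply Rinv_0_lt_compat; lra]).
  assert (H2 : Cmod (Kfun w - Kfun (RtoC (INR n)))%C <= T / INR n).
  { eapply Rle_trans; [exact H|]. unfold T. replace ((ln 2 + PI) * B / INR n) with ((ln 2 + PI) * (B / INR n)) by (unfold Rdiv; ring).
    apply Rmult_le_compat_r; assumption. }
  assert (H3 : T / INR n <= eps / 4).
  { apply (Rmult_le_reg_r (INR n)); [lra|]. replace (T / INR n * INR n) with T by (field; lra).
    apply Rle_trans with (eps / 4 * (4 * T / eps)); [right; field; lra | apply Rmult_le_compat_l; lra]. }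
  assert (H5 := Cmod_tri_sub (Kfun w) (Kfun (RtoC (INR n))) kap). lra.
Qed.

(** Integration of 1 / (w + t), whose modulus is at most 1 / (c (|w| + t)) by [sector_lower]. *)
Lemma Clog_ray_bound d : 0 < d < PI -> exists c, 0 < c <= 1 /\ forall w a b, sector d w -> 0 <= a <= b ->
  Cmod (Clog (w + RtoC b) - Clog (w + RtoC a))%C <= / c * (ln (Cmod w + b) - ln (Cmod w + a)).
Proof.
  intros Hd. destruct (sector_lower d Hd) as [c [Hc Hl]]. exists c. split; [exact Hc|]. intros w a b Hw Hab.
  assert (Hw0 : 0 < Cmod w) by (apply Cmod_gt_0, slit_neq_0, Hw).
  rewrite Rmult_minus_distr_l.
  apply (Cder_mean_value (fun t => Clog (w + RtoC t)) (fun t => 1 / (w + RtoC t))%C (fun t => / c * ln (Cmod w + t)) (fun t => / c * / (Cmod w + t))); [lra| | |].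
  - intros t Ht. apply is_Cder_Clog with (g := fun s => (w + RtoC s)%C); [apply slit_plus; [apply Hw | lra]|].
    eapply is_Cder_eq; [|apply is_Cder_plus; [apply is_Cder_const | apply is_Cder_id]]. ring.
  - intros t Ht. auto_derive; [lra | field; split; lra].
  - intros t Ht. specialize (Hl w t Hw ltac:(lra)).
    assert (0 < c * (Cmod w + t)) by (apply Rmult_lt_0_compat; lra).
    rewrite Cmod_div, Cmod_1 by (apply slit_add_neq0; [apply Hw | lra]).
    replace (/ c * / (Cmod w + t)) with (/ (c * (Cmod w + t))) by (field; split; lra).
    unfold Rdiv. rewrite Rmult_1_l. apply Rinv_le_contravar; assumption.
Qed.

(** * Comparison of [Ilog N] with [Ilog 1] by blocks *)

Lemma Clog_one_plus_div w t : slit_plane w -> 0 < t -> Clog (1 + w / RtoC t)%C = (Clog (w + RtoC t) - ln t)%C.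
Proof.
  intros Hw Ht. assert (Ht0 : RtoC t <> RtoC 0) by (apply RtoC_neq0; lra).
  replace (1 + w / RtoC t)%C with (RtoC (/ t) * (w + RtoC t))%C by (rewrite RtoC_inv by lra; field; exact Ht0).
  rewrite Clog_scal; [|apply Rinv_0_lt_compat, Ht | apply slit_add_neq0; [exact Hw | lra]].
  rewrite ln_Rinv, RtoC_opp by exact Ht. ring.
Qed.

Lemma ln_S_le n : (1 <= n)%nat -> / INR (S n) <= ln (INR (S n)) - ln (INR n) <= / INR n.
Proof.
  intros Hn. assert (H1 : 1 <= INR n) by (change 1 with (INR 1); apply le_INR; lia). split.
  - assert (H := ln_step n ltac:(lia)). lra.
  - rewrite <- ln_div by (rewrite ?S_INR; lra).
    replace (INR (S n) / INR n) with (1 + / INR n) by (rewrite S_INR; field; lra).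
    assert (Hp : 0 < / INR n) by (apply Rinv_0_lt_compat; lra).
    rewrite <- (ln_exp (/ INR n)) at 2. apply ln_le; [lra|]. left. apply exp_ineq1. lra.
Qed.

Lemma harmonic_block a p : (1 <= a)%nat ->
  ln (INR (a + p)) - ln (INR a) - (/ INR a - / INR (a + p)) <= Rsum (fun i => / INR (S (a + i))) p <= ln (INR (a + p)) - ln (INR a).
Proof.
  intros Ha. induction p as [|p IH]; [rewrite Nat.add_0_r; simpl; lra|].
  rewrite Rsum_S, <- plus_n_Sm. assert (H := ln_S_le (a + p) ltac:(lia)). lra.
Qed.

Lemma Ccv_subseq u a (phi : nat -> nat) : (forall n, (n <= phi n)%nat) -> Ccv u a -> Ccv (fun n => u (phi n)) a.
Proof.
  intros H Hu eps Heps. destruct (Hu eps Heps) as [n0 Hn0]. exists n0. intros n Hn. apply Hn0. specialize (H n). lia.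
Qed.

(** This is Clog(1 + t/w). Unlike Clog(1 + w/t), the summand of [Ilog], it tends to 0 as w tends to
    infinity with t fixed, which is what dominated convergence requires. *)
Definition hlog (w : C) (t : R) : C := (Clog (w + RtoC t) - Clog w)%C.

(* Compares the term n + 1 of [Ilog N w] with the terms n^N < m <= (n + 1)^N of [Ilog 1 w / N]: the map n |-> n^N
   multiplies the measure dn / n by N. *)
Definition block_diff (N : nat) (w : C) (n : nat) : C :=
  (/ INR (S n) * hlog w (INR (S n ^ N))
   - / INR N * (Csum (fun m => / INR (S m) * hlog w (INR (S m))) (S n ^ N) - Csum (fun m => / INR (S m) * hlog w (INR (S m))) (n ^ N)))%C.

(** Both 1/(n + 1) and the N-th part of the harmonic block from n^N to (n + 1)^N approximate ln(n +
    1) - ln n with error at most n^(-2). *)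
Lemma block_coef N n : (1 <= N)%nat -> (1 <= n)%nat ->
  Rabs (/ INR (S n) - / INR N * Rsum (fun i => / INR (S (n ^ N + i))) (S n ^ N - n ^ N)) <= / INR n ^ 2 /\
  0 <= / INR N * Rsum (fun i => / INR (S (n ^ N + i))) (S n ^ N - n ^ N) <= / INR n.
Proof.
  intros HN Hn. set (a := (n ^ N)%nat). set (b := (S n ^ N)%nat).
  assert (Hab : (a <= b)%nat) by (apply Nat.pow_le_mono_l; lia).
  assert (Ha : (1 <= a)%nat) by (unfold a; assert (n ^ N <> 0)%nat by (apply Nat.pow_nonzero; lia); lia).
  assert (H := harmonic_block a (b - a) Ha). replace (a + (b - a))%nat with b in H by lia.
  assert (Hn1 : 1 <= INR n) by (change 1 with (INR 1); apply le_INR; lia). assert (Hs := S_INR n).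
  assert (HNp : 1 <= INR N) by (change 1 with (INR 1); apply le_INR; lia).
  assert (Ea : INR a = INR n ^ N) by apply pow_INR. assert (Eb : INR b = INR (S n) ^ N) by apply pow_INR.
  assert (La : ln (INR a) = INR N * ln (INR n)) by (rewrite Ea; apply ln_pow; lra).
  assert (Lb : ln (INR b) = INR N * ln (INR (S n))) by (rewrite Eb; apply ln_pow; lra).
  assert (Hl := ln_S_le n Hn).
  assert (Hnonneg : 0 <= Rsum (fun i => / INR (S (a + i))) (b - a)).
  { apply Rsum_nonneg. intros i _. left. apply Rinv_0_lt_compat, lt_0_INR. lia. }
  set (Sg := Rsum (fun i => / INR (S (a + i))) (b - a)) in *. rewrite La, Lb in H.
  assert (HNi : 0 < / INR N) by (apply Rinv_0_lt_compat; lra).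
  assert (HNi1 : / INR N <= 1) by (rewrite <- Rinv_1; apply Rinv_le_contravar; lra).
  assert (Hup : / INR N * Sg <= ln (INR (S n)) - ln (INR n)).
  { apply (Rmult_le_reg_l (INR N)); [lra|]. rewrite <- Rmult_assoc, Rinv_r, Rmult_1_l by lra. lra. }
  (* For N >= 2 the single term 1/a = n^(-N) suffices; for N = 1 the difference is needed and equals
     1 / (n (n + 1)). *)
  assert (Hab1 : / INR a - / INR b <= / INR n ^ 2).
  { assert (Hb0 : 0 < / INR b) by (apply Rinv_0_lt_compat; rewrite Eb; apply pow_lt; lra).
    destruct (Nat.eq_dec N 1) as [E|E].
    - rewrite Ea, Eb, E, !pow_1, Hs. replace (/ INR n - / (INR n + 1)) with (/ (INR n * (INR n + 1))) by (field; lra).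
      apply Rinv_le_contravar; nra.
    - apply Rle_trans with (/ INR a); [lra|]. rewrite Ea. apply Rinv_le_contravar; [apply pow_lt; lra | apply Rle_pow; [lra | lia]]. }
  assert (Hlow : ln (INR (S n)) - ln (INR n) - / INR n ^ 2 <= / INR N * Sg).
  { apply Rle_trans with (/ INR N * (INR N * ln (INR (S n)) - INR N * ln (INR n) - (/ INR a - / INR b))).
    - replace (/ INR N * (INR N * ln (INR (S n)) - INR N * ln (INR n) - (/ INR a - / INR b)))
        with (ln (INR (S n)) - ln (INR n) - / INR N * (/ INR a - / INR b)) by (field; repeat split; try lra; rewrite ?Ea, ?Eb; apply pow_nonzero; lra).
      assert (Hq : / INR a - / INR b >= 0).
      { assert (/ INR b <= / INR a); [|lra]. apply Rinv_le_contravar; [apply lt_0_INR; lia | apply le_INR, Hab]. }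
      assert (/ INR N * (/ INR a - / INR b) <= 1 * (/ INR a - / INR b)) by (apply Rmult_le_compat_r; lra). lra.
    - apply Rmult_le_compat_l; [lra|]. lra. }
  assert (Hd : / INR n - / INR (S n) <= / INR n ^ 2).
  { rewrite Hs. replace (/ INR n - / (INR n + 1)) with (/ (INR n * (INR n + 1))) by (field; lra).
    apply Rinv_le_contravar; nra. }
  split; [apply Rabs_le; lra|]. split; [apply Rmult_le_pos; lra | lra].
Qed.

(** The difference splits into the coefficient error of [block_coef] times [hlog] at the end of the
    block, and the variation of [hlog] inside the block, where the logarithm changes by at most N /
    (c n). Both are O(n^(-2) (1 + ln n)) uniformly for |w| >= 1, since then |hlog w t| <= ln(1 + t)
    / c. *)
Lemma block_diff_bound d N : 0 < d < PI -> (1 <= N)%nat -> exists A, 0 <= A /\ forall w n, sector d w -> 1 <= Cmod w ->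
  Cmod (block_diff N w n) <= A * (/ INR (S n) ^ 2 + ln (INR (S n)) / INR (S n) ^ 2).
Proof.
  intros Hd HN. destruct (Clog_ray_bound d Hd) as [c [Hc Hr]].
  assert (HNp : 1 <= INR N) by (change 1 with (INR 1); apply le_INR; lia).
  assert (Hci : 0 < / c) by (apply Rinv_0_lt_compat; lra).
  assert (HNi : 0 < / INR N) by (apply Rinv_0_lt_compat; lra).
  assert (HNi1 : / INR N <= 1) by (rewrite <- Rinv_1; apply Rinv_le_contravar; lra).
  assert (Hl2 : 0 < ln 2) by (rewrite <- ln_1; apply ln_increasing; lra).
  exists (4 * / c * (ln 2 + INR N)). split; [apply Rmult_le_pos; lra|].
  intros w n Hw Hw1.
  assert (Hn1 := INR_S_ge1 n). assert (Hln := ln_INR_nonneg n).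
  assert (Hh : forall t, 0 < t -> Cmod (hlog w t) <= / c * ln (1 + t)).
  { intros t Ht. specialize (Hr w 0 t Hw ltac:(lra)). rewrite !Rplus_0_r in Hr. unfold hlog.
    replace (w + RtoC 0)%C with w in Hr by ring. eapply Rle_trans; [exact Hr|].
    apply Rmult_le_compat_l; [lra|]. rewrite <- ln_div by lra. apply ln_le; [apply Rdiv_lt_0_compat; lra|].
    apply (Rmult_le_reg_r (Cmod w)); [lra|]. unfold Rdiv. rewrite Rmult_assoc, Rinv_l by lra. nra. }
  assert (Hb : Cmod (hlog w (INR (S n ^ N))) <= / c * (ln 2 + INR N * ln (INR (S n)))).
  { assert (E : INR (S n ^ N) = INR (S n) ^ N) by apply pow_INR. assert (Hp := INR_S_pow_ge1 n N).
    eapply Rle_trans; [apply Hh; rewrite E; lra|]. apply Rmult_le_compat_l; [lra|].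
    rewrite <- ln_pow, <- ln_mult by lra. rewrite E. apply ln_le; lra. }
  assert (Hsq : 0 < / INR (S n) ^ 2) by (apply Rinv_0_lt_compat, pow_lt; lra).
  set (V := / INR (S n) ^ 2 + ln (INR (S n)) / INR (S n) ^ 2).
  assert (HV : (1 + ln (INR (S n))) * / INR (S n) ^ 2 = V) by (unfold V, Rdiv; ring).
  assert (HV0 : 0 <= V) by (rewrite <- HV; apply Rmult_le_pos; lra).
  assert (Hsum : ln 2 + INR N * ln (INR (S n)) <= (ln 2 + INR N) * (1 + ln (INR (S n)))) by nra.
  unfold block_diff. rewrite <- Csum_diff_tail by (apply Nat.pow_le_mono_l; lia).
  (* The first block is the single integer 1 and lies outside [block_coef], but there both parts are
     multiples of the same [hlog w 1]. *)
  destruct n as [|n].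
  - rewrite Nat.pow_1_l, Nat.pow_0_l by lia. cbn [Csum Nat.sub Nat.add]. rewrite Nat.pow_1_l in Hb.
    replace (/ INR 1 * hlog w (INR 1) - / INR N * (RtoC 0 + / INR 1 * hlog w (INR 1)))%C with (RtoC (1 - / INR N) * hlog w (INR 1))%C.
    2: { rewrite RtoC_minus, RtoC_inv by lra. change (INR 1) with 1. field. apply RtoC_neq0. lra. }
    rewrite Cmod_mult, Cmod_R, Rabs_right by lra.
    change (INR 1) with 1 in *. rewrite ln_1 in *. unfold V in *. rewrite ln_1 in *.
    replace (/ 1 ^ 2 + 0 / 1 ^ 2) with 1 by field. rewrite Rmult_0_r, Rplus_0_r in Hb.
    assert (H0 := Cmod_ge_0 (hlog w 1)). assert (Hcl : 0 <= / c * ln 2) by (apply Rmult_le_pos; lra).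
    assert (HcN : 0 <= / c * INR N) by (apply Rmult_le_pos; lra).
    apply Rle_trans with (1 * (/ c * ln 2)); [apply Rmult_le_compat; lra|]. lra.
  - set (n' := S n) in *. destruct (block_coef N n' HN ltac:(unfold n'; lia)) as [C1 C2].
    set (a := (n' ^ N)%nat) in *. set (b := (S n' ^ N)%nat) in *.
    assert (Hab : (a <= b)%nat) by (apply Nat.pow_le_mono_l; lia).
    assert (Ha : (1 <= a)%nat) by (unfold a; assert (n' ^ N <> 0)%nat by (apply Nat.pow_nonzero; unfold n'; lia); lia).
    assert (Hnp : 1 <= INR n') by apply INR_S_ge1. assert (Hs := S_INR n').
    assert (Ea : INR a = INR n' ^ N) by apply pow_INR. assert (Eb : INR b = INR (S n') ^ N) by apply pow_INR.
    set (Sg := Rsum (fun i => / INR (S (a + i))) (b - a)) in *.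
    replace (/ INR (S n') * hlog w (INR b) - / INR N * Csum (fun i => / INR (S (a + i)) * hlog w (INR (S (a + i)))) (b - a))%C
      with (RtoC (/ INR (S n') - / INR N * Sg)%R * hlog w (INR b) + / INR N * Csum (fun i => / INR (S (a + i)) * (hlog w (INR b) - hlog w (INR (S (a + i))))) (b - a))%C.
    2: { rewrite (Csum_ext (fun i => / INR (S (a + i)) * (hlog w (INR b) - hlog w (INR (S (a + i)))))%C
           (fun i => hlog w (INR b) * RtoC (/ INR (S (a + i)))%R - / INR (S (a + i)) * hlog w (INR (S (a + i))))%C)
           by (intros i _; rewrite RtoC_inv by (apply not_0_INR; lia); ring).
         rewrite Csum_minus, Csum_scal, <- RtoC_Rsum. fold Sg. rewrite RtoC_minus, RtoC_mult, !RtoC_inv by (try apply not_0_INR; lia || lra). ring. }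
    assert (Hinc : Cmod (Csum (fun i => / INR (S (a + i)) * (hlog w (INR b) - hlog w (INR (S (a + i)))))%C (b - a)) <= (/ c * (INR N * / INR n')) * Sg).
    { unfold Sg. rewrite <- Rsum_scal. apply Cmod_Csum_le. intros i Hi.
      rewrite Cmod_mult, <- RtoC_inv, Cmod_R, Rabs_right by (try apply not_0_INR; try lia; left; apply Rinv_0_lt_compat, lt_0_INR; lia).
      rewrite Rmult_comm. apply Rmult_le_compat_r; [left; apply Rinv_0_lt_compat, lt_0_INR; lia|].
      replace (hlog w (INR b) - hlog w (INR (S (a + i))))%C with (Clog (w + INR b) - Clog (w + INR (S (a + i))))%C by (unfold hlog; ring).
      assert (Hib : INR (S (a + i)) <= INR b) by (apply le_INR; lia). assert (Hia : INR a <= INR (S (a + i))) by (apply le_INR; lia).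
      assert (Ha0 : 1 <= INR a) by (change 1 with (INR 1); apply le_INR; lia).
      eapply Rle_trans; [apply Hr; [exact Hw | lra]|]. apply Rmult_le_compat_l; [lra|].
      assert (Hq : ln (Cmod w + INR b) - ln (Cmod w + INR (S (a + i))) <= ln (INR b) - ln (INR a)).
      { rewrite <- !ln_div by lra. apply ln_le; [apply Rdiv_lt_0_compat; lra|].
        apply (Rmult_le_reg_r ((Cmod w + INR (S (a + i))) * INR a)); [apply Rmult_lt_0_compat; lra|].
        replace ((Cmod w + INR b) / (Cmod w + INR (S (a + i))) * ((Cmod w + INR (S (a + i))) * INR a)) with ((Cmod w + INR b) * INR a) by (field; lra).
        replace (INR b / INR a * ((Cmod w + INR (S (a + i))) * INR a)) with (INR b * (Cmod w + INR (S (a + i)))) by (field; lra). nra. }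
      eapply Rle_trans; [exact Hq|]. rewrite Ea, Eb, !ln_pow by lra.
      assert (Hl := ln_S_le n' ltac:(unfold n'; lia)). rewrite <- Rmult_minus_distr_l. apply Rmult_le_compat_l; lra. }
    assert (Hsq4 : / INR n' ^ 2 <= 4 * / INR (S n') ^ 2).
    { rewrite Hs. apply (Rmult_le_reg_r (INR n' ^ 2 * (INR n' + 1) ^ 2)); [apply Rmult_lt_0_compat; apply pow_lt; lra|].
      replace (/ INR n' ^ 2 * (INR n' ^ 2 * (INR n' + 1) ^ 2)) with ((INR n' + 1) ^ 2) by (field; lra).
      replace (4 * / (INR n' + 1) ^ 2 * (INR n' ^ 2 * (INR n' + 1) ^ 2)) with (4 * INR n' ^ 2) by (field; lra). nra. }
    assert (Hq0 : 0 < / INR n' ^ 2) by (apply Rinv_0_lt_compat, pow_lt; lra).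
    assert (Hn0 : 0 < / INR n') by (apply Rinv_0_lt_compat; lra).
    assert (T1 : Cmod (RtoC (/ INR (S n') - / INR N * Sg)%R * hlog w (INR b))%C <= / INR n' ^ 2 * (/ c * (ln 2 + INR N * ln (INR (S n'))))).
    { rewrite Cmod_mult, Cmod_R. apply Rmult_le_compat; [apply Rabs_pos | apply Cmod_ge_0 | exact C1 | exact Hb]. }
    assert (T2 : Cmod (/ INR N * Csum (fun i => / INR (S (a + i)) * (hlog w (INR b) - hlog w (INR (S (a + i))))) (b - a))%C <= / INR n' ^ 2 * (/ c * INR N)).
    { rewrite Cmod_mult, <- RtoC_inv, Cmod_R, Rabs_right by lra.
      apply Rle_trans with (/ INR N * (/ c * (INR N * / INR n') * Sg)); [apply Rmult_le_compat_l; lra|].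
      replace (/ INR N * (/ c * (INR N * / INR n') * Sg)) with ((/ INR N * Sg) * (/ c * INR N * / INR n')) by ring.
      replace (/ INR n' ^ 2 * (/ c * INR N)) with (/ INR n' * (/ c * INR N * / INR n')) by (field; repeat split; lra).
      apply Rmult_le_compat_r; [|lra]. apply Rmult_le_pos; [apply Rmult_le_pos|]; lra. }
    eapply Rle_trans; [apply Cmod_triangle|].
    apply Rle_trans with (/ INR n' ^ 2 * (/ c * ((ln 2 + INR N) * (1 + ln (INR (S n')))))).
    + apply Rle_trans with (/ INR n' ^ 2 * (/ c * (ln 2 + INR N * ln (INR (S n')) + INR N))); [lra|].
      apply Rmult_le_compat_l; [lra|]. apply Rmult_le_compat_l; [lra|].
      assert (0 <= ln 2 * ln (INR (S n'))) by (apply Rmult_le_pos; lra). nra.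
    + rewrite <- HV. replace (4 * / c * (ln 2 + INR N) * ((1 + ln (INR (S n'))) * / INR (S n') ^ 2))
        with ((4 * / INR (S n') ^ 2) * (/ c * ((ln 2 + INR N) * (1 + ln (INR (S n')))))) by ring.
      apply Rmult_le_compat_r; [|exact Hsq4]. apply Rmult_le_pos; [lra|]. apply Rmult_le_pos; lra.
Qed.

Lemma hlog_to_0 d v t : 0 < d < PI -> 0 < t -> (forall L, sector d (v L)) -> to_infinity v -> Ccv (fun L => hlog (v L) t) (RtoC 0).
Proof.
  intros Hd Ht Hs Hv. destruct (Clog_ray_bound d Hd) as [c [Hc Hr]].
  assert (Hci : 0 < / c) by (apply Rinv_0_lt_compat; lra).
  intros eps Heps. destruct (Hv (2 * (/ c * t) / eps)) as [L1 HL1]. exists L1. intros L HL. specialize (HL1 L HL).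
  assert (H := Hr (v L) 0 t (Hs L) ltac:(lra)). rewrite Rplus_0_r in H. unfold hlog.
  replace (Clog (v L + RtoC t) - Clog (v L) - 0)%C with (Clog (v L + RtoC t) - Clog (v L + RtoC 0))%C by (replace (v L + RtoC 0)%C with (v L) by ring; ring).
  eapply Rle_lt_trans; [exact H|].
  assert (Hm : 0 < Cmod (v L)) by (apply Cmod_gt_0, slit_neq_0, Hs).
  assert (Hl : ln (Cmod (v L) + t) - ln (Cmod (v L)) <= t / Cmod (v L)).
  { rewrite <- ln_div by lra. replace ((Cmod (v L) + t) / Cmod (v L)) with (1 + t / Cmod (v L)) by (field; lra).
    assert (Hp : 0 < t / Cmod (v L)) by (apply Rdiv_lt_0_compat; lra).
    rewrite <- (ln_exp (t / Cmod (v L))) at 2. apply ln_le; [lra|]. left. apply exp_ineq1. lra. }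
  apply Rle_lt_trans with (/ c * (t / Cmod (v L))); [apply Rmult_le_compat_l; lra|].
  apply (Rmult_lt_reg_r (Cmod (v L))); [exact Hm|]. replace (/ c * (t / Cmod (v L)) * Cmod (v L)) with (/ c * t) by (field; lra).
  assert (Hct : 0 < / c * t) by (apply Rmult_lt_0_compat; lra).
  apply Rlt_le_trans with (eps * (2 * (/ c * t) / eps)); [|apply Rmult_le_compat_l; lra].
  replace (eps * (2 * (/ c * t) / eps)) with (2 * (/ c * t)) by (field; lra). lra.
Qed.

(** The blocks telescope to a partial sum up to P against one up to P^N. Since [hlog w t] = Clog(1 +
    w/t) + ln t - Clog w, the ln t terms yield the first Stieltjes constant and the Clog w terms
    Euler's constant; the multiples of ln P and (ln P)^2 cancel because ln(P^N) = N ln P. *)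
Lemma block_diff_sum N w : (1 <= N)%nat -> slit_plane w ->
  Ccv (Csum (block_diff N w))
    (Ilog N w - Ilog 1 w / INR N + (INR N - / INR N) * stieltjes 1 - (1 - / INR N) * stieltjes 0 * Clog w)%C.
Proof.
  intros HN Hw. assert (HN0 : INR N <> 0) by (apply not_0_INR; lia). assert (HNC := RtoC_neq0 _ HN0).
  set (H0 := fun P => Rsum (fun i => / INR (S i)) P - ln (INR P)).
  set (H1 := fun P => Rsum (fun i => ln (INR (S i)) / INR (S i)) P - ln (INR P) ^ 2 / 2).
  set (IN := fun N' P => Csum (fun n => / INR (S n) * Clog (1 + w / INR (S n) ^ N'))%C P).
  assert (Hsub : forall P, (P <= P ^ N)%nat).
  { intros P. destruct P as [|P]; [lia|]. rewrite <- (Nat.pow_1_r (S P)) at 1. apply Nat.pow_le_mono_r; lia. }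
  assert (Hh : forall t, 0 < t -> hlog w t = (Clog (1 + w / RtoC t) + ln t - Clog w)%C).
  { intros t Ht. rewrite Clog_one_plus_div by assumption. unfold hlog. ring. }
  assert (E1 : forall N' P, Csum (fun n => / INR (S n) * hlog w (INR (S n) ^ N'))%C P
     = (IN N' P + RtoC (INR N' * Rsum (fun i => ln (INR (S i)) / INR (S i)) P)%R - Clog w * RtoC (Rsum (fun i => / INR (S i)) P)%R)%C).
  { intros N' P. unfold IN. rewrite RtoC_mult, !RtoC_Rsum, <- !Csum_scal, <- Csum_plus, <- Csum_minus. apply Csum_ext. intros n _.
    assert (Hn := INR_S_ge1 n). rewrite Hh by (apply pow_lt; lra). rewrite ln_pow by lra.
    unfold Rdiv. rewrite !RtoC_mult, RtoC_pow, RtoC_inv by lra. ring. }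
  apply Ccv_S.
  apply Ccv_ext with (fun P => (IN N (S P) - / INR N * IN 1%nat (S P ^ N)%nat + (INR N * RtoC (H1 (S P)) - / INR N * RtoC (H1 (S P ^ N)%nat))
     - Clog w * (RtoC (H0 (S P)) - / INR N * RtoC (H0 (S P ^ N)%nat)))%C).
  - intros P. unfold block_diff. rewrite Csum_minus, Csum_scal.
    rewrite (Csum_telescope (fun n => Csum (fun m => / INR (S m) * hlog w (INR (S m)))%C (n ^ N))), Nat.pow_0_l by lia.
    rewrite (Csum_ext (fun n => / INR (S n) * hlog w (INR (S n ^ N)))%C (fun n => / INR (S n) * hlog w (INR (S n) ^ N))%C) by (intros; rewrite pow_INR; reflexivity).
    rewrite (Csum_ext (fun m => / INR (S m) * hlog w (INR (S m)))%C (fun n => / INR (S n) * hlog w (INR (S n) ^ 1))%C (S P ^ N)) by (intros; rewrite pow_1; reflexivity).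
    rewrite !E1. unfold H0, H1. rewrite !pow_INR, ln_pow by (apply lt_0_INR; lia). cbn [Csum].
    change (INR 1) with 1. set (l := ln (INR (S P))).
    unfold Rdiv. rewrite !RtoC_minus, !RtoC_mult, !RtoC_pow, !RtoC_mult. rewrite RtoC_inv by lra. field. exact HNC.
  - replace (Ilog N w - Ilog 1 w / INR N + (INR N - / INR N) * stieltjes 1 - (1 - / INR N) * stieltjes 0 * Clog w)%C
      with (Ilog N w - / INR N * Ilog 1 w + (INR N * stieltjes 1 - / INR N * stieltjes 1) - Clog w * (stieltjes 0 - / INR N * stieltjes 0))%C by (field; exact HNC).
    assert (C0 : Ccv (fun P => RtoC (H0 P)) (stieltjes 0)) by (apply Ccv_RtoC, stieltjes_0).
    assert (C1 : Ccv (fun P => RtoC (H1 P)) (stieltjes 1)) by (apply Ccv_RtoC, stieltjes_1).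
    assert (CN : Ccv (IN N) (Ilog N w)) by (apply Ilog_cv, HN).
    assert (CJ : Ccv (IN 1%nat) (Ilog 1 w)) by (apply Ilog_cv; lia).
    apply (Ccv_S (fun P => (IN N P - / INR N * IN 1%nat (P ^ N)%nat + (INR N * RtoC (H1 P) - / INR N * RtoC (H1 (P ^ N)%nat))
     - Clog w * (RtoC (H0 P) - / INR N * RtoC (H0 (P ^ N)%nat)))%C)).
    apply Ccv_minus; [apply Ccv_plus|].
    + apply Ccv_minus; [exact CN|]. apply Ccv_scal, (Ccv_subseq _ _ (fun P => (P ^ N)%nat) Hsub CJ).
    + apply Ccv_minus; apply Ccv_scal; [exact C1|]. apply (Ccv_subseq _ _ (fun P => (P ^ N)%nat) Hsub C1).
    + apply Ccv_scal, Ccv_minus; [exact C0|]. apply Ccv_scal, (Ccv_subseq _ _ (fun P => (P ^ N)%nat) Hsub C0).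
Qed.

(** Each [block_diff] involves finitely many values of [hlog] and so tends to 0; the uniform
    majorant of [block_diff_bound] carries this over to the sum. *)
Lemma block_compare d N v : 0 < d < PI -> (1 <= N)%nat -> (forall L, sector d (v L)) -> to_infinity v ->
  Ccv (fun L => Ilog N (v L) - Ilog 1 (v L) / INR N + (INR N - / INR N) * stieltjes 1 - (1 - / INR N) * stieltjes 0 * Clog (v L))%C (RtoC 0).
Proof.
  intros Hd HN Hs Hv. destruct (block_diff_bound d N Hd HN) as [A [HA HB]].
  apply Ccv_dominated with (f := fun L => block_diff N (v L)) (h := fun _ => RtoC 0)
    (g := fun n => A * (/ INR (S n) ^ 2 + ln (INR (S n)) / INR (S n) ^ 2)).
  - intros n. unfold block_diff.
    assert (Hz : forall m, (0 < m)%nat -> Ccv (fun L => hlog (v L) (INR m)) (RtoC 0)).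
    { intros m Hm. apply (hlog_to_0 d); try assumption. apply lt_0_INR, Hm. }
    assert (Hzs : forall p, Ccv (fun L => Csum (fun m => / INR (S m) * hlog (v L) (INR (S m)))%C p) (RtoC 0)).
    { intros p. eapply Ccv_eq; [|apply Ccv_Csum_fin with (h := fun _ => RtoC 0); intros m _].
      - apply Csum_0. reflexivity.
      - eapply Ccv_eq; [|apply Ccv_scal, Hz; lia]. ring. }
    eapply Ccv_eq; [|apply Ccv_minus; [apply Ccv_scal, Hz | apply Ccv_scal, Ccv_minus; apply Hzs]].
    + ring.
    + assert (S n ^ N <> 0)%nat by (apply Nat.pow_nonzero; lia). lia.
  - destruct (Hv 1) as [L1 HL1]. exists L1. intros L n HL. apply HB; [apply Hs | apply HL1, HL].
  - apply Rbdd_scal; [exact HA|]. apply Rbdd_plus; [apply Rbdd_inv_sq | apply Rbdd_ln_sq].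
  - intros L. apply block_diff_sum; [exact HN | apply Hs].
  - apply Ccv_ext with (fun _ => RtoC 0); [intros; symmetry; apply Csum_0; reflexivity | apply Ccv_const].
Qed.

(** * The constant kappa and the asymptotics of [Ilog N] *)

Lemma Clog_conj_pair t : (Clog (1 + RtoC t * Ci) + Clog (1 + RtoC (- t) * Ci))%C = RtoC (ln (1 + t ^ 2)).
Proof.
  set (a := (1 + RtoC t * Ci)%C). set (b := (1 + RtoC (- t) * Ci)%C).
  assert (Ha : Re a = 1 /\ Im a = t) by (unfold a; simpl; split; ring).
  assert (Hb : Re b = 1 /\ Im b = - t) by (unfold b; simpl; split; ring).
  destruct Ha as [Ha1 Ha2]. destruct Hb as [Hb1 Hb2].
  assert (Sa : slit_plane a) by (apply slit_of_Re; lra). assert (Sb : slit_plane b) by (apply slit_of_Re; lra).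
  assert (Hp : 0 < 1 + t ^ 2) by (assert (H := pow2_ge_0 t); lra).
  rewrite <- (Clog_Cexp (Clog a + Clog b)%C).
  - rewrite Cexp_plus, !Cexp_Clog by (apply slit_neq_0; assumption). rewrite <- Clog_RtoC by exact Hp. f_equal.
    unfold a, b. apply C_eq; simpl; ring.
  - replace (Im (Clog a + Clog b)%C) with (Carg a + Carg b) by reflexivity.
    rewrite !Carg_Re_pos by lra. rewrite Ha1, Ha2, Hb1, Hb2. unfold Rdiv. rewrite Rinv_1, !Rmult_1_r, atan_opp.
    assert (HP := PI_RGT_0). lra.
Qed.

Lemma Ilog_2 r : Ilog 2 (RtoC (r ^ 2)) = (Ilog 1 (RtoC r * Ci) + Ilog 1 (RtoC (- r) * Ci))%C.
Proof.
  apply Ccv_unique with (1 := Ilog_cv 2 _ ltac:(lia)).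
  eapply Ccv_ext; [|apply Ccv_plus; [apply (Ilog_cv 1 (RtoC r * Ci)); lia | apply (Ilog_cv 1 (RtoC (- r) * Ci)); lia]].
  intros P. cbv beta. rewrite <- Csum_plus. apply Csum_ext. intros n _. rewrite <- Cmult_plus_distr_l. f_equal.
  assert (Hn := INR_S_ge1 n). assert (Hn0 := INR_S_neq0 n). rewrite Cpow_1_r.
  assert (E : forall s, (1 + RtoC s * Ci / INR (S n))%C = (1 + RtoC (s / INR (S n)) * Ci)%C) by (intros s; rewrite RtoC_div by lra; field; exact Hn0).
  rewrite !E. replace (- r / INR (S n)) with (- (r / INR (S n))) by (field; lra). rewrite Clog_conj_pair.
  rewrite <- Clog_RtoC by (assert (H := pow2_ge_0 (r / INR (S n))); lra). f_equal.
  rewrite RtoC_plus, !RtoC_pow, RtoC_div by lra. field. exact Hn0.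
Qed.

Lemma to_infinity_INR (v : nat -> C) c : 0 < c -> (forall L, c * INR L <= Cmod (v L)) -> to_infinity v.
Proof.
  intros Hc Hv A. destruct (INR_unbounded (A / c)) as [n Hn]. exists n. intros L HL. eapply Rle_trans; [|apply Hv].
  assert (INR n <= INR L) by (apply le_INR, HL). apply Rle_trans with (c * (A / c)); [right; field; lra | apply Rmult_le_compat_l; lra].
Qed.

(* Testing the comparison with N = 2 on w = r^2: the square roots of -w are i r and -i r, so Clog w ^ 2 / 2 is compared
   with the sum of the two squares (ln r + i PI / 2)^2 / 2 and (ln r - i PI / 2)^2 / 2. *)
Lemma Kfun_limit_value kap : (forall d v, 0 < d < PI -> (forall L, sector d (v (S L))) -> to_infinity v -> Ccv (fun L => Kfun (v L)) kap) ->
  kap = (PI ^ 2 / 6 - stieltjes 1)%C.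
Proof.
  intros HK. assert (HP := PI_RGT_0). assert (Hd : 0 < PI / 2 < PI) by lra.
  set (r := fun L => INR (S L)). assert (Hr : forall L, 1 <= r L) by (intros; apply INR_S_ge1).
  assert (Hrot : forall s L, Rabs s = 1 -> sector (PI / 2) (RtoC (s * r L) * Ci)%C /\ Clog (RtoC (s * r L) * Ci)%C = (ln (r L) + RtoC (s * (PI / 2)) * Ci)%C).
  { intros s L Hs. specialize (Hr L).
    assert (E : (RtoC (s * r L) * Ci)%C = Cexp (ln (r L) + RtoC (s * (PI / 2)) * Ci)%C).
    { rewrite Cexp_plus, Cexp_RtoC, exp_ln, Cexp_Ci by lra.
      assert (Hss : s = 1 \/ s = -1) by (unfold Rabs in Hs; destruct (Rcase_abs s); lra).
      destruct Hss as [-> | ->].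
      - rewrite !Rmult_1_l, cos_PI2, sin_PI2. ring.
      - replace (-1 * (PI / 2)) with (- (PI / 2)) by ring. rewrite cos_neg, sin_neg, cos_PI2, sin_PI2, RtoC_mult, !RtoC_opp. ring. }
    rewrite E. apply sector_Cexp; [lra|].
    replace (Im (ln (r L) + RtoC (s * (PI / 2)) * Ci)%C) with (s * (PI / 2)) by (simpl; ring).
    rewrite Rabs_mult, Hs, Rabs_right; lra. }
  assert (Hpos : forall L, sector (PI / 2) (RtoC (r L ^ 2)) /\ Clog (RtoC (r L ^ 2)) = RtoC (2 * ln (r L))).
  { intros L. specialize (Hr L). assert (0 < r L ^ 2) by (apply pow_lt; lra). split; [apply sector_RtoC; lra|].
    rewrite Clog_RtoC, ln_pow by lra. reflexivity. }
  assert (HrL : forall L, INR L <= r L) by (intros; apply le_INR; lia).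
  assert (Kv : forall s, Rabs s = 1 -> Ccv (fun L => Kfun (RtoC (s * r L) * Ci)%C) kap).
  { intros s Hs. apply (HK (PI / 2)); [exact Hd | intros; apply Hrot, Hs|]. apply to_infinity_INR with 1; [lra|]. intros L.
    rewrite Cmod_mult, Cmod_Ci, Cmod_R, Rabs_mult, Hs, Rabs_right by (apply Rle_ge; assert (H := Hr L); lra). specialize (HrL L). lra. }
  assert (Hsqm : forall L, 1 * INR L <= Cmod (RtoC (r L ^ 2))).
  { intros L. specialize (Hr L). rewrite Cmod_R, Rabs_right by (apply Rle_ge, pow_le; lra). specialize (HrL L). nra. }
  assert (Kw : Ccv (fun L => Kfun (RtoC (r L ^ 2))) kap).
  { apply (HK (PI / 2)); [exact Hd | intros; apply Hpos|]. apply to_infinity_INR with 1; [lra | exact Hsqm]. }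
  assert (HB := block_compare (PI / 2) 2 (fun L => RtoC (r L ^ 2)) Hd ltac:(lia) ltac:(intros; apply Hpos) ltac:(apply to_infinity_INR with 1; [lra | exact Hsqm])).
  assert (HB2 : Ccv (fun L => Kfun (RtoC (1 * r L) * Ci) + Kfun (RtoC (-1 * r L) * Ci) - / 2 * Kfun (RtoC (r L ^ 2)) + (RtoC (3 / 2) * stieltjes 1 - RtoC (PI ^ 2 / 4)))%C
    (kap + kap - / 2 * kap + (RtoC (3 / 2) * stieltjes 1 - RtoC (PI ^ 2 / 4)))%C).
  { apply Ccv_plus; [|apply Ccv_const]. apply Ccv_minus; [apply Ccv_plus|]; [apply Kv, Rabs_R1 | apply Kv | apply Ccv_scal, Kw].
    rewrite Rabs_left; lra. }
  (* All terms in ln r cancel, and the squares of i PI / 2 and -i PI / 2 leave - PI^2 / 4. The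
     relation is (3/2) kappa + (3/2) gamma_1 - PI^2 / 4 = 0. *)
  assert (Heq : (kap + kap - / 2 * kap + (RtoC (3 / 2) * stieltjes 1 - RtoC (PI ^ 2 / 4)))%C = RtoC 0).
  { apply Ccv_unique with (1 := HB2). eapply Ccv_ext; [|exact HB]. intros L. cbv beta.
    rewrite Ilog_2. unfold Kfun.
    destruct (Hrot 1 L Rabs_R1) as [_ ->]. destruct (Hrot (-1) L ltac:(rewrite Rabs_left; lra)) as [_ ->]. destruct (Hpos L) as [_ ->].
    rewrite Rmult_1_l. replace (-1 * r L) with (- r L) by ring. change (INR 2) with 2.
    set (I1 := Ilog 1 (RtoC (r L) * Ci)). set (I2 := Ilog 1 (RtoC (- r L) * Ci)). set (I3 := Ilog 1 (RtoC (r L ^ 2))).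
    set (l := ln (r L)). replace (-1 * (PI / 2)) with (- (1 * (PI / 2))) by ring. rewrite Rmult_1_l.
    apply C_eq; simpl; field. }
  transitivity (RtoC (2 / 3) * ((kap + kap - / 2 * kap + (RtoC (3 / 2) * stieltjes 1 - RtoC (PI ^ 2 / 4))) - (RtoC (3 / 2) * stieltjes 1 - RtoC (PI ^ 2 / 4))))%C.
  - rewrite <- RtoC_inv by lra. generalize (RtoC (PI ^ 2 / 4)) (RtoC (3 / 2) * stieltjes 1)%C. intros p q.
    apply C_eq; unfold Re, Im; simpl; field.
  - rewrite Heq. apply C_eq; simpl; field.
Qed.

(** [block_compare] plus 1 / N times the limit of [Kfun]; the contributions - gamma_1 / N from kappa
    and - (N - 1/N) gamma_1 from the blocks add up to - N gamma_1. *)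
Lemma Ilog_asymp d N v : 0 < d < PI -> (1 <= N)%nat -> (forall L, sector d (v (S L))) -> to_infinity v ->
  Ccv (fun L => Ilog N (v L) - Clog (v L) ^ 2 / (2 * INR N) - stieltjes 0 * Clog (v L))%C (PI ^ 2 / (6 * INR N) - INR N * stieltjes 1)%C.
Proof.
  intros Hd HN Hs Hv. destruct Kfun_cv as [kap HK]. assert (Hkap := Kfun_limit_value kap HK).
  assert (HNC : RtoC (INR N) <> RtoC 0) by (apply RtoC_neq0, not_0_INR; lia).
  assert (H1 := HK d v Hd Hs Hv). apply (Ccv_S (fun L => Kfun (v L))) in H1.
  assert (Hv' : to_infinity (fun L => v (S L))).
  { intros A. destruct (Hv A) as [L0 HL0]. exists L0. intros L HL. apply HL0. lia. }
  assert (H2 := block_compare d N (fun L => v (S L)) Hd HN Hs Hv').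
  apply Ccv_S. eapply Ccv_eq; [|eapply Ccv_ext; [|exact (Ccv_plus _ _ _ _ H2 (Ccv_plus _ _ _ _ (Ccv_scal (/ INR N) _ _ H1) (Ccv_const (- ((INR N - / INR N) * stieltjes 1)))))]].
  - rewrite Hkap. field. exact HNC.
  - intros L. cbv beta. unfold Kfun. field. exact HNC.
Qed.

(** Since the sum of Clog(n^N x) / n diverges, it cannot be split off as for k >= 2. Only digamma(y
    + L + 1) is replaced, by Clog(y + L) with an error O(1 / (n |x|)); the remaining Clog(y + L) -
    Clog y is the logarithm in [Ilog] at w = L / x. *)
Lemma G_limit_1 N x (G : nat -> C) : (1 <= N)%nat -> slit_plane x ->
  (forall L, Ccv (Csum (fun n => (digamma (ynx N x n + INR L + 1) - Clog (ynx N x n)) / INR (S n) ^ 1)%C) (G L)) ->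
  Ccv (fun L => G L - Ilog N (INR L / x))%C (RtoC 0).
Proof.
  intros HN Hx HG. destruct (slit_sector x Hx) as [d [Hd Hs]].
  destruct (sector_lower d Hd) as [c [Hc Hl]].
  destruct (digamma1_asymp 0 d Hd) as [R0 [B [HR0 [HB HA]]]].
  destruct (INR_unbounded (R0 / c)) as [n0 Hn0].
  assert (Hx0 := slit_neq_0 x Hx).
  assert (Hmx : 0 < Cmod x) by (apply Cmod_gt_0, Hx0).
  apply Ccv_dominated with (f := fun L n => (/ INR (S n) * (digamma (ynx N x n + INR L + 1) - Clog (ynx N x n + INR L)))%C)
    (h := fun n => RtoC 0) (g := fun n => B / (c * Cmod x) * / INR (S n) ^ 2).
  - intros n. assert (Hy : slit_plane (ynx N x n)) by (apply slit_ynx, Hx).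
    assert (Hy1 : slit_plane (ynx N x n + 1)%C) by (apply slit_plus; [exact Hy | lra]).
    eapply Ccv_eq; [|eapply Ccv_ext; [|exact (Ccv_scal (/ INR (S n)) _ _ (Ccv_minus _ _ _ _ (Ccv_digamma_add _ Hy1) (Ccv_Clog_add _ Hy)))]].
    + ring.
    + intros L. cbv beta. replace (ynx N x n + 1 + INR L)%C with (ynx N x n + INR L + 1)%C by ring. ring.
  - exists n0. intros L n HL. set (y := ynx N x n). set (v := (y + INR L)%C).
    assert (HLn : INR n0 <= INR L) by (apply le_INR; lia).
    assert (HR0c : 0 < R0 / c) by (apply Rdiv_lt_0_compat; lra).
    assert (Hys : sector d y) by (apply sector_ynx, Hs).
    assert (Hvl := Hl y (INR L) Hys ltac:(lra)). fold v in Hvl.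
    assert (Hym : Cmod y = INR (S n) ^ N * Cmod x) by apply Cmod_ynx.
    assert (Hn1 := INR_S_ge1 n).
    assert (HnN : INR (S n) <= INR (S n) ^ N) by (rewrite <- (pow_1 (INR (S n))) at 1; apply Rle_pow; assumption).
    assert (Hy0 := Cmod_ge_0 y).
    assert (HvR : R0 <= Cmod v).
    { eapply Rle_trans; [|exact Hvl]. apply Rle_trans with (c * (R0 / c)); [right; field; lra | apply Rmult_le_compat_l; lra]. }
    specialize (HA v ltac:(apply sector_add; [exact Hys | lra]) HvR). cbn [Csum] in HA. rewrite pow_1 in HA.
    rewrite Cmod_mult, <- RtoC_inv, Cmod_R, Rabs_right by (try apply Rle_ge, Rlt_le, Rinv_0_lt_compat; lra).
    replace (digamma (v + 1) - Clog v)%C with (digamma (v + 1) - Clog v - RtoC 0)%C by ring.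
    assert (Hni : 0 < / INR (S n)) by (apply Rinv_0_lt_compat; lra).
    assert (Hcx : 0 < c * Cmod x) by (apply Rmult_lt_0_compat; lra).
    apply Rle_trans with (/ INR (S n) * (B / (c * Cmod x * INR (S n)))).
    + apply Rmult_le_compat_l; [lra|]. eapply Rle_trans; [exact HA|]. apply Rmult_le_compat_l; [exact HB|].
      apply Rinv_le_contravar; [apply Rmult_lt_0_compat; lra|].
      apply Rle_trans with (2 := Hvl). rewrite Rmult_assoc. apply Rmult_le_compat_l; [lra|].
      assert (Cmod x * INR (S n) <= Cmod y) by (rewrite Hym; nra). lra.
    + right. field. repeat split; lra.
  - apply Rbdd_scal; [|apply Rbdd_inv_sq]. apply Rmult_le_pos; [exact HB|]. left. apply Rinv_0_lt_compat, Rmult_lt_0_compat; lra.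
  - intros L. eapply Ccv_ext; [|exact (Ccv_minus _ _ _ _ (HG L) (Ilog_cv N (INR L / x) HN))].
    intros P. cbv beta. rewrite <- Csum_minus. apply Csum_ext. intros n _. rewrite Cpow_1_r.
    rewrite Clog_add by (try apply pos_INR; apply slit_ynx, Hx).
    replace (INR L / ynx N x n)%C with (INR L / x / INR (S n) ^ N)%C.
    + unfold Cdiv. ring.
    + unfold ynx. field. split; [exact Hx0 | apply Cpow_nz, INR_S_neq0].
  - apply Ccv_ext with (fun _ => RtoC 0); [intros; symmetry; apply Csum_0; reflexivity | apply Ccv_const].
Qed.

Lemma scriptF_at_0_eq1 N : (1 <= N)%nat ->
    expansion_at_0 (scriptF 1 (INR N))
      (fun x =>
         - (zeta (INR N + 1) / x)
         + 1 / INR N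
           * (PI ^ 2 / 6
              - (INR N - 1) * stieltjes 0 * Clog x
              + 1 / 2 * Clog x ^ 2
              - INR N * stieltjes 0 ^ 2
              - (INR N ^ 2 + 1) * stieltjes 1)
         + scriptB 1 N x)%C
      (fun m => - ((-1) ^ (m * (N + 1))
                * zeta (1 - INR m * INR N) * zeta (1 + INR m)))%C
      (fun m x => x ^ m)%C.
Proof.
  intros HN d Hd M.
  assert (HN0 : INR N <> 0) by (apply not_0_INR; lia). assert (HNC := RtoC_neq0 _ HN0).
  assert (H20 : RtoC 2 <> RtoC 0) by (apply RtoC_neq0; lra).
  set (ga := RtoC (stieltjes 0)). set (g1 := RtoC (stieltjes 1)).
  assert (CH : Ccv (fun P => RtoC (Rsum (fun i => / INR (S i)) P - ln (INR P))%R) ga) by (apply Ccv_RtoC, stieltjes_0).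
  assert (CL : Ccv (fun P => RtoC (Rsum (fun i => ln (INR (S i)) / INR (S i)) P - ln (INR P) ^ 2 / 2)%R) g1) by (apply Ccv_RtoC, stieltjes_1).
  assert (Hc0 : Ccv (fun P => Csum (fun n => / INR (S n) ^ 1) P - (if (1 =? 1)%nat then RtoC (ln (INR P)) else 0))%C ga).
  { eapply Ccv_ext; [|exact CH]. intros P. cbv beta. rewrite Nat.eqb_refl, RtoC_minus, RtoC_Rsum. f_equal. apply Csum_ext. intros i _.
    rewrite RtoC_inv, Cpow_1_r by (apply not_0_INR; lia). reflexivity. }
  destruct (tail_sum 1 N M d ga ltac:(lia) Hd Hc0) as [r [T [Hr [HT HA]]]].
  exists (T + Cmod (zeta 2)).
  exists (mkposreal (r / 2) ltac:(lra)). intros x Hball Hne Hs.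
  assert (Hxr : Cmod x < r) by (apply (ball_0_Cmod x (mkposreal r Hr)), Hball).
  assert (Hx : slit_plane x) by apply Hs. assert (Hx0 := slit_neq_0 x Hx).
  destruct (HA x Hs Hxr) as [s [E [Hs1 [HE Hs2]]]].
  assert (HG := fun L => F_decomposition 1 N x s L ltac:(lia) ltac:(lia) Hx Hs1).
  assert (HGl := G_limit_1 N x _ HN Hx HG).
  assert (HI := Ilog_asymp d N (fun L => INR L / x)%C Hd HN
    ltac:(intros L; apply sector_div; [apply lt_0_INR; lia | exact Hs])
    ltac:(apply to_infinity_INR with (/ Cmod x); [apply Rinv_0_lt_compat, Cmod_gt_0, Hx0 |
      intros L; rewrite Cmod_div, Cmod_R, Rabs_right by (try exact Hx0; apply Rle_ge, pos_INR); right; unfold Rdiv; ring])).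
  set (Phi := (scriptF (INR 1) (INR N) x + zeta (INR 1 + INR N) / x)%C) in *.
  set (S1 := Csum (fun i => zeta (INR 1 - INR (S i) * INR N) * zeta (1 + INR (S i)) * (- x) ^ S i)%C M) in *.
  set (X := Clog x).
  (* [Hcomb] adds the limits so that [G L], [Ilog] and the sums of S(m/x) / m disappear. The terms
     in ln L and (ln L)^2 cancel identically, so a constant sequence 0 remains and its limit
     expresses [Phi]. *)
  assert (Hlim : Ccv (fun L => RtoC 0)
    (Phi + ((S1 + E) + ((ga - X / INR N) * ga + / INR N * g1) - (PI ^ 2 / (6 * INR N) - INR N * g1)) - X * X / (2 * INR N) + ga * X)%C).
  { assert (Hcomb := Ccv_plus _ _ _ _ (Ccv_plus _ _ _ _ (Ccv_plus _ _ _ _ (Ccv_opp _ _ HGl) (Ccv_opp _ _ HI)) Hs2)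
        (Ccv_plus _ _ _ _ (Ccv_plus _ _ _ _ (Ccv_scal (ga - X / INR N) _ _ CH) (Ccv_scal (/ INR N) _ _ CL))
          (Ccv_const (Phi - X * X / (2 * INR N) + ga * X)))).
    (* The index L = 0 is dropped, since Clog(L / x) = ln L - Clog x requires L > 0. *)
    apply Ccv_S in Hcomb. eapply Ccv_eq; [|eapply Ccv_ext; [|exact Hcomb]].
    - cbv beta. fold g1. field. exact HNC.
    - intros P. cbv beta. set (L := S P).
      assert (E1 : Csum (fun m => / INR (S m) * (ga + L0 1 N (INR (S m) / x)))%C L
        = ((ga - X / INR N) * RtoC (Rsum (fun i => / INR (S i)) L)%R + / INR N * RtoC (Rsum (fun i => ln (INR (S i)) / INR (S i)) L)%R)%C).
      { rewrite !RtoC_Rsum, <- !Csum_scal, <- Csum_plus. apply Csum_ext. intros m _.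
        destruct (slit_div (INR (S m)) x ltac:(apply lt_0_INR; lia) Hx) as [W1 W2].
        rewrite L0_1, W2 by assumption. unfold Rdiv. rewrite RtoC_mult, RtoC_inv by (apply not_0_INR; lia). fold X. field.
        split; [apply INR_S_neq0 | exact HNC]. }
      rewrite E1. destruct (slit_div (INR L) x ltac:(apply lt_0_INR; unfold L; lia) Hx) as [_ W2]. rewrite W2. fold X.
      unfold Rdiv. rewrite !RtoC_minus, RtoC_mult, RtoC_pow, RtoC_inv by lra. fold ga. field. exact HNC. }
  assert (Heq := Ccv_unique _ _ _ Hlim (Ccv_const (RtoC 0))).
  assert (HF : scriptF (INR 1) (INR N) x = (- (zeta (INR N + 1) / x)
         + 1 / INR N * (PI ^ 2 / 6 - (INR N - 1) * ga * X + 1 / 2 * X ^ 2 - INR N * ga ^ 2 - (INR N ^ 2 + 1) * g1) - S1 - E)%C).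
  { replace (scriptF (INR 1) (INR N) x) with (Phi - zeta (INR 1 + INR N) / x)%C by (unfold Phi; ring).
    replace (INR 1 + INR N)%C with (INR N + 1)%C by (change (INR 1) with 1; ring).
    transitivity ((Phi + ((S1 + E) + ((ga - X / INR N) * ga + / INR N * g1) - (PI ^ 2 / (6 * INR N) - INR N * g1)) - X * X / (2 * INR N) + ga * X)
      - ((S1 + E) + ((ga - X / INR N) * ga + / INR N * g1) - (PI ^ 2 / (6 * INR N) - INR N * g1)) + X * X / (2 * INR N) - ga * X - zeta (INR N + 1) / x)%C; [ring|].
    rewrite Heq. field. repeat split; assumption. }
  change (scriptF 1 (INR N) x) with (scriptF (INR 1) (INR N) x).
  rewrite HF, Csum_sum_n_m, (scriptB_1 N x HN Hx0).
  rewrite (Csum_ext (fun i => - ((-1) ^ (S i * (N + 1)) * zeta (1 - INR (S i) * INR N) * zeta (1 + INR (S i))) * x ^ S i)%C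
    (fun i => ((-1) ^ 1 * ((-1) ^ (S i * (N + 1)) * zeta (INR 1 - INR (S i) * INR N) * zeta (1 + INR (S i)))) * x ^ S i)%C)
    by (intros i _; change (INR 1) with 1; rewrite Cpow_1_r; ring).
  rewrite Cmod_pow.
  match goal with |- Cmod ?z <= _ => replace z with (- E - S1 - (Bterm 1 N x + Csum (fun i => (-1) ^ 1 * ((-1) ^ (S i * (N + 1)) * zeta (INR 1 - INR (S i) * INR N) * zeta (1 + INR (S i))) * x ^ S i) M))%C by (fold ga g1 X; ring) end.
  apply expansion_remainder; [lia | exact HT | exact HE].
Qed.

Theorem theorem2p6 :
  (forall k N : R, 0 < k -> 0 < N -> 1 < k + N ->
    expansion_at_infty (scriptF k N)
      (fun x => - (1 / (2 * x)) * zeta (k + N))%C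
      (fun n => - (bernoulli (2 * n) / INR (2 * n)
                   * zeta (k + INR (2 * n) * N)))%C
      (fun n x => / x ^ (2 * n))%C)
  /\
  (forall k N : nat, (1 < k)%nat -> (k <= N)%nat ->
    expansion_at_0 (scriptF (INR k) (INR N))
      (fun x =>
         - (zeta (INR k + INR N) / x)
         - (stieltjes 0 + Clog x) * zeta (INR k)
         + INR N * C_derive zeta (INR k)
         + PI / INR N
           * (zeta (1 + (INR k - 1) / INR N) / sin (PI / INR N * (INR k - 1)))
           * Cpower x ((INR k - 1) / INR N)
         + Cpower x ((INR k - 1) / INR N) * scriptB k N x)%C
      (fun m => (-1) ^ k * ((-1) ^ (m * (N + 1))
                * zeta (INR k - INR m * INR N) * zeta (1 + INR m)))%C
      (fun m x => x ^ m)%C)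
  /\
  (forall N : nat, (1 <= N)%nat ->
    expansion_at_0 (scriptF 1 (INR N))
      (fun x =>
         - (zeta (INR N + 1) / x)
         + 1 / INR N
           * (PI ^ 2 / 6
              - (INR N - 1) * stieltjes 0 * Clog x
              + 1 / 2 * Clog x ^ 2
              - INR N * stieltjes 0 ^ 2
              - (INR N ^ 2 + 1) * stieltjes 1)
         + scriptB 1 N x)%C
      (fun m => - ((-1) ^ (m * (N + 1))
                * zeta (1 - INR m * INR N) * zeta (1 + INR m)))%C
      (fun m x => x ^ m)%C).
Proof.
  split; [exact scriptF_at_infty|]. split; [exact scriptF_at_0_gt1 | exact scriptF_at_0_eq1].
Qed.
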